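(* Let $u_0:\mathbb{R}\to\mathbb{R}$ be such that $u_0-\phi\in H^{1/2}(\mathbb{R})$. Then the equation $$\partial_t u=-(-\partial_{xx})^{1/2}u-f(u),\qquad u(\cdot,0)=u_0,$$ has a unique global smooth solution $u(x,t)$. Furthermore, if $u_0$ satisfies (i) $\mathcal{E}(u_0)<+\infty$, and (ii) there exist constants $a\le b$ such that $\phi(x-b)\le u_0(x)\le \phi(x-a)$ for all $x\in\mathbb{R}$, then there exist constants $x_0\in\mathbb{R}$, $c>0$ and $\mu>0$ such that $$|u(x,t)-\phi(x-x_0)|\le c\,\min\Big\{\frac{1}{1+|x|},\,e^{-\mu t}\Big\}\qquad\text{for all } t>0,\ x\in\mathbb{R}.$$
   Context: $F(u)=\frac{1}{\pi^2}(1+\cos(\pi u))$, $f(u)=F'(u)=-\frac1\pi\sin(\pi u)$, $\phi(x)=\frac{2}{\pi}\arctan x$. The operator $(-\partial_{xx})^{1/2}$ is $(-\partial_{xx})^{1/2}g(x)=\frac1\pi\,\mathrm{PV}\int_{\mathbb{R}}\frac{g(x)-g(y)}{|x-y|^2}\,dy$ (Fourier symbol $|\xi|$ on $H^1(\mathbb{R})$; the same formula is used for $\phi$), and $(-\partial_{xx})^{1/4}=(-\Delta)^{1/4}$ has Fourier symbol $|\xi|^{1/2}$. The profile $\phi$ satisfies $(-\partial_{xx})^{1/2}\phi+f(\phi)=0$ and $\phi(\pm\infty)=\pm1$. The perturbed energy is $$\mathcal{E}(u)=\int_{\mathbb{R}}\Big(\tfrac12|(-\Delta)^{1/4}(u-\phi)|^2-(u-\phi)f(\phi)+F(u)\Big)\,dx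 .$$ A global smooth solution with initial data $u_0$ means: $v:=u-\phi$ belongs to $C([0,\infty);H^{1/2}(\mathbb{R}))$ and to $C^k((0,\infty);H^j(\mathbb{R}))$ for all positive integers $k,j$, $v(\cdot,0)=u_0-\phi$, and $\partial_t v=-(-\partial_{xx})^{1/2}v-f(v+\phi)+f(\phi)$ in $L^2(\mathbb{R})$ for every $t>0$. *)

(* Defs.v *)
From HB Require Import structures.
From mathcomp Require Import all_boot all_order all_algebra.
From mathcomp Require Import complex.
From mathcomp Require Import all_classical all_reals all_analysis.
Set Implicit Arguments.
Unset Strict Implicit.
Unset Printing Implicit Defensive.
Import Order.TTheory GRing.Theory Num.Theory.
Import numFieldNormedType.Exports.
Local Open Scope classical_set_scope.
Local Open Scope ring_scope.

Section Defs.
Context {R : realType}.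
Implicit Types (s t x xi : R) (g : R -> R) (u v : R -> R -> R).

Notation mu := (@lebesgue_measure R).

Definition F (y : R) : R := (pi ^+ 2)^-1 * (1 + cos (pi * y)).
Definition f (y : R) : R := - (pi^-1 * sin (pi * y)).
Definition phi (x : R) : R := 2 / pi * atan x.

(* Functions R -> R stand for their classes modulo null sets.  [Lfun] only
   contains Borel functions; membership up to a.e. equality also accepts every
   Lebesgue measurable representative. *)
Definition in_L2 g : Prop :=
  exists2 h : R -> R, h \in Lfun mu 2%:E & g = h %[ae mu].

Definition L2_norm g : \bar R := 'N[mu]_2%:E[EFin \o g].

Definition normsq (z : R[i]) : R := complex.Re z ^+ 2 + complex.Im z ^+ 2.

(* \int_{-n}^n g(x) e^{-i x xi} dx *)
Definition truncated_fourier (n : nat) g xi : R[i] :=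
  (\int[mu]_(x in `[- n%:R, n%:R]) (g x * cos (x * xi)) +i*
   - \int[mu]_(x in `[- n%:R, n%:R]) (g x * sin (x * xi)))%C.

(* [w] is the Fourier-Plancherel transform of [g]: the limit in L^2 of the
   truncated Fourier integrals. *)
Definition is_fourier g (w : R -> R[i]) : Prop :=
  [/\ in_L2 g,
      in_L2 (fun xi => complex.Re (w xi)),
      in_L2 (fun xi => complex.Im (w xi)) &
      (\int[mu]_xi (normsq (truncated_fourier n g xi - w xi))%:E)%E
        @[n --> \oo] --> 0%E].

(* By Plancherel's theorem, a representative of the transform exists and is
   unique up to a.e. equality whenever [in_L2 g]. *)
Definition fourier g : R -> R[i] := xget (fun=> 0) [set w | is_fourier g w].

Definition sobolev_norm s g : \bar R :=
  ((\int[mu]_xi ((1 + xi ^+ 2) `^ s * normsq (fourier g xi))%:E) `^ (2^-1))%E.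

Definition in_sobolev s g : Prop := in_L2 g /\ (sobolev_norm s g < +oo)%E.

(* (-\Delta)^{1/4} g: the function, determined up to a.e. equality, whose
   Fourier transform is |xi|^{1/2} times that of [g]. *)
Definition quarter_laplacian g : R -> R :=
  xget (fun=> 0)
    [set h | is_fourier h
               (fun xi => ((`|xi| `^ (2^-1))%:C%C * fourier g xi))].

(* (-\partial_{xx})^{1/2} g as a principal value integral *)
Definition half_laplacian g x : R :=
  pi^-1 *
  lim (\int[mu]_(y in [set y | eps < `|x - y|]) ((g x - g y) / `|x - y| ^+ 2)
         @[eps --> 0^'+]).

Definition energy (u0 : R -> R) : \bar R :=
  (\int[mu]_x (2^-1 * quarter_laplacian (fun y => u0 y - phi y)%R x ^+ 2
               - (u0 x - phi x) * f (phi x) + F (u0 x))%:E)%E.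

(* Curves of functions are written [v t x], time first.  The next two notions
   are relative to a norm [N] on functions. *)
Definition has_time_derivative (N : (R -> R) -> \bar R) v t g : Prop :=
  N (fun x => h^-1 * (v (t + h) x - v t x) - g x) @[h --> 0^'] --> 0%E.

Definition continuous_curve_at (N : (R -> R) -> \bar R) (I : set R) v t : Prop :=
  N (fun x => v r x - v t x) @[r --> within I (nbhs t)] --> 0%E.

(* v \in C([0, \infty); H^s) *)
Definition C0_sobolev s v : Prop :=
  forall t, 0 <= t ->
    in_sobolev s (v t) /\
    continuous_curve_at (sobolev_norm s) [set r | 0 <= r] v t.

(* v \in C^k((0, \infty); H^s); [D i] is the i-th time derivative of [v] *)
Definition Ck_sobolev (k : nat) s v : Prop :=
  exists D : nat -> R -> R -> R,
    [/\ D 0 = v,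
        forall i t, (i <= k)%N -> 0 < t -> in_sobolev s (D i t),
        forall i t, (i < k)%N -> 0 < t ->
          has_time_derivative (sobolev_norm s) (D i) t (D i.+1 t) &
        forall t, 0 < t ->
          continuous_curve_at (sobolev_norm s) [set r | 0 < r] (D k) t].

(* For t > 0 the class v(., t), which lies in every H^j, is represented by its
   continuous representative, so that pointwise values of [u t] make sense. *)
Definition global_smooth_solution (u0 : R -> R) u : Prop :=
  let v t x := u t x - phi x in
  [/\ C0_sobolev 2^-1 v,
      forall k j : nat, (0 < k)%N -> (0 < j)%N -> Ck_sobolev k j%:R v,
      forall t, 0 < t -> continuous (v t),
      v 0 = (fun x => u0 x - phi x) %[ae mu] &
      forall t, 0 < t ->
        let rhs x := - half_laplacian (v t) x - f (v t x + phi x) + f (phi x) in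
        in_L2 rhs /\ has_time_derivative L2_norm v t rhs].

End Defs.

(* Main.v *)
(** Write [u = phi + v] and [f u = u - g u], where [g] is nondecreasing and
    2-Lipschitz, and let Lambda be the half-Laplacian. Then
    [v_t = - (Lambda + 1) v + (g (v + phi) - g phi)], and [- (Lambda + 1)]
    generates [e^{-t}] times the Poisson semigroup, which is positive. Hence
    the Duhamel formulation obeys a comparison principle, and it is solved by
    monotone iteration.

    The translates of [phi] are stationary, so a solution starting between
    two of them stays there, which gives the weight [1 / (1 + |x|)]. During one
    unit of time the Poisson kernel spreads whatever gap there is between the
    solution and a barrier over the whole line, with the decay of [phi']; one of
    the two barriers can then be moved towards the other by a fixed fraction of
    their distance, which gives the exponential rate.

    Smoothness comes from estimating spatial and temporal increments in the sup
    and the L^2 norm through the Duhamel formula. Sobolev norms are reached by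
    testing the spectral density of a function against [e^{-2t|xi|}] and the
    symbols of iterated differences: this turns them into L^2 norms of Poisson
    extensions and of differences. Uniqueness is Gronwall's inequality for the
    squared L^2 norm of a difference, by positivity of Lambda. *)
Require Import Defs.
From HB Require Import structures.
From mathcomp Require Import all_boot all_order all_algebra.
From mathcomp Require Import complex.
From mathcomp Require Import all_classical all_reals all_analysis.
From mathcomp Require Import measurable_realfun.
From mathcomp Require Import ring lra.
Set Implicit Arguments.
Unset Strict Implicit.
Unset Printing Implicit Defensive.
Import Order.TTheory GRing.Theory Num.Theory.
Import numFieldNormedType.Exports.
Local Open Scope classical_set_scope.
Local Open Scope ring_scope.
Notation Rmu := (@lebesgue_measure _).
Notation "'\I_' x F" := (Rintegral Rmu setT (fun x => F))
  (at level 36, x binder, F at level 36).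
Notation mfun f := (measurable_fun setT f).
Notation igr f := (Rmu.-integrable setT (EFin \o f)).

(** The datum is only in H^{1/2}: it need not be bounded, and the half-Laplacian of it need not be a
    function. Hence the equation is solved in integrated form, regularity estimates are uniform only
    on compact subintervals of (0, oo), and continuity in H^{1/2} at time 0 is a separate argument.
    There the Duhamel term is the difficulty: its integrand has half-order norm of size (t -
    s)^{-1/2}, which is integrable in time, whereas a full derivative costs 1 / (t - s) and would
    produce a logarithm. At positive times the same logarithm is avoided by a contraction argument
    on increments.

    Sup and L^2 bounds are carried by one predicate [nb], because the operators involved are
    averages of translates and treat both norms alike; L^2 control of differences feeds the Sobolev
    norms, sup control is what products need.

    The special form of the layer enters through arctan: its Poisson extension is explicit and sin
    (pi phi) is a multiple of a conjugate Poisson kernel, so that stationarity is checked by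
    calculus with explicit kernels. *)

Lemma normK2 {R : realDomainType} (x : R) : `|x| ^+ 2 = x ^+ 2.
Proof. exact: real_normK (num_real x). Qed.

(** Written through the real power [powR], the inverse is measurable on the whole line at once; at 0
    both sides are 0. *)
Lemma measurable_invr {R : realType} : mfun (fun x : R => x^-1).
Proof.
have -> : (fun x : R => x^-1) = (fun x => x * (`|x| `^ (-1)) ^+ 2).
  apply/funext => x; have [->|x0] := eqVneq x 0; first by rewrite mul0r invr0.
  rewrite powR_inv1 // exprVn normK2 -[RHS]mulr1.
  by field.
apply: measurable_funM => //; apply: measurable_funX.
by apply: (measurableT_comp (@measurable_powR R (-1))); exact: normr_measurable.
Qed.

Ltac meas := repeat first
 [ assumption | exact: measurable_cst | exact: measurable_id
 | exact: measurable_fst | exact: measurable_snd | exact: normr_measurable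
 | match goal with |- measurable_fun _ ?f => match f with
   | (fun _ => _ + _)%R => apply: measurable_funD
   | (fun _ => - _)%R => apply: measurable_funN
   | (fun _ => _ * _)%R => apply: measurable_funM
   | (fun _ => _ ^-1)%R => apply: (measurableT_comp measurable_invr)
   | (fun _ => expR _) => apply: (measurableT_comp (@measurable_expR _))
   | (fun _ => _ ^+ _)%R => apply: measurable_funX
   | (fun _ => @Num.norm _ _ _) => apply: (measurableT_comp (@normr_measurable _ _))
   | (fun _ => (_, _)) => apply: measurable_fun_pair
   | (fun _ => (_)%:E) => apply/measurable_EFinP
   | _ => match goal with H : measurable_fun _ _ |- _ => apply: (measurableT_comp H) end
   end end ].

(** * Real-valued integrals over the line: translation, reflection, Fubini *)

Section Integration.
Context {R : realType}.
Implicit Types (f g h k : R -> R).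
Notation mu := (@lebesgue_measure R).

Lemma measurable_shift (c : R) :
  mfun ((fun x => x + c) : measurableTypeR R -> measurableTypeR R).
Proof. by apply: continuous_measurable_fun => x; apply: cvgD; [exact: cvg_id|exact: cvg_cst]. Qed.

Lemma lebesgue_measure_shift (c : R) (A : set R) : measurable A ->
  mu A = pushforward mu ((fun x => x + c) : measurableTypeR R -> measurableTypeR R) A.
Proof.
move=> mA.
pose mphi := isMeasurableFun.Build _ _ _ _ _ (measurable_shift c).
pose phi : {mfun (measurableTypeR R) >-> (measurableTypeR R)} :=
  HB.pack (fun x : R => x + c) mphi.
apply: (@lebesgue_measure_unique R (pushforward mu phi)) => // _ [[a b]] _ <-.
rewrite /= /pushforward /=.
have -> : phi @^-1` `]a, b] = `]a - c, b - c]%classic.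
  by apply/seteqP; split => x /=; rewrite !in_itv/= ltrBlDr lerBrDr.
rewrite !lebesgue_measure_itv /= !lte_fin ltrD2r.
by case: ifP => // _; rewrite -!EFinB; congr EFin; ring.
Qed.

Lemma ge0_integral_shift (c : R) (f : R -> \bar R) : mfun f -> (forall x, 0 <= f x)%E ->
  (\int[mu]_x f (x + c)%R = \int[mu]_x f x)%E.
Proof.
move=> mf f0.
have mc := measurable_shift c.
transitivity (\int[pushforward mu ((fun x => x + c)%R : measurableTypeR R -> measurableTypeR R)]_x f x)%E.
  by rewrite ge0_integral_pushforward.
by apply: eq_measure_integral => //= A mA _; rewrite -lebesgue_measure_shift.
Qed.

Lemma ge0_integral_opp (f : R -> \bar R) : mfun f -> (forall x, 0 <= f x)%E ->
  (\int[mu]_x f (- x)%R = \int[mu]_x f x)%E.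
Proof.
move=> mf f0.
rewrite [RHS](eq_measure_integral (pushforward mu (-%R : measurableTypeR R -> measurableTypeR R)))/=; last first.
  by move=> A mA _; rewrite lebesgue_measureN.
by rewrite ge0_integral_pushforward//.
Qed.

Lemma integral_shift (c : R) (f : R -> \bar R) : mfun f ->
  (\int[mu]_x f (x + c)%R = \int[mu]_x f x)%E.
Proof.
move=> mf; rewrite integralE [RHS]integralE; congr (_ - _)%E.
  have mp : mfun (f^\+)%E := measurable_funepos mf.
  rewrite -[RHS](ge0_integral_shift c mp); last by move=> x; exact: funepos_ge0.
  by apply: eq_integral => x _; rewrite !funeposE.
have mp : mfun (f^\-)%E := measurable_funeneg mf.
rewrite -[RHS](ge0_integral_shift c mp); last by move=> x; exact: funeneg_ge0.
by apply: eq_integral => x _; rewrite !funenegE.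
Qed.

Lemma integral_opp (f : R -> \bar R) : mfun f ->
  (\int[mu]_x f (- x)%R = \int[mu]_x f x)%E.
Proof.
move=> mf; rewrite integralE [RHS]integralE; congr (_ - _)%E.
  have mp : mfun (f^\+)%E := measurable_funepos mf.
  rewrite -[RHS](ge0_integral_opp mp); last by move=> x; exact: funepos_ge0.
  by apply: eq_integral => x _; rewrite !funeposE.
have mp : mfun (f^\-)%E := measurable_funeneg mf.
rewrite -[RHS](ge0_integral_opp mp); last by move=> x; exact: funeneg_ge0.
by apply: eq_integral => x _; rewrite !funenegE.
Qed.

Lemma integral_reflect (c : R) (f : R -> \bar R) : mfun f ->
  (\int[mu]_x f (c - x)%R = \int[mu]_x f x)%E.
Proof.
move=> mf; rewrite -(integral_shift c mf).
rewrite -[RHS]integral_opp; last by meas.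
by apply: eq_integral => x _; rewrite addrC.
Qed.

Lemma I_shift c f : mfun f -> \I_x f (x + c) = \I_x f x.
Proof. by move=> mf; rewrite /Rintegral (integral_shift c (f := EFin \o f)) //; exact/measurable_EFinP. Qed.

Lemma I_reflect c f : mfun f -> \I_x f (c - x) = \I_x f x.
Proof. by move=> mf; rewrite /Rintegral (integral_reflect c (f := EFin \o f)) //; exact/measurable_EFinP. Qed.

Lemma igrP f : mfun f -> (\int[mu]_x (`|f x|)%:E < +oo)%E -> igr f.
Proof. by move=> mf h; apply/integrableP; split; [exact/measurable_EFinP|]. Qed.

Lemma igr_mfun f : igr f -> mfun f.
Proof. by move=> /integrableP [/measurable_EFinP]. Qed.

Lemma igr_lty f : igr f -> (\int[mu]_x (`|f x|)%:E < +oo)%E.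
Proof. by case/integrableP. Qed.

Lemma igr_le f g : mfun f -> igr g -> (forall x, `|f x| <= g x) -> igr f.
Proof.
move=> mf ig fg; apply: (le_integrable _ _ _ ig) => //; first exact/measurable_EFinP.
by move=> x _ /=; rewrite lee_fin (le_trans (fg x)) // ler_norm.
Qed.

Lemma igrD f g : igr f -> igr g -> igr (fun x => f x + g x).
Proof. by move=> h1 h2; exact: (integrableD measurableT h1 h2). Qed.

Lemma igrB f g : igr f -> igr g -> igr (fun x => f x - g x).
Proof. by move=> h1 h2; exact: (integrableB measurableT h1 h2). Qed.

Lemma igrZ c f : igr f -> igr (fun x => c * f x).
Proof. by move=> h; exact: (integrableZl measurableT c h). Qed.

Lemma igr_abs f : igr f -> igr (fun x => `|f x|).
Proof. by move=> h; exact: integrable_norm. Qed.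

Lemma igr_shift c f : igr f -> igr (fun x => f (x + c)).
Proof.
move=> h; have mf := igr_mfun h; apply: igrP; first by meas.
rewrite (ge0_integral_shift c (f := fun x => (`|f x|)%:E)) //; try exact: igr_lty.
by apply/measurable_EFinP; meas.
Qed.

Lemma igr_reflect c f : igr f -> igr (fun x => f (c - x)).
Proof.
move=> h; have mf := igr_mfun h; apply: igrP; first by meas.
rewrite (integral_reflect c (f := fun x => (`|f x|)%:E)) //; try exact: igr_lty.
by apply/measurable_EFinP; meas.
Qed.

Lemma eq_I f g : (forall x, f x = g x) -> \I_x f x = \I_x g x.
Proof. by move=> fg; congr (Rintegral _ _ _); apply/funext. Qed.

Lemma I_D f g : igr f -> igr g -> \I_x (f x + g x) = \I_x f x + \I_x g x.
Proof. by move=> h1 h2; rewrite RintegralD. Qed.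

Lemma I_B f g : igr f -> igr g -> \I_x (f x - g x) = \I_x f x - \I_x g x.
Proof. by move=> h1 h2; rewrite RintegralB. Qed.

Lemma I_Z c f : igr f -> \I_x (c * f x) = c * \I_x f x.
Proof. by move=> h; rewrite RintegralZl. Qed.

Lemma I_0 : \I_x (0 : R) = 0.
Proof. by rewrite /Rintegral integral0. Qed.

Lemma I_le f g : igr f -> igr g -> (forall x, f x <= g x) -> \I_x f x <= \I_x g x.
Proof. by move=> h1 h2 fg; apply: le_Rintegral. Qed.

Lemma I_ge0 f : (forall x, 0 <= f x) -> 0 <= \I_x f x.
Proof. by move=> f0; apply: Rintegral_ge0. Qed.

Lemma I_abs f : igr f -> `|\I_x f x| <= \I_x `|f x|.
Proof. by move=> h; apply: le_normr_Rintegral. Qed.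

Lemma I_fin f : igr f -> (\int[mu]_x (f x)%:E = (\I_x f x)%:E)%E.
Proof. by move=> h; rewrite /Rintegral fineK //; apply: integrable_fin_num. Qed.

Lemma I_le_ereal f (M : R) : mfun f -> (forall x, 0 <= f x) -> (\int[mu]_x (f x)%:E <= M%:E)%E ->
  igr f /\ \I_x f x <= M.
Proof.
move=> mf f0 h.
have ig : igr f.
  apply: igrP => //; under eq_integral do rewrite ger0_norm //.
  by rewrite (le_lt_trans h) // ltry.
by split => //; rewrite -lee_fin -I_fin.
Qed.

Lemma I_bound f g : igr g -> mfun f -> (forall x, `|f x| <= g x) -> `|\I_x f x| <= \I_x g x.
Proof.
move=> ig mf fg; have igf := igr_le mf ig fg.
by apply: (le_trans (I_abs igf)); apply: I_le => //; exact: igr_abs.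
Qed.

Lemma measurable_I d (T : measurableType d) (F : T * R -> R) : mfun F ->
  mfun (fun x => \I_y F (x, y)).
Proof.
move=> mF; rewrite /Rintegral.
(* Tonelli's measurability concerns nonnegative integrands, hence the positive and negative parts;
   slices that are not integrable are thereby covered too. *)
have -> : (fun x => fine (\int[mu]_y (F (x, y))%:E)) =
  (fun x => fine (\int[mu]_y ((EFin \o F)^\+ (x, y)) - \int[mu]_y ((EFin \o F)^\- (x, y)))%E).
  apply/funext => x; rewrite [in LHS]integralE; congr (fine (_ - _)%E);
    by apply: eq_integral => y _; rewrite ?funeposE ?funenegE.
have mE : @measurable_fun _ _ (T * measurableTypeR R)%type _ setT (EFin \o F).
  exact/measurable_EFinP.
apply: (measurableT_comp (@fine_measurable _ _ measurableT)) => //.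
apply: emeasurable_funB.
  exact: (measurable_fun_fubini_tonelli_F _ (measurable_funepos mE)).
exact: (measurable_fun_fubini_tonelli_F _ (measurable_funeneg mE)).
Qed.

Lemma measurable_int_param d (T : measurableType d) (F : T * R -> R) : mfun F ->
  (forall z, 0 <= F z) -> mfun (fun x => \int[mu]_y (F (x, y))%:E)%E.
Proof.
move=> mF F0.
have mE : @measurable_fun _ _ (T * measurableTypeR R)%type _ setT (EFin \o F).
  exact/measurable_EFinP.
have E0 (z : T * R) : (0 <= (EFin \o F) z)%E by rewrite lee_fin.
exact: (measurable_fun_fubini_tonelli_F (m2 := mu) (EFin \o F) mE E0).
Qed.

Lemma tonelli (F : R * R -> R) : mfun F -> (forall z, 0 <= F z) ->
  (\int[mu]_x \int[mu]_y (F (x, y))%:E = \int[mu]_y \int[mu]_x (F (x, y))%:E)%E.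
Proof.
move=> mF F0.
have mE : @measurable_fun _ _ (measurableTypeR R * measurableTypeR R)%type _ setT (EFin \o F).
  exact/measurable_EFinP.
by apply: (fubini_tonelli (m1 := mu) (m2 := mu) (EFin \o F) mE) => z; rewrite lee_fin.
Qed.

Lemma igr_I (F : R * R -> R) : mfun F ->
  (\int[mu]_x \int[mu]_y (`|F (x, y)|)%:E < +oo)%E -> igr (fun x => \I_y F (x, y)).
Proof.
move=> mF fin; apply: igrP; first exact: measurable_I.
apply: le_lt_trans fin; apply: ge0_le_integral => //.
- by apply/measurable_EFinP; apply: measurableT_comp => //; exact: measurable_I.
- by apply: (measurable_int_param (F := fun z => `|F z|)) => //; meas.
move=> x _; apply: (@le_trans _ _ `|\int[mu]_y (F (x, y))%:E|%E).
  by rewrite /Rintegral; case: (\int[mu]_y _)%E => //=; rewrite ?normr0 ?lee_fin ?leey.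
apply: le_abse_integral => //; apply/measurable_EFinP.
by apply: (measurableT_comp mF); meas.
Qed.

Lemma I_swap (F : R * R -> R) : mfun F ->
  (\int[mu]_x \int[mu]_y (`|F (x, y)|)%:E < +oo)%E ->
  [/\ igr (fun x => \I_y F (x, y)), igr (fun y => \I_x F (x, y)) &
    \I_x \I_y F (x, y) = \I_y \I_x F (x, y)].
Proof.
move=> mF fin.
have mE : @measurable_fun _ _ (measurableTypeR R * measurableTypeR R)%type _ setT (EFin \o F).
  exact/measurable_EFinP.
have iF : (mu \x mu)%E.-integrable setT (EFin \o F) by apply/integrable12ltyP.
have mFs : mfun (fun z : R * R => F (z.2, z.1)) by meas.
have j1 := igr_I mF fin.
have j2 : igr (fun y => \I_x F (x, y)).
  apply: (igr_I mFs); rewrite (tonelli (F := fun z => `|F (z.2, z.1)|)) //=.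
  by meas.
split; [exact: j1|exact: j2|]; apply: EFin_inj; rewrite -(I_fin j1) -(I_fin j2).
(* The real-valued inner integral agrees with the extended one only where the slice is integrable,
   which is almost everywhere. *)
have e1 : (\int[mu]_x (\I_y F (x, y))%:E = \int[mu]_x \int[mu]_y (F (x, y))%:E)%E.
  apply: (ae_eq_integral _ _ measurableT).
  - by apply/measurable_EFinP; exact: igr_mfun.
  - exact: (measurable_fubini_F iF).
  - by apply: filterS (ae_integrable1 iF) => x h _; rewrite I_fin.
have e2 : (\int[mu]_y (\I_x F (x, y))%:E = \int[mu]_y \int[mu]_x (F (x, y))%:E)%E.
  apply: (ae_eq_integral _ _ measurableT).
  - by apply/measurable_EFinP; exact: igr_mfun.
  - exact: (measurable_fubini_G iF).
  - by apply: filterS (ae_integrable2 iF) => x h _; rewrite I_fin.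
rewrite e1 e2; exact: (Fubini iF).
Qed.

(* AM-GM with the weight optimised afterwards. *)
Lemma cauchy_schwarz_weighted k f (A : R) : mfun k -> mfun f ->
  (forall x, 0 <= k x) -> (forall x, 0 <= f x) -> 0 < A -> (\int[mu]_x (k x)%:E <= A%:E)%E ->
  ((\int[mu]_x (k x * f x)%:E) * (\int[mu]_x (k x * f x)%:E) <=
     A%:E * \int[mu]_x (k x * f x ^+ 2)%:E)%E.
Proof.
move=> mk mf k0 f0 A0 hA.
have [->|hB] := eqVneq (\int[mu]_x (k x * f x ^+ 2)%:E)%E +oo%E.
  by rewrite gt0_muley ?leey // lte_fin.
have Bf : (\int[mu]_x (k x * f x ^+ 2)%:E)%E \is a fin_num.
  rewrite ge0_fin_numE ?lt_neqAle ?hB ?leey //.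
  by apply: integral_ge0 => x _; rewrite lee_fin mulr_ge0 // sqr_ge0.
set B := (\int[mu]_x (k x * f x ^+ 2)%:E)%E in Bf *; set b := fine B.
have igB : igr (fun x => k x * f x ^+ 2).
  apply: igrP; first by meas.
  under eq_integral do rewrite ger0_norm ?mulr_ge0 ?sqr_ge0 //.
  by rewrite -/B -(fineK Bf) ltry.
have [igk Ik] := I_le_ereal mk k0 hA.
have key l : 0 < l -> igr (fun x => k x * f x) /\ \I_x (k x * f x) <= 2^-1 * (l * A + l^-1 * b).
  move=> l0.
  have ig1 : igr (fun x => 2^-1 * (l * k x + l^-1 * (k x * f x ^+ 2))).
    by apply: igrZ; apply: igrD; apply: igrZ.
  have pt x : k x * f x <= 2^-1 * (l * k x + l^-1 * (k x * f x ^+ 2)).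
    have -> : 2^-1 * (l * k x + l^-1 * (k x * f x ^+ 2)) =
      k x * f x + 2^-1 * l^-1 * (k x * (f x - l) ^+ 2) by field; rewrite gt_eqF.
    by rewrite lerDl; apply: mulr_ge0; apply: mulr_ge0; rewrite ?sqr_ge0 // invr_ge0 ?ltW.
  have ig : igr (fun x => k x * f x).
    by apply: (igr_le _ ig1) => [|x]; [meas|rewrite ger0_norm ?mulr_ge0].
  split => //; apply: (le_trans (I_le ig ig1 pt)).
  rewrite I_Z ?I_D ?I_Z //; try by do ?[apply: igrD|apply: igrZ].
  have -> : b = \I_x (k x * f x ^+ 2) by [].
  by rewrite ler_pM2l // lerD2r ler_pM2l.
have [ig _] := key 1 ltr01.
rewrite I_fin // -(fineK Bf) -!EFinM lee_fin -/b.
set X := \I_x (k x * f x) in key *.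
have X0 : 0 <= X by apply: I_ge0 => x; rewrite mulr_ge0.
have b0 : 0 <= b by apply: fine_ge0; apply: integral_ge0 => x _; rewrite lee_fin mulr_ge0 // sqr_ge0.
have [->|Xn] := eqVneq X 0; first by rewrite mul0r mulr_ge0 // ltW.
have Xp : 0 < X by rewrite lt_neqAle eq_sym Xn.
have [_] := key (X / A) (divr_gt0 Xp A0).
rewrite divfK ?gt_eqF // invf_div => h.
have : X * X <= 2^-1 * (X * X + A * b).
  have -> : 2^-1 * (X * X + A * b) = X * (2^-1 * (X + A / X * b)) by field; rewrite gt_eqF.
  by rewrite ler_pM2l.
lra.
Qed.

End Integration.

(** * Simultaneous sup and L^2 bounds *)

Section NormedBound.
Context {R : realType}.
Implicit Types (f g h k : R -> R) (M A c : R).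
Notation mu := (@lebesgue_measure R).

(** One constant for both norms. Translations, averages and Lipschitz maps act on the two norms in
    the same way, so each estimate is proved once; a product takes the sup bound of one factor and
    both bounds of the other. *)
Definition nb g M := [/\ mfun g, forall x, `|g x| <= M &
  (\int[mu]_x (g x ^+ 2)%:E <= (M ^+ 2)%:E)%E].

Lemma nb_ge0 g M : nb g M -> 0 <= M.
Proof. by case=> _ h _; apply: le_trans (h 0). Qed.

Lemma nb_mfun g M : nb g M -> mfun g.
Proof. by case. Qed.

Lemma nb_sup g M : nb g M -> forall x, `|g x| <= M.
Proof. by case. Qed.

Lemma nb_I g M : nb g M -> igr (fun x => g x ^+ 2) /\ \I_x g x ^+ 2 <= M ^+ 2.
Proof.
by move=> [mg _ h]; apply: I_le_ereal h => [|x]; [exact: measurable_funX|exact: sqr_ge0].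
Qed.

Lemma nb_dom f g M : nb g M -> mfun f -> (forall x, `|f x| <= `|g x|) -> nb f M.
Proof.
move=> [mg sg l2] mf fg; split => // [x|]; first exact: le_trans (fg x) (sg x).
apply: le_trans l2; apply: ge0_le_integral => //.
- by move=> x _; rewrite lee_fin sqr_ge0.
- by apply/measurable_EFinP; meas.
- by apply/measurable_EFinP; meas.
by move=> x _; rewrite lee_fin -[leLHS]normK2 -[leRHS]normK2 lerXn2r ?nnegrE.
Qed.

Lemma nb_le g M M' : nb g M -> M <= M' -> nb g M'.
Proof.
move=> h MM; have M0 := nb_ge0 h; have [mg sg l2] := h; split => // [x|].
  exact: le_trans (sg x) MM.
by apply: (le_trans l2); rewrite lee_fin lerXn2r ?nnegrE // (le_trans M0).
Qed.

Lemma nb0 M : 0 <= M -> nb (fun=> 0) M.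
Proof.
move=> M0; split; first exact: measurable_cst.
  by move=> x; rewrite normr0.
by under eq_integral do rewrite expr0n /=; rewrite integral0 lee_fin sqr_ge0.
Qed.

Lemma nb_eq0 g : nb g 0 -> g = fun=> 0.
Proof. by case=> _ h _; apply/funext => x; apply/eqP; rewrite -normr_le0. Qed.

Lemma nbZ g M c : nb g M -> nb (fun x => c * g x) (`|c| * M).
Proof.
move=> hg; have [mg sg _] := hg; split; first by meas.
  by move=> x; rewrite normrM ler_wpM2l.
have [i1 l1] := nb_I hg; under eq_integral do rewrite exprMn.
by rewrite (I_fin (igrZ _ i1)) lee_fin (I_Z _ i1) exprMn normK2 ler_wpM2l ?sqr_ge0.
Qed.

Lemma nbN g M : nb g M -> nb (fun x => - g x) M.
Proof. by move=> h; apply: (nb_dom h) => [|x]; [have ? := nb_mfun h; meas|rewrite normrN]. Qed.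

Lemma nb_abs g M : nb g M -> nb (fun x => `|g x|) M.
Proof. by move=> h; apply: (nb_dom h) => [|x]; [have ? := nb_mfun h; meas|rewrite normr_id]. Qed.

(** Minkowski's inequality at the level of bounds: Young's inequality with weight M' / M reproduces
    exactly (M + M')^2. The weight makes no sense when M or M' is 0, but then the function vanishes
    identically. *)
Lemma nbD f g M M' : nb f M -> nb g M' -> nb (fun x => f x + g x) (M + M').
Proof.
move=> hf hg; have M0 := nb_ge0 hf; have M0' := nb_ge0 hg.
have [Mz|Mn] := eqVneq M 0.
  rewrite Mz in hf *; rewrite (nb_eq0 hf) add0r.
  by under [fun x => _]funext do rewrite add0r.
have [Mz'|Mn'] := eqVneq M' 0.
  rewrite Mz' in hg *; rewrite (nb_eq0 hg) addr0.
  by under [fun x => _]funext do rewrite addr0.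
have Mp : 0 < M by rewrite lt_neqAle eq_sym Mn.
have Mp' : 0 < M' by rewrite lt_neqAle eq_sym Mn'.
have [mf sf lf] := hf; have [mg sg lg] := hg.
split; first by meas.
  by move=> x; apply: (le_trans (ler_normD _ _)); apply: lerD.
have [i1 l1] := nb_I hf; have [i2 l2] := nb_I hg.
have p1 : 0 <= 1 + M' / M by rewrite addr_ge0 // divr_ge0.
have p2 : 0 <= 1 + M / M' by rewrite addr_ge0 // divr_ge0.
have j1 := igrZ (1 + M' / M) i1; have j2 := igrZ (1 + M / M') i2.
have H x : (f x + g x) ^+ 2 <= (1 + M' / M) * f x ^+ 2 + (1 + M / M') * g x ^+ 2.
  have -> : (1 + M' / M) * f x ^+ 2 + (1 + M / M') * g x ^+ 2 =
     (f x + g x) ^+ 2 + (M * M')^-1 * (M' * f x - M * g x) ^+ 2.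
    by field; rewrite Mn Mn'.
  by rewrite lerDl mulr_ge0 ?sqr_ge0 // invr_ge0 mulr_ge0.
have i3 : igr (fun x => (f x + g x) ^+ 2).
  by apply: (igr_le _ (igrD j1 j2)) => [|x]; [meas|rewrite ger0_norm ?sqr_ge0].
rewrite (I_fin i3) lee_fin; apply: (le_trans (I_le i3 (igrD j1 j2) H)).
rewrite (I_D j1 j2) (I_Z _ i1) (I_Z _ i2).
have -> : (M + M') ^+ 2 = (1 + M' / M) * M ^+ 2 + (1 + M / M') * M' ^+ 2 by field; rewrite Mn Mn'.
by apply: lerD; apply: ler_wpM2l.
Qed.

Lemma nbB f g M M' : nb f M -> nb g M' -> nb (fun x => f x - g x) (M + M').
Proof. by move=> hf hg; apply: nbD => //; exact: nbN. Qed.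

Lemma nbM f g M M' : nb f M -> nb g M' -> nb (fun x => f x * g x) (M * M').
Proof.
move=> hf hg; have M0 := nb_ge0 hf; have [mf sf lf] := hf; have mg := nb_mfun hg.
rewrite -(ger0_norm M0).
apply: (nb_dom (nbZ M hg)); first by meas.
by move=> x; rewrite !normrM ler_wpM2r // (ger0_norm M0).
Qed.

Lemma nb_shift g M c : nb g M -> nb (fun x => g (x + c)) M.
Proof.
move=> [mg sg lg]; split => //; first by meas.
rewrite (integral_shift c (f := fun x => (g x ^+ 2)%:E)) //.
by apply/measurable_EFinP; meas.
Qed.

Lemma nb_eps g M : (forall e, 0 < e -> nb g (M + e)) -> nb g M.
Proof.
move=> h; have [mg _ _] := h 1 ltr01.
have sg x : `|g x| <= M.
  by apply/ler_addgt0Pr => e e0; apply: (nb_sup (h e e0)).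
have M0 : 0 <= M := le_trans (normr_ge0 _) (sg 0).
split => //; apply/lee_addgt0Pr => e e0.
(* With d at most 1, the excess 2 M d + d^2 of (M + d)^2 over M^2 is at most (2 M + 1) d, hence at
   most e. *)
pose d := Num.min 1 (e / (2 * M + 1)).
have d0 : 0 < d by rewrite lt_min ltr01 divr_gt0 // ltr_wpDl // mulr_ge0.
have [_ _ l] := h d d0; apply: (le_trans l); rewrite -EFinD lee_fin sqrrD -addrA lerD2l.
have d1 : d <= 1 by rewrite ge_min lexx.
have de : d <= e / (2 * M + 1) by rewrite ge_min lexx orbT.
rewrite ler_pdivlMr in de; last by rewrite ltr_wpDl // mulr_ge0.
apply: le_trans de; rewrite -mulr_natl; nra.
Qed.

(** Fatou's lemma as an integrability criterion for a pointwise limit. Moments of spectral densities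
    are obtained this way from bounds on difference quotients. *)
Lemma fatou_bound (f_ : nat -> R -> R) (f : R -> R) (M : R) : (forall n, mfun (f_ n)) -> (forall n x, 0 <= f_ n x) ->
  (forall x, f_ ^~ x @ \oo --> f x) -> (\forall n \near \oo, (\int[mu]_x (f_ n x)%:E <= M%:E)%E) ->
  igr f /\ \I_x f x <= M.
Proof.
move=> mf f0 cv hM; have mlim : mfun f by apply: (measurable_fun_cvg (h := f_)).
have fl0 x : 0 <= f x.
  by apply: (ler_cvg_to (cvg_cst 0) (cv x)); apply: nearW => n.
apply: I_le_ereal => //.
have -> : (\int[mu]_x (f x)%:E = \int[mu]_x (limn_einf (fun n => (f_ n x)%:E)))%E.
  apply: eq_integral => x _.
  have c : (f_ n x)%:E @[n --> \oo] --> (f x)%:E by apply: cvg_EFin; [exact: nearW|exact: cv].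
  by rewrite is_cvg_limn_einfE ?(cvg_lim _ c) //; apply/cvg_ex; eexists; exact: c.
apply: (le_trans (fatou _ _ _ _)) => //.
- by move=> n; apply/measurable_EFinP; exact: mf.
- by move=> n x _; rewrite lee_fin.
rewrite limn_einf_lim; apply: lime_le; first exact: is_cvg_einfs.
near=> n; apply: ge_ereal_inf; exists (\int[mu]_x (f_ n x)%:E)%E; last by near: n.
by exists n => /=.
Unshelve. all: by end_near. Qed.

Lemma nb_lim (g_ : nat -> R -> R) g M : (forall n, nb (g_ n) M) ->
  (forall x, g_ ^~ x @ \oo --> g x) -> nb g M.
Proof.
move=> h cv.
have mg : mfun g by apply: (measurable_fun_cvg (h := g_)) => // n; exact: nb_mfun (h n).
split => // [x|].
  apply: (ler_cvg_to (cvg_norm (cv x)) (cvg_cst M)).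
  by apply: nearW => n; exact: nb_sup (h n) x.
have [||||i1 i2] := @fatou_bound (fun n x => g_ n x ^+ 2) (fun x => g x ^+ 2) (M ^+ 2).
- by move=> n; apply: measurable_funX; exact: nb_mfun (h n).
- by move=> n x; exact: sqr_ge0.
- by move=> x; apply: (cvgM (cv x) (cv x)).
- by apply: nearW => n; case: (h n).
by rewrite (I_fin i1) lee_fin.
Qed.

Lemma normr_I_le f : mfun f -> ((`|\I_y f y|)%:E <= \int[mu]_y (`|f y|)%:E)%E.
Proof.
move=> mf; apply: (@le_trans _ _ `|\int[mu]_y (f y)%:E|%E).
  by rewrite /Rintegral; case: (\int[mu]_y _)%E => //=; rewrite ?normr0 ?lee_fin ?leey.
by apply: le_abse_integral => //; apply/measurable_EFinP.
Qed.


(** Cauchy-Schwarz for the measure k(y) dy at each x, then Tonelli. *)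
Lemma superpose_sqr k (h : R * R -> R) A : mfun k -> (forall y, 0 <= k y) -> 0 < A ->
  (\int[mu]_y (k y)%:E <= A%:E)%E -> mfun h ->
  (\int[mu]_x ((\I_y (k y * h (y, x))) ^+ 2)%:E <= A%:E * \int[mu]_y ((k y)%:E * \int[mu]_x (h (y, x) ^+ 2)%:E))%E.
Proof.
move=> mk k0 A0 hA mh.
have mI : mfun (fun x => \I_y (k y * h (y, x))).
  by apply: (measurable_I (F := fun z : R * R => k z.2 * h (z.2, z.1))); meas.
have mF : mfun (fun z : R * R => k z.2 * h (z.2, z.1) ^+ 2) by meas.
have F0 (z : R * R) : 0 <= k z.2 * h (z.2, z.1) ^+ 2 by rewrite mulr_ge0 ?sqr_ge0.
have mFI := measurable_int_param mF F0.
apply: (@le_trans _ _ (\int[mu]_x (A%:E * \int[mu]_y (k y * h (y, x) ^+ 2)%:E))%E).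
  apply: ge0_le_integral => //.
  - by move=> x _; rewrite lee_fin sqr_ge0.
  - by apply/measurable_EFinP; exact: measurable_funX.
  - exact: measurable_funeM.
  move=> x _; have mx : mfun (fun y => `|h (y, x)|) by meas.
  have -> : (\int[mu]_y (k y * h (y, x) ^+ 2)%:E = \int[mu]_y (k y * `|h (y, x)| ^+ 2)%:E)%E.
    by apply: eq_integral => y _; rewrite real_normK ?num_real.
  apply: le_trans (cauchy_schwarz_weighted mk mx k0 _ A0 hA); last by move=> y.
  have mkh : mfun (fun y => k y * h (y, x)) by meas.
  have := normr_I_le mkh.
  rewrite (_ : (\int[mu]_y (`|k y * h (y, x)|)%:E = \int[mu]_y (k y * `|h (y, x)|)%:E)%E); last first.
    by apply: eq_integral => y _; rewrite normrM (ger0_norm (k0 y)).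
  by move=> le1; rewrite -[_ ^+ 2]normK2 expr2 EFinM; apply: lee_pmul => //; rewrite lee_fin.
rewrite ge0_integralZl //; last 2 first.
- by move=> x _; apply: integral_ge0 => y _; rewrite lee_fin (F0 (x, y)).
- by rewrite lee_fin ltW.
apply: lee_wpmul2l; first by rewrite lee_fin ltW.
rewrite (tonelli mF F0) le_eqVlt; apply/orP; left; apply/eqP; apply: eq_integral => y _ /=.
under eq_integral do rewrite EFinM.
rewrite ge0_integralZl ?lee_fin //; first by apply/measurable_EFinP; meas.
by move=> x _; rewrite lee_fin sqr_ge0.
Qed.

(** Minkowski's integral inequality, the source of almost all bounds below. The functions superposed
    are controlled only where the weight is positive, since Duhamel integrands are meaningless
    outside the time interval. *)
Lemma nb_minkowski k (h : R * R -> R) A M : mfun k -> (forall y, 0 <= k y) ->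
  (\int[mu]_y (k y)%:E <= A%:E)%E -> mfun h -> (forall y, 0 < k y -> nb (fun x => h (y, x)) M) ->
  0 <= M -> nb (fun x => \I_y (k y * h (y, x))) (A * M).
Proof.
move=> mk k0 hA mh hn M0.
(* Cauchy-Schwarz divides by the mass, so A = 0 is reached as the limit of A + e. *)
wlog A0 : A hA / 0 < A.
  have A0 : 0 <= A by rewrite -lee_fin (le_trans _ hA) // integral_ge0 // => x _; rewrite lee_fin.
  move=> H; have H' e : 0 < e -> nb (fun x => \I_y (k y * h (y, x))) ((A + e) * M).
    move=> e0; apply: H; last by rewrite ltr_wpDl.
    by apply: (le_trans hA); rewrite lee_fin lerDl ltW.
  apply: nb_eps => e e0.
  apply: (nb_le (H' (e / (M + 1)) _)); first by rewrite divr_gt0 // ltr_wpDl.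
  rewrite mulrDl lerD2l mulrAC ler_pdivrMr ?ltr_wpDl // ler_pM2l // lerDl ler01 //.
have [igk Ik] := I_le_ereal mk k0 hA.
pose F := fun z : R * R => k z.2 * h (z.2, z.1).
have mF : mfun F by rewrite /F; meas.
have mFy x : mfun (fun y => k y * h (y, x)) by meas.
have bd x y : `|k y * h (y, x)| <= k y * M.
  rewrite normrM (ger0_norm (k0 y)).
  have [->|ky] := eqVneq (k y) 0; first by rewrite !mul0r.
  have kp : 0 < k y by rewrite lt_neqAle eq_sym ky k0.
  by rewrite ler_pM2l //; apply: (nb_sup (hn y kp)).
have igM : igr (fun y => k y * M) by rewrite (_ : (fun y => _) = fun y => M * k y); [exact: igrZ|apply/funext => y; rewrite mulrC].
have IM : \I_y (k y * M) <= A * M.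
  rewrite (_ : (fun y => _) = fun y => M * k y); last by apply/funext => y; rewrite mulrC.
  by rewrite I_Z // mulrC ler_wpM2r.
have igx x : igr (fun y => k y * h (y, x)) by apply: (igr_le _ igM).
split; first exact: (measurable_I mF).
  by move=> x; apply: le_trans IM; exact: I_bound.
apply: le_trans (superpose_sqr mk k0 A0 hA mh) _.
apply: (@le_trans _ _ (A%:E * \int[mu]_y ((k y)%:E * (M ^+ 2)%:E))%E).
  apply: lee_wpmul2l => //; first by rewrite lee_fin ltW.
  apply: ge0_le_integral => //.
  - by move=> y _; rewrite mule_ge0 ?lee_fin // integral_ge0 // => x _; rewrite lee_fin sqr_ge0.
  - apply: emeasurable_funM; first exact/measurable_EFinP.
    apply: (measurable_int_param (F := fun z : R * R => h (z.1, z.2) ^+ 2)) => [|z]; [by meas|exact: sqr_ge0].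
  - by apply/measurable_EFinP; meas.
  move=> y _.
  have [->|ky] := eqVneq (k y) 0; first by rewrite !mul0e.
  have kp : 0 < k y by rewrite lt_neqAle eq_sym ky k0.
  by apply: lee_wpmul2l; rewrite ?lee_fin //; case: (hn y kp).
rewrite ge0_integralZr //; last 3 first.
- exact/measurable_EFinP.
- by move=> y _; rewrite lee_fin.
- by rewrite lee_fin sqr_ge0.
have -> : ((A * M) ^+ 2)%:E = (A%:E * (A%:E * (M ^+ 2)%:E))%E.
  by rewrite -!EFinM; congr EFin; ring.
apply: lee_wpmul2l; first by rewrite lee_fin ltW.
by apply: lee_wpmul2r => //; rewrite lee_fin sqr_ge0.
Qed.

End NormedBound.

(** * The Poisson kernel *)
Section Poisson.
Context {R : realType}.
Implicit Types (t s x y h : R) (g : R -> R).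
Notation mu := (@lebesgue_measure R).

Definition P t x : R := pi^-1 * (t / (t ^+ 2 + x ^+ 2)).

(* the x-derivative of [P t] *)
Definition dP t x : R := - (pi^-1 * (2 * t * x / (t ^+ 2 + x ^+ 2) ^+ 2)).

Lemma den_gt0 t x : 0 < t -> 0 < t ^+ 2 + x ^+ 2.
Proof. by move=> t0; rewrite ltr_pwDl ?exprn_gt0 ?sqr_ge0. Qed.

Lemma invpi_gt0 : 0 < (pi : R)^-1.
Proof. by rewrite invr_gt0 pi_gt0. Qed.

Lemma P_gt0 t x : 0 < t -> 0 < P t x.
Proof. by move=> t0; rewrite mulr_gt0 ?invpi_gt0 // divr_gt0 ?den_gt0. Qed.

Lemma P_ge0 t x : 0 <= t -> 0 <= P t x.
Proof.
by move=> t0; rewrite mulr_ge0 ?(ltW invpi_gt0) // divr_ge0 // addr_ge0 ?sqr_ge0.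
Qed.

Lemma PN t x : P t (- x) = P t x.
Proof. by rewrite /P sqrrN. Qed.

Lemma P_sym t x y : P t (x - y) = P t (y - x).
Proof. by rewrite -PN opprB. Qed.

Lemma mfun_P t : mfun (P t).
Proof. by rewrite /P; meas. Qed.

Lemma mfun_dP t : mfun (dP t).
Proof. by rewrite /dP; meas. Qed.

Lemma P_le t x : 0 < t -> P t x <= (pi * t)^-1.
Proof.
move=> t0; rewrite invfM ler_pM2l ?invpi_gt0 //.
rewrite ler_pdivrMr ?den_gt0 // mulrDr expr2 mulKf ?gt_eqF // lerDl.
by rewrite mulr_ge0 ?sqr_ge0 // invr_ge0 ltW.
Qed.

Lemma is_derive_P t x : 0 < t -> is_derive x 1 (P t) (dP t x).
Proof.
move=> t0; have d0 : t ^+ 2 + x ^+ 2 != 0 by rewrite gt_eqF ?den_gt0.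
have h : is_derive x 1 (fun x => t ^+ 2 + x ^+ 2) (2 * x).
  by apply: is_derive_eq; rewrite /GRing.scale /=; ring.
have h2 := is_deriveV d0.
rewrite /P /dP; apply: is_derive_eq.
by rewrite /GRing.scale /=; move: (pi^-1) => c; field.
Qed.

Lemma continuous_P t : 0 < t -> continuous (P t).
Proof.
move=> t0 x; apply: differentiable_continuous; apply/derivable1_diffP.
by have [] := is_derive_P x t0.
Qed.

Lemma int_P t : 0 < t -> (\int[mu]_x (P t x)%:E = 1)%E.
Proof.
move=> t0.
rewrite ge0_symfun_integralT //; last 3 first.
- by move=> x; exact/ltW/P_gt0.
- exact: continuous_P.
- by move=> x /=; rewrite PN.
pose F x : R := pi^-1 * atan (t^-1 * x).
have dF x : is_derive x 1 F (P t x).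
  rewrite /F; apply: is_derive_eq; rewrite /P /GRing.scale /= mulr1.
  have d0 : t ^+ 2 + x ^+ 2 != 0 by rewrite gt_eqF ?den_gt0.
  have p0 : (pi : R) != 0 by rewrite gt_eqF ?pi_gt0.
  have e0 : 1 + (t^-1 * x) ^+ 2 != 0 by rewrite gt_eqF // ltr_pwDl ?sqr_ge0.
  have t1 := gt_eqF t0.
  have -> : 1 + (t^-1 * x) ^+ 2 = t ^- 2 * (t ^+ 2 + x ^+ 2) by field; rewrite t1.
  have t1' : t != 0 by rewrite t1.
  by congr (_ * _); field; rewrite d0 t1'.
have -> : [set x : R | 0 <= x] = `[0, +oo[%classic by rewrite set_itvcy.
rewrite (@ge0_continuous_FTC2y _ (P t) F 0 (pi^-1 * (pi / 2))).
- rewrite /F mulr0 atan0 mulr0 sube0 -EFinM; congr EFin.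
  have p0 : (pi : R) != 0 by rewrite gt_eqF ?pi_gt0.
  by rewrite (mulrA pi^-1) mulVf // mul1r mulfV.
- by move=> x _; exact/ltW/P_gt0.
- by apply: continuous_subspaceT; exact: continuous_P.
- apply: cvgM; first exact: cvg_cst.
  apply: (cvg_comp _ _ _ (@cvgy_atan R)).
  by apply: gt0_cvgMry; [rewrite invr_gt0|exact: cvg_id].
- by move=> x _; have [] := dF x.
- apply: cvg_at_right_filter; apply: differentiable_continuous; apply/derivable1_diffP.
  by have [] := dF 0.
by move=> x _; rewrite derive1E; apply: derive_val.
Qed.

Lemma igr_P t : 0 < t -> igr (P t).
Proof.
move=> t0; apply: igrP; first exact: mfun_P.
under eq_integral do rewrite ger0_norm ?P_ge0 ?ltW //.
by rewrite int_P // ltry.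
Qed.

Lemma I_P t : 0 < t -> \I_x P t x = 1.
Proof. by move=> t0; apply: EFin_inj; rewrite -I_fin ?int_P //; exact: igr_P. Qed.

(** With y = x + h the claim reduces to 2 t (|x| + |y|) <= 2 t^2 + x^2 + y^2. The bound is made of
    Poisson kernels again, so its total mass is exactly |h| / t. *)
Lemma P_diff_le t x h : 0 < t ->
  `|P t (x + h) - P t x| <= `|h| / (2 * t) * (P t (x + h) + P t x).
Proof.
move=> t0; have [y ->] : exists y, h = y - x by exists (x + h); ring.
rewrite (addrC x) subrK.
have d0 : 0 < t ^+ 2 + x ^+ 2 by exact: den_gt0.
have d1 : 0 < t ^+ 2 + y ^+ 2 by exact: den_gt0.
have p0 : (pi : R) != 0 by rewrite gt_eqF ?pi_gt0.
have n0 := lt0r_neq0 d0; have n1 := lt0r_neq0 d1.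
have -> : P t y - P t x = - (y - x) * ((y + x) * t * pi^-1 * ((t ^+ 2 + y ^+ 2)^-1 * (t ^+ 2 + x ^+ 2)^-1)).
  by rewrite /P; move: (pi^-1) => c; field; rewrite n0 n1.
have -> : P t y + P t x = (2 * t ^+ 2 + x ^+ 2 + y ^+ 2) * t * pi^-1 * ((t ^+ 2 + y ^+ 2)^-1 * (t ^+ 2 + x ^+ 2)^-1).
  by rewrite /P; move: (pi^-1) => c; field; rewrite n0 n1.
rewrite normrM normrN -[leRHS]mulrA ler_wpM2l //.
set c := (X in _ * X).
have c0 : 0 < c by rewrite mulr_gt0 // invr_gt0.
have d2 : 0 <= t / pi * c.
  by apply: mulr_ge0; [apply: divr_ge0; exact: ltW (pi_gt0 R) || exact: ltW|exact: ltW].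
have -> : (2 * t)^-1 * ((2 * t ^+ 2 + x ^+ 2 + y ^+ 2) * t / pi * c) =
   ((2 * t ^+ 2 + x ^+ 2 + y ^+ 2) / (2 * t)) * (t / pi * c) by move: (pi^-1) => p; field; rewrite gt_eqF.
have -> : (y + x) * t / pi * c = (y + x) * (t / pi * c) by rewrite -!mulrA.
rewrite normrM (ger0_norm d2) ler_wpM2r //.
rewrite ler_pdivlMr ?mulr_gt0 //.
apply: (@le_trans _ _ ((`|y| + `|x|) * (2 * t))).
  by rewrite ler_wpM2r ?ler_normD // mulr_ge0 // ltW.
have := real_normK (num_real x); have := real_normK (num_real y).
move: `|x| `|y| => X Y <- <-; have := sqr_ge0 (t - X); have := sqr_ge0 (t - Y); nra.
Qed.

Lemma dP_le t x : 0 < t -> `|dP t x| = 2 * `|x| / (t ^+ 2 + x ^+ 2) * P t x.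
Proof.
move=> t0; have d0 := den_gt0 x t0; rewrite /dP /P normrN !normrM !normfV.
rewrite normrX (ger0_norm (ltW d0)) (ger0_norm (ltW t0)) (ger0_norm (ltW (pi_gt0 R))).
have n0 := lt0r_neq0 d0.
by rewrite (ger0_norm (ler0n _ 2)); move: (pi^-1) => c; field; rewrite n0.
Qed.

(* For [|h| <= t] the first order Taylor remainder of [P t] keeps the decay of [P t / (t^2 + x^2)]. *)
Lemma P_taylor t x h : 0 < t -> `|h| <= t ->
  `|P t (x + h) - P t x - h * dP t x| <= 18 * h ^+ 2 / (t ^+ 2 + x ^+ 2) * P t x.
Proof.
move=> t0; have [y hE] : exists y, h = y - x by exists (x + h); ring.
have -> : x + h = y by rewrite hE (addrC x) subrK.
move=> ht.
have d0 : 0 < t ^+ 2 + x ^+ 2 by exact: den_gt0.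
have d1 : 0 < t ^+ 2 + y ^+ 2 by exact: den_gt0.
have p0 : (pi : R) != 0 by rewrite gt_eqF ?pi_gt0.
have n0 := lt0r_neq0 d0; have n1 := lt0r_neq0 d1.
set a := t ^+ 2 + x ^+ 2 in d0 *; set b := t ^+ 2 + y ^+ 2 in d1 *.
have -> : P t y - P t x - h * dP t x =
    (t / pi * h ^+ 2 * a^-1) * ((b^-1) * (- 1 + 2 * x * (2 * x + h) / a)).
  by rewrite /P /dP /a /b hE; move: (pi^-1) => c; field; rewrite n0 n1.
have -> : 18 * h ^+ 2 / a * P t x = (t / pi * h ^+ 2 * a^-1) * (18 / a).
  by rewrite /P -/a; move: (pi^-1) => c; field; rewrite n0.
have c0 : 0 <= t / pi * h ^+ 2 / a.
  apply: divr_ge0; last exact: ltW.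
  by apply: mulr_ge0; [apply: divr_ge0; exact: ltW (pi_gt0 R) || exact: ltW|exact: sqr_ge0].
rewrite normrM (ger0_norm c0) ler_wpM2l //.
rewrite normrM ger0_norm; last by rewrite invr_ge0 ltW.
have h2 : h ^+ 2 <= t ^+ 2 by rewrite -normK2 lerXn2r ?nnegrE // ltW.
have xh : 2 * `|x * h| <= a.
  rewrite normrM; apply: (@le_trans _ _ (2 * (`|x| * t))).
    by rewrite ler_pM2l // ler_wpM2l.
  rewrite /a -(real_normK (num_real x)); move: `|x| => X; have := sqr_ge0 (t - X); nra.
(* Since |h| <= t, the denominators at the two points are comparable. The constant 18 is this 3
   times the 6 of the next bound. *)
have ab : a <= 3 * b.
  by move: h2; rewrite /a /b hE => h2; have := sqr_ge0 (2 * y - x - x + x); have := sqr_ge0 (x - 2 * (x - y)); nra.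
have m6 : `|- 1 + 2 * x * (2 * x + h) / a| <= 6.
  apply: (le_trans (ler_normD _ _)); rewrite normrN normr1.
  suff : `|2 * x * (2 * x + h) / a| <= 5 by lra.
  rewrite normrM normfV (ger0_norm (ltW d0)) ler_pdivrMr //.
  have -> : 2 * x * (2 * x + h) = 4 * x ^+ 2 + 2 * (x * h) by ring.
  apply: (le_trans (ler_normD _ _)).
  rewrite (ger0_norm (mulr_ge0 _ (sqr_ge0 x))) // [`|2 * _|]normrM (ger0_norm (ler0n _ 2)).
  have : x ^+ 2 <= a by rewrite /a lerDr sqr_ge0.
  lra.
have : b^-1 * 6 <= 18 / a.
  by rewrite mulrC ler_pdivlMr // mulrAC ler_pdivrMr //; lra.
by apply: le_trans; rewrite ler_pM2l // invr_gt0.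
Qed.

End Poisson.

Ltac pos := repeat first
 [ done | by apply: ltW | exact: sqr_ge0 | exact: expR_ge0 | exact: normr_ge0
 | match goal with
   | |- is_true (0 <= P _ _) => apply: P_ge0
   | |- is_true (0 <= _ * _) => apply: mulr_ge0
   | |- is_true (0 <= _ + _) => apply: addr_ge0
   | |- is_true (0 <= _ ^-1) => rewrite invr_ge0
   | |- is_true (0 < P _ _) => apply: P_gt0
   | |- is_true (0 < _ * _) => apply: mulr_gt0
   | |- is_true (0 < _ + _) => apply: addr_gt0
   | |- is_true (0 < _ ^-1) => rewrite invr_gt0
   | |- is_true (0 < expR _) => exact: expR_gt0
   end ].

Lemma is_derive_comp {R : realType} (f g : R -> R) (x df dg : R) :
  is_derive (g x) 1 f df -> is_derive x 1 g dg -> is_derive x 1 (fun x => f (g x)) (df * dg).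
Proof. by move=> hf hg; exact: (is_derive1_comp hf hg). Qed.

(** * The convolution identity of the Poisson kernels *)

Section Semigroup.
Context {R : realType}.
Implicit Types (t s x y h : R) (g : R -> R).
Notation mu := (@lebesgue_measure R).

Lemma mfun_P2 d (T : measurableType d) (f g : T -> R) : mfun f -> mfun g -> mfun (fun z => P (f z) (g z)).
Proof. by move=> mf mg; rewrite /P; meas. Qed.

(** The resultant of the two denominators as polynomials in y. For s, t > 0 it vanishes only when x
    = 0 and s = t: the kernels then share their poles and the partial fractions break down. *)
Let Delta s t x := (x ^+ 2 + (s - t) ^+ 2) * (x ^+ 2 + (s + t) ^+ 2).
Let A s t x := 2 * x / Delta s t x.
Let B s t x := (x ^+ 2 + s ^+ 2 - t ^+ 2) / Delta s t x.
Let D s t x := (x ^+ 2 + t ^+ 2 - s ^+ 2) / Delta s t x.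

(* Partial fractions give this primitive of the integrand of [P s * P t]. *)
Let Phi s t x y := s * t * pi^-1 ^+ 2 *
  (A s t x / 2 * (ln (t ^+ 2 + y ^+ 2) - ln (s ^+ 2 + (x - y) ^+ 2)) +
   B s t x / t * atan (t^-1 * y) - D s t x / s * atan (s^-1 * (x - y))).

(** Both arguments are at least y^2 / 4 while they differ by at most K y / 4, so their ratio is 1 +
    O(1 / y); ln (1 + z) <= z is used for the ratio and for its inverse. *)
Let log_ratio_cvg s t x : 0 < s -> 0 < t ->
  ln (t ^+ 2 + y ^+ 2) - ln (s ^+ 2 + (x - y) ^+ 2) @[y --> +oo] --> (0 : R).
Proof.
move=> s0 t0; pose K := 4 * (t ^+ 2 + s ^+ 2 + x ^+ 2 + 2 * `|x|).
have K0 : 0 <= K by rewrite mulr_ge0 // !addr_ge0 ?sqr_ge0 // mulr_ge0.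
have cK : K * y^-1 @[y --> +oo] --> (0 : R).
  rewrite -(mulr0 K); apply: cvgM; first exact: cvg_cst.
  apply/gtr0_cvgV0; last exact: cvg_id.
  by near=> y; near: y; exact: nbhs_pinfty_gt.
have cK' : - (K * y^-1) @[y --> +oo] --> (0 : R) by rewrite -oppr0; exact: cvgN.
apply: (squeeze_cvgr _ cK' cK); near=> y.
have y1 : 1 <= y by near: y; apply: nbhs_pinfty_ge; rewrite num_real.
have yx : 2 * `|x| <= y by near: y; apply: nbhs_pinfty_ge; rewrite num_real.
have y0 : 0 < y by rewrite (lt_le_trans _ y1).
have key (a b : R) : 0 < a -> y ^+ 2 / 4 <= b -> 0 < b -> `|a - b| <= K / 4 * y -> ln a - ln b <= K / y.
  move=> a0 yb b0 ab; rewrite -ln_div ?posrE //.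
  have -> : a / b = 1 + (a - b) / b by field; rewrite gt_eqF.
  apply: (le_trans (le_ln1Dx _)).
    by rewrite -subr_gt0 opprK addrC; have -> : 1 + (a - b) / b = a / b; [field; rewrite gt_eqF|rewrite divr_gt0].
  apply: (@le_trans _ _ ((K / 4 * y) / b)).
    by rewrite ler_pM2r ?invr_gt0 // (le_trans (ler_norm _)).
  rewrite ler_pdivrMr // ; apply: (@le_trans _ _ (K / y * (y ^+ 2 / 4))).
    by rewrite (_ : K / 4 * y = K / y * (y ^+ 2 / 4)) //; field; rewrite gt_eqF.
  by rewrite ler_wpM2l // divr_ge0 // ltW.
have a0 : 0 < t ^+ 2 + y ^+ 2 by exact: den_gt0.
have b0 : 0 < s ^+ 2 + (x - y) ^+ 2 by exact: den_gt0.
have xn := ler_norm x; have xn' := ler_norm (- x); rewrite normrN in xn'.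
have xx := real_normK (num_real x).
have yb : y ^+ 2 / 4 <= s ^+ 2 + (x - y) ^+ 2.
  have h : y / 2 <= y - x by lra.
  have : (y / 2) ^+ 2 <= (y - x) ^+ 2 by rewrite lerXn2r ?nnegrE //; [rewrite divr_ge0 // ltW|lra].
  by have := sqr_ge0 s; nra.
have ya : y ^+ 2 / 4 <= t ^+ 2 + y ^+ 2 by have := sqr_ge0 t; have := sqr_ge0 y; lra.
have ab : `|t ^+ 2 + y ^+ 2 - (s ^+ 2 + (x - y) ^+ 2)| <= K / 4 * y.
  have -> : K / 4 * y = (t ^+ 2 + s ^+ 2 + x ^+ 2) * y + 2 * `|x| * y by rewrite /K; field.
  have -> : t ^+ 2 + y ^+ 2 - (s ^+ 2 + (x - y) ^+ 2) = (t ^+ 2 - s ^+ 2 - x ^+ 2) + 2 * x * y by ring.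
  apply: (le_trans (ler_normD _ _)); apply: lerD; last by rewrite !normrM (gtr0_norm y0) ger0_norm.
  apply: (@le_trans _ _ (t ^+ 2 + s ^+ 2 + x ^+ 2)); last by rewrite ler_peMr // !addr_ge0 ?sqr_ge0.
  by rewrite ler_norml; have := sqr_ge0 t; have := sqr_ge0 s; have := sqr_ge0 x; lra.
apply/andP; split; last exact: key.
by rewrite lerNl opprB; apply: key => //; rewrite distrC.
Unshelve. all: by end_near. Qed.

Let is_derive_Phi s t x y : 0 < s -> 0 < t -> Delta s t x != 0 ->
  is_derive y 1 (Phi s t x) (P s (x - y) * P t y).
Proof.
move=> s0 t0 D0; rewrite /Phi.
have a0 : 0 < t ^+ 2 + y ^+ 2 by exact: den_gt0.
have b0 : 0 < s ^+ 2 + (x - y) ^+ 2 by exact: den_gt0.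
have da : is_derive y 1 (fun y => ln (t ^+ 2 + y ^+ 2)) ((t ^+ 2 + y ^+ 2)^-1 * (2 * y)).
  have h : is_derive y 1 (fun y => t ^+ 2 + y ^+ 2) (2 * y).
    by apply: is_derive_eq; rewrite /GRing.scale /=; ring.
  exact: (is_derive_comp (g := fun y => t ^+ 2 + y ^+ 2) (is_derive1_ln a0) h).
have db : is_derive y 1 (fun y => ln (s ^+ 2 + (x - y) ^+ 2)) ((s ^+ 2 + (x - y) ^+ 2)^-1 * (- 2 * (x - y))).
  have h : is_derive y 1 (fun y => s ^+ 2 + (x - y) ^+ 2) (- 2 * (x - y)).
    by apply: is_derive_eq; rewrite /GRing.scale /=; ring.
  exact: (is_derive_comp (g := fun y => s ^+ 2 + (x - y) ^+ 2) (is_derive1_ln b0) h).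
have dat : is_derive y 1 (fun y => atan (t^-1 * y)) (t / (t ^+ 2 + y ^+ 2)).
  have h : is_derive y 1 (fun y => t^-1 * y) t^-1.
    by apply: is_derive_eq; rewrite /GRing.scale /=; ring.
  have hh := is_derive_comp (g := fun y => t^-1 * y) (is_derive1_atan (t^-1 * y)) h; apply: (is_derive_eq hh).
  have e0 : 1 + (t^-1 * y) ^+ 2 != 0 by rewrite gt_eqF // ltr_pwDl ?sqr_ge0.
  have -> : 1 + (t^-1 * y) ^+ 2 = t ^- 2 * (t ^+ 2 + y ^+ 2) by field; rewrite gt_eqF.
  by field; rewrite !gt_eqF.
have das : is_derive y 1 (fun y => atan (s^-1 * (x - y))) (- s / (s ^+ 2 + (x - y) ^+ 2)).
  have h : is_derive y 1 (fun y => s^-1 * (x - y)) (- s^-1).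
    by apply: is_derive_eq; rewrite /GRing.scale /=; ring.
  have hh := is_derive_comp (g := fun y => s^-1 * (x - y)) (is_derive1_atan (s^-1 * (x - y))) h; apply: (is_derive_eq hh).
  have -> : 1 + (s^-1 * (x - y)) ^+ 2 = s ^- 2 * (s ^+ 2 + (x - y) ^+ 2) by field; rewrite gt_eqF.
  by field; rewrite !gt_eqF.
apply: is_derive_eq; rewrite /GRing.scale /= /P.
have n1 := lt0r_neq0 a0; have n2 := lt0r_neq0 b0; have n3 := lt0r_neq0 s0; have n4 := lt0r_neq0 t0.
move: (pi^-1) => p; move: D0; rewrite /A /B /D /Delta; rewrite mulf_eq0 negb_or => /andP[D1 D2].
by field; rewrite n1 n2 n3 n4 D1 D2.
Qed.

Lemma ge0_integral_halves (f : R -> \bar R) : mfun f -> (forall x, 0 <= f x)%E ->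
  (\int[mu]_x f x = \int[mu]_(x in `[0%R, +oo[) f x + \int[mu]_(x in `[0%R, +oo[) f (- x)%R)%E.
Proof.
move=> mf f0.
have mfN : mfun (fun x => f (- x)%R) by meas.
rewrite (ge0_integration_by_substitution0 mfN) //.
under [X in (_ + X)%E]eq_integral do rewrite opprK.
rewrite -(@integral_itv_obnd_cbnd _ 0 +oo%O); last exact: measurable_funTS.
rewrite addeC -ge0_integral_setU //=.
- suff -> : `]-oo, 0] `|` `]0, +oo[ = [set: R] by [].
  apply/seteqP; split => x //= _; rewrite !in_itv /= andbT.
  by case: (leP x 0); [left|right].
- exact: measurable_funTS.
- by apply/disj_setPS => x /= []; rewrite !in_itv /= andbT => h1 h2; have := le_lt_trans h1 h2; rewrite ltxx.
Qed.

Let atan_cvg s x : 0 < s -> atan (s^-1 * (x - y)) @[y --> +oo] --> (- (pi / 2) : R).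
Proof.
move=> s0.
have -> : (fun y => atan (s^-1 * (x - y))) = (fun y => - atan (s^-1 * (y - x))).
  by apply/funext => y; rewrite -atanN -mulrN opprB.
apply: cvgN; apply: (cvg_comp _ _ _ (@cvgy_atan R)).
apply: gt0_cvgMry; first by rewrite invr_gt0.
apply/cvgryPge => A0; near=> y; rewrite lerBrDr; near: y; apply: nbhs_pinfty_ge.
exact: num_real.
Unshelve. all: by end_near. Qed.

Let half s t x : 0 < s -> 0 < t -> Delta s t x != 0 ->
  (\int[mu]_(y in `[0%R, +oo[) (P s (x - y) * P t y)%:E =
   (s * t * pi^-1 ^+ 2 * ((B s t x / t + D s t x / s) * (pi / 2)) - Phi s t x 0)%:E)%E.
Proof.
move=> s0 t0 D0.
have dPhi y := is_derive_Phi y s0 t0 D0.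
rewrite (@ge0_continuous_FTC2y _ (fun y => P s (x - y) * P t y) (Phi s t x) 0
  (s * t * pi^-1 ^+ 2 * ((B s t x / t + D s t x / s) * (pi / 2)))) //.
- by move=> y _; rewrite mulr_ge0 // ltW // P_gt0.
- apply: continuous_subspaceT => y; apply: cvgM; last exact: continuous_P.
  apply: (continuous_comp (f := fun y => x - y)); last exact: continuous_P.
  by apply: cvgB; [exact: cvg_cst|exact: cvg_id].
- apply: cvgM; first exact: cvg_cst.
  have -> : (B s t x / t + D s t x / s) * (pi / 2) =
    A s t x / 2 * 0 + B s t x / t * (pi / 2) - D s t x / s * (- (pi / 2)) by move: (pi : R) => p; ring.
  apply: cvgB; last by apply: cvgM; [exact: cvg_cst|exact: atan_cvg].
  apply: cvgD; first by apply: cvgM; [exact: cvg_cst|exact: log_ratio_cvg].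
  apply: cvgM; first exact: cvg_cst.
  apply: (cvg_comp _ _ _ (@cvgy_atan R)).
  by apply: gt0_cvgMry; [rewrite invr_gt0|exact: cvg_id].
- apply: cvg_at_right_filter; apply: differentiable_continuous; apply/derivable1_diffP.
  by have [] := dPhi 0.
by move=> y _; rewrite derive1E; apply: derive_val.
Qed.

Let P_conv_nondeg s t x : 0 < s -> 0 < t -> Delta s t x != 0 ->
  (\int[mu]_y (P s (x - y) * P t y)%:E = (P (s + t) x)%:E)%E.
Proof.
move=> s0 t0 D0.
rewrite ge0_integral_halves; last 2 first.
- by apply/measurable_EFinP; apply: measurable_funM; apply: mfun_P2; meas.
- by move=> y; rewrite lee_fin mulr_ge0 // ltW // P_gt0.
rewrite half //.
have -> : (\int[mu]_(y in `[0%R, +oo[) (P s (x - - y) * P t (- y))%:E =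
  \int[mu]_(y in `[0%R, +oo[) (P s ((- x) - y) * P t y)%:E)%E.
  by apply: eq_integral => y _; rewrite (PN t) -(PN s (x - - y)) opprK opprD.
have DN : Delta s t (- x) = Delta s t x by rewrite /Delta sqrrN.
rewrite half // ?DN // -EFinD; congr EFin.
have AN : A s t (- x) = - A s t x by rewrite /A DN mulrN mulNr.
have BN : B s t (- x) = B s t x by rewrite /B DN sqrrN.
have DDN : D s t (- x) = D s t x by rewrite /D DN sqrrN.
(* The primitive is odd in x at y = 0, so the boundary terms of the two half-lines cancel and only
   the arctan limits at infinity remain. *)
have -> : Phi s t (- x) 0 = - Phi s t x 0.
  rewrite /Phi AN BN DDN !subr0 sqrrN mulr0 atan0 mulrN atanN; move: (pi^-1) => p.
  by ring.
have p0 : (pi : R) != 0 by rewrite gt_eqF ?pi_gt0.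
have n3 := lt0r_neq0 s0; have n4 := lt0r_neq0 t0.
have n5 : s + t != 0 by rewrite gt_eqF ?addr_gt0.
have n6 := lt0r_neq0 (den_gt0 x (addr_gt0 s0 t0)).
transitivity (s * t * pi^-1 * (pi^-1 * pi) * (B s t x / t + D s t x / s)).
  by rewrite BN DDN; move: (pi : R) (pi^-1) => q p; field; rewrite n3 n4.
rewrite mulVf // mulr1.
rewrite /P; move: (pi^-1) => p.
move: D0; rewrite /B /D /Delta; rewrite mulf_eq0 negb_or => /andP[D1 D2].
by field; rewrite ?n3 ?n4 ?D1 ?D2 ?n6.
Qed.

Lemma P_conv s t x : 0 < s -> 0 < t ->
  (\int[mu]_y (P s (x - y) * P t y)%:E = (P (s + t) x)%:E)%E.
Proof.
move=> s0 t0; have [D0|] := eqVneq (Delta s t x) 0; last exact: P_conv_nondeg.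
have [x0 st] : x = 0 /\ s = t.
  move/eqP: D0; rewrite /Delta mulf_eq0 !paddr_eq0 ?sqr_ge0 // !sqrf_eq0 subr_eq0.
  case/orP => /andP[/eqP x0 /eqP h]; split => //.
  by have := addr_gt0 s0 t0; rewrite h ltxx.
subst x s.
(* splitting one factor as [P (t/3) * P (2t/3)] avoids the degenerate case *)
have nd a b z : 0 < a -> 0 < b -> a != b ->
    (\int[mu]_y (P a (z - y) * P b y)%:E = (P (a + b) z)%:E)%E.
  move=> a0 b0 ab; apply: P_conv_nondeg => //.
  rewrite /Delta mulf_neq0 // gt_eqF //.
    by rewrite ltr_wpDl ?sqr_ge0 // lt_neqAle sqr_ge0 andbT eq_sym sqrf_eq0 subr_eq0.
  by rewrite ltr_wpDl ?sqr_ge0 // exprn_gt0 // addr_gt0.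
pose a := t / 3; pose b := 2 * t / 3.
have a0 : 0 < a by rewrite divr_gt0.
have b0 : 0 < b by rewrite divr_gt0 // mulr_gt0.
have tE : t = a + b by rewrite /a /b; field.
have mP u v c d (T : measurableType d) (f g : T -> R) : mfun f -> mfun g -> 
  mfun (fun z : T => P u (c - f z) * P v (g z)).
  by move=> mf mg; apply: measurable_funM; apply: mfun_P2; meas.
(* Associativity of convolution: the pairs that occur, (a, b), (t, a) and (t + a, b), all have
   unequal parameters. *)
transitivity (\int[mu]_y \int[mu]_z (P t (0 - y) * (P a (y - z) * P b z))%:E)%E.
  apply: eq_integral => y _; under [RHS]eq_integral do rewrite EFinM.
  rewrite ge0_integralZl //; last 3 first.
  - by apply/measurable_EFinP; exact: (mP a b y _ _ id id).
  - by move=> z _; rewrite lee_fin mulr_ge0 // ltW // P_gt0.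
  - by rewrite lee_fin ltW // P_gt0.
  rewrite nd // -?tE ?EFinM //; rewrite /a /b; apply/eqP => h.
  by have : t = 0 by [lra|]; move/eqP; rewrite gt_eqF.
rewrite (tonelli (F := fun z => P t (0 - z.1) * (P a (z.1 - z.2) * P b z.2))); last 2 first.
- by apply: measurable_funM; [|apply: measurable_funM]; apply: mfun_P2; meas.
- by move=> z; pos.
transitivity (\int[mu]_z (P (t + a) (0 - z) * P b z)%:E)%E.
  apply: eq_integral => z _ /=.
  have he : (\int[mu]_y (P t (0 - y) * P a (y - z))%:E = (P (t + a) (0 - z))%:E)%E.
    rewrite -(integral_shift z (f := fun y => (P t (0 - y) * P a (y - z))%:E)); last first.
      by apply/measurable_EFinP; apply: measurable_funM; apply: mfun_P2; meas.
    rewrite -nd //; last by apply/eqP; rewrite /a => h; have : t = 0 by [lra|]; move/eqP; rewrite gt_eqF.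
    by apply: eq_integral => y _; rewrite addrK opprD addrA addrAC.
  under eq_integral do rewrite mulrA EFinM.
  rewrite ge0_integralZr //; last 3 first.
  - by apply/measurable_EFinP; apply: measurable_funM; apply: mfun_P2; meas.
  - by move=> y _; rewrite lee_fin; pos.
  - by rewrite lee_fin; pos.
  by rewrite he EFinM.
rewrite nd ?addr_gt0 //; last by apply/eqP; rewrite /a /b => h; have : t = 0 by [lra|]; move/eqP; rewrite gt_eqF.
by rewrite -addrA -tE.
Qed.

Lemma igr_P_conv s t x z : 0 < s -> 0 < t ->
  igr (fun y => P s (x - y) * P t (y - z)) /\
  \I_y (P s (x - y) * P t (y - z)) = P (s + t) (x - z).
Proof.
move=> s0 t0.
have p0 y : 0 <= P s (x - y) * P t (y - z) by rewrite mulr_ge0 // ltW // P_gt0.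
have m : mfun (fun y => P s (x - y) * P t (y - z)) by apply: measurable_funM; apply: mfun_P2; meas.
have e : (\int[mu]_y (P s (x - y) * P t (y - z))%:E = (P (s + t) (x - z))%:E)%E.
  rewrite -(integral_shift z (f := fun y => (P s (x - y) * P t (y - z))%:E)); last exact/measurable_EFinP.
  rewrite -P_conv //; apply: eq_integral => y _.
  by rewrite addrK opprD addrA addrAC.
have ig : igr (fun y => P s (x - y) * P t (y - z)).
  by apply: igrP => //; under eq_integral do rewrite ger0_norm //; rewrite e ltry.
by split => //; apply: EFin_inj; rewrite -I_fin.
Qed.

End Semigroup.

Ltac meas2 := repeat first [ progress meas
 | match goal with |- measurable_fun _ ?f => match f with
   | (fun _ => P _ _) => apply: mfun_P2 end end ].

(** * Poisson extensions as operators on functions *)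

Section PoissonOperator.
Context {R : realType}.
Implicit Types (t s x y h a b : R) (g k : R -> R) (M C : R).
Notation mu := (@lebesgue_measure R).

Definition pc t g x := \I_y (P t (x - y) * g y).

(** A common domain for the Poisson extension: it contains the datum, which is in L^2 but may be
    unbounded, and also the layer and constants, which are bounded but not in L^2. *)
Definition pint g := mfun g /\ forall t x, 0 < t -> igr (fun y => P t (x - y) * g y).

Lemma mfun_pc d (T : measurableType d) (a b : T -> R) (G : T * R -> R) :
  mfun a -> mfun b -> mfun G -> mfun (fun z => \I_y (P (a z) (b z - y) * G (z, y))).
Proof.
move=> ma mb mG; apply: (measurable_I (F := fun z => P (a z.1) (b z.1 - z.2) * G z)).
by meas2.
Qed.

Lemma pint_mfun g : pint g -> mfun g. Proof. by case. Qed.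

Lemma pint_abs g : pint g -> pint (fun x => `|g x|).
Proof.
move=> [mg h]; split; first by meas.
move=> t x t0; apply: (igr_le _ (igr_abs (h t x t0))) => [|y]; first by meas2.
by rewrite !normrM normr_id.
Qed.

Lemma pint_dom g k : mfun g -> pint k -> (forall x, `|g x| <= k x) -> pint g.
Proof.
move=> mg [mk h] gk; split => // t x t0.
apply: (igr_le _ (h t x t0)) => [|y]; first by meas2.
by rewrite normrM ger0_norm ?ler_wpM2l // ltW // P_gt0.
Qed.

Lemma pintZ c g : pint g -> pint (fun x => c * g x).
Proof.
move=> [mg h]; split; first by meas.
move=> t x t0; rewrite (_ : (fun y => _) = fun y => c * (P t (x - y) * g y)); first exact: igrZ (h t x t0).
by apply/funext => y; rewrite mulrCA.
Qed.

Lemma pintD g k : pint g -> pint k -> pint (fun x => g x + k x).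
Proof.
move=> [mg h] [mk h']; split; first by meas.
move=> t x t0; under [fun y => _]funext do rewrite mulrDr.
by apply: igrD; [exact: h|exact: h'].
Qed.

Lemma pintB g k : pint g -> pint k -> pint (fun x => g x - k x).
Proof.
move=> [mg h] [mk h']; split; first by meas.
move=> t x t0; under [fun y => _]funext do rewrite mulrBr.
by apply: igrB; [exact: h|exact: h'].
Qed.

Lemma igr_Px t x : 0 < t -> igr (fun y => P t (x - y)).
Proof. by move=> t0; apply: (igr_reflect x (igr_P t0)). Qed.

Lemma I_Px t x : 0 < t -> \I_y P t (x - y) = 1.
Proof. by move=> t0; rewrite (I_reflect x (f := P t)) ?I_P //; exact: mfun_P. Qed.

Lemma pint_bounded g M : mfun g -> (forall x, `|g x| <= M) -> pint g.
Proof.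
move=> mg bg; split => // t x t0.
apply: (igr_le _ (igrZ M (igr_Px x t0))) => [|y]; first by meas2.
by rewrite normrM (ger0_norm (P_ge0 _ (ltW t0))) mulrC ler_wpM2r // P_ge0 // ltW.
Qed.

Lemma pint_cst c : pint (fun=> c).
Proof. by apply: (@pint_bounded _ `|c|) => //; exact: measurable_cst. Qed.

Lemma pint_sqr g : mfun g -> igr (fun x => g x ^+ 2) -> pint g.
Proof.
move=> mg ig; split => // t x t0.
apply: (igr_le (g := fun y => 2^-1 * ((pi * t)^-1 * P t (x - y) + g y ^+ 2))) => [||y]; first by meas2.
  by apply: igrZ; apply: igrD => //; apply: igrZ; exact: igr_Px.
rewrite normrM ger0_norm; last by rewrite ltW // P_gt0.
have p0 : 0 <= P t (x - y) by rewrite ltW // P_gt0.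
have pl := P_le (x - y) t0.
rewrite -(real_normK (num_real (g y))); move: p0 pl; move: (P t (x - y)) (pi * t)^-1 `|g y| => p q z p0 pl.
by have := sqr_ge0 (p - z); have := ler_wpM2r p0 pl; nra.
Qed.

Lemma pcD t g k x : 0 < t -> pint g -> pint k -> pc t (fun y => g y + k y) x = pc t g x + pc t k x.
Proof.
move=> t0 hg hk; rewrite /pc -I_D; [|exact: hg.2|exact: hk.2].
by apply: eq_I => y; rewrite mulrDr.
Qed.

Lemma pcB t g k x : 0 < t -> pint g -> pint k -> pc t (fun y => g y - k y) x = pc t g x - pc t k x.
Proof.
move=> t0 hg hk; rewrite /pc -I_B; [|exact: hg.2|exact: hk.2].
by apply: eq_I => y; rewrite mulrBr.
Qed.

Lemma pcZ t c g x : 0 < t -> pint g -> pc t (fun y => c * g y) x = c * pc t g x.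
Proof.
move=> t0 hg; rewrite /pc -I_Z; last exact: hg.2.
by apply: eq_I => y; rewrite mulrCA.
Qed.

Lemma pc_cst t c x : 0 < t -> pc t (fun=> c) x = c.
Proof.
move=> t0; rewrite -[RHS]mulr1 -(I_Px x t0) -I_Z; last exact: igr_Px.
by apply: eq_I => y; rewrite mulrC.
Qed.

Lemma pc_le t g k x : 0 < t -> pint g -> pint k -> (forall y, g y <= k y) -> pc t g x <= pc t k x.
Proof.
move=> t0 hg hk gk; apply: I_le; [exact: hg.2|exact: hk.2|] => y.
by rewrite ler_wpM2l // ltW // P_gt0.
Qed.

Lemma pc_ge0 t g x : 0 < t -> (forall y, 0 <= g y) -> 0 <= pc t g x.
Proof. by move=> t0 g0; apply: I_ge0 => y; rewrite mulr_ge0 // ltW // P_gt0. Qed.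

Lemma pc_abs t g x : 0 < t -> pint g -> `|pc t g x| <= pc t (fun y => `|g y|) x.
Proof.
move=> t0 hg; apply: I_bound; [exact: (pint_abs hg).2|have := pint_mfun hg => ?; by meas2|] => y.
by rewrite normrM ger0_norm // ltW // P_gt0.
Qed.

Lemma pc_sup t g M x : 0 < t -> mfun g -> (forall y, `|g y| <= M) -> `|pc t g x| <= M.
Proof.
move=> t0 mg bg; have pg := pint_bounded mg bg.
apply: (le_trans (pc_abs x t0 pg)); rewrite -[leRHS](pc_cst _ x t0).
by apply: pc_le => //; [exact: pint_abs|exact: pint_cst].
Qed.

Lemma mfun_pc1 t g : mfun g -> mfun (pc t g).
Proof.
move=> mg; apply: (@mfun_pc _ R (fun=> t) id (fun z => g z.2)); [by meas|by meas|by meas].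
Qed.

(** Integrating out the middle variable of |P_s P_t g| leaves P_{s+t} |g|, which is integrable; one
    use of Fubini gives both the convergence of the outer extension and the semigroup law. *)
Lemma pc_swap s t g x : 0 < s -> 0 < t -> pint g ->
  igr (fun y => P s (x - y) * pc t g y) /\ pc s (pc t g) x = pc (s + t) g x.
Proof.
move=> s0 t0 hg; have mg := pint_mfun hg.
pose F z : R := P s (x - z.1) * (P t (z.1 - z.2) * g z.2).
have mF : mfun (F : R * R -> R) by rewrite /F; meas2.
have fin : (\int[mu]_y \int[mu]_z (`|F (y, z)|)%:E < +oo)%E.
  rewrite (tonelli (F := fun z => `|F z|)) //; last by meas.
  have -> : (\int[mu]_z \int[mu]_y (`|F (y, z)|)%:E = \int[mu]_z (`|P (s + t) (x - z) * g z|)%:E)%E.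
    apply: eq_integral => z _.
    have [ig e] := igr_P_conv x z s0 t0.
    transitivity (\int[mu]_y ((P s (x - y) * P t (y - z))%:E * (`|g z|)%:E))%E.
      apply: eq_integral => y _; rewrite -EFinM /F /= mulrA normrM ger0_norm //.
      by rewrite mulr_ge0 // ltW // P_gt0.
    rewrite ge0_integralZr //; last 2 first.
    - by apply/measurable_EFinP; meas2.
    - by move=> y _; rewrite lee_fin mulr_ge0 // ltW // P_gt0.
    by rewrite I_fin // e -EFinM normrM ger0_norm // ltW // P_gt0 // addr_gt0.
  exact: igr_lty (hg.2 _ x (addr_gt0 s0 t0)).
have [i1 i2 e] := I_swap mF fin.
have e1 y : \I_z F (y, z) = P s (x - y) * pc t g y by rewrite /F /= /pc (I_Z _ (hg.2 t y t0)).
split; first by rewrite -(funext e1); exact: i1.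
transitivity (\I_y \I_z F (y, z)); first by apply: eq_I => y; rewrite e1.
rewrite e /pc; apply: eq_I => z.
have [ig ez] := igr_P_conv x z s0 t0.
rewrite -ez mulrC -(I_Z _ ig); apply: eq_I => y.
by rewrite /F /= mulrA mulrC.
Qed.

Lemma pc_semigroup s t g x : 0 < s -> 0 < t -> pint g -> pc s (pc t g) x = pc (s + t) g x.
Proof. by move=> s0 t0 hg; have [] := pc_swap x s0 t0 hg. Qed.

Lemma pint_pc t g : 0 < t -> pint g -> pint (pc t g).
Proof.
move=> t0 hg; split; first exact: mfun_pc1 (pint_mfun hg).
by move=> s x s0; have [] := pc_swap x s0 t0 hg.
Qed.

Lemma pcE t g x : mfun g -> pc t g x = \I_y (P t y * g (x - y)).
Proof.
move=> mg; rewrite /pc -(I_reflect x); last by meas2.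
by apply: eq_I => y; rewrite opprB addrC subrK.
Qed.

Lemma pc_shift t g x h : mfun g -> pc t g (x + h) = pc t (fun y => g (y + h)) x.
Proof.
move=> mg; rewrite !pcE //; last by meas.
by apply: eq_I => y; rewrite addrAC.
Qed.

Lemma nb_pc t g M : 0 < t -> nb g M -> nb (pc t g) M.
Proof.
move=> t0 hg; have M0 := nb_ge0 hg; have mg := nb_mfun hg.
have -> : pc t g = (fun x => \I_y (P t y * g (x - y))) by apply/funext => x; exact: pcE.
rewrite -[M]mul1r; apply: (nb_minkowski (h := fun z => g (z.2 - z.1))) => //.
- exact: mfun_P.
- by move=> y; rewrite ltW // P_gt0.
- by rewrite int_P.
- by meas.
by move=> y _ /=; exact: nb_shift.
Qed.

(** A real factor in place of a restricted domain: time integrals become integrals over the line,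
    with a weight to which [I_swap] and [nb_minkowski] apply directly. *)
Definition ind a b s : R := if (a < s) && (s < b) then 1 else 0.

Lemma ind_ge0 a b s : 0 <= ind a b s. Proof. by rewrite /ind; case: ifP. Qed.

Lemma mfun_ind d (T : measurableType d) (a b s : T -> R) : mfun a -> mfun b -> mfun s ->
  mfun (fun z => ind (a z) (b z) (s z)).
Proof.
move=> ma mb ms; rewrite /ind; apply: measurable_fun_ifT; [|exact: measurable_cst|exact: measurable_cst].
by apply: measurable_and; exact: measurable_fun_ltr.
Qed.

Lemma mfun_ind1 a b : mfun (ind a b).
Proof. by apply: (@mfun_ind _ _ (fun=> a) (fun=> b) id); meas. Qed.

Lemma int_ind a b : a <= b -> (\int[mu]_s (ind a b s)%:E = (b - a)%:E)%E.
Proof.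
move=> ab; transitivity (\int[mu]_s (\1_(`]a, b[%classic : set R) s)%:E)%E.
  apply: eq_integral => s _; rewrite indicE /ind.
  have -> : (s \in `]a, b[%classic) = (a < s < b) by apply/idP/idP; rewrite inE /= in_itv.
  by case: ifP.
rewrite integral_indic //= setIT lebesgue_measure_itv /= lte_fin.
by case: (ltP a b) => [|ba]; rewrite -?EFinB //; congr EFin; apply/eqP; rewrite eq_sym subr_eq0 eq_le ab ba.
Qed.

Lemma igr_ind a b : igr (ind a b).
Proof.
case: (leP a b) => ab; last first.
  rewrite (_ : ind a b = fun=> 0); first by apply: integrable0.
  apply/funext => s; rewrite /ind; case: ifP => // /andP[h1 h2].
  by have := lt_trans (lt_trans h1 h2) ab; rewrite ltxx.
apply: igrP; first by apply: mfun_ind; meas.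
by under eq_integral do rewrite ger0_norm ?ind_ge0 //; rewrite int_ind // ltry.
Qed.

Lemma I_ind a b : a <= b -> \I_s ind a b s = b - a.
Proof. by move=> ab; apply: EFin_inj; rewrite -I_fin ?int_ind //; exact: igr_ind. Qed.

End PoissonOperator.

Ltac meas3 := repeat first [ progress meas2
 | match goal with
   | |- measurable_fun _ (ind _ _) => exact: mfun_ind1
   | |- measurable_fun _ (P _) => exact: mfun_P
   | |- measurable_fun _ (fun _ => ind _ _ _) => apply: mfun_ind end ].

(** * Mild solutions *)
Section Duhamel.
Context {R : realType}.
Implicit Types (t s x y h a b : R) (k : R -> R) (g w : R -> R -> R) (M C : R).
Notation mu := (@lebesgue_measure R).

Definition mfun2 g := mfun (fun z : R * R => g z.1 z.2).

Lemma mfun2_comp d (T : measurableType d) g (a b : T -> R) : mfun2 g -> mfun a -> mfun b ->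
  mfun (fun z => g (a z) (b z)).
Proof. by move=> mg ma mb; exact: (measurableT_comp mg (measurable_fun_pair ma mb)). Qed.

Lemma mfun2_1 g s : mfun2 g -> mfun (g s).
Proof. by move=> mg; apply: (mfun2_comp mg); [exact: measurable_cst|exact: measurable_id]. Qed.

(* the semigroup generated by minus the half-Laplacian minus the identity *)
Definition qc t k x := expR (- t) * pc t k x.

Definition duh a t g x := \I_s (ind a t s * qc (t - s) (g s) x).

(* The Duhamel integral over (a, t) at [x] converges, with integrand bounded by [C]. *)
Definition dbound a t g x C := forall s, a < s -> s < t ->
  pint (g s) /\ pc (t - s) (fun y => `|g s y|) x <= C.

Lemma mfun_qc d (T : measurableType d) g (a s b : T -> R) : mfun2 g -> mfun a -> mfun s -> mfun b ->
  mfun (fun z => qc (a z) (g (s z)) (b z)).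
Proof.
move=> mg ma ms mb; apply: measurable_funM; first by meas.
apply: (mfun_pc (G := fun z => g (s z.1) z.2)) => //.
by apply: (mfun2_comp mg); meas.
Qed.

Lemma mfun_duh_int d (T : measurableType d) g (a t s x : T -> R) : mfun2 g -> mfun a -> mfun t ->
  mfun s -> mfun x -> mfun (fun z => ind (a z) (t z) (s z) * qc (t z - s z) (g (s z)) (x z)).
Proof.
move=> mg ma mt ms mx; apply: measurable_funM; first exact: mfun_ind.
by apply: mfun_qc => //; meas.
Qed.

Lemma mfun_duh d (T : measurableType d) g (a t x : T -> R) : mfun2 g -> mfun a -> mfun t ->
  mfun x -> mfun (fun z => duh (a z) (t z) g (x z)).
Proof.
move=> mg ma mt mx; rewrite /duh.
apply: (measurable_I (F := fun z => ind (a z.1) (t z.1) z.2 * qc (t z.1 - z.2) (g z.2) (x z.1))).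
by apply: mfun_duh_int => //; meas.
Qed.

Lemma expRN_le1 t : 0 <= t -> expR (- t) <= 1.
Proof. by move=> t0; rewrite -expR0 ler_expR oppr_le0. Qed.

Lemma duh_int_le a t g x C s : dbound a t g x C ->
  `|ind a t s * qc (t - s) (g s) x| <= C * ind a t s.
Proof.
move=> h; rewrite /ind; case: ifP => [/andP[h1 h2]|_]; last by rewrite !mul0r normr0 mulr0.
have [hp hC] := h s h1 h2; have ts : 0 < t - s by rewrite subr_gt0.
rewrite mul1r mulr1 /qc normrM ger0_norm ?expR_ge0 //.
apply: le_trans hC; apply: (le_trans _ (pc_abs x ts hp)).
by rewrite ler_piMl // expRN_le1 // ltW.
Qed.

Lemma igr_duh a t g x C : mfun2 g -> dbound a t g x C ->
  igr (fun s => ind a t s * qc (t - s) (g s) x).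
Proof.
move=> mg h; apply: (igr_le _ (igrZ C (igr_ind a t))) => [|s]; last exact: duh_int_le.
by apply: mfun_duh_int => //; meas.
Qed.

Lemma dbound_le a t g x C g' C' : dbound a t g' x C' -> C' <= C ->
  (forall s, mfun (g s)) -> (forall s y, a < s -> s < t -> `|g s y| <= g' s y) -> dbound a t g x C.
Proof.
move=> h CC mg gg s h1 h2; have [hp hC] := h s h1 h2.
have pg : pint (g s) by apply: (pint_dom (mg s) hp) => y; exact: gg.
split => //; apply: le_trans CC; apply: le_trans hC; apply: pc_le => //.
- by rewrite subr_gt0.
- exact: pint_abs.
- exact: pint_abs.
by move=> y; apply: (le_trans (gg s y h1 h2)); exact: ler_norm.
Qed.

Lemma duh_le a t g g' x C : mfun2 g -> mfun2 g' -> dbound a t g x C -> dbound a t g' x C ->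
  (forall s y, a < s -> s < t -> g s y <= g' s y) -> duh a t g x <= duh a t g' x.
Proof.
move=> mg mg' h h' gg; apply: I_le; [exact: igr_duh h|exact: igr_duh h'|] => s.
rewrite /ind; case: ifP => [/andP[h1 h2]|_]; last by rewrite !mul0r.
rewrite !mul1r ler_wpM2l ?expR_ge0 //.
apply: pc_le; [by rewrite subr_gt0|exact: (h s h1 h2).1|exact: (h' s h1 h2).1|] => y; exact: gg.
Qed.

Lemma duhB a t g g' x C : mfun2 g -> mfun2 g' -> dbound a t g x C -> dbound a t g' x C ->
  duh a t (fun s y => g s y - g' s y) x = duh a t g x - duh a t g' x.
Proof.
move=> mg mg' h h'; rewrite /duh -I_B; [|exact: igr_duh h|exact: igr_duh h'].
apply: eq_I => s.
rewrite /ind; case: ifP => [/andP[h1 h2]|_]; last by rewrite !mul0r subr0.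
rewrite !mul1r /qc pcB; first by ring.
- by rewrite subr_gt0.
- exact: (h s h1 h2).1.
exact: (h' s h1 h2).1.
Qed.

Lemma duh_abs a t g x C : a <= t -> dbound a t g x C -> mfun2 g -> `|duh a t g x| <= C * (t - a).
Proof.
move=> at0 h mg; apply: (le_trans (I_bound (igrZ C (igr_ind a t)) _ _)).
- by apply: mfun_duh_int => //; meas.
- by move=> s; exact: duh_int_le.
by rewrite I_Z ?I_ind //; exact: igr_ind.
Qed.

Lemma duh_split a b t g x C : a <= b -> b <= t -> mfun2 g -> dbound a t g x C ->
  duh a t g x = \I_s (ind a b s * qc (t - s) (g s) x) + duh b t g x.
Proof.
move=> ab bt mg h.
have m1 : mfun (fun s => qc (t - s) (g s) x) by apply: mfun_qc => //; meas.
have bd s : `|ind a b s * qc (t - s) (g s) x| <= C * ind a t s /\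
            `|ind b t s * qc (t - s) (g s) x| <= C * ind a t s.
  have C0 : a < s < t -> 0 <= C.
    move=> /andP[h1 h2]; apply: le_trans (h s h1 h2).2.
    by apply: pc_ge0 => // ; rewrite subr_gt0.
  have := duh_int_le s h; rewrite /ind.
  case: (boolP (a < s < t)) => hs; last first.
    move=> _; split; case: ifP => [/andP[h1 h2]|_]; rewrite ?mul0r ?normr0 ?mulr0 //.
    - by move: hs; rewrite h1 (lt_le_trans h2 bt).
    - by move: hs; rewrite h2 (le_lt_trans ab h1).
  by rewrite mulr1 mul1r => hh; split; case: ifP => _; rewrite ?mul1r // mul0r normr0 C0.
rewrite /duh -I_D; last 2 first.
- apply: (igr_le _ (igrZ C (igr_ind a t))) => [|s]; last exact: (bd s).1.
  by apply: measurable_funM => //; meas3.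
- apply: (igr_le _ (igrZ C (igr_ind a t))) => [|s]; last exact: (bd s).2.
  by apply: measurable_funM => //; meas3.
apply: EFin_inj; rewrite -!I_fin.
- apply: ae_eq_integral => //.
  + by apply/measurable_EFinP; apply: measurable_funM => //; meas3.
  + by apply/measurable_EFinP; apply: measurable_funD; apply: measurable_funM => //; meas3.
  (* The open intervals (a, b) and (b, t) miss only the point b of (a, t). *)
  exists [set b]; split => //; first exact: lebesgue_measure_set1.
  move=> s /= /not_implyP [_ hs]; apply: contrapT => sb; apply: hs; congr EFin.
  rewrite -mulrDl; congr (_ * _); rewrite /ind.
  case: (ltgtP s b) => [sb'|sb'|//].
  - by rewrite (lt_le_trans sb' bt) /= addr0.
  - by rewrite andbF add0r /= (le_lt_trans ab sb').
- exact: igr_duh h.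
- apply: igrD.
  + apply: (igr_le _ (igrZ C (igr_ind a t))) => [|s]; last exact: (bd s).1.
    by apply: measurable_funM => //; meas3.
  + apply: (igr_le _ (igrZ C (igr_ind a t))) => [|s]; last exact: (bd s).2.
    by apply: measurable_funM => //; meas3.
Qed.

(** Fubini and the semigroup law: P_{t-b}, moved under the time integral, merges with P_{b-s} into
    P_{t-s}. The double integral converges absolutely because [dbound] at the later time t controls
    the merged kernel applied to |g s|. *)
Lemma qc_duh a b t g x : a <= b -> b < t -> mfun2 g -> (forall t' x', exists C, dbound a t' g x' C) ->
  igr (fun y => P (t - b) (x - y) * duh a b g y) /\
  qc (t - b) (duh a b g) x = \I_s (ind a b s * qc (t - s) (g s) x).
Proof.
move=> ab bt mg H; have tb : 0 < t - b by rewrite subr_gt0.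
pose F z : R := P (t - b) (x - z.1) * (ind a b z.2 * qc (b - z.2) (g z.2) z.1).
have mF : mfun (F : R * R -> R).
  by apply: measurable_funM; [meas2|apply: mfun_duh_int => //; meas].
have [C hC] := H t x; have C0 : a < b -> 0 <= C.
  move=> ab'; have s1 : a < (a + b) / 2 by lra.
  have s2 : (a + b) / 2 < t by lra.
  by apply: le_trans (hC _ s1 s2).2; apply: pc_ge0 => //; rewrite subr_gt0.
have fin : (\int[mu]_y \int[mu]_s (`|F (y, s)|)%:E < +oo)%E.
  rewrite (tonelli (F := fun z => `|F z|)) //; last by meas.
  apply: (@le_lt_trans _ _ (\int[mu]_s (C * ind a b s)%:E)%E); last first.
    by rewrite I_fin ?ltry //; apply: igrZ; exact: igr_ind.
  apply: ge0_le_integral => //.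
  - by move=> s _; apply: integral_ge0 => y _; rewrite lee_fin.
  - apply: (measurable_int_param (F := fun z => `|F (z.2, z.1)|)) => //.
    by apply: measurableT_comp => //; apply: (measurableT_comp mF); meas.
  - by apply/measurable_EFinP; meas3.
  move=> s _; rewrite /F /= /ind; case: ifP => [/andP[h1 h2]|_]; last first.
    by under eq_integral do rewrite mul0r mulr0 normr0; rewrite integral0 mulr0.
  have [hp hc] := hC s h1 (lt_trans h2 bt).
  have bs : 0 < b - s by rewrite subr_gt0.
  have [ig e] := pc_swap x tb bs (pint_abs hp).
  have mgs := mfun2_1 s mg.
  rewrite mulr1 -lee_fin in hc *; apply: le_trans hc.
  have -> : t - s = t - b + (b - s) by ring.
  rewrite -e -(I_fin ig); apply: ge0_le_integral.
  - exact: measurableT.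
  - by move=> y _; rewrite lee_fin.
  - apply/measurable_EFinP; apply: (measurableT_comp (@normr_measurable _ _)); apply: measurable_funM; first by meas2.
    by apply: measurable_funM => //; apply: mfun_qc => //; meas.
  - by apply/measurable_EFinP; exact: (igr_mfun ig).
  move=> y _; rewrite lee_fin mul1r normrM ger0_norm; last by pos.
  rewrite ler_wpM2l //; first by pos.
  rewrite /qc normrM ger0_norm ?expR_ge0 //; apply: (le_trans _ (pc_abs y bs hp)).
  by rewrite ler_piMl // expRN_le1 // ltW.
have [i1 i2 e] := I_swap mF fin.
have e1 y : \I_s F (y, s) = P (t - b) (x - y) * duh a b g y.
  have [C' hC'] := H b y.
  by rewrite /F /= I_Z; [|exact: igr_duh hC'].
split.
  have -> : (fun y => P (t - b) (x - y) * duh a b g y) = (fun y => \I_s F (y, s)) by apply/funext => y; rewrite e1.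
  exact: i1.
rewrite /qc /pc.
have -> : (fun y => P (t - b) (x - y) * duh a b g y) = (fun y => \I_s F (y, s)) by apply/funext => y; rewrite e1.
rewrite e -(I_Z _ i2); apply: eq_I => s.
rewrite /F /= /ind; case: ifP => [/andP[h1 h2]|_]; last first.
  rewrite [X in Rintegral _ _ X](_ : _ = fun=> 0); last by apply/funext => y; rewrite mul0r mulr0.
  by rewrite I_0 mulr0 mul0r.
have [hp hc] := hC s h1 (lt_trans h2 bt).
have bs : 0 < b - s by rewrite subr_gt0.
have [ig es] := pc_swap x tb bs hp.
transitivity (expR (- (t - b)) * \I_y (expR (- (b - s)) * (P (t - b) (x - y) * pc (b - s) (g s) y))).
  by congr (_ * Rintegral _ _ _); apply/funext => y; rewrite mul1r /qc mulrCA.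
rewrite (I_Z _ ig) -/(pc _ _ _) es mulrA -expRD mul1r.
by congr (expR _ * pc _ _ _); ring.
Qed.

Lemma pint_duh a b g : a <= b -> mfun2 g -> (forall t' x', exists C, dbound a t' g x' C) ->
  pint (duh a b g).
Proof.
move=> ab mg H; split; first by apply: mfun_duh => //; meas.
move=> t x t0; have bt : b < b + t by rewrite ltrDl.
by have [] := qc_duh x ab bt mg H; rewrite addrAC subrr add0r.
Qed.

Lemma qcD t k k' x : 0 < t -> pint k -> pint k' -> qc t (fun y => k y + k' y) x = qc t k x + qc t k' x.
Proof. by move=> t0 h h'; rewrite /qc pcD // mulrDr. Qed.

Lemma qcB t k k' x : 0 < t -> pint k -> pint k' -> qc t (fun y => k y - k' y) x = qc t k x - qc t k' x.
Proof. by move=> t0 h h'; rewrite /qc pcB // mulrBr. Qed.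

Lemma qc_semigroup s t k x : 0 < s -> 0 < t -> pint k -> qc s (qc t k) x = qc (s + t) k x.
Proof.
move=> s0 t0 hk; rewrite /qc pcZ //; last exact: pint_pc.
by rewrite pc_semigroup // mulrA -expRD opprD.
Qed.

(* [w] solves w_t = - Lambda w - w + g in integrated form after time [a]. *)
Definition mild_from a w g := forall t x, a < t -> w t x = qc (t - a) (w a) x + duh a t g x.

(** The flow property of the Duhamel formula. Comparison over successive short intervals and the
    smoothing at positive times both start from a restarted equation. *)
Lemma mild_restart a b w g : a <= b -> mfun2 g -> (forall t x, exists C, dbound a t g x C) ->
  pint (w a) -> mild_from a w g -> mild_from b w g.
Proof.
move=> ab mg H pa hm t x bt.
move: ab bt; rewrite le_eqVlt => /predU1P[<-|ab] bt; first exact: hm.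
have tb : 0 < t - b by rewrite subr_gt0.
have ba : 0 < b - a by rewrite subr_gt0.
have [C hC] := H t x.
rewrite hm ?(lt_trans ab) // (duh_split (ltW ab) (ltW bt) mg hC) addrA; congr (_ + _).
have -> : w b = (fun y => qc (b - a) (w a) y + duh a b g y) by apply/funext => y; exact: hm.
rewrite qcD //; last 2 first.
- by apply: pintZ; exact: pint_pc.
- exact: pint_duh (ltW ab) mg H.
rewrite (qc_duh x (ltW ab) bt mg H).2 qc_semigroup //.
by congr (qc _ _ _ + _); ring.
Qed.

End Duhamel.

(** * The monotone part of the nonlinearity; limits in the Duhamel formula *)

Section Nonlinearity.
Context {R : realType}.
Implicit Types (t s x y h a b u : R) (M C : R).
Notation mu := (@lebesgue_measure R).

Lemma mean_value_le (f df : R -> R) a b : a <= b -> (forall x, is_derive x 1 f (df x)) ->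
  exists2 c, a <= c <= b & f b - f a = df c * (b - a).
Proof.
move=> ab hd; move: ab; rewrite le_eqVlt => /predU1P[->|ab].
  by exists b; rewrite ?lexx // !subrr mulr0.
have cf : continuous f.
  by move=> x; apply: differentiable_continuous; apply/derivable1_diffP; have [] := hd x.
have [c hc e] := MVT ab (fun x _ => hd x) (continuous_subspaceT cf).
by exists c => //; move: hc; rewrite in_itv /= => /andP[/ltW -> /ltW ->].
Qed.

Lemma mean_value (f df : R -> R) a b : (forall x, is_derive x 1 f (df x)) ->
  exists2 c, `|c - a| <= `|b - a| & f b - f a = df c * (b - a).
Proof.
move=> hd; case: (leP a b) => [ab|/ltW ba].
  have [c /andP[h1 h2] e] := mean_value_le ab hd; exists c => //.
  by rewrite !ger0_norm ?subr_ge0 // lerD2r.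
have [c /andP[h1 h2] e] := mean_value_le ba hd; exists c.
  by rewrite !ler0_norm ?subr_le0 // !opprB lerD2l lerN2.
by apply: oppr_inj; rewrite opprB -mulrN opprB.
Qed.

Lemma lipschitz_of_derive (f df : R -> R) K a b : (forall x, is_derive x 1 f (df x)) ->
  (forall x, `|df x| <= K) -> `|f b - f a| <= K * `|b - a|.
Proof.
move=> hd hK; have [c _ ->] := mean_value a b hd.
by rewrite normrM ler_wpM2r.
Qed.

Lemma sin_lip a b : `|sin b - sin a| <= `|b - a|.
Proof.
rewrite -[leRHS]mul1r; apply: (lipschitz_of_derive a b (fun x => is_derive_sin x)) => x.
by rewrite ler_norml cos_geN1 cos_le1.
Qed.

Lemma cos_lip a b : `|cos b - cos a| <= `|b - a|.
Proof.
rewrite -[leRHS]mul1r; apply: (lipschitz_of_derive a b (fun x => is_derive_cos x)) => x.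
by rewrite normrN ler_norml sin_geN1 sin_le1.
Qed.

Definition gnl u : R := u + pi^-1 * sin (pi * u).

(** The function sin (pi u) / pi is 1-Lipschitz, so adding it to u gives slopes between 0 and 2. *)
Lemma gnl_bounds a b : a <= b -> 0 <= gnl b - gnl a <= 2 * (b - a).
Proof.
move=> ab; have -> : gnl b - gnl a = (b - a) + pi^-1 * (sin (pi * b) - sin (pi * a)).
  by rewrite /gnl; ring.
have p0 := pi_gt0 R.
have : `|pi^-1 * (sin (pi * b) - sin (pi * a))| <= b - a.
  rewrite normrM ger0_norm ?invr_ge0 ?(ltW p0) // mulrC ler_pdivrMr //.
  apply: (le_trans (sin_lip _ _)).
  by rewrite -mulrBr normrM (gtr0_norm p0) ger0_norm ?subr_ge0 // mulrC.
by rewrite ler_norml => /andP[h1 h2]; lra.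
Qed.

(** The source as a function of v = u - phi. It vanishes at v = 0 and is Lipschitz in v, hence it
    keeps v in L^2. *)
Definition Gnl x v : R := gnl (v + phi x) - gnl (phi x).

Lemma Gnl_mono x v w : v <= w -> 0 <= Gnl x w - Gnl x v <= 2 * (w - v).
Proof.
move=> vw; have /gnl_bounds : v + phi x <= w + phi x by rewrite lerD2r.
have -> : w + phi x - (v + phi x) = w - v by ring.
by rewrite /Gnl; move: (gnl _) (gnl _) (gnl _) => p q r; lra.
Qed.

Lemma Gnl0 x : Gnl x 0 = 0. Proof. by rewrite /Gnl add0r subrr. Qed.

Lemma Gnl_lip x v w : `|Gnl x w - Gnl x v| <= 2 * `|w - v|.
Proof.
case: (leP v w) => [vw|/ltW vw].
  by have /andP[h1 h2] := Gnl_mono x vw; rewrite !ger0_norm // subr_ge0.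
have /andP[h1 h2] := Gnl_mono x vw.
by rewrite distrC [`|w - v|]distrC !ger0_norm // subr_ge0.
Qed.

Lemma Gnl_le x v : `|Gnl x v| <= 2 * `|v|.
Proof. by have := Gnl_lip x 0 v; rewrite Gnl0 !subr0. Qed.

Lemma continuous_phi : continuous (phi : R -> R).
Proof. by move=> x; apply: cvgM; [exact: cvg_cst|exact: continuous_atan]. Qed.

Lemma mfun_phi : mfun (phi : R -> R).
Proof. exact: continuous_measurable_fun continuous_phi. Qed.

Lemma mfun_gnl : mfun gnl.
Proof.
apply: measurable_funD; first exact: measurable_id.
apply: measurable_funM; first exact: measurable_cst.
apply: (measurableT_comp (continuous_measurable_fun (@continuous_sin R))); exact: mulrl_measurable.
Qed.

Lemma mfun_Gnl d (T : measurableType d) (a b : T -> R) : mfun a -> mfun b -> mfun (fun z => Gnl (a z) (b z)).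
Proof.
move=> ma mb; have mp := mfun_phi; have mg := mfun_gnl; rewrite /Gnl.
by apply: measurable_funD; [|apply: measurable_funN]; apply: (measurableT_comp mg); [apply: measurable_funD => //|]; apply: (measurableT_comp mp).
Qed.

Lemma I_cvg (f_ : nat -> R -> R) (f g : R -> R) : (forall n, mfun (f_ n)) -> igr g ->
  (forall n x, `|f_ n x| <= g x) -> (forall x, f_ ^~ x @ \oo --> f x) ->
  \I_x f_ n x @[n --> \oo] --> \I_x f x.
Proof.
move=> mf ig fg cv.
have mlim : mfun f by apply: (measurable_fun_cvg (h := f_)).
have [] := @dominated_convergence _ _ R mu setT measurableT (fun n => EFin \o f_ n) (EFin \o f) (EFin \o g).
- by move=> n; apply/measurable_EFinP; exact: mf n.
- exact/measurable_EFinP.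
- by apply: aeW => x _; apply: cvg_EFin; [exact: nearW|exact: cv].
- exact: ig.
- by apply: aeW => x n _; rewrite /= lee_fin.
move=> i1 _ c.
have e : (\int[mu]_x (EFin \o f) x = (\I_x f x)%:E)%E by rewrite I_fin.
rewrite e in c; exact: (fine_cvg c).
Qed.

Lemma duh_ext a t (g g' : R -> R -> R) x : (forall s, a < s -> s < t -> g s = g' s) -> duh a t g x = duh a t g' x.
Proof.
move=> h; apply: eq_I => s; rewrite /ind.
by case: ifP => [/andP[h1 h2]|_]; rewrite ?mul0r // h.
Qed.

Lemma pc_cvg t (g_ : nat -> R -> R) (g k : R -> R) x : 0 < t -> (forall n, mfun (g_ n)) -> pint k ->
  (forall n y, `|g_ n y| <= k y) -> (forall y, g_ ^~ y @ \oo --> g y) ->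
  pc t (g_ n) x @[n --> \oo] --> pc t g x.
Proof.
move=> t0 mg pk gk cv; apply: (I_cvg (g := fun y => P t (x - y) * k y)).
- by move=> n; have := mg n => ?; meas2.
- exact: pk.2.
- by move=> n y; rewrite normrM ger0_norm ?ler_wpM2l //; pos.
by move=> y; apply: cvgM; [exact: cvg_cst|exact: cv].
Qed.

Lemma duh_cvg a t (g_ : nat -> R -> R -> R) (g k : R -> R -> R) x C :
  (forall n, mfun2 (g_ n)) -> dbound a t k x C ->
  (forall n s y, a < s -> s < t -> `|g_ n s y| <= k s y) ->
  (forall s y, a < s -> s < t -> g_ ^~ s ^~ y @ \oo --> g s y) ->
  duh a t (g_ n) x @[n --> \oo] --> duh a t g x.
Proof.
move=> mg hb gk cv; apply: (I_cvg (g := fun s => C * ind a t s)).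
- by move=> n; apply: mfun_duh_int => //; meas.
- by apply: igrZ; exact: igr_ind.
- move=> n s; apply: duh_int_le; apply: (dbound_le hb (lexx C)) => [s'|]; last exact: gk.
  exact: mfun2_1.
move=> s; rewrite /ind; case: ifP => [/andP[h1 h2]|_]; last first.
  by under eq_fun do rewrite mul0r; rewrite mul0r; exact: cvg_cst.
apply: cvgM; first exact: cvg_cst.
apply: cvgM; first exact: cvg_cst.
apply: (pc_cvg (k := k s)); first by rewrite subr_gt0.
- by move=> n; exact: mfun2_1.
- exact: (hb s h1 h2).1.
- by move=> n y; exact: gk.
by move=> y; exact: cv.
Qed.

End Nonlinearity.

(** * Construction of a mild solution by monotone iteration *)

Section Existence.
Context {R : realType}.
Implicit Types (t s x y h a b : R) (M C : R).
Notation mu := (@lebesgue_measure R).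

Lemma I_ind_FTC (f F : R -> R) a b : a <= b -> (forall x, a <= x -> x <= b -> is_derive x 1 F (f x)) ->
  (forall x, a <= x -> x <= b -> {for x, continuous f}) -> mfun f ->
  igr (fun s => ind a b s * f s) /\ \I_s (ind a b s * f s) = F b - F a.
Proof.
move=> ab dF cf mf; have cF x : a <= x -> x <= b -> {for x, continuous F}.
  by move=> h1 h2; apply: differentiable_continuous; apply/derivable1_diffP; have [] := dF x h1 h2.
have wf : {within `[a, b], continuous f}.
  by apply: continuous_in_subspaceT => x; rewrite mem_setE in_itv /= => /andP[h1 h2]; exact: cf.
have e : (\int[mu]_(x in `]a, b[) (f x)%:E = \int[mu]_x (ind a b x * f x)%:E)%E.
  rewrite integral_mkcond; apply: eq_integral => x _; rewrite patchE /ind mem_setE in_itv /=.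
  by case: ifP; rewrite ?mul1r ?mul0r.
have e2 : (\int[mu]_(x in `[a, b]) (f x)%:E = \int[mu]_(x in `]a, b[) (f x)%:E)%E.
  by rewrite integral_itv_bndoo //; apply/measurable_EFinP; exact: measurable_funTS.
have ig : igr (fun s => ind a b s * f s).
  have : mu.-integrable `[a, b] (EFin \o f).
    by apply: continuous_compact_integrable; [exact: segment_compact|].
  move=> hh; have h := (integrable_mkcond (mu := mu) (EFin \o f) (measurable_itv `[a, b])).1 hh.
  apply: (le_integrable _ _ _ h) => //; first by apply/measurable_EFinP; apply: measurable_funM => //; exact: mfun_ind1.
  move=> x _; rewrite /= patchE mem_setE in_itv /= /ind.
  case: ifP => [/andP[h1 h2]|_]; last by rewrite mul0r normr0 abse_ge0.
  by rewrite (ltW h1) (ltW h2) mul1r.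
split => //; apply: EFin_inj; rewrite -I_fin // -e -e2.
move: ab; rewrite le_eqVlt => /predU1P[->|ab]; last first.
  rewrite (continuous_FTC2 (F := F)) ?EFinB //.
  - split; [|apply: cvg_at_right_filter; exact: cF (ltW ab)|apply: cvg_at_left_filter; exact: (cF b (ltW ab) (lexx _))].
    by move=> x; rewrite in_itv /= => /andP[h1 h2]; have [] := dF x (ltW h1) (ltW h2).
  - by move=> x; rewrite in_itv /= => /andP[h1 h2]; rewrite derive1E; have ? := dF x (ltW h1) (ltW h2); exact: derive_val.
by rewrite subrr set_itv1 integral_set1.
Qed.

Lemma duhZ a t g x C c : mfun2 g -> dbound a t g x C -> duh a t (fun s y => c * g s y) x = c * duh a t g x.
Proof.
move=> mg h; rewrite /duh -I_Z; last exact: igr_duh h.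
apply: eq_I => s.
rewrite /ind; case: ifP => [/andP[h1 h2]|_]; last by rewrite !mul0r mulr0.
rewrite !mul1r /qc pcZ; [by ring|by rewrite subr_gt0|exact: (h s h1 h2).1].
Qed.

Variable v0 : R -> R.
Hypothesis pv : pint v0.

(** The solution with datum |v0| of the linear equation w_t = - (Lambda + 1) w + 2 w, where the
    factor e^{-t} becomes e^t. It dominates the nonlinear problem because |Gnl x v| <= 2 |v|. *)
Definition Maj t x := expR t * pc t (fun y => `|v0 y|) x.

Let pa : pint (fun y => `|v0 y|) := pint_abs pv.

Lemma mfun2_Maj : mfun2 Maj.
Proof.
have m0 := pint_mfun pa; apply: measurable_funM; first by meas.
apply: (@mfun_pc _ _ _ (fun z : R * R => z.1) (fun z => z.2) (fun z => `|v0 z.2|)); meas.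
by have mv := pint_mfun pv; apply: (measurableT_comp mv); meas.
Qed.

Lemma Maj_ge0 t x : 0 < t -> 0 <= Maj t x.
Proof. by move=> t0; apply: mulr_ge0; [exact: expR_ge0|apply: pc_ge0 => // y]. Qed.

Lemma pint_Maj t : 0 < t -> pint (Maj t).
Proof. by move=> t0; apply: pintZ; exact: pint_pc. Qed.

Lemma pc_Maj r s x : 0 < r -> 0 < s -> pc r (Maj s) x = expR s * pc (r + s) (fun y => `|v0 y|) x.
Proof. by move=> r0 s0; rewrite /Maj pcZ ?pc_semigroup //; exact: pint_pc. Qed.

Lemma dbound_Maj t x : dbound 0 t (fun s y => 2 * Maj s y) x (2 * Maj t x).
Proof.
move=> s s0 st; split; first by apply: pintZ; exact: pint_Maj.
have ts : 0 < t - s by rewrite subr_gt0.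
have -> : (fun y => `|2 * Maj s y|) = (fun y => 2 * Maj s y).
  by apply/funext => y; rewrite ger0_norm // mulr_ge0 // Maj_ge0.
rewrite pcZ //; last exact: pint_Maj.
rewrite ler_pM2l // pc_Maj // subrK ler_wpM2r ?ler_expR ?(ltW st) //.
by apply: pc_ge0 => //; exact: lt_trans st.
Qed.

Lemma dbound_Maj2 t x : dbound 0 t (fun s y => 2 * (2 * Maj s y)) x (4 * Maj t x).
Proof.
move=> s s0 st; have [p1 p2] := @dbound_Maj t x s s0 st; split; first exact: pintZ.
have ts : 0 < t - s by rewrite subr_gt0.
under [fun y => `|_|]funext do rewrite normrM (ger0_norm (ler0n _ 2)).
by rewrite pcZ //; [lra|exact: pint_abs].
Qed.

Let mfun2_2Maj : mfun2 (fun s y => 2 * Maj s y).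
Proof. by apply: measurable_funM; [exact: measurable_cst|exact: mfun2_Maj]. Qed.

Lemma Maj_mild t x : 0 < t -> Maj t x = qc t (fun y => `|v0 y|) x + duh 0 t (fun s y => 2 * Maj s y) x.
Proof.
move=> t0; set A := pc t (fun y => `|v0 y|) x.
have dF s : is_derive s 1 (fun s => expR (2 * s)) (2 * expR (2 * s)).
  have h : is_derive s 1 (fun s => 2 * s) 2 by apply: is_derive_eq; rewrite /GRing.scale /= mulr1.
  rewrite mulrC; exact: (is_derive_comp (g := fun s => 2 * s) (is_derive_expR (2 * s)) h).
have cF : continuous (fun s => 2 * expR (2 * s)).
  move=> s; apply: cvgM; first exact: cvg_cst.
  apply: (continuous_comp (f := fun s => 2 * s) (g := expR)); last exact: continuous_expR.
  by apply: cvgM; [exact: cvg_cst|exact: cvg_id].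
have [ig e] := I_ind_FTC (ltW t0) (fun s _ _ => dF s) (fun s _ _ => cF s) (continuous_measurable_fun cF).
have -> : duh 0 t (fun s y => 2 * Maj s y) x = (expR (- t) * A) * (expR (2 * t) - 1).
  move: e; rewrite mulr0 expR0 => <-; rewrite -(I_Z _ ig).
  apply: eq_I => s; rewrite /ind; case: ifP => [/andP[h1 h2]|_]; last by rewrite !mul0r mulr0.
  have ts : 0 < t - s by rewrite subr_gt0.
  rewrite !mul1r /qc pcZ ?pc_Maj //; last exact: pint_Maj.
  rewrite subrK -/A.
  have -> : expR (2 * s) = expR s * expR s by rewrite -expRD; congr expR; ring.
  by rewrite opprB expRD; ring.
rewrite /Maj /qc -/A.
have -> : expR (2 * t) = expR t * expR t by rewrite -expRD; congr expR; ring.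
have e1 : expR (- t) * expR t = 1 by rewrite -expRD addNr expR0.
transitivity (expR t * A * (expR (- t) * expR t)); first by rewrite e1 mulr1.
by ring.
Qed.

(* The source of the equation shifted by the majorant, which is monotone and nonnegative. *)
Let Src (V : R -> R -> R) s y := Gnl y (V s y - Maj s y) + 2 * Maj s y.

(** The unknown is V = v + Maj, hence the datum v0 + |v0|. The start V = 0 stands for the lower
    bound v = - Maj, from which the iteration increases. The value 0 for t <= 0 keeps the sequence
    monotone and measurable there. *)
Fixpoint picard n t x : R := if n is m.+1 then
  (if 0 < t then qc t (fun y => v0 y + `|v0 y|) x + duh 0 t (Src (picard m)) x else 0) else 0.

Let picardS n t x : picard n.+1 t x =
  if 0 < t then qc t (fun y => v0 y + `|v0 y|) x + duh 0 t (Src (picard n)) x else 0.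
Proof. by []. Qed.

Let mfun2_Src V : mfun2 V -> mfun2 (Src V).
Proof.
move=> mV; have mM := mfun2_Maj; apply: measurable_funD; last exact: mfun2_2Maj.
by apply: mfun_Gnl; meas; apply: measurable_funD => //; exact: measurable_funN.
Qed.

Let mfun2_step V : mfun2 V -> mfun2 (fun t x => if 0 < t then qc t (fun y => v0 y + `|v0 y|) x + duh 0 t (Src V) x else 0).
Proof.
move=> mV; have m0 := pint_mfun pv.
apply: measurable_fun_ifT; [|apply: measurable_funD|exact: measurable_cst].
- by apply: measurable_fun_ltr; meas.
- apply: (@mfun_qc _ _ _ (fun _ y => v0 y + `|v0 y|) (fun z : R * R => z.1) (fun=> 0) (fun z => z.2)); meas.
  by apply: measurable_funD; apply: measurableT_comp => //; apply: measurableT_comp.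
- by apply: mfun_duh; [exact: mfun2_Src|meas..].
Qed.

Lemma mfun2_picard n : mfun2 (picard n).
Proof. by elim: n => [|n IH]; [exact: measurable_cst|exact: mfun2_step]. Qed.

Let Src_bounds V s y : 0 < s -> 0 <= V s y <= 2 * Maj s y -> 0 <= Src V s y <= 4 * Maj s y.
Proof.
move=> s0 /andP[h1 h2]; have M0 := Maj_ge0 y s0; rewrite /Src.
have a1 : - Maj s y <= V s y - Maj s y by lra.
have a2 : V s y - Maj s y <= Maj s y by lra.
have /andP[b1 _] := Gnl_mono y a1; have /andP[b2 _] := Gnl_mono y a2.
have := Gnl_le y (- Maj s y); have := Gnl_le y (Maj s y).
rewrite normrN !(ger0_norm M0) !ler_norml => /andP[_ c1] /andP[c2 _].
move: b1 b2 c1 c2; move: (Gnl _ _) (Gnl _ _) (Gnl _ _) => p q r.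
lra.
Qed.

Let dbound_Src V t x : mfun2 V -> (forall s y, 0 < s -> 0 <= V s y <= 2 * Maj s y) ->
  dbound 0 t (Src V) x (4 * Maj t x).
Proof.
move=> mV hV.
have h := @dbound_Maj2 t x.
apply: (dbound_le h (lexx _)) => [s|s y s0 st]; first exact: mfun2_1 (mfun2_Src mV).
have /andP[h1 h2] := Src_bounds s0 (hV s y s0).
by rewrite ger0_norm //; lra.
Qed.

Let pint_v0D : pint (fun y => v0 y + `|v0 y|).
Proof. exact: pintD. Qed.

Lemma picard_bounds n t x : 0 < t -> 0 <= picard n t x <= 2 * Maj t x.
Proof.
elim: n t x => [|n IH] t x t0; first by rewrite lexx mulr_ge0 // Maj_ge0.
rewrite picardS t0; have mV := mfun2_picard n.
have hb := @dbound_Src (picard n) t x mV IH.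
have h4 := @dbound_Maj2 t x.
apply/andP; split.
  apply: addr_ge0; first apply: mulr_ge0; first exact: expR_ge0.
    by apply: pc_ge0 => // y; have := ler_norm (- v0 y); rewrite normrN; lra.
  apply: I_ge0 => s; rewrite /ind; case: ifP => [/andP[h1 h2]|_]; last by rewrite mul0r.
  rewrite mul1r; apply: mulr_ge0; first exact: expR_ge0.
  apply: pc_ge0; first by rewrite subr_gt0.
  by move=> y; have /andP[] := Src_bounds h1 (IH s y h1).
rewrite Maj_mild // mulrDr; apply: lerD.
  rewrite /qc mulrCA ler_wpM2l ?expR_ge0 // -pcZ //.
  by apply: pc_le => //; [exact: pintZ|move=> y; have := ler_norm (v0 y); lra].
rewrite -(duhZ 2 mfun2_2Maj (@dbound_Maj t x)).
apply: (duh_le (C := 4 * Maj t x)) => //.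
- exact: mfun2_Src.
- by apply: measurable_funM; [exact: measurable_cst|exact: mfun2_2Maj].
by move=> s y s0 st; have /andP[_] := Src_bounds s0 (IH s y s0); lra.
Qed.

Lemma picard_le n t x : picard n t x <= picard n.+1 t x.
Proof.
elim: n t x => [|n IH] t x.
  rewrite picardS [leLHS]/=; case: ifP => // t0; have /andP[] := picard_bounds 1 x t0.
  by rewrite picardS t0.
(* One Picard step is exposed on each side, while the iterates inside stay folded so that the
   induction hypothesis applies to them. *)
change ((fun V : R -> R -> R => if 0 < t then qc t (fun y => v0 y + `|v0 y|) x + duh 0 t (Src V) x else 0) (picard n)
  <= (fun V : R -> R -> R => if 0 < t then qc t (fun y => v0 y + `|v0 y|) x + duh 0 t (Src V) x else 0) (picard n.+1)).
cbv beta; case: (ltP 0 t) => [t0|_]; last exact: lexx.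
apply: lerD; first exact: lexx.
have hp m s y : 0 < s -> 0 <= picard m s y <= 2 * Maj s y by exact: picard_bounds.
apply: (duh_le (C := 4 * Maj t x)).
- exact: mfun2_Src (mfun2_picard n).
- exact: mfun2_Src (mfun2_picard n.+1).
- exact: (@dbound_Src _ t x (mfun2_picard n) (hp n)).
- exact: (@dbound_Src _ t x (mfun2_picard n.+1) (hp n.+1)).
move=> s y s0 st; rewrite /Src lerD2r.
have : picard n s y - Maj s y <= picard n.+1 s y - Maj s y by rewrite lerD2r; exact: IH.
by move/(Gnl_mono y) => /andP[h _]; move: h; rewrite subr_ge0.
Qed.

Let V t x := limn (fun n => picard n t x).

Let picard_cvg t x : picard n t x @[n --> \oo] --> V t x.
Proof.
apply: nondecreasing_is_cvgn; first by apply/nondecreasing_seqP => n; exact: picard_le.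
exists (Num.max 0 (2 * Maj t x)) => _ [n _ <-].
case: (ltP 0 t) => t0; first by have /andP[_ h] := picard_bounds n x t0; rewrite le_max h orbT.
by case: n => [|n] /=; rewrite ?ltNge ?t0 /= le_max lexx.
Qed.

Let mfun2_V : mfun2 V.
Proof.
apply: (measurable_fun_cvg (h := fun n (z : R * R) => picard n z.1 z.2)) => [n|z _].
  exact: mfun2_picard.
exact: picard_cvg.
Qed.

Let V_bounds t x : 0 < t -> 0 <= V t x <= 2 * Maj t x.
Proof.
move=> t0; apply/andP; split.
  apply: (ler_cvg_to (cvg_cst 0) (@picard_cvg t x)); apply: nearW => n.
  by have /andP[] := picard_bounds n x t0.
apply: (ler_cvg_to (@picard_cvg t x) (cvg_cst _)); apply: nearW => n.
by have /andP[] := picard_bounds n x t0.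
Qed.

Let V_fix t x : 0 < t -> V t x = qc t (fun y => v0 y + `|v0 y|) x + duh 0 t (Src V) x.
Proof.
move=> t0.
have c1 : picard n.+1 t x @[n --> \oo] --> V t x.
  by rewrite (cvg_shiftS (fun n => picard n t x)); exact: picard_cvg.
have c2 : picard n.+1 t x @[n --> \oo] --> qc t (fun y => v0 y + `|v0 y|) x + duh 0 t (Src V) x.
  under eq_fun do rewrite picardS t0; apply: cvgD; first exact: cvg_cst.
  apply: (duh_cvg (k := fun s y => 2 * (2 * Maj s y)) (C := 4 * Maj t x)).
  - by move=> n; exact: mfun2_Src (mfun2_picard n).
  - exact: dbound_Maj2.
  - move=> n s y s0 st; have /andP[h1 h2] := Src_bounds s0 (picard_bounds n y s0).
    by rewrite ger0_norm //; lra.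
  move=> s y s0 st; rewrite /Src; apply: cvgD; last exact: cvg_cst.
  have cG : continuous (Gnl y).
    move=> u; apply: cvgB; last exact: cvg_cst.
    apply: (continuous_comp (f := fun u => u + phi y) (g := gnl)).
      by apply: cvgD; [exact: cvg_id|exact: cvg_cst].
    apply: cvgD; first exact: cvg_id.
    apply: cvgM; first exact: cvg_cst.
    apply: (continuous_comp (f := fun u => pi * u) (g := sin)); last exact: continuous_sin.
    by apply: cvgM; [exact: cvg_cst|exact: cvg_id].
  apply: (cvg_comp (fun n => picard n s y - Maj s y) (Gnl y)); last exact: cG.
  by apply: cvgB; [exact: picard_cvg|exact: cvg_cst].
exact: (cvg_unique _ c1 c2).
Qed.

Theorem mild_solution : exists v : R -> R -> R, [/\ mfun2 v, forall t, t <= 0 -> v t = v0,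
  forall t x, 0 < t -> `|v t x| <= Maj t x & mild_from 0 v (fun s y => Gnl y (v s y))].
Proof.
(* Subtracting the majorant undoes the shift. For t <= 0 the curve is frozen at the datum, which
   makes [v 0] in the mild formula equal to [v0]. *)
exists (fun t x => if 0 < t then V t x - Maj t x else v0 x); split.
- apply: measurable_fun_ifT.
  + by apply: measurable_fun_ltr; meas.
  + by apply: measurable_funB; [exact: mfun2_V|exact: mfun2_Maj].
  + by have m0 := pint_mfun pv; apply: (measurableT_comp m0); meas.
- by move=> t t0; rewrite ltNge t0.
- by move=> t x t0; rewrite t0 ler_norml; have /andP[] := V_bounds x t0; lra.
move=> t x t0; rewrite t0 ltxx subr0 V_fix // Maj_mild // qcD //.
rewrite [in RHS](@duh_ext _ 0 t _ (fun s y => Src V s y - 2 * Maj s y)); last first.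
  by move=> s s0 _; apply/funext => y; rewrite s0 /Src addrK.
rewrite (duhB (C := 4 * Maj t x)); first by move: (qc _ _ _) (qc _ _ _) (duh _ _ _ _) (duh _ _ _ _) => p q r s; ring.
- exact: mfun2_Src mfun2_V.
- exact: mfun2_2Maj.
- exact: (@dbound_Src _ t x mfun2_V V_bounds).
move=> s s0 st; have [p1 p2] := @dbound_Maj t x s s0 st; split => //.
by apply: (le_trans p2); have := Maj_ge0 x t0; lra.
Qed.

End Existence.

(** * The layer and convergence to its translates *)
Section StationaryLayer.
Context {R : realType}.
Implicit Types (t s x y h a b : R) (M C : R).
Notation mu := (@lebesgue_measure R).

(* the Poisson extension of the layer: [phit (1 + t)] is [pc t phi] *)
Definition phit a x : R := 2 / pi * atan (a^-1 * x).

(** Up to the factor 1 / pi, the conjugate Poisson kernel. It appears twice: as - pi / 2 times the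
    derivative of [phit] in its parameter, and in [gnl_phi] as the nonlinearity evaluated on the
    layer. *)
Definition conjP a x : R := x / (a ^+ 2 + x ^+ 2).

Lemma mfun_atan : mfun (atan : R -> R).
Proof. exact: continuous_measurable_fun (@continuous_atan R). Qed.

Lemma phit_bound a x : `|phit a x| <= 1.
Proof.
have p0 := pi_gt0 R; rewrite /phit normrM ger0_norm ?divr_ge0 ?(ltW p0) //.
rewrite mulrAC ler_pdivrMr // mul1r.
have h1 := atan_gtNpi2 (a^-1 * x); have h2 := atan_ltpi2 (a^-1 * x).
have : `|atan (a^-1 * x)| <= pi / 2 by rewrite ler_norml (ltW h1) (ltW h2).
by move: (pi : R) => q; lra.
Qed.

Lemma mfun_phit a : mfun (phit a).
Proof.
apply: measurable_funM; first exact: measurable_cst.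
by apply: (measurableT_comp mfun_atan); exact: mulrl_measurable.
Qed.

Lemma phit1 x : phit 1 x = phi x. Proof. by rewrite /phit invr1 mul1r. Qed.

Lemma phitN a x : phit a (- x) = - phit a x.
Proof. by rewrite /phit mulrN atanN mulrN. Qed.

Lemma is_derive_phit a x : 0 < a -> is_derive x 1 (phit a) (2 * P a x).
Proof.
move=> a0; have h : is_derive x 1 (fun x => a^-1 * x) a^-1.
  by apply: is_derive_eq; rewrite /GRing.scale /=; ring.
have hh := is_derive_comp (g := fun x => a^-1 * x) (is_derive1_atan (a^-1 * x)) h.
rewrite /phit; apply: is_derive_eq; rewrite /P /GRing.scale /=.
have d0 := lt0r_neq0 (den_gt0 x a0); have n := lt0r_neq0 a0.
have -> : 1 + (a^-1 * x) ^+ 2 = a ^- 2 * (a ^+ 2 + x ^+ 2) by field; rewrite n.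
by move: (pi^-1) => c; field; rewrite d0 n.
Qed.

Lemma P_lip a x y : 1 <= a -> `|P a y - P a x| <= `|y - x|.
Proof.
move=> a1; have a0 : 0 < a by rewrite (lt_le_trans _ a1).
have h := P_diff_le x (y - x) a0; rewrite (addrC x) subrK in h; apply: (le_trans h).
rewrite -[leRHS]mulr1 -mulrA ler_wpM2l //.
have q : forall z, P a z <= 1.
  move=> z; apply: (le_trans (P_le z a0)); rewrite invf_le1 ?mulr_gt0 ?pi_gt0 //.
  have p2 : (1 : R) <= pi by have := @pi_ge2 R; lra.
  by rewrite -[1]mulr1 ler_pM.
by rewrite mulrC ler_pdivrMr ?mulr_gt0 // mul1r; have := q x; have := q y; lra.
Qed.

Lemma phit_taylor a x h : 1 <= a -> `|phit a (x + h) - phit a x - h * (2 * P a x)| <= 2 * h ^+ 2.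
Proof.
move=> a1; have a0 : 0 < a by rewrite (lt_le_trans _ a1).
have [c hc ->] := mean_value x (x + h) (fun y => is_derive_phit y a0).
have -> : x + h - x = h by ring.
have -> : 2 * P a c * h - h * (2 * P a x) = 2 * (h * (P a c - P a x)) by ring.
rewrite !normrM (ger0_norm (ler0n _ 2)) ler_pM2l // -[h ^+ 2]normK2 expr2 ler_wpM2l //.
by apply: (le_trans (P_lip _ _ a1)); move: hc; rewrite (_ : x + h - x = h) //; ring.
Qed.

(** Cutting h into n equal steps makes the total increment at most C h^2 / n. This replaces
    differentiation under the integral sign in the identification of Poisson extensions. *)
Lemma eq_of_sq_bound (D : R -> R) C x h : (forall x h, `|D (x + h) - D x| <= C * h ^+ 2) -> D (x + h) = D x.
Proof.
move=> hD.
have key n (k : R) : `|D (x + k *+ n) - D x| <= C * k ^+ 2 *+ n.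
  elim: n => [|n IH]; first by rewrite !mulr0n addr0 subrr normr0.
  rewrite !mulrSr addrA; apply: (le_trans (ler_distD (D (x + k *+ n)) _ _)).
  by rewrite [leRHS]addrC; apply: lerD.
have C0 : 0 <= C by have := le_trans (normr_ge0 _) (hD 0 1); rewrite expr1n mulr1.
apply/eqP; rewrite -subr_eq0 -normr_le0; apply/ler_addgt0Pr => e e0; rewrite add0r.
pose n := (Num.truncn (C * h ^+ 2 / e)).+1.
have n0 : (0 : R) < n%:R by rewrite ltr0n.
have hn : C * h ^+ 2 / e < n%:R by rewrite /n truncnS_gt.
have hk := key n (h / n%:R); rewrite -(mulr_natr (h / n%:R) n) divfK ?gt_eqF // in hk; apply: (le_trans hk).
rewrite -mulr_natr exprMn.
have -> : C * (h ^+ 2 * n%:R^-1 ^+ 2) * n%:R = C * h ^+ 2 / n%:R by field; rewrite gt_eqF.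
by rewrite ler_pdivrMr // [leRHS]mulrC -ler_pdivrMr // ltW.
Qed.

Lemma pint_phit a : pint (phit a).
Proof. exact: pint_bounded (mfun_phit a) (phit_bound a). Qed.

Lemma pint_P a : 0 < a -> pint (P a).
Proof.
move=> a0; apply: (@pint_bounded _ _ (pi * a)^-1); first exact: mfun_P.
by move=> x; rewrite ger0_norm ?P_le //; pos.
Qed.

Lemma pc_P t a x : 0 < t -> 0 < a -> pc t (P a) x = P (t + a) x.
Proof.
move=> t0 a0; rewrite /pc; have [_] := igr_P_conv x 0 t0 a0.
by rewrite subr0 => <-; apply: eq_I => y; rewrite subr0.
Qed.

(** Both sides have derivative 2 P_{t+a}, with a quadratic Taylor error that averaging preserves;
    their difference is therefore constant, and it vanishes at 0 because both sides are odd. *)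
Lemma pc_phit t a x : 0 < t -> 1 <= a -> pc t (phit a) x = phit (t + a) x.
Proof.
move=> t0 a1; have a0 : 0 < a by rewrite (lt_le_trans _ a1).
have ta1 : 1 <= t + a by rewrite (le_trans a1) // lerDr ltW.
pose D x := pc t (phit a) x - phit (t + a) x.
have mf := mfun_phit a.
have hD y h : `|D (y + h) - D y| <= 4 * h ^+ 2.
  have e : pc t (phit a) (y + h) - pc t (phit a) y - h * (2 * P (t + a) y) =
           pc t (fun z => phit a (z + h) - phit a z - h * (2 * P a z)) y.
    have ps : pint (fun z => phit a (z + h)).
      by apply: (@pint_bounded _ _ 1) => [|z]; [meas|exact: phit_bound].
    have pp := pint_phit a; have pP : pint (fun z => h * (2 * P a z)) by do 2 apply: pintZ; exact: pint_P.
    rewrite (pcB _ t0 (pintB ps pp) pP) (pcB _ t0 ps pp) (pcZ _ _ t0 (pintZ 2 (pint_P a0))) (pcZ _ _ t0 (pint_P a0)).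
    by rewrite pc_P // pc_shift.
  have b1 : `|pc t (phit a) (y + h) - pc t (phit a) y - h * (2 * P (t + a) y)| <= 2 * h ^+ 2.
    rewrite e; apply: pc_sup => // [|z]; last exact: phit_taylor.
    by have mP := @mfun_P R a; meas.
  have b2 := phit_taylor y h ta1.
  have -> : D (y + h) - D y = (pc t (phit a) (y + h) - pc t (phit a) y - h * (2 * P (t + a) y)) -
    (phit (t + a) (y + h) - phit (t + a) y - h * (2 * P (t + a) y)) by rewrite /D; ring.
  by apply: (le_trans (ler_normB _ _)); lra.
have D0 : D 0 = 0.
  have e : pc t (phit a) 0 = - pc t (phit a) 0.
    rewrite {1}pcE // -[RHS]mulN1r /pc -I_Z; last exact: (pint_phit a).2.
    apply: eq_I => y.
    by rewrite !sub0r PN phitN mulN1r mulrN.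
  have p0 : pc t (phit a) 0 = 0 by lra.
  by rewrite /D p0 /phit mulr0 atan0 mulr0 subr0.
have := eq_of_sq_bound 0 x hD; rewrite add0r D0 => /eqP.
by rewrite /D subr_eq0 => /eqP.
Qed.

Lemma is_derive_phit_param a x : 0 < a -> is_derive a 1 (fun a => phit a x) (- (2 / pi * conjP a x)).
Proof.
move=> a0; have n := lt0r_neq0 a0.
have h : is_derive a 1 (fun a => a^-1 * x) (- (a ^- 2 * x)).
  have h0 := is_deriveV (f := id) n.
  by apply: is_derive_eq; rewrite /GRing.scale /=; ring.
have hh := is_derive_comp (g := fun a => a^-1 * x) (is_derive1_atan (a^-1 * x)) h.
rewrite /phit; apply: is_derive_eq; rewrite /conjP /GRing.scale /=.
have d0 := lt0r_neq0 (den_gt0 x a0).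
have -> : 1 + (a^-1 * x) ^+ 2 = a ^- 2 * (a ^+ 2 + x ^+ 2) by field; rewrite n.
by move: (pi^-1) => c; field; rewrite d0 n.
Qed.

Lemma conjP_bound a x : 1 <= a -> `|conjP a x| <= 1.
Proof.
move=> a1; have d0 := den_gt0 x (lt_le_trans ltr01 a1).
rewrite /conjP normrM normfV (ger0_norm (ltW d0)) ler_pdivrMr // mul1r.
rewrite -(real_normK (num_real x)); move: `|x| => X.
have : 1 <= a ^+ 2 by rewrite exprn_ege1.
by have := sqr_ge0 (X - 1); nra.
Qed.

Lemma conjP_lip a c x : 1 <= a -> a <= c -> `|conjP c x - conjP a x| <= c - a.
Proof.
move=> a1 ac; have a0 : 0 < a by rewrite (lt_le_trans _ a1).
have c0 : 0 < c by rewrite (lt_le_trans _ ac).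
have d0 := den_gt0 x a0; have d1 := den_gt0 x c0.
have n0 := lt0r_neq0 d0; have n1 := lt0r_neq0 d1.
have -> : conjP c x - conjP a x = - (c - a) * (((c + a) * x / (c ^+ 2 + x ^+ 2)) * (a ^+ 2 + x ^+ 2)^-1).
  by rewrite /conjP; field; rewrite n0 n1.
rewrite normrM normrN (ger0_norm (_ : 0 <= c - a)) ?subr_ge0 //.
rewrite -[leRHS]mulr1 ler_wpM2l ?subr_ge0 // normrM -[leRHS]mulr1.
apply: ler_pM => //.
  rewrite normrM normfV (ger0_norm (ltW d1)) ler_pdivrMr // mul1r normrM.
  rewrite (ger0_norm (_ : 0 <= c + a)); last by rewrite addr_ge0 // ltW.
  rewrite -(real_normK (num_real x)); have := normr_ge0 x; move: `|x| => X X0.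
  by have := sqr_ge0 (X - c); nra.
rewrite normfV (ger0_norm (ltW d0)) invf_le1 //.
by rewrite -[1]addr0 lerD ?sqr_ge0 // exprn_ege1.
Qed.

Lemma phit_param_taylor a h x : 1 <= a -> 0 < h ->
  `|phit (a + h) x - phit a x + h * (2 / pi * conjP a x)| <= 2 / pi * h ^+ 2.
Proof.
move=> a1 h0; have a0 : 0 < a by rewrite (lt_le_trans _ a1).
have ah : a < a + h by rewrite ltrDl.
have dd y : y \in `]a, (a + h)[ -> is_derive y 1 (fun a => phit a x) (- (2 / pi * conjP y x)).
  by rewrite in_itv /= => /andP[ay _]; apply: is_derive_phit_param; exact: lt_trans ay.
have cc : {within `[a, a + h], continuous (fun a => phit a x)}.
  apply: continuous_in_subspaceT => y; rewrite mem_setE in_itv /= => /andP[ay _].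
  apply: differentiable_continuous; apply/derivable1_diffP.
  by have [] := is_derive_phit_param x (lt_le_trans a0 ay).
have [c hc ->] := MVT ah dd cc; move: hc; rewrite in_itv /= => /andP[ac ch].
have -> : - (2 / pi * conjP c x) * (a + h - a) + h * (2 / pi * conjP a x) = - (2 / pi * h) * (conjP c x - conjP a x).
  by move: (pi^-1) => p; ring.
have q0 : 0 <= 2 / (pi : R) by rewrite divr_ge0 // ltW // pi_gt0.
rewrite normrM normrN (ger0_norm (_ : 0 <= 2 / pi * h)); last by rewrite mulr_ge0 // ltW.
rewrite expr2 mulrA ler_wpM2l //; first by rewrite mulr_ge0 // ltW.
by apply: (le_trans (conjP_lip x a1 (ltW ac))); lra.
Qed.

Lemma mfun_conjP a : mfun (conjP a).
Proof. by rewrite /conjP; meas. Qed.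

(** [conjP] is a multiple of the derivative of [phit] in its parameter, and [pc_phit] shifts that
    parameter by t. Comparing the expansions with step h before and after the shift leaves an error
    of at most 2 h, which is e. *)
Lemma pc_conjP t x : 0 < t -> pc t (conjP 1) x = conjP (t + 1) x.
Proof.
move=> t0; have t1 : 1 <= t + 1 by rewrite lerDr ltW.
have pq : pint (conjP 1) by apply: (pint_bounded (mfun_conjP 1)) => y; exact: conjP_bound.
apply/eqP; rewrite -subr_eq0 -normr_le0; apply/ler_addgt0Pr => e e0; rewrite add0r.
have q0 : 0 < 2 / (pi : R) by rewrite divr_gt0 // pi_gt0.
pose h := e / 2; have h0 : 0 < h by rewrite divr_gt0.
have b1 : `|phit (t + (1 + h)) x - phit (t + 1) x + h * (2 / pi * pc t (conjP 1) x)| <= 2 / pi * h ^+ 2.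
  have h1 : 1 <= 1 + h by rewrite lerDl ltW.
  rewrite -!pc_phit // -pcZ // -pcZ; [|exact: t0|exact: pintZ].
  rewrite -pcB //; [|exact: pint_phit|exact: pint_phit].
  rewrite -pcD //; [|by apply: pintB; exact: pint_phit|by do 2 apply: pintZ].
  apply: pc_sup => // [|z]; last exact: phit_param_taylor.
  have m1 := mfun_phit (1 + h); have m2 := mfun_phit 1; have m3 := mfun_conjP 1; by meas.
have b2 := phit_param_taylor x t1 h0; rewrite -(addrA t 1 h) (addrC 1 h) (addrC h 1) in b2.
have k0 : 0 < h * (2 / pi) by rewrite mulr_gt0.
rewrite -(ler_pM2l k0).
have -> : h * (2 / pi) * `|pc t (conjP 1) x - conjP (t + 1) x| =
  `|(phit (t + (1 + h)) x - phit (t + 1) x + h * (2 / pi * pc t (conjP 1) x)) -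
    (phit (t + (1 + h)) x - phit (t + 1) x + h * (2 / pi * conjP (t + 1) x))|.
  by rewrite -{1}(ger0_norm (ltW k0)) -normrM; congr (`|_|); move: (pi^-1) => p; ring.
apply: (le_trans (ler_normB _ _)); apply: (le_trans (lerD b1 b2)).
by rewrite /h le_eqVlt; apply/orP; left; apply/eqP; move: (pi^-1) => p; field.
Qed.

(** The angle pi phi(y) is twice an arctangent, and sin (2 arctan y) = 2 y / (1 + y^2). This
    identity is what makes the layer stationary. *)
Lemma gnl_phi y : gnl (phi y) = phi y + 2 / pi * conjP 1 y :> R.
Proof.
rewrite /gnl /phi; congr (_ + _).
have p0 : (pi : R) != 0 by rewrite gt_eqF ?pi_gt0.
have -> : pi * (2 / pi * atan y) = (atan y) *+ 2 by rewrite -mulr_natl; move: p0; move: (pi : R) => q p0; field.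
have s0 : 0 < 1 + y ^+ 2 by rewrite ltr_pwDl ?sqr_ge0.
have hs : sin (atan y) = y / Num.sqrt (1 + y ^+ 2).
  rewrite -cos_atan -{2}(atanK y) /tan divfK // cos_atan invr_eq0.
  by rewrite gt_eqF // sqrtr_gt0.
rewrite sin_mulr2n hs cos_atan /conjP expr1n.
have -> : (Num.sqrt (1 + y ^+ 2))^-1 * (y / Num.sqrt (1 + y ^+ 2)) = y / (Num.sqrt (1 + y ^+ 2)) ^+ 2.
  by rewrite expr2 invfM mulrCA mulrA.
by rewrite sqr_sqrtr ?(ltW s0) // -mulr_natl; move: (pi^-1) => p; ring.
Qed.

Lemma gnl_phi_bound y : `|gnl (phi y)| <= (3 : R).
Proof.
rewrite gnl_phi; apply: (le_trans (ler_normD _ _)).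
have := phit_bound 1 y; rewrite phit1 => h.
have q0 : 0 <= 2 / (pi : R) by rewrite divr_ge0 // ltW // pi_gt0.
have q1 : 2 / (pi : R) <= 1 by rewrite ler_pdivrMr ?pi_gt0 // mul1r pi_ge2.
have : `|2 / pi * conjP 1 y| <= 1.
  by rewrite normrM (ger0_norm q0) -[leRHS]mulr1; apply: ler_pM => //; exact: conjP_bound.
lra.
Qed.

Lemma dbound_sup a t (g : R -> R -> R) x C : mfun2 g -> (forall s y, a < s -> s < t -> `|g s y| <= C) -> dbound a t g x C.
Proof.
move=> mg gC s s1 s2; have mgs := mfun2_1 s mg.
have p : pint (g s) by apply: (pint_bounded mgs) => y; exact: gC.
split => //; have ts : 0 < t - s by rewrite subr_gt0.
apply: (le_trans (ler_norm _)); apply: pc_sup => // [|y]; first by meas.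
by rewrite normr_id; exact: gC.
Qed.

Lemma mfun_gnl_phi : mfun (fun y => gnl (phi y) : R).
Proof. by apply: (measurableT_comp mfun_gnl); exact: mfun_phi. Qed.

(** [F] runs from the damped Poisson extension of phi at s = a to phi itself at s = t. By [gnl_phi]
    its derivative in s is the Duhamel integrand, so the formula is the fundamental theorem of
    calculus. *)
Lemma phi_mild a t x : a < t -> phi x = qc (t - a) phi x + duh a t (fun _ y => gnl (phi y)) x.
Proof.
move=> at0; pose F s := expR (- (t - s)) * phit (1 + (t - s)) x.
pose f s := expR (- (t - s)) * (phit (1 + (t - s)) x + 2 / pi * conjP (1 + (t - s)) x).
have c0 s : s <= t -> 0 < 1 + (t - s) by rewrite -subr_ge0 => h; rewrite ltr_pwDl.
have dF s : a <= s -> s <= t -> is_derive s 1 F (f s).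
  move=> _ st; have h1 : is_derive s 1 (fun s => - (t - s)) 1.
    by apply: is_derive_eq; rewrite /GRing.scale /=; ring.
  have h2 : is_derive s 1 (fun s => 1 + (t - s)) (- 1).
    by apply: is_derive_eq; rewrite /GRing.scale /=; ring.
  have h3 := is_derive_comp (g := fun s => - (t - s)) (is_derive_expR (- (t - s))) h1.
  have h4 := is_derive_comp (g := fun s => 1 + (t - s)) (is_derive_phit_param x (c0 s st)) h2.
  rewrite /F /f; apply: is_derive_eq; rewrite /GRing.scale /=.
  by move: (pi^-1) => p; ring.
have cf s : a <= s -> s <= t -> {for s, continuous f}.
  move=> _ st.
  have ce : {for s, continuous (fun s => expR (- (t - s)))}.
    apply: (continuous_comp (f := fun s => - (t - s)) (g := expR)); last exact: continuous_expR.
    by apply: cvgN; apply: cvgB; [exact: cvg_cst|exact: cvg_id].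
  have c1 : {for s, continuous (fun s => 1 + (t - s))}.
    by apply: cvgD; [exact: cvg_cst|apply: cvgB; [exact: cvg_cst|exact: cvg_id]].
  apply: cvgM; first exact: ce.
  apply: cvgD.
    apply: (continuous_comp (f := fun s => 1 + (t - s)) (g := fun a => phit a x)); first exact: c1.
    apply: differentiable_continuous; apply/derivable1_diffP.
    by have [] := is_derive_phit_param x (c0 s st).
  apply: cvgM; first exact: cvg_cst.
  apply: cvgM; first exact: cvg_cst.
  apply: cvgV; first by rewrite gt_eqF // den_gt0 // c0.
  apply: cvgD; last exact: cvg_cst.
  by rewrite expr2; apply: cvgM; exact: c1.
have mf : mfun f.
  rewrite /f /phit /conjP; apply: measurable_funM; first by meas.
  apply: measurable_funD; last by meas.
  apply: measurable_funM; first exact: measurable_cst.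
  by apply: (measurableT_comp mfun_atan); meas.
have [ig e] := I_ind_FTC (ltW at0) dF cf mf.
have ta : 0 < t - a by rewrite subr_gt0.
have pphi : pint (phi : R -> R) by rewrite (_ : phi = phit 1); [exact: pint_phit|apply/funext => y; rewrite phit1].
have pq : pint (conjP 1) by apply: (pint_bounded (mfun_conjP 1)) => y; exact: conjP_bound.
have pcphi r y : 0 < r -> pc r phi y = phit (1 + r) y.
  by move=> r0; rewrite (_ : phi = phit 1) ?pc_phit // 1?addrC //; apply/funext => z; rewrite phit1.
have -> : duh a t (fun _ y => gnl (phi y)) x = F t - F a.
  rewrite -e; apply: eq_I => s; rewrite /ind.
  case: ifP => [/andP[h1 h2]|_]; last by rewrite !mul0r.
  have ts : 0 < t - s by rewrite subr_gt0.
  rewrite !mul1r /qc /f; congr (_ * _).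
  rewrite (_ : (fun y => gnl (phi y)) = fun y => phi y + 2 / pi * conjP 1 y); last by apply/funext => y; rewrite gnl_phi.
  rewrite (pcD _ ts pphi (pintZ (2 / pi) pq)) (pcZ _ _ ts pq) pcphi // pc_conjP //.
  by rewrite (addrC 1).
by rewrite /F /qc pcphi // subrr oppr0 expR0 mul1r addr0 phit1; ring.
Qed.

(** Translates of the layer measured from [phi] itself. They decrease as b grows, so the lower
    barrier of a trapping interval carries its right end. *)
Definition psi b x : R := phi (x - b) - phi x.

Lemma mfun_psi b : mfun (psi b).
Proof. by have mp := @mfun_phi R; rewrite /psi; meas. Qed.

Lemma phi_bound x : `|phi x| <= (1 : R).
Proof. by rewrite -phit1; exact: phit_bound. Qed.

Lemma psi_bound b x : `|psi b x| <= 2.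
Proof. by apply: (le_trans (ler_normB _ _)); have := phi_bound x; have := phi_bound (x - b); lra. Qed.

Lemma Gnl_psi b y : Gnl y (psi b y) = gnl (phi (y - b)) - gnl (phi y).
Proof. by rewrite /Gnl /psi subrK. Qed.

(** The difference of the formulas for phi at x - b and at x, since convolution commutes with
    translations. *)
Lemma psi_mild b a : mild_from a (fun _ => psi b) (fun _ y => Gnl y (psi b y)).
Proof.
move=> t x at0; have ta : 0 < t - a by rewrite subr_gt0.
have mp := @mfun_phi R; have mg := mfun_gnl_phi.
have mgb : mfun (fun y => gnl (phi (y - b)) : R) by meas.
have p1 : pint (phi : R -> R) by apply: (pint_bounded mp) => y; exact: phi_bound.
have p2 : pint (fun y => phi (y - b) : R).
  by apply: (@pint_bounded _ _ 1) => [|y]; [meas|exact: phi_bound].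
have m1 : mfun2 (fun _ y => gnl (phi y) : R) by apply: (measurableT_comp mg); meas.
have m2 : mfun2 (fun _ y => gnl (phi (y - b)) : R) by apply: (measurableT_comp mgb); meas.
have b1 : dbound a t (fun _ y => gnl (phi y)) x 3 by apply: dbound_sup => // s y _ _; exact: gnl_phi_bound.
have b2 : dbound a t (fun _ y => gnl (phi (y - b))) x 3 by apply: dbound_sup => // s y _ _; exact: gnl_phi_bound.
rewrite (_ : (fun _ y => Gnl y (psi b y)) = fun _ y => gnl (phi (y - b)) - gnl (phi y)); last first.
  by apply/funext => s; apply/funext => y; rewrite Gnl_psi.
rewrite (duhB m2 m1 b2 b1) qcB // {1}/psi (phi_mild (x - b) at0) [in X in _ - X](phi_mild x at0).
have -> : qc (t - a) phi (x - b) = qc (t - a) (fun y => phi (y - b)) x by rewrite /qc pc_shift.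
have -> : duh a t (fun _ y => gnl (phi y)) (x - b) = duh a t (fun _ y => gnl (phi (y - b))) x.
  by apply: eq_I => s; rewrite /qc pc_shift.
by rewrite opprD addrACA.
Qed.

End StationaryLayer.

(** * Comparison principle and contraction of the trapping interval *)

Section Comparison.
Context {R : realType}.
Implicit Types (t s x y h a b : R) (M C : R).
Notation mu := (@lebesgue_measure R).

Definition solves a (w : R -> R -> R) := mild_from a w (fun s y => Gnl y (w s y)).

Lemma mfun2_Gnl (w : R -> R -> R) : mfun2 w -> mfun2 (fun s y => Gnl y (w s y)).
Proof. by move=> mw; apply: mfun_Gnl; meas. Qed.

(** The source is nondecreasing and 2-Lipschitz, so over a time of at most 1/4 the Duhamel integral
    turns an upper bound of w1 - w2 into at most half of it. From the trivial bound 2 C one reaches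
    2 C / 2^n for every n. *)
Lemma comparison_step a T C (w1 w2 : R -> R -> R) : T <= a + 4^-1 -> mfun2 w1 -> mfun2 w2 ->
  solves a w1 -> solves a w2 -> (forall s y, a <= s -> s <= T -> `|w1 s y| <= C /\ `|w2 s y| <= C) ->
  (forall x, w1 a x <= w2 a x) -> forall t x, a <= t -> t <= T -> w1 t x <= w2 t x.
Proof.
move=> Ta m1 m2 s1 s2 bd h0 t x; rewrite le_eqVlt => /predU1P[<- _|at0 tT]; first exact: h0.
have aT : a <= T by rewrite (le_trans (ltW at0)).
have C0 : 0 <= C by have [h _] := bd a 0 (lexx _) aT; exact: le_trans h.
have g1 := mfun2_Gnl m1; have g2 := mfun2_Gnl m2.
have key n : forall t x, a < t -> t <= T -> w1 t x - w2 t x <= 2 * C * 2^-1 ^+ n.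
  elim: n => [|n IH] {at0 tT} {}t {}x at0 tT.
    have [] := bd t x (ltW at0) tT; rewrite !ler_norml expr0 => /andP[? ?] /andP[? ?]; lra.
  have ta : 0 < t - a by rewrite subr_gt0.
  have db (w : R -> R -> R) : mfun2 w -> (forall s y, a <= s -> s <= T -> `|w s y| <= C) ->
      dbound a t (fun s y => Gnl y (w s y)) x (2 * C).
    move=> mw bw; apply: dbound_sup => [|s y sa st]; first exact: mfun2_Gnl.
    apply: (le_trans (Gnl_le _ _)); rewrite ler_pM2l //; apply: bw (ltW sa) _.
    by rewrite (le_trans (ltW st)).
  have d1 := db _ m1 (fun s y q1 q2 => (bd s y q1 q2).1).
  have d2 := db _ m2 (fun s y q1 q2 => (bd s y q1 q2).2).
  have ma : mfun (w1 a) by exact: mfun2_1.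
  have ma' : mfun (w2 a) by exact: mfun2_1.
  have q12 : qc (t - a) (w1 a) x <= qc (t - a) (w2 a) x.
    apply: ler_wpM2l; first exact: expR_ge0.
    apply: pc_le => //.
    + by apply: (@pint_bounded _ _ C) => // y; have [] := bd a y (lexx _) aT.
    + by apply: (@pint_bounded _ _ C) => // y; have [] := bd a y (lexx _) aT.
  pose K := 2 * (2 * C * 2^-1 ^+ n).
  have K0 : 0 <= K by rewrite !mulr_ge0 // exprn_ge0.
  have dK : dbound a t (fun _ _ => K) x K.
    by apply: dbound_sup => [|s y _ _]; [exact: measurable_cst|rewrite ger0_norm].
  have b1 : duh a t (fun s y => Gnl y (w1 s y) - Gnl y (w2 s y)) x <= duh a t (fun _ _ => K) x.
    apply: (duh_le (C := Num.max K (4 * C))).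
    - by apply: measurable_funB.
    - exact: measurable_cst.
    - apply: dbound_sup => [|s y sa st]; first exact: measurable_funB.
      have st' : s <= T by rewrite (le_trans (ltW st)).
      have [b1 b2] := bd s y (ltW sa) st'.
      apply: (le_trans (ler_normB _ _)); rewrite le_max; apply/orP; right.
      by have := Gnl_le y (w1 s y); have := Gnl_le y (w2 s y); lra.
    - by move=> s sa st; have [p q] := dK s sa st; split => //; rewrite le_max q.
    move=> s y sa st; have st' : s <= T by rewrite (le_trans (ltW st)).
    have h := IH s y sa st'; rewrite /K.
    case: (leP (w2 s y) (w1 s y)) => [|/ltW] h'.
      by have /andP[_ h2] := Gnl_mono y h'; apply: (le_trans h2); rewrite ler_pM2l.
    by have /andP[h2 _] := Gnl_mono y h'; rewrite subr_ge0 in h2; apply: le_trans K0; rewrite subr_le0.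
  rewrite (duhB g1 g2 d1 d2) in b1.
  have b2 : duh a t (fun _ _ => K) x <= K * (t - a).
    by apply: (le_trans (ler_norm _)); apply: duh_abs; [exact: ltW|exact: dK|exact: measurable_cst].
  rewrite s1 // s2 //.
  have b3 : K * (t - a) <= K * 4^-1 by rewrite ler_wpM2l // lerBlDl (le_trans tT).
  have -> : 2 * C * 2^-1 ^+ n.+1 = K * 4^-1 by rewrite exprSr /K; field.
  move: q12 b1 b2 b3; move: (qc _ _ _) (qc _ _ _) (duh _ _ _ _) (duh _ _ _ _) (duh _ _ _ _) => p q r s u; lra.
rewrite -subr_le0; apply/ler_addgt0Pr => e e0; rewrite add0r.
have c0 : (fun n => 2 * C * 2^-1 ^+ n) @ \oo --> (0 : R).
  rewrite -[X in _ --> X](mulr0 (2 * C)); apply: cvgM; first exact: cvg_cst.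
  by apply: cvg_expr; rewrite ger0_norm // invf_lt1 // ltr1n.
have : \forall n \near \oo, 2 * C * 2^-1 ^+ n < e by apply: (cvgr_lt _ c0).
by case=> n _ /(_ n (leqnn n)) /= h; apply: (le_trans (key n t x at0 tT)); exact: ltW.
Qed.

(** The step 1/4 does not depend on the bound C, so finitely many steps reach any time even if the
    bound grows. *)
Lemma comparison a (w1 w2 : R -> R -> R) : mfun2 w1 -> mfun2 w2 ->
  (forall b, a <= b -> solves b w1) -> (forall b, a <= b -> solves b w2) ->
  (forall T, exists C, forall s y, a <= s -> s <= T -> `|w1 s y| <= C /\ `|w2 s y| <= C) ->
  (forall x, w1 a x <= w2 a x) -> forall t x, a <= t -> w1 t x <= w2 t x.
Proof.
move=> m1 m2 s1 s2 bd h0.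
have key n : forall t x, a <= t -> t <= a + 4^-1 * n%:R -> w1 t x <= w2 t x.
  elim: n => [|n IH] t x at0 tn.
    have -> : t = a by apply/eqP; rewrite eq_le at0 andbT; move: tn; rewrite mulr0 addr0.
    exact: h0.
  pose b := a + 4^-1 * n%:R.
  have ab : a <= b by rewrite lerDl mulr_ge0.
  case: (leP t b) => tb; first exact: IH.
  have [C hC] := bd t.
  apply: (@comparison_step b t C w1 w2) => //.
  - by move: tn; rewrite -[n.+1%:R]natr1 /b; lra.
  - exact: s1.
  - exact: s2.
  - by move=> s y bs st; apply: hC => //; exact: le_trans bs.
  - by move=> y; exact: IH.
  exact: ltW.
move=> t x at0; apply: (key (Num.truncn (4 * (t - a))).+1) => //.
have h : 4 * (t - a) < (Num.truncn (4 * (t - a))).+1%:R by rewrite truncnS_gt.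
by rewrite -lerBlDl ler_pdivlMl // ltW.
Qed.

Lemma phi_shift_le a b x : a <= b -> phi (x - b) <= phi (x - a) :> R.
Proof.
move=> ab; rewrite /phi ler_pM2l ?divr_gt0 ?pi_gt0 //.
have [c hc e] := mean_value (x - b) (x - a) (fun y => is_derive1_atan y).
rewrite -subr_ge0 e mulr_ge0 //; last by lra.
by rewrite invr_ge0 addr_ge0 ?sqr_ge0.
Qed.

(** Harnack's inequality for the kernel at a fixed time: recentring costs a factor that depends only
    on the displacement. *)
Lemma P1_harnack K x h : `|h| <= K -> P 1 (x + h) <= 2 * (1 + K ^+ 2) * P 1 x.
Proof.
move=> hK; rewrite /P [leRHS]mulrCA ler_pM2l ?invpi_gt0 // !div1r expr1n.
have d0 : 0 < 1 + x ^+ 2 by rewrite ltr_pwDl ?sqr_ge0.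
have d1 : 0 < 1 + (x + h) ^+ 2 by rewrite ltr_pwDl ?sqr_ge0.
rewrite ler_pdivlMr // mulrC ler_pdivrMr //.
have hk : h ^+ 2 <= K ^+ 2 by rewrite -normK2 lerXn2r // nnegrE // (le_trans _ hK).
have := sqr_ge0 (x + h + h); have := sqr_ge0 (x + h); have := sqr_ge0 K; have := sqr_ge0 h.
have : 0 <= K ^+ 2 * (x + h) ^+ 2 by rewrite mulr_ge0 // sqr_ge0.
nra.
Qed.

(** Mean value theorem for the layer, whose derivative is 2 P_1, followed by Harnack's inequality to
    recentre the kernel at c. *)
Lemma phi_diff_le K a b x c : a <= b -> (forall d, a <= d -> d <= b -> `|c - d| <= K) ->
  phi (x - a) - phi (x - b) <= (b - a) * (4 * (1 + K ^+ 2) * P 1 (x - c)).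
Proof.
move=> ab hK; rewrite -!phit1.
have ab' : x - b <= x - a by rewrite lerD2l lerN2.
have [d /andP[d1 d2] ->] := mean_value_le ab' (fun y => is_derive_phit y ltr01).
have -> : x - a - (x - b) = b - a by ring.
rewrite mulrC ler_wpM2l ?subr_ge0 //.
have -> : d = (x - c) + (c - (x - d)) by ring.
apply: (@le_trans _ _ (2 * (2 * (1 + K ^+ 2) * P 1 (x - c)))); last by move: (P _ _) => p; lra.
by rewrite ler_pM2l //; apply: P1_harnack; apply: hK; lra.
Qed.

Lemma phi_diff_ge K a b x : a <= b -> `|x| + b <= K -> - K <= - `|x| + a -> 0 <= K ->
  (b - a) * (2 * P 1 K) <= phi (x - a) - phi (x - b).
Proof.
move=> ab h1 h2 K0; rewrite -!phit1.
have ab' : x - b <= x - a by rewrite lerD2l lerN2.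
have [d /andP[d1 d2] ->] := mean_value_le ab' (fun y => is_derive_phit y ltr01).
have -> : x - a - (x - b) = b - a by ring.
rewrite [leRHS]mulrC ler_wpM2l ?subr_ge0 // ler_pM2l // /P ler_pM2l ?invpi_gt0 //.
rewrite !div1r expr1n lef_pV2 ?posrE ?ltr_pwDl ?sqr_ge0 // lerD2l.
rewrite -normK2 lerXn2r ?nnegrE //.
have := ler_norm x; have := ler_norm (- x); rewrite normrN ler_norml => n1 n2.
by apply/andP; split; lra.
Qed.

(** Only the part of k near a is kept; there Harnack's inequality with displacement 1 costs the
    factor 2 (1 + 1) = 4. *)
Lemma pc1_lower (k : R -> R) a x : pint k -> (forall y, 0 <= k y) ->
  4^-1 * P 1 (x - a) * \I_y (ind (a - 1) (a + 1) y * k y) <= pc 1 k x.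
Proof.
move=> pk k0; have mk := pint_mfun pk.
have ig2 : igr (fun y => P 1 (x - y) * k y) by apply: pk.2.
have hh y : a - 1 < y < a + 1 -> 4^-1 * P 1 (x - a) <= P 1 (x - y).
  move=> /andP[y1 y2]; have : `|y - a| <= 1 by rewrite ler_norml; lra.
  move/(P1_harnack (x - y)); rewrite (_ : x - y + (y - a) = x - a); last by ring.
  by rewrite expr1n; move: (P _ _) (P _ _) => p q; lra.
have pt y : 4^-1 * P 1 (x - a) * (ind (a - 1) (a + 1) y * k y) <= P 1 (x - y) * k y.
  rewrite mulrA ler_wpM2r // /ind; case: ifP => [/hh|_]; first by rewrite mulr1.
  by rewrite mulr0; pos.
have ig1 : igr (fun y => 4^-1 * P 1 (x - a) * (ind (a - 1) (a + 1) y * k y)).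
  apply: (igr_le _ ig2) => [|y]; first by meas3.
  rewrite ger0_norm //; apply: mulr_ge0; first by pos.
  by apply: mulr_ge0; rewrite ?ind_ge0.
have p0 : 4^-1 * P 1 (x - a) != 0 by rewrite gt_eqF //; pos.
have ig : igr (fun y => ind (a - 1) (a + 1) y * k y).
  have := igrZ (4^-1 * P 1 (x - a))^-1 ig1.
  by under [fun y => _]funext do rewrite mulKf //.
by rewrite -(I_Z _ ig); apply: I_le.
Qed.

Lemma igr_ind_bounded a b (k : R -> R) M : mfun k -> (forall y, `|k y| <= M) -> igr (fun y => ind a b y * k y).
Proof.
move=> mk hk; apply: (igr_le _ (igrZ M (igr_ind a b))) => [|y]; first by meas3.
by rewrite normrM (ger0_norm (ind_ge0 _ _ _)) mulrC ler_wpM2r // ind_ge0.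
Qed.

Lemma psi_diff_mass L a b : a <= b -> b - a <= L ->
  4 * P 1 (1 + L) * (b - a) <= \I_y (ind (a - 1) (a + 1) y * (psi a y - psi b y)).
Proof.
move=> ab hL; have mp := @mfun_psi R a; have mp' := @mfun_psi R b.
(* The window (a - 1, a + 1) has length 2, and on it the gap between the barriers is at least 2
   P_1(1 + L) (b - a), because the intermediate arguments of phi' stay within 1 + L of 0. *)
have -> : 4 * P 1 (1 + L) * (b - a) = \I_y (ind (a - 1) (a + 1) y * (2 * P 1 (1 + L) * (b - a))).
  under [X in Rintegral _ _ X]funext do rewrite mulrC.
  rewrite (I_Z _ (igr_ind _ _)) I_ind; last by lra.
  by move: (P _ _) => p; ring.
apply: I_le.
- by apply: (@igr_ind_bounded _ _ _ `|2 * P 1 (1 + L) * (b - a)|) => //; exact: measurable_cst.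
- apply: (@igr_ind_bounded _ _ _ 4) => [|y]; first by meas.
  by apply: (le_trans (ler_normB _ _)); have := psi_bound a y; have := psi_bound b y; lra.
move=> y; rewrite /ind; case: ifP => [/andP[y1 y2]|_]; last by rewrite !mul0r.
rewrite !mul1r /psi; have -> : phi (y - a) - phi y - (phi (y - b) - phi y) = phi (y - a) - phi (y - b) :> R by ring.
have h0 : 0 <= b - a by rewrite subr_ge0.
have := @phi_diff_ge (1 + L) 0 (b - a) (y - a) h0.
rewrite !subr0 (_ : y - a - (b - a) = y - b); last by ring.
have : `|y - a| <= 1 by rewrite ler_norml; lra.
move=> ya h; have L0 : 0 <= 1 + L by lra.
by have := h _ _ L0; move: (P _ _) => p; lra.
Qed.

Section Contraction.
Variables (w : R -> R -> R) (L : R).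
Hypotheses (mw : mfun2 w) (sw : forall b, 0 <= b -> solves b w) (L0 : 0 <= L).
Hypothesis bw : forall T, exists C, forall s y, 0 <= s -> s <= T -> `|w s y| <= C.

Definition trapped t a b := forall x, psi b x <= w t x <= psi a x.

Let sp b a : solves a (fun _ => psi b) := @psi_mild R b a.

Let mp b : mfun2 (fun _ => psi b).
Proof. by have m := @mfun_psi R b; apply: (measurableT_comp m); meas. Qed.

Let bw2 b t : 0 <= t -> forall T, exists C, forall s y, t <= s -> s <= T -> `|w s y| <= C /\ `|psi b y| <= C.
Proof.
move=> t0 T; have [C hC] := bw T; exists (Num.max C 2) => s y ts sT; rewrite !le_max psi_bound orbT.
by rewrite hC // (le_trans t0).
Qed.

Let bw2' b t : 0 <= t -> forall T, exists C, forall s y, t <= s -> s <= T -> `|psi b y| <= C /\ `|w s y| <= C.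
Proof. by move=> t0 T; have [C hC] := bw2 b t0 T; exists C => s y h1 h2; have [] := hC s y h1 h2. Qed.

Lemma trapped_later t s a b : 0 <= t -> t <= s -> trapped t a b -> trapped s a b.
Proof.
move=> t0 ts h x; apply/andP; split.
  apply: (@comparison t (fun _ => psi b) w (mp b) mw) => //.
  - by move=> c tc; apply: sw; exact: le_trans tc.
  - exact: bw2'.
  - by move=> y; have /andP[] := h y.
apply: (@comparison t w (fun _ => psi a) mw (mp a)) => //.
- by move=> c tc; apply: sw; exact: le_trans tc.
- exact: bw2.
- by move=> y; have /andP[] := h y.
Qed.

(* By comparison the source terms are ordered, so one unit of time keeps at
   least the diffused part of the gap. *)
Let gap (w1 w2 : R -> R -> R) t : 0 <= t -> mfun2 w1 -> mfun2 w2 -> solves t w1 -> solves t w2 ->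
  (forall s y, t <= s -> s <= t + 1 -> w1 s y <= w2 s y /\ `|w1 s y| <= 2 /\ `|w2 s y| <= 2) ->
  forall x, expR (- 1) * pc 1 (fun y => w2 t y - w1 t y) x <= w2 (t + 1) x - w1 (t + 1) x.
Proof.
move=> t0 m1 m2 s1 s2 h x; have tt : t < t + 1 by rewrite ltrDl.
have db (w' : R -> R -> R) : mfun2 w' -> (forall s y, t <= s -> s <= t + 1 -> `|w' s y| <= 2) ->
    dbound t (t + 1) (fun s y => Gnl y (w' s y)) x 4.
  move=> mw' bw'; apply: dbound_sup => [|s y sa st]; first exact: mfun2_Gnl.
  by apply: (le_trans (Gnl_le _ _)); have := bw' s y (ltW sa) (ltW st); lra.
have d1 := db _ m1 (fun s y q1 q2 => (h s y q1 q2).2.1).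
have d2 := db _ m2 (fun s y q1 q2 => (h s y q1 q2).2.2).
have p1 : pint (w1 t).
  by apply: (@pint_bounded _ _ 2) => [|y]; [exact: mfun2_1|have [_ []] := h t y (lexx _) (ltW tt)].
have p2 : pint (w2 t).
  by apply: (@pint_bounded _ _ 2) => [|y]; [exact: mfun2_1|have [_ []] := h t y (lexx _) (ltW tt)].
have d12 : duh t (t + 1) (fun s y => Gnl y (w1 s y)) x <= duh t (t + 1) (fun s y => Gnl y (w2 s y)) x.
  apply: (duh_le (C := 4)) => //; [exact: mfun2_Gnl|exact: mfun2_Gnl|].
  move=> s y sa st; have [/(Gnl_mono y) /andP[q _] _] := h s y (ltW sa) (ltW st).
  by rewrite subr_ge0 in q.
rewrite s1 // s2 // (_ : t + 1 - t = 1); last by ring.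
rewrite pcB // /qc; move: d12; move: (duh _ _ _ _) (duh _ _ _ _) (pc _ _ _) (pc _ _ _) (expR _) => d d' p p' e; lra.
Qed.

(* the fraction of the gap between the two barriers that is closed per unit of time *)
Definition rate : R := 2^-1 * (expR (- 1) * 4^-1 * (2 * P 1 (1 + L)) / (4 * (1 + L ^+ 2))).

Lemma rate_gt0 : 0 < rate.
Proof.
have h : 0 < 1 + L ^+ 2 by rewrite ltr_pwDl ?sqr_ge0.
by rewrite /rate; pos.
Qed.

Lemma rate_lt1 : rate < 1.
Proof.
have h : 1 <= 1 + L ^+ 2 by rewrite lerDl sqr_ge0.
have e1 : expR (- 1) <= 1 :> R by rewrite expRN_le1.
have e0 : 0 < expR (- 1) :> R by exact: expR_gt0.
have P1 : P 1 (1 + L) <= 1.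
  apply: (le_trans (P_le _ ltr01)); rewrite mulr1 invf_le1 ?pi_gt0 //.
  by have := @pi_ge2 R; lra.
have P0 : 0 < P 1 (1 + L) by pos.
rewrite /rate ltr_pdivrMl // mulr1 ltr_pdivrMr; last by lra.
by move: e1 e0 P1 P0 h; move: (P _ _) (expR _) (L ^+ 2) => p e l; nra.
Qed.

(** Pigeonhole: the two gaps add up to psi a - psi b, so near a one of them carries at least half of
    the mass guaranteed by [psi_diff_mass]. One unit of time later that gap exceeds a multiple of
    P_1(x - a) everywhere, and by [phi_diff_le] this pays for displacing the corresponding barrier
    by rate (b - a). *)
Lemma trapped_contract t a b : 0 <= t -> a <= b -> b - a <= L -> trapped t a b ->
  exists a' b', [/\ a <= a', a' <= b', b' <= b, b' - a' <= (1 - rate) * (b - a) & trapped (t + 1) a' b'].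
Proof.
move=> t0 ab abL h.
have th s : t <= s -> trapped s a b by move=> ts; exact: trapped_later h.
have bnd s y : t <= s -> `|w s y| <= 2.
  move=> ts; have /andP[q1 q2] := th s ts y.
  by have := psi_bound a y; have := psi_bound b y; rewrite !ler_norml => /andP[q5 q3] /andP[q4 q6]; lra.
have mwt : mfun (w t) by exact: mfun2_1.
have g1 := @gap (fun _ => psi b) w t t0 (mp b) mw (@sp b t) (sw t0).
have g2 := @gap w (fun _ => psi a) t t0 mw (mp a) (sw t0) (@sp a t).
have {}g1 x : expR (- 1) * pc 1 (fun y => w t y - psi b y) x <= w (t + 1) x - psi b x.
  by apply: g1 => s y q1 q2; rewrite psi_bound bnd //; have /andP[] := th s q1 y.
have {}g2 x : expR (- 1) * pc 1 (fun y => psi a y - w t y) x <= psi a x - w (t + 1) x.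
  by apply: g2 => s y q1 q2; rewrite psi_bound bnd //; have /andP[] := th s q1 y.
have mb := @mfun_psi R b; have ma := @mfun_psi R a.
have k1 y : `|w t y - psi b y| <= 4.
  by apply: (le_trans (ler_normB _ _)); have := psi_bound b y; have := bnd t y (lexx _); lra.
have k2 y : `|psi a y - w t y| <= 4.
  by apply: (le_trans (ler_normB _ _)); have := psi_bound a y; have := bnd t y (lexx _); lra.
have m1 : mfun (fun y => w t y - psi b y) by meas.
have m2 : mfun (fun y => psi a y - w t y) by meas.
set J1 := \I_y (ind (a - 1) (a + 1) y * (w t y - psi b y)).
set J2 := \I_y (ind (a - 1) (a + 1) y * (psi a y - w t y)).
have JJ : 4 * P 1 (1 + L) * (b - a) <= J1 + J2.
  rewrite /J1 /J2 -I_D; [|exact: (igr_ind_bounded _ _ m1 k1)|exact: (igr_ind_bounded _ _ m2 k2)].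
  apply: (le_trans (psi_diff_mass ab abL)); rewrite le_eqVlt; apply/orP; left; apply/eqP.
  by apply: eq_I => y; ring.
(* The factors of [rate] meet here: e^{-1} from the damping, 1/4 from [pc1_lower], 2 P_1(1 + L) from
   half of the mass, and 4 (1 + L^2) from the cost of displacing a barrier. *)
have lo (k : R -> R) J x : mfun k -> (forall y, `|k y| <= 4) -> (forall y, 0 <= k y) ->
    J = \I_y (ind (a - 1) (a + 1) y * k y) -> 2 * P 1 (1 + L) * (b - a) <= J ->
    (rate * (b - a)) * (4 * (1 + L ^+ 2) * P 1 (x - a)) <= expR (- 1) * pc 1 k x.
  move=> mk bk k0 -> hJ; have pk := pint_bounded mk bk.
  apply: (@le_trans _ _ (expR (- 1) * (4^-1 * P 1 (x - a) * (2 * P 1 (1 + L) * (b - a))))); last first.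
    rewrite ler_wpM2l ?expR_ge0 //; apply: le_trans (pc1_lower a x pk k0).
    by rewrite ler_wpM2l //; pos.
  have n : 1 + L ^+ 2 != 0 by rewrite gt_eqF // ltr_pwDl ?sqr_ge0.
  have -> : rate * (b - a) * (4 * (1 + L ^+ 2) * P 1 (x - a)) =
    2^-1 * (expR (- 1) * (4^-1 * P 1 (x - a) * (2 * P 1 (1 + L) * (b - a)))).
    by rewrite /rate; move: n; move: (L ^+ 2) (expR _) (P _ _) (P _ _) => l e p q n; field; rewrite n.
  rewrite ler_piMl //; last by rewrite invf_le1 // ler1n.
  apply: mulr_ge0; first exact: expR_ge0.
  by apply: mulr_ge0; [pos|apply: mulr_ge0; [pos|rewrite subr_ge0]].
have r0 := rate_gt0; have r1 := rate_lt1.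
have ab0 : 0 <= b - a by rewrite subr_ge0.
have rb : 0 <= rate * (b - a) by rewrite mulr_ge0 // ltW.
have rb1 : rate * (b - a) <= b - a by rewrite ler_piMl // ltW.
have t1 : trapped (t + 1) a b by apply: th; rewrite lerDl.
have Kb d : a <= d -> d <= b -> `|a - d| <= L by move=> q1 q2; rewrite ler_norml; lra.
case: (leP (2 * P 1 (1 + L) * (b - a)) J1) => hJ.
  have ar : a <= b - rate * (b - a) by rewrite lerBrDr -lerBrDl.
  exists a, (b - rate * (b - a)); split => //; [by rewrite gerBl|by rewrite mulrBl mul1r addrAC|].
  move=> x; have /andP[_ ->] := t1 x; rewrite andbT.
  have w0 y : 0 <= w t y - psi b y by rewrite subr_ge0; have /andP[] := h y.
  have q1 := le_trans (lo _ _ x m1 k1 w0 erefl hJ) (g1 x).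
  have q2 : b - rate * (b - a) <= b by rewrite gerBl.
  have Kb' d : b - rate * (b - a) <= d -> d <= b -> `|a - d| <= L by move=> d1; exact: Kb (le_trans ar d1).
  have q3 := @phi_diff_le L _ _ x a q2 Kb'.
  rewrite (_ : b - (b - rate * (b - a)) = rate * (b - a)) in q3; last by ring.
  have := le_trans q3 q1; rewrite /psi.
  by move: (phi _) (phi _) (phi _) (w _ _) => p1 p2 p3 p4; lra.
have hJ2 : 2 * P 1 (1 + L) * (b - a) <= J2 by move: JJ hJ; move: (P _ _) J1 J2 => p j1 j2; nra.
have ar : a + rate * (b - a) <= b by rewrite -lerBrDl.
exists (a + rate * (b - a)), b; split => //; [by rewrite lerDl|by rewrite mulrBl mul1r opprD addrA|].
move=> x; have /andP[-> _] := t1 x; rewrite /=.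
have w0 y : 0 <= psi a y - w t y by rewrite subr_ge0; have /andP[] := h y.
have q1 := le_trans (lo _ _ x m2 k2 w0 erefl hJ2) (g2 x).
have q2 : a <= a + rate * (b - a) by rewrite lerDl.
have Kb' d : a <= d -> d <= a + rate * (b - a) -> `|a - d| <= L by move=> d1 d2; exact: Kb d1 (le_trans d2 ar).
have q3 := @phi_diff_le L _ _ x a q2 Kb'.
rewrite (_ : a + rate * (b - a) - a = rate * (b - a)) in q3; last by ring.
have := le_trans q3 q1; rewrite /psi.
by move: (phi _) (phi _) (phi _) (w _ _) => p1 p2 p3 p4; lra.
Qed.

Lemma trapped_iter a b n : a <= b -> b - a = L -> trapped 0 a b ->
  exists a' b', [/\ a <= a', a' <= b', b' <= b, b' - a' <= (1 - rate) ^+ n * (b - a) & trapped n%:R a' b'].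
Proof.
move=> ab abL h; elim: n => [|n [a' [b' [h1 h2 h3 h4 h5]]]].
  by exists a, b; split => //; rewrite expr0 mul1r.
have hL : b' - a' <= L by lra.
have [a2 [b2 [k1 k2 k3 k4 k5]]] := trapped_contract (ler0n _ n) h2 hL h5.
exists a2, b2; split; [exact: le_trans k1|exact: k2|exact: (le_trans k3)| |by rewrite -natr1].
by apply: (le_trans k4); rewrite exprS -mulrA ler_wpM2l // subr_ge0 ltW // rate_lt1.
Qed.

End Contraction.

End Comparison.

(** * The limiting translate and the rate of convergence *)

Section Decay.
Context {R : realType}.
Implicit Types (t s x y h a b : R) (M C : R).

Lemma atan_ge0 y : 0 <= atan y -> 0 <= y.
Proof.
move=> h; rewrite leNgt; apply/negP => y0.
have [c _ e] := mean_value_le (ltW y0) (fun y => is_derive1_atan y).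
have : 0 < (1 + c ^+ 2)^-1 * (0 - y).
  by apply: mulr_gt0; [rewrite invr_gt0 ltr_pwDl ?sqr_ge0|rewrite subr_gt0].
by rewrite -e atan0; lra.
Qed.

Variables (w : R -> R -> R) (a b : R).
Hypotheses (mw : mfun2 w) (sw : forall b, 0 <= b -> solves b w).
Hypothesis bw : forall T, exists C, forall s y, 0 <= s -> s <= T -> `|w s y| <= C.
Hypotheses (ab : a <= b) (h0 : trapped w 0 a b).

Let trapped_ordered s t a1 b1 a2 b2 : 0 <= s -> 0 <= t -> trapped w s a1 b1 -> trapped w t a2 b2 -> a1 <= b2.
Proof.
move=> s0 t0 h1 h2; pose r := Num.max s t.
have sr : s <= r by rewrite le_max lexx.
have tr : t <= r by rewrite le_max lexx orbT.
(* Both trappings are compared at a common later time and at the point b2, where the lower translate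
   takes the value phi(0) = 0; so phi(b2 - a1) must be nonnegative. *)
have /andP[_ q1] := trapped_later mw sw bw s0 sr h1 b2.
have /andP[q2 _] := trapped_later mw sw bw t0 tr h2 b2.
have := le_trans q2 q1; rewrite lerD2r subrr /phi atan0 mulr0.
have p0 : 0 < 2 / (pi : R) by rewrite divr_gt0 // pi_gt0.
by rewrite pmulr_rge0 // => /atan_ge0; rewrite subr_ge0.
Qed.

Lemma decay : exists x0 c m : R, [/\ 0 < c, 0 < m & forall t x, 0 <= t ->
  `|w t x + phi x - phi (x - x0)| <= c * Num.min (1 / (1 + `|x|)) (expR (- (m * t)))].
Proof.
pose L := b - a; have L0 : 0 <= L by rewrite subr_ge0.
(* By [trapped_ordered] no left end of a trapping interval exceeds the right end of another,
   whatever the times; hence the supremum of the left ends lies in all of these intervals. *)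
pose S := [set a' : R | exists n : nat, exists2 b' : R, a <= a' /\ b' <= b & trapped w n%:R a' b'].
have Sub a' b' (n : nat) : trapped w n%:R a' b' -> ubound S b'.
  move=> h z [n' [b2 _ h']]; exact: (trapped_ordered (ler0n _ _) (ler0n _ _) h' h).
have S0 : S a by exists 0, b.
pose x0 := sup S.
have x0_in (n : nat) a' b' : a <= a' -> b' <= b -> trapped w n%:R a' b' -> a' <= x0 <= b'.
  move=> h1 h2 h; apply/andP; split.
    by apply: ub_le_sup; [exists b'; exact: Sub h|exists n, b'].
  by apply: ge_sup; [exists a|exact: Sub h].
pose K := `|a| + `|b|; have K0 : 0 <= K by rewrite addr_ge0.
have th0 := @rate_gt0 R L; have th1 := @rate_lt1 R L.
pose th := rate L; pose D := 8 * (1 + K ^+ 2) * L; have D0 : 0 <= D.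
  by rewrite !mulr_ge0 // addr_ge0 // sqr_ge0.
(* D vanishes when a = b, hence D + 1. The factor e^th pays for replacing t by the integer below
   it. *)
exists x0, (expR th * (D + 1)), th; split => //.
  by rewrite mulr_gt0 ?expR_gt0 // ltr_wpDl.
move=> t x t0; pose n := Num.truncn t.
have [a' [b' [h1 h2 h3 h4 h5]]] := @trapped_iter R w L mw sw bw a b n ab erefl h0.
have nt : n%:R <= t by rewrite truncn_le.
have tn : t < n%:R + 1 by rewrite natr1 truncnS_gt.
have /andP[q1 q2] := trapped_later mw sw bw (ler0n _ n) nt h5 x.
have /andP[xa xb] := x0_in n a' b' h1 h3 h5.
have q3 := @phi_shift_le R _ _ x xa; have q4 := @phi_shift_le R _ _ x xb.
have hK d : a' <= d -> d <= b' -> `|0 - d| <= K.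
  move=> d1 d2; rewrite sub0r normrN ler_norml /K.
  have := ler_norm b; have := ler_norm (- a); rewrite normrN.
  by have := normr_ge0 a; have := normr_ge0 b; lra.
have q5 := @phi_diff_le R K _ _ x 0 h2 hK; rewrite subr0 in q5.
have b1 : `|w t x + phi x - phi (x - x0)| <= phi (x - a') - phi (x - b').
  rewrite ler_norml; move: q1 q2 q3 q4; rewrite /psi.
  by move: (phi _) (phi _) (phi _) (phi _) => p p' p2 p3; lra.
have P1 : P 1 x <= 2 / (1 + `|x|).
  have x1 : 0 < 1 + `|x| by rewrite ltr_pwDl.
  apply: (@le_trans _ _ (1 + x ^+ 2)^-1).
    rewrite /P div1r expr1n ler_piMl ?invr_ge0 ?addr_ge0 ?sqr_ge0 // invf_le1 ?pi_gt0 //.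
    by have := @pi_ge2 R; lra.
  rewrite -div1r ler_pdivlMr // mulrAC ler_pdivrMr ?ltr_pwDl ?sqr_ge0 //.
  by rewrite -(real_normK (num_real x)); move: `|x| => X; have := sqr_ge0 (X - 1); have := sqr_ge0 X; nra.
have pw : (1 - th) ^+ n <= expR th * expR (- (th * t)).
  apply: (@le_trans _ _ (expR (- th) ^+ n)).
    by rewrite lerXn2r ?nnegrE ?subr_ge0 ?expR_ge0 ?(ltW th1) //; exact: expR_ge1Dx.
  rewrite -expRM_natl -expRD ler_expR.
  have : 0 <= th * (n%:R + 1 - t) by rewrite mulr_ge0 ?subr_ge0 // ltW.
  by lra.
have x1 : 1 / (1 + `|x|) <= 1 by rewrite div1r invf_le1 ?ltr_pwDl // lerDl.
have x1' : 0 <= 1 / (1 + `|x|) by rewrite divr_ge0 // addr_ge0.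
have e1 : expR (- (th * t)) <= 1 by rewrite expRN_le1 // mulr_ge0 // ltW.
(* The bound obtained is the product of a spatial and a temporal factor; both are at most 1, so it
   lies below their minimum. *)
have b2 : `|w t x + phi x - phi (x - x0)| <= expR th * (D + 1) * (1 / (1 + `|x|) * expR (- (th * t))).
  apply: (le_trans b1); apply: (le_trans q5).
  apply: (@le_trans _ _ ((1 - th) ^+ n * L * (4 * (1 + K ^+ 2) * (2 / (1 + `|x|))))).
    apply: ler_pM; [by rewrite subr_ge0| |exact: h4|].
      by apply: mulr_ge0; [rewrite mulr_ge0 // addr_ge0 // sqr_ge0|pos].
    by rewrite ler_wpM2l // mulr_ge0 // addr_ge0 // sqr_ge0.
  apply: (@le_trans _ _ (expR th * expR (- (th * t)) * L * (4 * (1 + K ^+ 2) * (2 / (1 + `|x|))))).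
    rewrite ler_wpM2r ?ler_wpM2r //.
    by rewrite !mulr_ge0 ?addr_ge0 ?sqr_ge0 ?invr_ge0 ?addr_ge0.
  have -> : expR th * expR (- (th * t)) * L * (4 * (1 + K ^+ 2) * (2 / (1 + `|x|))) =
    expR th * D * (1 / (1 + `|x|) * expR (- (th * t))).
    by rewrite /D div1r; move: (expR _) (expR _) (_ ^-1) (K ^+ 2) => p p' p2 p3; ring.
  apply: ler_wpM2r; first by rewrite mulr_ge0 ?expR_ge0.
  by apply: ler_wpM2l; [exact: expR_ge0|rewrite lerDl].
apply: (le_trans b2); apply: ler_wpM2l; first by rewrite mulr_ge0 ?expR_ge0 ?addr_ge0.
rewrite le_min; apply/andP; split; first by rewrite ler_piMr.
by rewrite ler_piMl ?expR_ge0.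
Qed.

End Decay.

(** * Smoothness in space *)
Section DifferenceQuotients.
Context {R : realType}.
Implicit Types (t s x y h a b : R) (M C L N : R) (w g : R -> R -> R).
Notation mu := (@lebesgue_measure R).

Lemma is_derive_cvg (f : R -> R) x D : h^-1 * (f (x + h) - f x) @[h --> 0^'] --> D -> is_derive x 1 f D.
Proof.
move=> h; have e : (fun h => h^-1 *: ((f \o shift x) (h *: 1) - f x)) = (fun h => h^-1 * (f (x + h) - f x)).
  by apply/funext => k; rewrite /= /GRing.scale /= mulr1 (addrC k).
apply: DeriveDef; first by apply/cvg_ex; exists D; rewrite e.
by rewrite /derive e; apply: cvg_lim h.
Qed.

Lemma cvg_of_is_derive (f : R -> R) x D : is_derive x 1 f D -> h^-1 * (f (x + h) - f x) @[h --> 0^'] --> D.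
Proof.
move=> [hd <-]; have e : (fun h => h^-1 *: ((f \o shift x) (h *: 1) - f x)) = (fun h => h^-1 * (f (x + h) - f x)).
  by apply/funext => k; rewrite /= /GRing.scale /= mulr1 (addrC k).
by rewrite /derive e; move/cvg_ex: hd => [l]; rewrite e => hl; rewrite (cvg_lim _ hl).
Qed.

Lemma derive_seq (f : R -> R) x D (u : nat -> R) : is_derive x 1 f D -> (forall n, u n != 0) ->
  u @ \oo --> (0 : R) -> (u n)^-1 * (f (x + u n) - f x) @[n --> \oo] --> D.
Proof. by move=> /cvg_of_is_derive /cvgr_dnbhsP h u0 cu; exact: (h u). Qed.

Lemma is_derive_sq (f : R -> R) x D C d : 0 < d ->
  (forall h, `|h| <= d -> `|f (x + h) - f x - h * D| <= C * h ^+ 2) -> is_derive x 1 f D.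
Proof.
move=> d0 H; apply: is_derive_cvg; apply/cvgr_dnbhsP => u [u0 cu].
have bd n : `|u n| <= d -> `|(u n)^-1 * (f (x + u n) - f x) - D| <= C * `|u n|.
  move=> un; have -> : (u n)^-1 * (f (x + u n) - f x) - D = (u n)^-1 * (f (x + u n) - f x - u n * D).
    by rewrite [in RHS]mulrBr mulKf.
  rewrite normrM normfV mulrC ler_pdivrMr ?normr_gt0 //.
  by apply: (le_trans (H _ un)); rewrite -(real_normK (num_real (u n))) expr2 mulrA.
apply/cvgrPdist_le => e e0.
have cn : C * `|u n| @[n --> \oo] --> (0 : R).
  rewrite -(mulr0 C) -(@normr0 _ R); apply: cvgM; first exact: cvg_cst.
  exact: (cvg_norm cu).
near=> n; rewrite distrC; apply: (le_trans (bd n _)).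
  near: n; have := cvgr_norm_le _ cu; rewrite normr0; exact.
apply: ltW; near: n; exact: (cvgr_lt _ cn).
Unshelve. all: by end_near. Qed.

Definition hstep n : R := n.+1%:R^-1.

Lemma hstep_neq0 n : hstep n != 0.
Proof. by rewrite invr_eq0 pnatr_eq0. Qed.

Lemma hstep_cvg : hstep @ \oo --> (0 : R).
Proof. exact: cvg_harmonic. Qed.

Lemma nb_qc t (k : R -> R) M : 0 < t -> nb k M -> nb (qc t k) M.
Proof.
move=> t0 h; apply: (nb_dom (nb_pc t0 h)).
  by rewrite /qc; apply: measurable_funM; [exact: measurable_cst|apply: mfun_pc1; exact: nb_mfun h].
by move=> x; rewrite /qc normrM ger0_norm ?expR_ge0 // ler_piMl // expRN_le1 // ltW.
Qed.

Lemma nb_duh a t g M : a <= t -> mfun2 g -> 0 <= M -> (forall s, a < s -> s < t -> nb (g s) M) ->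
  nb (duh a t g) ((t - a) * M).
Proof.
move=> at0 mg M0 h; apply: (nb_minkowski (h := fun z => qc (t - z.1) (g z.1) z.2)) => //.
- exact: mfun_ind1.
- by move=> s; exact: ind_ge0.
- by rewrite int_ind.
- by apply: mfun_qc => //; meas.
move=> s; rewrite /ind; case: ifP => [/andP[h1 h2] _|_]; last by rewrite ltxx.
by rewrite /=; apply: (nb_qc (k := g s)); [rewrite subr_gt0|exact: (h s h1 h2)].
Qed.

Lemma nb_pint (k : R -> R) M : nb k M -> pint k.
Proof. by move=> [mk h _]; exact: pint_bounded h. Qed.

Lemma pc_diffE t (k : R -> R) x h : mfun k -> pint k -> 0 < t ->
  pc t k (x + h) - pc t k x = \I_y ((P t (y + h) - P t y) * k (x - y)).
Proof.
move=> mk pk t0; rewrite /pc -I_B; [|exact: pk.2|exact: pk.2].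
rewrite -(I_reflect x); last by meas2.
by apply: eq_I => y; rewrite !opprB -mulrBl; congr ((P _ _ - P _ _) * _); ring.
Qed.

(** The difference of the two kernels is dominated by a positive kernel of mass |h| / t, which acts
    on both norms: one derivative is gained at the price 1 / t. *)
Lemma nb_pc_diff t (k : R -> R) M h : 0 < t -> nb k M ->
  nb (fun x => pc t k (x + h) - pc t k x) (`|h| / t * M).
Proof.
move=> t0 hk; have mk := nb_mfun hk; have pk := nb_pint hk; have M0 := nb_ge0 hk.
pose K y := `|h| / (2 * t) * (P t (y + h) + P t y).
have mP := @mfun_P R t.
have mK : mfun K by rewrite /K; meas.
have K0 y : 0 <= K y by rewrite /K; apply: mulr_ge0; [rewrite divr_ge0 // mulr_ge0 // ltW|pos].
have igK : igr K by apply: igrZ; apply: igrD; [apply: igr_shift|]; exact: igr_P.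
have IK : \I_y K y = `|h| / t.
  rewrite I_Z ?I_D ?I_shift ?I_P //; first by field; rewrite gt_eqF.
  - by apply: igr_shift; exact: igr_P.
  - exact: igr_P.
  - by apply: igrD; [apply: igr_shift|]; exact: igr_P.
apply: (nb_dom (nb_minkowski (k := K) (h := fun z => `|k (z.2 - z.1)|) (A := `|h| / t) (M := M) mK K0 _ _ _ M0)).
- by rewrite I_fin // IK.
- by meas.
- by move=> y _; rewrite /=; exact: (nb_abs (nb_shift (- y) hk)).
- by have m1 := mfun_pc1 t mk; meas.
move=> x; rewrite pc_diffE //; apply: le_trans (ler_norm _).
have b y : `|(P t (y + h) - P t y) * k (x - y)| <= K y * `|k (x - y)|.
  by rewrite normrM ler_wpM2r // P_diff_le.
apply: I_bound => //; last by meas.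
apply: (igr_le _ (igrZ M igK)) => [|y]; first by meas.
rewrite normrM normr_id ger0_norm // mulrC ler_wpM2r //; exact: nb_sup hk _.
Qed.

Lemma is_derive_pc t (k : R -> R) M x : 0 < t -> mfun k -> (forall y, `|k y| <= M) ->
  is_derive x 1 (pc t k) (\I_y (dP t y * k (x - y))).
Proof.
move=> t0 mk bk; have pk := pint_bounded mk bk.
have M0 : 0 <= M := le_trans (normr_ge0 _) (bk 0).
have mP := @mfun_P R t; have mdP := @mfun_dP R t.
have t2 : 0 < t ^+ 2 by rewrite exprn_gt0.
have igd : igr (fun y => dP t y * k (x - y)).
  apply: (igr_le (g := fun y => (M / t) * P t y)); first by meas.
    by apply: igrZ; exact: igr_P.
  move=> y; rewrite normrM dP_le // mulrC mulrA ler_wpM2r //; first by pos.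
  apply: ler_pM => //; first by rewrite divr_ge0 ?mulr_ge0 // ltW // den_gt0.
  rewrite ler_pdivrMr ?den_gt0 // ler_pdivlMl //.
  by rewrite -(real_normK (num_real y)); move: `|y| => Y; have := sqr_ge0 (Y - t); nra.
apply: (@is_derive_sq _ _ _ (18 / t ^+ 2 * M) t t0) => h ht.
have igB : igr (fun y => (P t (y + h) - P t y) * k (x - y)).
  apply: (igr_le (g := fun y => M * (P t (y + h) + P t y))); first by meas.
    by apply: igrZ; apply: igrD; [apply: igr_shift|]; exact: igr_P.
  move=> y; rewrite normrM mulrC; apply: ler_pM => //.
  by apply: (le_trans (ler_normB _ _)); rewrite !ger0_norm //; pos.
rewrite pc_diffE // -(I_Z _ igd) -I_B //; last exact: igrZ.
apply: (le_trans (I_bound (g := fun y => (18 / t ^+ 2 * M * h ^+ 2) * P t y) _ _ _)).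
- by apply: igrZ; exact: igr_P.
- by meas.
- move=> y; rewrite mulrA -mulrBl normrM.
  apply: (@le_trans _ _ (18 * h ^+ 2 / t ^+ 2 * P t y * M)).
    apply: ler_pM => //; apply: (le_trans (P_taylor y t0 ht)).
    rewrite ler_wpM2r //; first by pos.
    apply: ler_wpM2l; first by rewrite mulr_ge0 ?sqr_ge0.
    by rewrite lef_pV2 ?posrE ?den_gt0 // lerDl sqr_ge0.
  by rewrite le_eqVlt; apply/orP; left; apply/eqP; move: (t ^+ 2)^-1 (P _ _) => p q; ring.
by rewrite I_Z ?I_P ?mulr1 //; exact: igr_P.
Qed.

End DifferenceQuotients.

(** * Classes of curves stable under the nonlinearity *)

Section RegularityClasses.
Context {R : realType}.
Implicit Types (t s x y h a b : R) (M C L N : R) (w v g f : R -> R -> R) (k : nat).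

(** Bounds are required only on time intervals away from 0, since they may blow up at the initial
    time. *)
Definition locb w := [/\ mfun2 w, forall t, 0 < t -> continuous (w t) &
  forall a b, 0 < a -> exists M, forall t, a <= t -> t <= b -> nb (w t) M].

Definition xderiv w w' := forall t x, 0 < t -> is_derive x 1 (w t) (w' t x).

(* [X] holds of the [k]-th spatial derivative of [w]; the lower ones are locally bounded *)
Fixpoint KX (X : (R -> R -> R) -> Prop) k w : Prop :=
  if k is k'.+1 then locb w /\ exists w', xderiv w w' /\ KX X k' w' else X w.

(** The closure properties that carry a property of the k-th derivative of v over to that of Gnl(v).
    They are instantiated by [locb] for plain boundedness and by [LipBy] for quantitative control of
    increments. *)
Record regular_class (X : (R -> R -> R) -> Prop) : Prop := {
  rc_locb : forall w, X w -> locb w;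
  rc_deriv : forall w w', locb w -> locb w' -> xderiv w w' -> X w;
  rc_add : forall f g, X f -> X g -> X (fun t x => f t x + g t x);
  rc_mul : forall f g, X f -> X g -> X (fun t x => f t x * g t x);
  rc_comp : forall (G : R -> R) C f, (forall a b, `|G b - G a| <= C * `|b - a|) -> G 0 = 0 -> X f ->
    X (fun t x => G (f t x)) }.

Lemma lipschitz_continuous (G : R -> R) C : (forall a b, `|G b - G a| <= C * `|b - a|) -> continuous G.
Proof.
move=> hG x; apply/cvgrPdist_le => e e0; near=> y.
apply: (@le_trans _ _ ((`|C| + 1) * `|x - y|)).
  by apply: (le_trans (hG _ _)); rewrite ler_wpM2r //; have := ler_norm C; lra.
rewrite mulrC -ler_pdivlMr; last by rewrite ltr_wpDl.
near: y; apply: cvgr_dist_le; first exact: cvg_id.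
by rewrite divr_gt0 // ltr_wpDl.
Unshelve. all: by end_near. Qed.

Lemma locb_mfun w : locb w -> mfun2 w. Proof. by case. Qed.

Lemma locb_nb w a b : locb w -> 0 < a -> exists M, forall t, a <= t -> t <= b -> nb (w t) M.
Proof. by case=> _ _; exact. Qed.

Lemma locb_comp (G : R -> R) C f : (forall a b, `|G b - G a| <= C * `|b - a|) -> G 0 = 0 -> locb f ->
  locb (fun t x => G (f t x)).
Proof.
move=> hG G0 [mf cf bf]; have cG := lipschitz_continuous hG; split.
- exact: (measurableT_comp (continuous_measurable_fun cG)).
- by move=> t t0 x; apply: (continuous_comp (f := f t) (g := G)); [exact: cf|exact: cG].
move=> a b a0; have [M hM] := bf a b a0; exists (`|C| * M) => t ta tb.
apply: (nb_dom (nbZ C (hM t ta tb))).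
  by apply: (measurableT_comp (continuous_measurable_fun cG)); exact: mfun2_1.
move=> x; have := hG 0 (f t x); rewrite G0 !subr0 => h; apply: (le_trans h).
by rewrite normrM ler_wpM2r //; exact: ler_norm.
Qed.

Lemma locbD f g : locb f -> locb g -> locb (fun t x => f t x + g t x).
Proof.
move=> [mf cf bf] [mg cg bg]; split; first exact: measurable_funD.
  by move=> t t0 x; apply: cvgD; [exact: cf|exact: cg].
move=> a b a0; have [M hM] := bf a b a0; have [N hN] := bg a b a0.
by exists (M + N) => t ta tb; apply: nbD; [exact: hM|exact: hN].
Qed.

Lemma locbM f g : locb f -> locb g -> locb (fun t x => f t x * g t x).
Proof.
move=> [mf cf bf] [mg cg bg]; split; first exact: measurable_funM.
  by move=> t t0 x; apply: cvgM; [exact: cf|exact: cg].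
move=> a b a0; have [M hM] := bf a b a0; have [N hN] := bg a b a0.
by exists (M * N) => t ta tb; apply: nbM; [exact: hM|exact: hN].
Qed.

Lemma regular_locb : regular_class locb.
Proof. by split => //; [exact: locbD|exact: locbM|exact: locb_comp]. Qed.

(** The increment is the integral of dq along the segment, to which Minkowski's inequality applies;
    a mean value argument would control the sup norm only. *)
Lemma nb_diff (q dq : R -> R) M h : (forall x, is_derive x 1 q (dq x)) -> continuous dq -> nb dq M ->
  nb (fun x => q (x + h) - q x) (`|h| * M).
Proof.
move=> hd cd hn; have md := nb_mfun hn.
have -> : (fun x => q (x + h) - q x) = (fun x => h * \I_th (ind 0 1 th * dq (x + h * th))).
  apply/funext => x.
  have dF (th : R) : is_derive th 1 (fun th => q (x + h * th)) (h * dq (x + h * th)).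
    have d1 : is_derive th 1 (fun th => x + h * th) h by apply: is_derive_eq; rewrite /GRing.scale /=; ring.
    by rewrite mulrC; exact: (is_derive_comp (g := fun th => x + h * th) (hd (x + h * th)) d1).
  have cF : continuous (fun th => h * dq (x + h * th)).
    move=> th; apply: cvgM; first exact: cvg_cst.
    apply: (continuous_comp (f := fun th => x + h * th) (g := dq)); last exact: cd.
    by apply: cvgD; [exact: cvg_cst|apply: cvgM; [exact: cvg_cst|exact: cvg_id]].
  have [ig e] := I_ind_FTC ler01 (fun s _ _ => dF s) (fun s _ _ => cF s) (continuous_measurable_fun cF).
  rewrite mulr1 mulr0 addr0 in e; rewrite -e -I_Z.
    by apply: eq_I => th; rewrite mulrCA.
  apply: (igr_le _ (igrZ M (igr_ind 0 1))) => [|th]; first by meas3.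
  by rewrite normrM (ger0_norm (ind_ge0 _ _ _)) mulrC ler_wpM2r ?ind_ge0 //; exact: nb_sup hn _.
apply: nbZ; rewrite -[M]mul1r.
apply: (nb_minkowski (h := fun z => dq (z.2 + h * z.1))).
- exact: mfun_ind1.
- by move=> s; exact: ind_ge0.
- by rewrite int_ind // subr0.
- by meas.
- by move=> s _; exact: (nb_shift (h * s) hn).
exact: nb_ge0 hn.
Qed.

(** Increments of w are controlled by those of w0 up to O(h). With w0 the k-th derivative of v, the
    k-th derivative of Gnl(v) has this property: by the chain rule it involves w0 and lower
    derivatives, whose increments are already O(h). *)
Definition LipBy (w0 : R -> R -> R) w := locb w /\ forall a b, 0 < a ->
  exists2 L, 0 <= L & forall t h N, a <= t -> t <= b -> nb (fun x => w0 t (x + h) - w0 t x) N ->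
    nb (fun x => w t (x + h) - w t x) (L * N + L * `|h|).

Lemma LipBy_refl w : locb w -> LipBy w w.
Proof.
move=> lw; split => // a b a0; exists 1 => // t h N _ _ hN; rewrite !mul1r.
by apply: (nb_le hN); rewrite lerDl.
Qed.

Lemma regular_LipBy w0 : regular_class (LipBy w0).
Proof.
split.
- by move=> w [].
- move=> w w' lw lw' dw; split => // a b a0; have [M hM] := locb_nb b lw' a0.
  exists `|M| => // t h N ta tb hN; have t0 : 0 < t := lt_le_trans a0 ta.
  have M0 := nb_ge0 (hM t ta tb); have N0 := nb_ge0 hN.
  apply: (@nb_le _ _ (`|h| * M)); last by rewrite (ger0_norm M0) (mulrC `|h|) lerDr mulr_ge0.
  by have [_ c _] := lw'; exact: (nb_diff h (fun x => dw t x t0) (c t t0) (hM t ta tb)).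
- move=> f g [lf hf] [lg hg]; split; first exact: locbD.
  move=> a b a0; have [L L0 hL] := hf a b a0; have [L' L'0 hL'] := hg a b a0.
  exists (L + L') => [|t h N ta tb hN]; first exact: addr_ge0.
  have -> : (L + L') * N + (L + L') * `|h| = (L * N + L * `|h|) + (L' * N + L' * `|h|) by ring.
  under [fun x => _]funext do rewrite opprD addrACA.
  by apply: nbD; [exact: hL|exact: hL'].
- move=> f g [lf hf] [lg hg]; split; first exact: locbM.
  move=> a b a0; have [L L0 hL] := hf a b a0; have [L' L'0 hL'] := hg a b a0.
  have [Mf bf] := locb_nb b lf a0; have [Mg bg] := locb_nb b lg a0.
  exists (L * `|Mg| + L' * `|Mf|) => [|t h N ta tb hN].
    by apply: addr_ge0; apply: mulr_ge0.
  have gM := bg t ta tb; have fM := bf t ta tb.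
  rewrite (ger0_norm (nb_ge0 gM)) (ger0_norm (nb_ge0 fM)).
  have -> : (L * Mg + L' * Mf) * N + (L * Mg + L' * Mf) * `|h| =
    (L * N + L * `|h|) * Mg + Mf * (L' * N + L' * `|h|) by ring.
  rewrite (_ : (fun x => _) = fun x => (f t (x + h) - f t x) * g t (x + h) + f t x * (g t (x + h) - g t x)); last first.
    by apply/funext => x; ring.
  by apply: nbD; apply: nbM => //; [exact: hL|exact: nb_shift|exact: hL'].
move=> G C f hG G0 [lf hf]; split; first exact: locb_comp hG G0 lf.
move=> a b a0; have [L L0 hL] := hf a b a0.
exists (`|C| * L) => [|t h N ta tb hN]; first by rewrite mulr_ge0.
rewrite -!mulrA -mulrDr.
apply: (nb_dom (nbZ C (hL t h N ta tb hN))).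
  have mG := continuous_measurable_fun (lipschitz_continuous hG).
  have m := mfun2_1 t (locb_mfun lf); apply: measurable_funB; apply: (measurableT_comp mG) => //.
  by meas.
move=> x; apply: (le_trans (hG _ _)); rewrite normrM ler_wpM2r //; exact: ler_norm.
Qed.

Section Closure.
Variable X : (R -> R -> R) -> Prop.
Hypothesis hX : regular_class X.

Lemma KX_locb k w : KX X k w -> locb w.
Proof. by case: k => [|k] /=; [exact: rc_locb|case]. Qed.

Lemma KX_pred k w : KX X k.+1 w -> KX X k w.
Proof.
elim: k w => [|k IH] w /= [lw [w' [d h]]].
  by apply: (rc_deriv hX lw _ d); exact: (rc_locb hX h).
by split => //; exists w'; split => //; exact: IH.
Qed.

Lemma KX_add k f g : KX X k f -> KX X k g -> KX X k (fun t x => f t x + g t x).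
Proof.
elim: k f g => [|k IH] f g; first exact: rc_add.
move=> [lf [f' [df hf]]] [lg [g' [dg hg]]]; split; first exact: locbD.
exists (fun t x => f' t x + g' t x); split; last exact: IH.
by move=> t x t0; apply: is_deriveD; [exact: df|exact: dg].
Qed.

Lemma KX_mul k f g : KX X k f -> KX X k g -> KX X k (fun t x => f t x * g t x).
Proof.
elim: k f g => [|k IH] f g; first exact: rc_mul.
move=> hf hg; have hf' := KX_pred hf; have hg' := KX_pred hg.
move: hf hg => [lf [f' [df hf]]] [lg [g' [dg hg]]]; split; first exact: locbM.
exists (fun t x => f' t x * g t x + f t x * g' t x); split.
  move=> t x t0; have d1 := df t x t0; have d2 := dg t x t0.
  by apply: is_derive_eq; rewrite /GRing.scale /=; ring.
by apply: KX_add; exact: IH.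
Qed.

Lemma KX_scale k c f : KX X k f -> KX X k (fun t x => c * f t x).
Proof.
elim: k f => [|k IH] f.
  move=> h; apply: (rc_comp (G := fun z => c * z) hX (C := `|c|)) => //; last by rewrite mulr0.
  by move=> a b; rewrite -mulrBr normrM.
move=> [lf [f' [df hf]]]; split.
  apply: (locb_comp (G := fun z => c * z) (C := `|c|)) => //; last by rewrite mulr0.
  by move=> a b; rewrite -mulrBr normrM.
exists (fun t x => c * f' t x); split; last exact: IH.
by move=> t x t0; have d1 := df t x t0; apply: is_derive_eq; rewrite /GRing.scale /=; ring.
Qed.

(** The cosine is shifted by 1 so that both functions vanish at 0; only then does composition
    preserve square integrability. *)
Definition sinp u : R := sin (pi * u).
Definition cosp u : R := cos (pi * u) - 1.

Lemma sinp_lip a b : `|sinp b - sinp a| <= pi * `|b - a|.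
Proof.
apply: (le_trans (sin_lip _ _)); rewrite -mulrBr normrM ger0_norm //; exact: ltW (pi_gt0 R).
Qed.

Lemma cosp_lip a b : `|cosp b - cosp a| <= pi * `|b - a|.
Proof.
rewrite /cosp; have -> : cos (pi * b) - 1 - (cos (pi * a) - 1) = cos (pi * b) - cos (pi * a) by ring.
apply: (le_trans (cos_lip _ _)); rewrite -mulrBr normrM ger0_norm //; exact: ltW (pi_gt0 R).
Qed.

Lemma sinp0 : sinp 0 = 0. Proof. by rewrite /sinp mulr0 sin0. Qed.
Lemma cosp0 : cosp 0 = 0. Proof. by rewrite /cosp mulr0 cos0 subrr. Qed.

Lemma is_derive_sinp (q : R -> R) x d : is_derive x 1 q d ->
  is_derive x 1 (fun x => sinp (q x)) (pi * (cosp (q x) * d) + pi * d).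
Proof.
move=> h; have h1 : is_derive x 1 (fun x => pi * q x) (pi * d).
  by apply: is_derive_eq; rewrite /GRing.scale /= ?scaler0; ring.
have h2 := is_derive_comp (g := fun x => pi * q x) (is_derive_sin (pi * q x)) h1.
by apply: (is_derive_eq h2); rewrite /cosp; ring.
Qed.

Lemma is_derive_cosp (q : R -> R) x d : is_derive x 1 q d ->
  is_derive x 1 (fun x => cosp (q x)) (- pi * (sinp (q x) * d)).
Proof.
move=> h; have h1 : is_derive x 1 (fun x => pi * q x) (pi * d).
  by apply: is_derive_eq; rewrite /GRing.scale /= ?scaler0; ring.
have h2 := is_derive_comp (g := fun x => pi * q x) (is_derive_cos (pi * q x)) h1.
have h3 := is_deriveB h2 (is_derive_cst (1 : R) x 1).
by apply: (is_derive_eq h3); rewrite /sinp; ring.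
Qed.

Lemma KX_trig k v : KX X k v -> KX X k (fun t x => sinp (v t x)) /\ KX X k (fun t x => cosp (v t x)).
Proof.
elim: k v => [|k IH] v.
  by move=> h; split; [apply: (rc_comp hX sinp_lip sinp0)|apply: (rc_comp hX cosp_lip cosp0)].
move=> hv; have [hs hc] := IH _ (KX_pred hv); move: hv => [lv [v' [dv hv]]].
split; split.
- exact: locb_comp sinp_lip sinp0 lv.
- exists (fun t x => pi * (cosp (v t x) * v' t x) + pi * v' t x); split.
    by move=> t x t0; apply: is_derive_sinp; exact: dv.
  by apply: KX_add; [apply: KX_scale; exact: KX_mul|exact: KX_scale].
- exact: locb_comp cosp_lip cosp0 lv.
exists (fun t x => - pi * (sinp (v t x) * v' t x)); split.
  by move=> t x t0; apply: is_derive_cosp; exact: dv.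
by apply: KX_scale; exact: KX_mul.
Qed.

(** [bump] is 1 + cos (pi phi) and [odd_bump] is sin (pi phi), as [Gnl_trig] shows. Both are in L^2,
    and their derivatives are polynomials in the two, so all orders are treated together. *)
Definition bump x : R := 2 / (1 + x ^+ 2).
Definition odd_bump x : R := x * bump x.

Let den1 x : 1 + x ^+ 2 != 0 :> R. Proof. by rewrite gt_eqF // ltr_pwDl ?sqr_ge0. Qed.

Lemma is_derive_bump x : is_derive x 1 bump (- (odd_bump x * bump x)).
Proof.
have h : is_derive x 1 (fun x => 1 + x ^+ 2) (2 * x).
  by apply: is_derive_eq; rewrite /GRing.scale /=; ring.
have h2 := is_deriveV (den1 x).
rewrite /odd_bump /bump; apply: is_derive_eq; rewrite /GRing.scale /=.
by field; rewrite den1.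
Qed.

Lemma is_derive_odd_bump x : is_derive x 1 odd_bump (bump x * bump x - bump x).
Proof.
have h := is_derive_bump x; rewrite /odd_bump; apply: is_derive_eq; rewrite /GRing.scale /=.
by rewrite /odd_bump /bump; field; rewrite den1.
Qed.

Lemma locb_cst (q : R -> R) M : continuous q -> nb q M -> locb (fun _ => q).
Proof.
move=> cq hq; split => //; last by move=> a b _; exists M.
have mq := nb_mfun hq; apply: (measurableT_comp mq); meas.
Qed.

Lemma sq_P1_bound (q : R -> R) : mfun q -> (forall x, q x ^+ 2 <= 16 * P 1 x) -> nb q 4.
Proof.
move=> mq hq; split => //.
  move=> x; have := hq x; have := P_le x ltr01; rewrite mulr1.
  have p2 : (pi : R)^-1 <= 1 by rewrite invf_le1 ?pi_gt0 //; have := @pi_ge2 R; lra.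
  rewrite -(real_normK (num_real (q x))); have := normr_ge0 (q x); move: `|q x| (P _ _) => Q p.
  by move=> h1 h2 h3; rewrite leNgt; apply/negP => h4; nra.
apply: (@le_trans _ _ (\int[Rmu]_x (16 * P 1 x)%:E)%E).
  apply: ge0_le_integral.
  - exact: measurableT.
  - by move=> x _; rewrite lee_fin sqr_ge0.
  - by apply/measurable_EFinP; meas.
  - by have mP := @mfun_P R 1; apply/measurable_EFinP; meas.
  by move=> x _; rewrite lee_fin.
rewrite I_fin; last by apply: igrZ; exact: igr_P.
rewrite I_Z; last exact: igr_P.
by rewrite I_P // mulr1 lee_fin; lra.
Qed.

Lemma locb_bump : locb (fun _ => bump) /\ locb (fun _ => odd_bump).
Proof.
have p4 : (4 : R)^-1 <= pi^-1 by rewrite lef_pV2 ?posrE ?pi_gt0 //; have h := @pihalf_lt2 R; lra.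
have c1 : continuous bump.
  move=> x; apply: differentiable_continuous; apply/derivable1_diffP.
  by have [] := is_derive_bump x.
have c2 : continuous odd_bump.
  move=> x; apply: differentiable_continuous; apply/derivable1_diffP.
  by have [] := is_derive_odd_bump x.
have d1 x : 0 < 1 + x ^+ 2 :> R by rewrite ltr_pwDl ?sqr_ge0.
have Pl x : 4 / (1 + x ^+ 2) <= 16 * P 1 x.
  rewrite /P div1r expr1n mulrA ler_wpM2r ?invr_ge0 ?(ltW (d1 x)) //.
  by move: p4; move: (pi^-1) => p; lra.
split; apply: (@locb_cst _ 4) => //; apply: sq_P1_bound.
- exact: continuous_measurable_fun.
- move=> x; apply: le_trans (Pl x); rewrite /bump expr_div_n ler_pdivrMr ?exprn_gt0 //.
  rewrite expr2 mulrA divfK // [leRHS]mulrC; have := sqr_ge0 x; nra.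
- exact: continuous_measurable_fun.
move=> x; apply: le_trans (Pl x); rewrite /odd_bump /bump mulrA expr_div_n ler_pdivrMr ?exprn_gt0 //.
rewrite [_ ^+ 2 in leRHS]expr2 mulrA divfK //; have := sqr_ge0 x; nra.
Qed.

Lemma KX_bump k : KX X k (fun _ => bump) /\ KX X k (fun _ => odd_bump).
Proof.
have [l1 l2] := locb_bump.
elim: k => [|k [IH1 IH2]].
  have d1 : xderiv (fun _ => bump) (fun _ x => -1 * (odd_bump x * bump x)).
    by move=> t x _; rewrite mulN1r; exact: is_derive_bump.
  have d2 : xderiv (fun _ => odd_bump) (fun _ x => bump x * bump x + -1 * bump x).
    by move=> t x _; rewrite mulN1r; exact: is_derive_odd_bump.
  have sc f : locb f -> locb (fun t x => -1 * f t x).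
    move=> lf; apply: (locb_comp (G := fun z => -1 * z) (C := 1)) => //; last by rewrite mulr0.
    by move=> a b; rewrite -mulrBr normrM normrN normr1.
  split; [apply: (rc_deriv hX l1 _ d1)|apply: (rc_deriv hX l2 _ d2)].
    by apply: sc; exact: locbM.
  by apply: locbD; [exact: locbM|exact: sc].
split; split => //.
  exists (fun _ x => -1 * (odd_bump x * bump x)); split.
    by move=> t x _; rewrite mulN1r; exact: is_derive_bump.
  by apply: KX_scale; exact: (KX_mul IH2 IH1).
exists (fun _ x => bump x * bump x + -1 * bump x); split.
  by move=> t x _; rewrite mulN1r; exact: is_derive_odd_bump.
by apply: KX_add; [exact: (KX_mul IH1 IH1)|exact: KX_scale].
Qed.

(** Addition formula for sin (pi (v + phi)). It separates v from the coefficients in x, and each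
    factor is a function that decays in the L^2 sense, so the closure properties apply. *)
Lemma Gnl_trig x (v : R) : Gnl x v = v + pi^-1 * (cosp v * odd_bump x + (sinp v * bump x + -1 * sinp v)).
Proof.
have p0 : (pi : R) != 0 by rewrite gt_eqF ?pi_gt0.
have s0 : 0 < 1 + x ^+ 2 by rewrite ltr_pwDl ?sqr_ge0.
have hphi : pi * phi x = (atan x) *+ 2.
  by rewrite /phi -mulr_natl; move: p0; move: (pi : R) => q p0; field.
have hs : sin (atan x) = x / Num.sqrt (1 + x ^+ 2).
  rewrite -cos_atan -{2}(atanK x) /tan divfK // cos_atan invr_eq0.
  by rewrite gt_eqF // sqrtr_gt0.
have q2 : (Num.sqrt (1 + x ^+ 2))^-1 ^+ 2 = (1 + x ^+ 2)^-1 by rewrite exprVn sqr_sqrtr // ltW.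
have e1 : sin (pi * phi x) = odd_bump x.
  by rewrite hphi sin_mulr2n hs cos_atan /odd_bump /bump -q2 -mulr_natl; move: (Num.sqrt _)^-1 => z; ring.
have e2 : cos (pi * phi x) = bump x - 1.
  rewrite hphi cos_mulr2n cos_atan q2 -mulr_natl /bump; ring.
rewrite /Gnl /gnl mulrDr sinD e1 e2 /sinp /cosp.
by move: (pi^-1) (sin _) (cos _) (phi _) (odd_bump _) (bump _) => p s c f o u; ring.
Qed.

Lemma KX_Gnl k v : KX X k v -> KX X k (fun t x => Gnl x (v t x)).
Proof.
move=> hv; have [hs hc] := KX_trig hv; have [hb ho] := KX_bump k.
have -> : (fun t x => Gnl x (v t x)) = (fun t x => v t x + pi^-1 * (cosp (v t x) * odd_bump x +
    (sinp (v t x) * bump x + -1 * sinp (v t x)))).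
  by apply/funext => t; apply/funext => x; rewrite Gnl_trig.
apply: KX_add => //; apply: KX_scale; apply: KX_add; first exact: (KX_mul hc ho).
by apply: KX_add; [exact: (KX_mul hs hb)|exact: KX_scale].
Qed.

End Closure.

Lemma KX_mono (X Y : (R -> R -> R) -> Prop) k w : (forall f, X f -> Y f) -> KX X k w -> KX Y k w.
Proof.
move=> XY; elim: k w => [|k IH] w /=; first exact: XY.
by move=> [lw [w' [d h]]]; split => //; exists w'; split => //; exact: IH.
Qed.

(** This names the k-th derivative: [KX (fun f => f = wk) k w] says that wk is the k-th spatial
    derivative of w. *)
Lemma KX_witness (X : (R -> R -> R) -> Prop) k w : KX X k w -> exists2 wk, KX (fun f => f = wk) k w & X wk.
Proof.
elim: k w => [|k IH] w /=; first by exists w.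
move=> [lw [w' [d /IH [wk h1 h2]]]]; exists wk => //; split => //; by exists w'.
Qed.

End RegularityClasses.

(** * Bootstrap of spatial regularity through the Duhamel formula *)

Section Bootstrap.
Context {R : realType}.
Implicit Types (t s x y h a b : R) (M C L N : R) (w v g f : R -> R -> R) (k : nat).

Definition lnb w := mfun2 w /\ forall a b, 0 < a -> exists M, forall t, a <= t -> t <= b -> nb (w t) M.

Definition mild w g := forall a, 0 < a -> mild_from a w g.

Lemma locb_lnb w : locb w -> lnb w. Proof. by case. Qed.

Lemma dbound_nb a t g x M : mfun2 g -> (forall s, a < s -> s < t -> nb (g s) M) -> dbound a t g x M.
Proof. by move=> mg h; apply: dbound_sup => // s y s1 s2; exact: nb_sup (h s s1 s2) y. Qed.

Lemma qc_shift t (k : R -> R) x h : mfun k -> qc t k (x + h) = qc t (fun y => k (y + h)) x.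
Proof. by move=> mk; rewrite /qc pc_shift. Qed.

Lemma qcZ t c (k : R -> R) x : 0 < t -> pint k -> qc t (fun y => c * k y) x = c * qc t k x.
Proof. by move=> t0 pk; rewrite /qc pcZ // mulrCA. Qed.

Lemma duh_diffq a t g x M h c : mfun2 g -> (forall s, a < s -> s < t -> nb (g s) M) ->
  c * (duh a t g (x + h) - duh a t g x) = duh a t (fun s y => c * (g s (y + h) - g s y)) x.
Proof.
move=> mg hg; have mgh : mfun2 (fun s y => g s (y + h)) by apply: (mfun2_comp mg); meas.
have hgh s : a < s -> s < t -> nb (fun y => g s (y + h)) M by move=> s1 s2; exact: nb_shift (hg s s1 s2).
have -> : duh a t g (x + h) = duh a t (fun s y => g s (y + h)) x.
  by apply: eq_I => s; rewrite qc_shift //; exact: mfun2_1.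
have db := dbound_nb x mg hg; have db' := dbound_nb x mgh hgh.
have dbB : dbound a t (fun s y => g s (y + h) - g s y) x (M + M).
  by apply: dbound_nb => [|s s1 s2]; [exact: measurable_funB|apply: nbB; [exact: hgh|exact: hg]].
by rewrite (duhZ c _ dbB) ?(duhB mgh mg db' db) //; exact: measurable_funB.
Qed.

Lemma mild_diffq a t w g x M h c : a < t -> mild_from a w g -> mfun2 g -> nb (w a) M ->
  (forall s, a < s -> s < t -> nb (g s) M) ->
  c * (w t (x + h) - w t x) = qc (t - a) (fun y => c * (w a (y + h) - w a y)) x +
    duh a t (fun s y => c * (g s (y + h) - g s y)) x.
Proof.
move=> at0 hm mg ha hg; have ta : 0 < t - a by rewrite subr_gt0.
have mw := nb_mfun ha; have pw := nb_pint ha; have pwh := nb_pint (nb_shift h ha).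
rewrite -(duh_diffq x h c mg hg) (qcZ _ _ ta (pintB pwh pw)) qcB // -qc_shift // !hm // -mulrDr.
by rewrite opprD addrACA.
Qed.

Lemma nb_duh_diff r t g h E : r < t -> mfun2 g -> 0 <= E -> (exists M, forall s, r < s -> s < t -> nb (g s) M) ->
  (forall s, r < s -> s < t -> nb (fun x => g s (x + h) - g s x) E) ->
  nb (fun x => duh r t g (x + h) - duh r t g x) ((t - r) * E).
Proof.
move=> rt mg E0 [M hM] hE.
have -> : (fun x => duh r t g (x + h) - duh r t g x) = duh r t (fun s y => 1 * (g s (y + h) - g s y)).
  by apply/funext => x; rewrite -(duh_diffq x h 1 mg hM) mul1r.
apply: nb_duh => //; first exact: ltW.
  by apply: measurable_funM; [exact: measurable_cst|apply: measurable_funB => //; apply: (mfun2_comp mg); meas].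
by move=> s s1 s2; under [fun y => _]funext do rewrite mul1r; exact: hE.
Qed.

(* Restarting the equation shortly before [t], at distance proportional to
   [t - a], turns the smoothing of the kernel into a contraction for the
   weighted quantity [(t - a) * nb (increment)]; no logarithm is lost. *)
Lemma mild_lipschitz w g a b : lnb w -> lnb g -> mild w g ->
  (forall a b, 0 < a -> exists2 L, 0 <= L & forall t h N, a <= t -> t <= b ->
     nb (fun x => w t (x + h) - w t x) N -> nb (fun x => g t (x + h) - g t x) (L * N + L * `|h|)) ->
  0 < a -> exists2 M, 0 <= M & forall t h, a <= t -> t <= b -> nb (fun x => w t (x + h) - w t x) (M * `|h|).
Proof.
move=> [mw bw] [mg bg] hm hL b0; pose a1 := a / 2; have a10 : 0 < a1 by rewrite divr_gt0.
have [M0 hM0] := bw a1 b a10; have [Mg hMg] := bg a1 b a10; have [L L0 hLip] := hL a1 b a10.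
case: (leP a b) => ab; last first.
  by exists 0 => // t h h1 h2; have := lt_le_trans ab (le_trans h1 h2); rewrite ltxx.
have a1b : a1 < b by rewrite /a1; lra.
pose T := b - a1; have T0 : 0 < T by rewrite subr_gt0.
have MM0 : 0 <= M0 by exact: (nb_ge0 (hM0 b (ltW a1b) (lexx _))).
(* Two requirements fix [th]: th <= 1/2 keeps the restart time in the second half of (a1, t), where
   1 / (s - a1) is at most 2 / (t - a1), and 4 th L T <= 1 lets the Duhamel term contract by 1/2. *)
pose th := (2 + 4 * L * T)^-1; have LT : 0 <= 4 * L * T by rewrite !mulr_ge0 // ltW.
have d0 : 0 < 2 + 4 * L * T by rewrite ltr_pwDl.
have th0 : 0 < th by rewrite invr_gt0.
have th1 : th <= 2^-1 by rewrite lef_pV2 ?posrE // lerDl.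
have thL : 4 * (th * L * T) <= 1.
  have -> : 4 * (th * L * T) = (4 * L * T) / (2 + 4 * L * T) by rewrite /th; ring.
  by rewrite ler_pdivrMr // mul1r lerDr.
(* [A] is the fixed point of A -> (M0 / th + L T^2) + A / 2; [B] is the crude bound 2 M0 of an
   increment times the largest weight T. *)
pose A := 2 * (M0 / th + L * T ^+ 2); pose B := 2 * M0 * T.
have A0 : 0 <= A by rewrite mulr_ge0 // addr_ge0 ?divr_ge0 ?mulr_ge0 ?sqr_ge0 // ltW.
have B0 : 0 <= B by rewrite !mulr_ge0 // ltW.
have key h n : forall t, a1 < t -> t <= b ->
    nb (fun x => w t (x + h) - w t x) ((A * `|h| + B * 2^-1 ^+ n) / (t - a1)).
  elim: n => [|n IH] t at0 tb.
    have ta : 0 < t - a1 by rewrite subr_gt0.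
    have hw := hM0 t (ltW at0) tb.
    apply: (nb_le (nbB (nb_shift h hw) hw)); rewrite expr0 mulr1 ler_pdivlMr //.
    apply: (@le_trans _ _ B); last by rewrite lerDr mulr_ge0.
    have : t - a1 <= T by rewrite /T lerD2r.
    by rewrite /B; nra.
  have ta : 0 < t - a1 by rewrite subr_gt0.
  have taT : t - a1 <= T by rewrite /T lerD2r.
  pose dl := th * (t - a1); have dl0 : 0 < dl by rewrite mulr_gt0.
  have dl1 : dl <= 2^-1 * (t - a1) by rewrite ler_wpM2r // ltW.
  pose r := t - dl; have rt : r < t by rewrite /r; lra.
  have ra : a1 < r by rewrite /r; move: dl1 ta; clear; lra.
  have r0 : 0 < r by exact: lt_trans ra.
  have rb : r <= b by rewrite (le_trans (ltW rt)).
  pose E := A * `|h| + B * 2^-1 ^+ n.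
  have E0 : 0 <= E by rewrite addr_ge0 // mulr_ge0 // exprn_ge0.
  have gN s : r < s -> s < t -> nb (g s) Mg.
    by move=> s1 s2; apply: hMg; [exact: ltW (lt_trans ra s1)|exact: le_trans (ltW s2) tb].
  have gE s : r < s -> s < t -> nb (fun x => g s (x + h) - g s x) (L * (2 * E / (t - a1)) + L * `|h|).
    move=> s1 s2; have s3 := lt_trans ra s1; have s4 := le_trans (ltW s2) tb.
    apply: hLip; [exact: ltW|exact: s4|].
    apply: (nb_le (IH s s3 s4)); rewrite -/E ler_pdivrMr ?subr_gt0 // mulrAC ler_pdivlMr //.
    by rewrite (mulrC 2) -mulrA ler_wpM2l //; rewrite /r in s1; move: dl1 s1; clear; lra.
  have nb1 : nb (fun x => qc (t - r) (w r) (x + h) - qc (t - r) (w r) x) (`|h| / dl * M0).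
    have tr : t - r = dl by rewrite /r; ring.
    have hr := hM0 r (ltW ra) rb; have n1 := nb_pc_diff h dl0 hr; rewrite tr.
    apply: (nb_dom n1).
      have m := mfun_pc1 dl (nb_mfun hr); rewrite /qc.
      apply: measurable_funB; apply: measurable_funM (measurable_cst _) _; last exact: m.
      exact: (measurableT_comp m (measurable_shift h)).
    move=> x; rewrite /qc -mulrBr normrM ger0_norm ?expR_ge0 // ler_piMl // expRN_le1 //; exact: ltW.
  have nb2 := nb_duh_diff rt mg _ (ex_intro _ Mg gN) gE.
  have {}nb2 := nb2 (addr_ge0 (mulr_ge0 L0 (divr_ge0 (mulr_ge0 (ler0n _ 2) E0) (ltW ta))) (mulr_ge0 L0 (normr_ge0 _))).
  have -> : (fun x => w t (x + h) - w t x) = (fun x => (qc (t - r) (w r) (x + h) - qc (t - r) (w r) x) +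
    (duh r t g (x + h) - duh r t g x)) by apply/funext => x; rewrite !(hm r r0 t _ rt);
      move: (qc _ _ _) (qc _ _ _) (duh _ _ _ _) (duh _ _ _ _) => p p' d d'; ring.
  apply: (nb_le (nbD nb1 nb2)).
  rewrite ler_pdivlMr //.
  have -> : (`|h| / dl * M0 + (t - r) * (L * (2 * E / (t - a1)) + L * `|h|)) * (t - a1) =
    `|h| * (M0 / th + th * (L * ((t - a1) * (t - a1)))) + 2 * (th * L * (t - a1)) * E.
    by rewrite /r /dl; field; rewrite !gt_eqF.
  have e1 : th * (L * ((t - a1) * (t - a1))) <= L * T ^+ 2.
    rewrite -[leRHS]mul1r; apply: ler_pM; [exact: ltW| |by move: th1; clear; lra|].
      by rewrite mulr_ge0 // mulr_ge0 // ltW.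
    by rewrite ler_wpM2l // expr2; apply: ler_pM => //; exact: ltW.
  have e2 : 2 * (th * L * (t - a1)) <= 2^-1.
    have : th * L * (t - a1) <= th * L * T by rewrite ler_wpM2l // mulr_ge0 // ltW.
    by move: thL; clear; lra.
  have -> : A * `|h| + B * 2^-1 ^+ n.+1 = `|h| * (M0 / th + L * T ^+ 2) + 2^-1 * E.
    by rewrite /E exprSr /A; move: (M0 / th) => q; field.
  apply: lerD; first by rewrite ler_wpM2l // lerD2l.
  by rewrite ler_wpM2r.
have aa1 : 0 < a - a1 by rewrite /a1; lra.
exists (A / (a - a1)) => [|t h ta tb]; first by rewrite divr_ge0 // ltW.
have a1t : a1 < t by rewrite (lt_le_trans _ ta) // -subr_gt0.
have ta0 : 0 < t - a1 by rewrite subr_gt0.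
apply: nb_eps => e e0.
have c0 : (fun n => B * 2^-1 ^+ n) @ \oo --> (0 : R).
  rewrite -[X in _ --> X](mulr0 B); apply: cvgM; first exact: cvg_cst.
  by apply: cvg_expr; rewrite ger0_norm // invf_lt1 // ltr1n.
have ee : 0 < e * (t - a1) by rewrite mulr_gt0.
have : \forall n \near \oo, B * 2^-1 ^+ n < e * (t - a1) by apply: (cvgr_lt _ c0).
case=> n _ /(_ n (leqnn n)) /= hn; apply: (nb_le (key h n t a1t tb)).
rewrite mulrDl; apply: lerD; last by rewrite ler_pdivrMr // ltW.
rewrite mulrAC ler_wpM2r // ler_wpM2l // lef_pV2 ?posrE // lerD2r //.
Qed.

Lemma continuous_seq (q : R -> R) : (forall x (u : nat -> R), u @ \oo --> x -> q (u n) @[n --> \oo] --> q x) -> continuous q.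
Proof.
by move=> h x; apply/continuous_withinNx; apply/cvgr_dnbhsP => u [_ cu]; exact: h.
Qed.

Lemma cvg_seq (q : R -> R) x (u : nat -> R) : continuous q -> u @ \oo --> x -> q (u n) @[n --> \oo] --> q x.
Proof. by move=> cq cu; exact: (cvg_comp u q cu (cq x)). Qed.

Lemma is_derive_continuous (q dq : R -> R) : (forall x, is_derive x 1 q (dq x)) -> continuous q.
Proof.
by move=> hd x; apply: differentiable_continuous; apply/derivable1_diffP; have [] := hd x.
Qed.

Lemma continuous_pc t (k : R -> R) M : 0 < t -> mfun k -> (forall y, `|k y| <= M) -> continuous (pc t k).
Proof.
move=> t0 mk bk; apply: is_derive_continuous => x; exact: (is_derive_pc x t0 mk bk).
Qed.

Lemma continuous_qc t (k : R -> R) M : 0 < t -> mfun k -> (forall y, `|k y| <= M) -> continuous (qc t k).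
Proof.
move=> t0 mk bk x; rewrite /qc; apply: cvgM; first exact: cvg_cst.
exact: (continuous_pc t0 mk bk).
Qed.

Lemma mild_continuous w g t : lnb w -> lnb g -> mild w g -> 0 < t -> continuous (w t).
Proof.
move=> [mw bw] [mg bg] hm t0; pose a := t / 2; have a0 : 0 < a by rewrite divr_gt0.
have at0 : a < t by rewrite /a; lra.
have [M hM] := bw a t a0; have [Mg hMg] := bg a t a0.
have ha := hM a (lexx _) (ltW at0); have ta : 0 < t - a by rewrite subr_gt0.
have -> : w t = (fun x => qc (t - a) (w a) x + duh a t g x) by apply/funext => x; exact: hm.
have cq := continuous_qc ta (nb_mfun ha) (nb_sup ha).
apply: continuous_seq => x u cu; apply: cvgD; first exact: cvg_seq.
apply: (I_cvg (g := fun s => Mg * ind a t s)).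
- by move=> n; apply: mfun_duh_int => //; meas.
- by apply: igrZ; exact: igr_ind.
- move=> n s; apply: duh_int_le; apply: dbound_nb => // s' s1 s2.
  by apply: hMg; exact: ltW.
move=> s; rewrite /ind; case: ifP => [/andP[s1 s2]|_]; last first.
  by under eq_fun do rewrite mul0r; rewrite mul0r; exact: cvg_cst.
apply: cvgM; first exact: cvg_cst.
have hs := hMg s (ltW s1) (ltW s2); have ts : 0 < t - s by rewrite subr_gt0.
exact: (cvg_seq (continuous_qc ts (nb_mfun hs) (nb_sup hs))).
Qed.

Definition pcd t (k : R -> R) x : R := \I_y (dP t y * k (x - y)).

Lemma mfun_pcd d (T : measurableType d) g (a s b : T -> R) : mfun2 g -> mfun a -> mfun s -> mfun b ->
  mfun (fun z => pcd (a z) (g (s z)) (b z)).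
Proof.
move=> mg ma ms mb; rewrite /pcd.
apply: (measurable_I (F := fun z => dP (a z.1) z.2 * g (s z.1) (b z.1 - z.2))).
apply: measurable_funM; last by apply: (mfun2_comp mg); meas.
by rewrite /dP; meas.
Qed.

Lemma is_derive_qc t (k : R -> R) M x : 0 < t -> mfun k -> (forall y, `|k y| <= M) ->
  is_derive x 1 (qc t k) (expR (- t) * pcd t k x).
Proof.
move=> t0 mk bk; have h := is_derive_pc x t0 mk bk; rewrite /qc; apply: is_derive_eq.
by rewrite /GRing.scale /= -/(pcd t k x); ring.
Qed.

Lemma igr_dP t : 0 < t -> igr (dP t).
Proof.
move=> t0; apply: (igr_le (g := fun y => t^-1 * P t y)); first exact: mfun_dP.
  by apply: igrZ; exact: igr_P.
move=> y; rewrite dP_le //; apply: ler_wpM2r; first by pos.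
rewrite ler_pdivrMr ?den_gt0 // ler_pdivlMl //.
by rewrite -(real_normK (num_real y)); move: `|y| => Y; have := sqr_ge0 (Y - t); nra.
Qed.

Lemma continuous_pcd t (k : R -> R) M : 0 < t -> continuous k -> (forall y, `|k y| <= M) -> continuous (pcd t k).
Proof.
move=> t0 ck bk; have mk := continuous_measurable_fun ck; have md := @mfun_dP R t.
apply: continuous_seq => x u cu.
apply: (I_cvg (g := fun y => M * `|dP t y|)).
- by move=> n; meas.
- by apply: igrZ; apply: igr_abs; exact: igr_dP.
- by move=> n y; rewrite normrM mulrC ler_wpM2r.
move=> y; apply: cvgM; first exact: cvg_cst.
apply: (cvg_seq (u := fun n => u n - y) ck).
by apply: cvgB; [exact: cu|exact: cvg_cst].
Qed.

(** The spatial derivative as a limit along one fixed sequence of steps, which makes it jointly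
    measurable in time and space; the value 0 for t <= 0 is a convention. *)
Definition xdiff w t x : R := if 0 < t then limn (fun n => (hstep n)^-1 * (w t (x + hstep n) - w t x)) else 0.

Lemma xdiffE w t x d : 0 < t -> is_derive x 1 (w t) d -> xdiff w t x = d.
Proof.
move=> t0 h; rewrite /xdiff t0; apply: (cvg_lim _ (derive_seq h hstep_neq0 hstep_cvg)).
exact: Rhausdorff.
Qed.

(** Difference quotients are passed from the kernel to k. For Lipschitz k the derivative of its
    extension is thus bounded without the factor 1 / t, which would not be integrable in the Duhamel
    formula. *)
Lemma sup_pcd t (k : R -> R) M L x : 0 < t -> mfun k -> (forall y, `|k y| <= M) ->
  (forall h y, `|k (y + h) - k y| <= L * `|h|) -> `|pcd t k x| <= L.
Proof.
move=> t0 mk bk lk; have h := derive_seq (is_derive_pc x t0 mk bk) hstep_neq0 hstep_cvg.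
apply: (ler_cvg_to (cvg_norm h) (cvg_cst L)); apply: nearW => n.
have pk := pint_bounded mk bk.
rewrite normrM normfV ler_pdivrMl ?normr_gt0 ?hstep_neq0 // mulrC pc_shift //.
rewrite -pcB //; last by apply: (@pint_bounded _ _ M) => //; meas.
by apply: pc_sup => //; meas.
Qed.

(** For a Lipschitz source the integrand of the Duhamel formula has difference quotients bounded by
    L, so dominated convergence allows differentiation under the time integral; it also gives
    continuity of the derivative. *)
Lemma mild_differentiable w g : lnb w -> lnb g -> mild w g ->
  (forall a b, 0 < a -> exists2 M, 0 <= M & forall t h, a <= t -> t <= b ->
     nb (fun x => w t (x + h) - w t x) (M * `|h|)) ->
  (forall a b, 0 < a -> exists2 M, 0 <= M & forall t h, a <= t -> t <= b ->
     nb (fun x => g t (x + h) - g t x) (M * `|h|)) ->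
  exists2 w', xderiv w w' & locb w'.
Proof.
move=> [mw bw] [mg bg] hm Lw Lg.
have cont q L : (forall h, nb (fun x => q (x + h) - q x) (L * `|h|)) -> continuous q.
  move=> h; apply: (@lipschitz_continuous _ _ L) => a b.
  by have := nb_sup (h (b - a)) a; rewrite (addrC a) subrK.
have main t : 0 < t -> exists d : R -> R, (forall x, is_derive x 1 (w t) (d x)) /\ continuous d.
  move=> t0; pose a := t / 2; have a0 : 0 < a by rewrite divr_gt0.
  have at0 : a < t by rewrite /a; lra.
  have [M hM] := bw a t a0; have [Mg hMg] := bg a t a0; have [L _ hL] := Lg a t a0.
  have [L' _ hL'] := Lw a t a0.
  have ha := hM a (lexx _) (ltW at0); have ta : 0 < t - a by rewrite subr_gt0.
  have wE : w t = (fun x => qc (t - a) (w a) x + duh a t g x) by apply/funext => x; exact: hm.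
  pose D s x := ind a t s * (expR (- (t - s)) * pcd (t - s) (g s) x).
  have gsup s y : a < s -> s < t -> `|g s y| <= Mg by move=> s1 s2; apply: nb_sup (hMg s (ltW s1) (ltW s2)) y.
  have glip s h y : a < s -> s < t -> `|g s (y + h) - g s y| <= L * `|h|.
    by move=> s1 s2; apply: nb_sup (hL s h (ltW s1) (ltW s2)) y.
  have Dle s x : `|D s x| <= L * ind a t s.
    rewrite /D /ind; case: ifP => [/andP[s1 s2]|_]; last by rewrite !mul0r normr0 mulr0.
    have ts : 0 < t - s by rewrite subr_gt0.
    rewrite mul1r mulr1 normrM ger0_norm ?expR_ge0 //.
    apply: (@le_trans _ _ `|pcd (t - s) (g s) x|); first by rewrite ler_piMl // expRN_le1 // ltW.
    apply: (@sup_pcd _ _ Mg L) => // [|y|h y]; [exact: mfun2_1|exact: gsup|exact: glip].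
  have mD x : mfun (D ^~ x).
    apply: measurable_funM; first exact: mfun_ind1.
    apply: measurable_funM; first by meas.
    by apply: (mfun_pcd (g := g)) => //; meas.
  exists (fun x => expR (- (t - a)) * pcd (t - a) (w a) x + \I_s D s x); split.
    move=> x; apply: is_derive_cvg; apply/cvgr_dnbhsP => u [u0 cu].
    have -> : (fun n => (u n)^-1 * (w t (x + u n) - w t x)) = (fun n =>
      (u n)^-1 * (qc (t - a) (w a) (x + u n) - qc (t - a) (w a) x) +
      \I_s (ind a t s * ((u n)^-1 * (qc (t - s) (g s) (x + u n) - qc (t - s) (g s) x)))).
      apply/funext => n; rewrite wE.
      have igd y : igr (fun s => ind a t s * qc (t - s) (g s) y).
        by apply: (igr_duh (C := Mg) mg); apply: dbound_nb => // s s1 s2; apply: hMg; exact: ltW.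
      rewrite (_ : (fun s => ind a t s * ((u n)^-1 * (qc (t - s) (g s) (x + u n) - qc (t - s) (g s) x))) =
        fun s => (u n)^-1 * (ind a t s * qc (t - s) (g s) (x + u n) - ind a t s * qc (t - s) (g s) x)); last first.
        by apply/funext => s; ring.
      rewrite I_Z; last exact: igrB.
      by rewrite I_B // -mulrDr opprD addrACA.
    apply: cvgD; first exact: (derive_seq (is_derive_qc x ta (nb_mfun ha) (nb_sup ha)) u0 cu).
    apply: (I_cvg (g := fun s => L * ind a t s)).
    - move=> n; apply: measurable_funM; first exact: mfun_ind1.
      apply: measurable_funM; first exact: measurable_cst.
      by apply: measurable_funB; apply: mfun_qc => //; meas.
    - by apply: igrZ; exact: igr_ind.
    - move=> n s; rewrite /ind; case: ifP => [/andP[s1 s2]|_]; last by rewrite !mul0r normr0 mulr0.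
      have ts : 0 < t - s by rewrite subr_gt0.
      have mgs := mfun2_1 s mg; have pg := nb_pint (hMg s (ltW s1) (ltW s2)).
      have pgh := nb_pint (nb_shift (u n) (hMg s (ltW s1) (ltW s2))).
      rewrite mul1r mulr1 normrM normfV ler_pdivrMl ?normr_gt0 // qc_shift // -qcB // /qc normrM ger0_norm ?expR_ge0 //.
      apply: (@le_trans _ _ `|pc (t - s) (fun y => g s (y + u n) - g s y) x|).
        by rewrite ler_piMl // expRN_le1 // ltW.
      rewrite mulrC; apply: pc_sup => // [|y]; [by meas|exact: glip].
    move=> s; rewrite /D /ind; case: ifP => [/andP[s1 s2]|_]; last first.
      by under eq_fun do rewrite mul0r; rewrite mul0r; exact: cvg_cst.
    have ts : 0 < t - s by rewrite subr_gt0.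
    apply: cvgM; first exact: cvg_cst.
    by apply: (derive_seq (is_derive_qc x ts (mfun2_1 s mg) _) u0 cu) => y; exact: gsup.
  have ca : continuous (w a) := cont _ _ (fun h => hL' a h (lexx _) (ltW at0)).
  apply: continuous_seq => x u cu; apply: cvgD.
    apply: cvgM; first exact: cvg_cst.
    exact: (cvg_seq (continuous_pcd ta ca (nb_sup ha)) cu).
  apply: (I_cvg (g := fun s => L * ind a t s)) => // [|s]; first by apply: igrZ; exact: igr_ind.
  rewrite /D /ind; case: ifP => [/andP[s1 s2]|_]; last first.
    by under eq_fun do rewrite mul0r; rewrite mul0r; exact: cvg_cst.
  have ts : 0 < t - s by rewrite subr_gt0.
  apply: cvgM; first exact: cvg_cst.
  apply: cvgM; first exact: cvg_cst.
  apply: (cvg_seq _ cu); apply: (continuous_pcd ts (cont _ _ (fun h => hL s h (ltW s1) (ltW s2)))) => y.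
  exact: gsup.
have xd : xderiv w (xdiff w).
  by move=> t x t0; have [d [hd _]] := main t t0; rewrite (xdiffE t0 (hd x)); exact: hd.
exists (xdiff w) => //; split.
- pose q n (z : R * R) : R := if 0 < z.1 then (hstep n)^-1 * (w z.1 (z.2 + hstep n) - w z.1 z.2) else 0.
  apply: (measurable_fun_cvg (h := q)) => [n|z _].
    apply: measurable_fun_ifT; [by apply: measurable_fun_ltr; meas| |exact: measurable_cst].
    apply: measurable_funM; first exact: measurable_cst.
    by apply: measurable_funB; apply: (mfun2_comp mw); meas.
  rewrite /q; case: (ltP 0 z.1) => z0; last by rewrite /xdiff ltNge z0 /=; exact: cvg_cst.
  exact: (derive_seq (xd z.1 z.2 z0) hstep_neq0 hstep_cvg).
- move=> t t0; have [d [hd cd]] := main t t0.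
  by rewrite (_ : xdiff w t = d) //; apply/funext => x; exact: xdiffE.
move=> a b a0; have [M M0 hM] := Lw a b a0; exists M => t ta tb; have t0 : 0 < t := lt_le_trans a0 ta.
apply: (nb_lim (g_ := fun n x => (hstep n)^-1 * (w t (x + hstep n) - w t x))) => [n|x].
  have := nbZ (hstep n)^-1 (hM t (hstep n) ta tb).
  by rewrite normfV mulrCA mulVf ?mulr1 // normr_eq0 hstep_neq0.
exact: (derive_seq (xd t x t0) hstep_neq0 hstep_cvg).
Qed.

(** The equation is linear in (w, g) and commutes with translations, so difference quotients satisfy
    it exactly; the derivatives then satisfy it in the limit. *)
Lemma mild_deriv w g w' g' : locb w -> locb g -> locb w' -> locb g' -> xderiv w w' -> xderiv g g' ->
  mild w g -> mild w' g'.
Proof.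
move=> lw lg lw' lg' dw dg hm a a0 t x at0.
have [M hM] := locb_nb t lw a0; have [Mg hMg] := locb_nb t lg a0.
have [M' hM'] := locb_nb t lw' a0; have [Mg' hMg'] := locb_nb t lg' a0.
have t0 : 0 < t := lt_trans a0 at0; have ta : 0 < t - a by rewrite subr_gt0.
have mg := locb_mfun lg; have mwa := mfun2_1 a (locb_mfun lw).
pose N := Num.max M Mg.
have wN : nb (w a) N by apply: (nb_le (hM a (lexx _) (ltW at0))); rewrite le_max lexx.
have gN s : a < s -> s < t -> nb (g s) N.
  by move=> s1 s2; apply: (nb_le (hMg s (ltW s1) (ltW s2))); rewrite le_max lexx orbT.
have lip q dq C h y : (forall x, is_derive x 1 q (dq x)) -> nb dq C -> h != 0 -> `|h^-1 * (q (y + h) - q y)| <= C.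
  move=> hd hn h0; rewrite normrM normfV ler_pdivrMl ?normr_gt0 // mulrC.
  have := lipschitz_of_derive y (y + h) hd (nb_sup hn); rewrite (_ : y + h - y = h) //; ring.
have c1 := derive_seq (dw t x t0) hstep_neq0 hstep_cvg.
have c2 : (hstep n)^-1 * (w t (x + hstep n) - w t x) @[n --> \oo] --> qc (t - a) (w' a) x + duh a t g' x.
  have -> : (fun n => (hstep n)^-1 * (w t (x + hstep n) - w t x)) = (fun n =>
    qc (t - a) (fun y => (hstep n)^-1 * (w a (y + hstep n) - w a y)) x +
    duh a t (fun s y => (hstep n)^-1 * (g s (y + hstep n) - g s y)) x).
    by apply/funext => n; exact: (mild_diffq x (hstep n) _ at0 (hm a a0) mg wN gN).
  apply: cvgD.
    apply: cvgM; first exact: cvg_cst.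
    apply: (pc_cvg (k := fun=> M')) => //.
    - by move=> n; meas.
    - exact: pint_cst.
    - move=> n y; apply: (lip _ (w' a)); [by move=> z; exact: dw| |exact: hstep_neq0].
      exact: hM' (lexx _) (ltW at0).
    by move=> y; exact: (derive_seq (dw a y a0) hstep_neq0 hstep_cvg).
  apply: (duh_cvg (k := fun _ _ => Mg') (C := `|Mg'|)).
  - move=> n; apply: measurable_funM; first exact: measurable_cst.
    by apply: measurable_funB => //; apply: (mfun2_comp mg); meas.
  - by apply: dbound_sup => [|s y _ _]; [exact: measurable_cst|].
  - move=> n s y s1 s2; apply: (lip _ (g' s)); [by move=> z; apply: dg; exact: lt_trans s1| |exact: hstep_neq0].
    exact: hMg' (ltW s1) (ltW s2).
  by move=> s y s1 s2; exact: (derive_seq (dg s y (lt_trans a0 s1)) hstep_neq0 hstep_cvg).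
exact: (cvg_unique _ c1 c2).
Qed.

Lemma mild_tower k w g wk gk : KX (fun f => f = wk) k w -> KX (fun f => f = gk) k g -> locb wk -> locb gk ->
  mild w g -> mild wk gk.
Proof.
move=> + + lwk lgk; elim: k w g => [|k IH] w g /=; first by move=> -> ->.
move=> [lw [w' [dw hw]]] [lg [g' [dg hg]]] hm.
have lw' : locb w' by apply: (KX_locb regular_locb (k := k)); apply: KX_mono hw => f ->.
have lg' : locb g' by apply: (KX_locb regular_locb (k := k)); apply: KX_mono hg => f ->.
exact: (IH w' g' hw hg (mild_deriv lw lg lw' lg' dw dg hm)).
Qed.

Lemma KX_extend k w wk w' : KX (fun f => f = wk) k w -> locb wk -> xderiv wk w' -> locb w' -> KX locb k.+1 w.
Proof.
move=> + lwk dw lw'; elim: k w => [|k IH] w.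
  by move=> /= ->; split => //; exists w'.
move=> [lw [w1 [d1 h1]]]; split => //; exists w1; split => //; exact: IH.
Qed.

(** One derivative per round: the k-th derivative solves the mild equation with the k-th derivative
    of the source, whose increments [LipBy] controls by its own. It is therefore Lipschitz, so is
    its source, and it is differentiable. *)
Theorem mild_smooth v : lnb v -> mild v (fun t x => Gnl x (v t x)) -> forall k, KX locb k v.
Proof.
move=> lv hm; have [mv bv] := lv.
pose G t x := Gnl x (v t x).
have lG : lnb G.
  split; first exact: mfun2_Gnl.
  move=> a b a0; have [M hM] := bv a b a0; exists (2 * M) => t ta tb.
  rewrite -(ger0_norm (ler0n R 2)); apply: (nb_dom (nbZ 2 (hM t ta tb))).
    by apply: mfun_Gnl; [exact: measurable_id|exact: mfun2_1].
  by move=> x; rewrite normrM (ger0_norm (ler0n _ 2)); exact: Gnl_le.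
have lbv : locb v by split => // t t0; exact: (mild_continuous lv lG hm).
elim=> [|k IH]; first exact: lbv.
have [wk hk lwk] := KX_witness IH.
have hL : KX (LipBy wk) k v by apply: KX_mono hk => f ->; exact: LipBy_refl.
have hGL := KX_Gnl (regular_LipBy wk) hL.
have [gk hgk [lgk lip]] := KX_witness hGL.
have mk : mild wk gk := mild_tower hk hgk lwk lgk hm.
have Lw a b : 0 < a -> exists2 M, 0 <= M & forall t h, a <= t -> t <= b ->
    nb (fun x => wk t (x + h) - wk t x) (M * `|h|).
  by move=> a0; exact: (mild_lipschitz b (locb_lnb lwk) (locb_lnb lgk) mk lip a0).
have Lg a b : 0 < a -> exists2 M, 0 <= M & forall t h, a <= t -> t <= b ->
    nb (fun x => gk t (x + h) - gk t x) (M * `|h|).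
  move=> a0; have [M M0 hM] := Lw a b a0; have [L L0 hL'] := lip a b a0.
  exists (L * M + L) => [|t h ta tb]; first by rewrite addr_ge0 // mulr_ge0.
  by rewrite mulrDl -mulrA; apply: hL' => //; exact: hM.
have [w' dw lw'] := mild_differentiable (locb_lnb lwk) (locb_lnb lgk) mk Lw Lg.
exact: (KX_extend hk lwk dw lw').
Qed.

End Bootstrap.

(** * The half-Laplacian and smoothness in time *)
Section HalfLaplacian.
Context {R : realType}.
Implicit Types (t s x y h a b r : R) (M C L N : R) (w v g f : R -> R -> R) (q : R -> R) (k m : nat).

Definition Dh h m q : R -> R := iter m (fun q x => q (x + h) - q x) q.

Fixpoint sm m q M : Prop := continuous q /\
  (if m is m'.+1 then exists q', (forall x, is_derive x 1 q (q' x)) /\ sm m' q' M else nb q M).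

Lemma sm_diff m q M h : sm m.+1 q M -> sm m (fun x => q (x + h) - q x) (`|h| * M).
Proof.
have csh (p : R -> R) : continuous p -> continuous (fun x => p (x + h) - p x).
  move=> cp x; apply: cvgB; last exact: cp.
  by apply: (continuous_comp (f := fun x => x + h) (g := p)); [apply: cvgD; [exact: cvg_id|exact: cvg_cst]|exact: cp].
elim: m q => [|m IH] q [cq [q' [dq hq]]].
  by split; [exact: csh|exact: (nb_diff h dq hq.1 hq.2)].
split; first exact: csh.
exists (fun x => q' (x + h) - q' x); split; last exact: IH.
move=> x; have d1 := dq (x + h); have d2 := dq x.
have d3 : is_derive x 1 (fun x => x + h) 1 by apply: is_derive_eq; rewrite addr0.
have d4 := is_derive_comp (g := fun x => x + h) d1 d3; rewrite mulr1 in d4.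
exact: is_deriveB d4 d2.
Qed.

Lemma nb_Dh m q M h : sm m q M -> nb (Dh h m q) (`|h| ^+ m * M).
Proof.
elim: m q M => [|m IH] q M; first by case=> _; rewrite expr0 mul1r.
by move=> /(sm_diff h) /IH; rewrite mulrA -exprSr /Dh iterSr.
Qed.

Lemma KX_sm m w a b : KX locb m w -> 0 < a -> exists M, forall t, a <= t -> t <= b -> sm m (w t) M.
Proof.
move=> + a0; elim: m w => [|m IH] w /=.
  move=> [_ c h]; have [M hM] := h a b a0; exists M => t ta tb; split; last exact: hM.
  by apply: c; exact: lt_le_trans ta.
move=> [[_ c _] [w' [d /IH[M hM]]]]; exists M => t ta tb; have t0 : 0 < t := lt_le_trans a0 ta.
by split; [exact: c|exists (w' t); split; [move=> x; exact: d|exact: hM]].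
Qed.

Definition d2 y q x : R := 2 * q x - q (x + y) - q (x - y).

Lemma nb_d2 q M y : sm 2 q M -> nb (d2 y q) (y ^+ 2 * M).
Proof.
move=> h; have := nb_Dh y h; rewrite normK2 => hn.
have := nbN (nb_shift (- y) hn); congr (nb _ _); apply/funext => x.
by rewrite /Dh /d2 /= subrK; ring.
Qed.

Lemma nb_d2_triv q M y : nb q M -> nb (d2 y q) (4 * M).
Proof.
move=> h; have -> : 4 * M = `|2| * M + M + M by rewrite ger0_norm //; ring.
by apply: nbB; [apply: nbB; [exact: nbZ|exact: nb_shift]|exact: (nb_shift (- y) h)].
Qed.

(* what makes the singular integral [Lam q] converge *)
Definition lamb q M0 M2 := nb q M0 /\ forall y, nb (d2 y q) (y ^+ 2 * M2).

Lemma sm_lamb q M0 M2 : nb q M0 -> sm 2 q M2 -> lamb q M0 M2.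
Proof. by move=> h h2; split => // y; exact: nb_d2. Qed.

(** The half-Laplacian with the singular integral symmetrised in y: the second difference cancels
    the singularity, so no principal value is needed for smooth q. *)
Definition Lam q x : R := 2^-1 * \I_y (pi^-1 * y ^- 2 * d2 y q x).

Lemma mfun_d2 d (T : measurableType d) (w : R -> R -> R) (s a b : T -> R) : mfun2 w ->
  mfun s -> mfun a -> mfun b -> mfun (fun z => d2 (a z) (w (s z)) (b z)).
Proof.
move=> mw ms ma mb; rewrite /d2.
apply: measurable_funB; [apply: measurable_funB; [apply: measurable_funM|]|];
  try exact: measurable_cst; by apply: (mfun2_comp mw); meas.
Qed.

Lemma mfun2_cst q : mfun q -> mfun2 (fun _ : R => q).
Proof. by move=> mq; apply: (measurableT_comp mq); meas. Qed.

Lemma mfun_Lam d (T : measurableType d) (w : R -> R -> R) (s b : T -> R) : mfun2 w ->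
  mfun s -> mfun b -> mfun (fun z => Lam (w (s z)) (b z)).
Proof.
move=> mw ms mb; rewrite /Lam; apply: measurable_funM; first exact: measurable_cst.
apply: (measurable_I (F := fun z => pi^-1 * z.2 ^- 2 * d2 z.2 (w (s z.1)) (b z.1))).
by apply: measurable_funM; [meas|apply: (mfun_d2 mw); meas].
Qed.

(** The singular kernel is rewritten as a Poisson kernel of mass 1 times a function with bounded
    [nb] norm, so that [nb_minkowski] applies. The scale r is free. *)
Lemma LamE r q x y : 0 < r ->
  pi^-1 * y ^- 2 * d2 y q x = P r y * (r^-1 * (r ^+ 2 + y ^+ 2) * y ^- 2 * d2 y q x).
Proof.
move=> r0; rewrite !mulrA; congr (_ * _).
have [->|y0] := eqVneq y 0; first by rewrite expr0n /= invr0 !mulr0.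
rewrite /P; move: (pi^-1) => p; field.
by rewrite y0 !gt_eqF // den_gt0.
Qed.


Lemma nb_weight r q M0 M2 y : 0 < r -> lamb q M0 M2 ->
  nb (fun x => r^-1 * (r ^+ 2 + y ^+ 2) * y ^- 2 * d2 y q x) (r * `|M2| + 4 * M0 / r).
Proof.
move=> r0 [h0 h2]; have M0' := nb_ge0 h0.
have [->|y0] := eqVneq y 0.
  rewrite expr0n /= invr0 mulr0; under [fun x => _]funext do rewrite mul0r.
  by apply: nb0; rewrite addr_ge0 // ?mulr_ge0 // ?invr_ge0 ltW.
have y2 : 0 < y ^+ 2 by rewrite lt_neqAle sqr_ge0 andbT eq_sym sqrf_eq0.
have -> : (fun x => r^-1 * (r ^+ 2 + y ^+ 2) * y ^- 2 * d2 y q x) =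
    (fun x => r / y ^+ 2 * d2 y q x + r^-1 * d2 y q x).
  by apply/funext => x; rewrite -mulrDl; congr (_ * _); field; rewrite y0 gt_eqF.
have e1 : `|r / y ^+ 2| * (y ^+ 2 * M2) <= r * `|M2|.
  rewrite ger0_norm; last by rewrite divr_ge0 ?sqr_ge0 // ltW.
  rewrite mulrA divfK ?gt_eqF // ler_wpM2l //; [exact: ltW|exact: ler_norm].
have e2 : `|r^-1| * (4 * M0) = 4 * M0 / r by rewrite ger0_norm ?invr_ge0 1?mulrC // ltW.
apply: (nb_le (nbD (nbZ (r / y ^+ 2) (h2 y)) (nbZ r^-1 (nb_d2_triv y h0)))).
by rewrite e2 lerD2r.
Qed.

Lemma igr_Lam q M0 M2 x : lamb q M0 M2 -> igr (fun y => pi^-1 * y ^- 2 * d2 y q x).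
Proof.
move=> h; have mq := nb_mfun h.1.
apply: (igr_le _ (igrZ (1 * `|M2| + 4 * M0 / 1) (igr_P ltr01))) => [|y].
  by apply: measurable_funM; [meas|apply: (mfun_d2 (mfun2_cst mq) (s := fun=> 0)); meas].
rewrite (LamE q x y ltr01) normrM ger0_norm; last by pos.
by rewrite mulrC ler_wpM2r //; [pos|exact: nb_sup (nb_weight y ltr01 h) x].
Qed.

Lemma nb_half q M : nb q M -> nb (fun x => 2^-1 * q x) (2^-1 * M).
Proof. by move=> h; have := nbZ 2^-1 h; rewrite ger0_norm // invr_ge0. Qed.

(** An interpolation inequality: a function small in [nb] with merely bounded second differences has
    a small half-Laplacian once r is chosen small and then the function small against r. *)
Lemma nb_Lam r q M0 M2 : 0 < r -> lamb q M0 M2 -> nb (Lam q) (2^-1 * (r * `|M2| + 4 * M0 / r)).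
Proof.
move=> r0 h; have mq := nb_mfun h.1; have M0' := nb_ge0 h.1.
apply: nb_half.
have -> : (fun x => \I_y (pi^-1 * y ^- 2 * d2 y q x)) =
  (fun x => \I_y (P r y * (r^-1 * (r ^+ 2 + y ^+ 2) * y ^- 2 * d2 y q x))).
  by apply/funext => x; apply: eq_I => y; exact: LamE.
rewrite -[_ + _]mul1r.
apply: (nb_minkowski (h := fun z => r^-1 * (r ^+ 2 + z.1 ^+ 2) * z.1 ^- 2 * d2 z.1 q z.2)).
- exact: mfun_P.
- by move=> y; pos.
- by rewrite int_P.
- by apply: measurable_funM; [meas|apply: (mfun_d2 (mfun2_cst mq) (s := fun=> 0)); meas].
- by move=> y _; exact: (nb_weight y r0 h).
by rewrite addr_ge0 // ?mulr_ge0 // ?invr_ge0 ltW.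
Qed.

Lemma LamB p q M0 M2 N0 N2 x : lamb p M0 M2 -> lamb q N0 N2 ->
  Lam (fun x => p x - q x) x = Lam p x - Lam q x.
Proof.
move=> hp hq; rewrite /Lam -mulrBr -I_B; [|exact: igr_Lam hp|exact: igr_Lam hq].
by congr (_ * Rintegral _ _ _); apply/funext => y; rewrite /d2; ring.
Qed.

Lemma LamZ c p M0 M2 x : lamb p M0 M2 -> Lam (fun x => c * p x) x = c * Lam p x.
Proof.
move=> hp; rewrite /Lam mulrCA -(I_Z c (igr_Lam x hp)).
by congr (_ * Rintegral _ _ _); apply/funext => y; rewrite /d2; ring.
Qed.

Lemma lambZ c p M0 M2 : lamb p M0 M2 -> lamb (fun x => c * p x) (`|c| * M0) (`|c| * M2).
Proof.
move=> [h0 h2]; split; first exact: nbZ.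
move=> y; rewrite mulrCA; have := nbZ c (h2 y); congr (nb _ _).
by apply/funext => x; rewrite /d2; ring.
Qed.

Lemma lambB p q M0 M2 N0 N2 : lamb p M0 M2 -> lamb q N0 N2 -> lamb (fun x => p x - q x) (M0 + N0) (M2 + N2).
Proof.
move=> [h0 h2] [k0 k2]; split; first exact: nbB.
move=> y; rewrite mulrDr; have := nbB (h2 y) (k2 y); congr (nb _ _).
by apply/funext => x; rewrite /d2; ring.
Qed.

Lemma is_derive_Lam q q' M0 M2 N0 N2 x : lamb q M0 M2 -> lamb q' N0 N2 -> (forall x, is_derive x 1 q (q' x)) ->
  is_derive x 1 (Lam q) (Lam q' x).
Proof.
move=> hq hq' dq; have mq := nb_mfun hq.1; have mq' := nb_mfun hq'.1.
have dd (y z : R) : is_derive z 1 (d2 y q) (d2 y q' z).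
  have s (c : R) : is_derive z 1 (fun x => q (x + c)) (q' (z + c)).
    have d3 : is_derive z 1 (fun x => x + c) 1 by apply: is_derive_eq; rewrite addr0.
    by have := is_derive_comp (g := fun x => x + c) (dq (z + c)) d3; rewrite mulr1.
  have d1 := s y; have d3 := s (- y); have d0 := dq z.
  by rewrite /d2; apply: is_derive_eq; rewrite /GRing.scale /=; ring.
apply: is_derive_cvg; apply/cvgr_dnbhsP => u [u0 cu].
have -> : (fun n => (u n)^-1 * (Lam q (x + u n) - Lam q x)) = (fun n =>
   2^-1 * \I_y (pi^-1 * y ^- 2 * ((u n)^-1 * (d2 y q (x + u n) - d2 y q x)))).
  apply/funext => n; rewrite /Lam -mulrBr mulrCA; congr (_ * _).
  rewrite -I_B; [|exact: igr_Lam hq|exact: igr_Lam hq].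
  rewrite -I_Z; last by apply: igrB; exact: igr_Lam hq.
  by apply: eq_I => y; ring.
apply: cvgM; first exact: cvg_cst.
have md z : mfun (fun y => d2 y q z).
  by apply: (mfun_d2 (mfun2_cst mq) (s := fun=> 0)); meas.
apply: (I_cvg (g := fun y => (1 * `|N2| + 4 * N0 / 1) * P 1 y)).
- move=> n; apply: measurable_funM; first by meas.
  by apply: measurable_funM; [exact: measurable_cst|apply: measurable_funB].
- by apply: igrZ; exact: igr_P.
- move=> n y; have hb z := nb_sup (nb_weight y ltr01 hq') z.

  have [c hc] : exists c, (u n)^-1 * (d2 y q (x + u n) - d2 y q x) = d2 y q' c.
    have [c _ ->] := mean_value x (x + u n) (dd y); exists c.
    by rewrite (_ : x + u n - x = u n); [rewrite mulrC mulfK|ring].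
  rewrite hc (LamE q' c y ltr01) normrM ger0_norm; last by pos.
  by rewrite mulrC; apply: ler_wpM2r; [pos|exact: hb].
move=> y; apply: cvgM; first exact: cvg_cst.
exact: (derive_seq (dd y x) u0 cu).
Qed.

(** Three derivatives are spent: two make the integral converge, and the third gives a derivative of
    the result, hence its continuity. *)
Lemma KX_Lam k w : KX locb k.+3 w -> KX locb k (fun t => Lam (w t)).
Proof.
have base w' : KX locb 3 w' -> locb (fun t => Lam (w' t)) /\
    (forall w'', xderiv w' w'' -> KX locb 2 w'' -> xderiv (fun t => Lam (w' t)) (fun t => Lam (w'' t))).
  move=> h3; have h2 := KX_pred regular_locb h3; have h0 := KX_locb regular_locb h3.
  have der w'' : xderiv w' w'' -> KX locb 2 w'' -> xderiv (fun t => Lam (w' t)) (fun t => Lam (w'' t)).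
    move=> d hw'' t x t0; have l'' := KX_locb regular_locb hw''.
    have [M0 b0] := locb_nb t h0 t0; have [M2 b2] := KX_sm t h2 t0.
    have [N0 c0] := locb_nb t l'' t0; have [N2 c2] := KX_sm t hw'' t0.
    apply: (is_derive_Lam x (M0 := M0) (M2 := M2) (N0 := N0) (N2 := N2)).
    - by apply: sm_lamb; [exact: b0|exact: b2].
    - by apply: sm_lamb; [exact: c0|exact: c2].
    by move=> z; exact: d.
  split => //; split.
  - by apply: (mfun_Lam (w := w')); [exact: locb_mfun|meas|meas].
  - move: h3 => [_ [w'' [d hw'']]] t t0; apply: is_derive_continuous => x; exact: (der w'' d hw'' t x t0).
  move=> a b a0; have [M0 b0] := locb_nb b h0 a0; have [M2 b2] := KX_sm b h2 a0.
  exists (2^-1 * (1 * `|M2| + 4 * M0 / 1)) => t ta tb; apply: nb_Lam => //.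
  by apply: sm_lamb; [exact: b0|exact: b2].
elim: k w => [|k IH] w h; first by have [] := base w h.
have h3 : KX locb 3 w.
  elim: k h {IH} => [|k IHk] h; first exact: (KX_pred regular_locb h).
  by apply: IHk; exact: (KX_pred regular_locb h).
have [l der] := base w h3; split => //.
move: h => [_ [w'' [d h'']]]; exists (fun t => Lam (w'' t)); split; last exact: IH.
apply: der => //.
have down j : KX locb j.+2 w'' -> KX locb 2 w''.
  by elim: j => // j IHj hj; apply: IHj; exact: (KX_pred regular_locb hj).
exact: (down k.+1 h'').
Qed.

(** Exact identity: h / (pi y^2) - P_h(y) = P_h(y) h^2 / y^2. The remainder is thus a Poisson
    average of h^2 y^-2 times second differences, which are O(y^2). *)
Lemma nb_pc_generator q M0 M2 h : 0 < h -> 0 <= M2 -> lamb q M0 M2 ->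
  nb (fun x => pc h q x - q x + h * Lam q x) (2^-1 * (h ^+ 2 * M2)).
Proof.
move=> h0 M2' hq; have mq := nb_mfun hq.1; have pq := nb_pint hq.1.
have mP := @mfun_P R h.
have igP c x : igr (fun y => P h y * q (x + c * y)).
  apply: (igr_le _ (igrZ M0 (igr_P h0))) => [|y]; first by meas.
  rewrite normrM (ger0_norm (_ : 0 <= P h y)); last by pos.
  by rewrite mulrC; apply: ler_wpM2r; [pos|exact: nb_sup hq.1 _].
have e x : pc h q x - q x + h * Lam q x = 2^-1 * \I_y (P h y * (h ^+ 2 * y ^- 2 * d2 y q x)).
  have e1 : pc h q x = \I_y (P h y * q (x + 1 * y)).
    rewrite pcE // -(I_reflect 0); last by meas.
    by apply: eq_I => y; rewrite sub0r PN opprK mul1r.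
  have e2 : pc h q x = \I_y (P h y * q (x + -1 * y)).
    by rewrite pcE //; apply: eq_I => y; rewrite mulN1r.
  have igd : igr (fun y => P h y * d2 y q x).
    rewrite (_ : (fun y => _) = fun y => 2 * q x * P h y - P h y * q (x + 1 * y) - P h y * q (x + -1 * y)); last first.
      by apply/funext => y; rewrite /d2 mul1r mulN1r; ring.
    by apply: igrB; [apply: igrB|]; [apply: igrZ; exact: igr_P|exact: igP|exact: igP].
  have e3 : pc h q x - q x = - (2^-1 * \I_y (P h y * d2 y q x)).
    rewrite (_ : (fun y => P h y * d2 y q x) = fun y => 2 * q x * P h y - P h y * q (x + 1 * y) - P h y * q (x + -1 * y)); last first.
      by apply/funext => y; rewrite /d2 mul1r mulN1r; ring.
    have i0 : igr (fun y => 2 * q x * P h y) by apply: igrZ; exact: igr_P.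
    rewrite (I_B (igrB i0 (igP 1 x)) (igP (-1) x)) (I_B i0 (igP 1 x)) -e1 -e2.
    by rewrite I_Z ?I_P //; [field|exact: igr_P].
  rewrite e3 /Lam mulrCA -(I_Z h (igr_Lam x hq)).
  rewrite addrC -mulrBr -I_B //; last by apply: igrZ; exact: igr_Lam hq.
  congr (_ * Rintegral _ _ _); apply/funext => y.
  have [->|y0] := eqVneq y 0.
    have z : d2 0 q x = 0 by rewrite /d2 subr0 addr0; ring.
    by rewrite z !mulr0 subr0.
  rewrite !mulrA -mulrBl; congr (_ * _); rewrite /P; move: (pi^-1) => p.
  by field; rewrite y0 gt_eqF // den_gt0.
have -> : (fun x => pc h q x - q x + h * Lam q x) = (fun x => 2^-1 * \I_y (P h y * (h ^+ 2 * y ^- 2 * d2 y q x))).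
  by apply/funext => x; exact: e.
apply: nb_half; rewrite -[h ^+ 2 * M2]mul1r.
apply: (nb_minkowski (h := fun z => h ^+ 2 * z.1 ^- 2 * d2 z.1 q z.2)) => //.
- by move=> y; pos.
- by rewrite int_P.
- by apply: measurable_funM; [meas|apply: (mfun_d2 (mfun2_cst mq) (s := fun=> 0)); meas].
- move=> y _ /=; have [->|y0] := eqVneq y 0.
    by rewrite expr0n /= invr0 mulr0; under [fun x => _]funext do rewrite mul0r; apply: nb0; rewrite mulr_ge0 ?sqr_ge0.
  have := nbZ (h ^+ 2 * y ^- 2) (hq.2 y); rewrite ger0_norm; last by rewrite mulr_ge0 ?invr_ge0 ?sqr_ge0.
  by rewrite mulrA divfK // sqrf_eq0.
by rewrite mulr_ge0 ?sqr_ge0.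
Qed.

End HalfLaplacian.

(** * Calculus of time derivatives, uniformly in space *)

Section TimeDerivative.
Context {R : realType}.
Implicit Types (t s x y h a b r e : R) (M C L N K : R) (w v z g f : R -> R -> R) (q : R -> R) (k m n : nat).

(* differentiability in time in the norms of [nb], uniformly on compact intervals *)
Definition DT w w1 := forall a b e, 0 < a -> 0 < e -> exists2 d, 0 < d &
  forall t t', a <= t -> t <= b -> a <= t' -> t' <= b -> `|t' - t| < d ->
    nb (fun x => w t' x - w t x - (t' - t) * w1 t x) (e * `|t' - t|).

(** The segment from t to t' is cut into steps shorter than d and the increments are added. The
    error e may depend on everything but the final constant K, and it is sent to 0 afterwards. *)
Lemma nb_telescope z a b K : (forall e, 0 < e -> exists2 d, 0 < d &
    forall t t', a <= t -> t <= b -> a <= t' -> t' <= b -> `|t' - t| < d ->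
    nb (fun x => z t' x - z t x) ((K + e) * `|t' - t|)) ->
  forall t t', a <= t -> t <= b -> a <= t' -> t' <= b -> nb (fun x => z t' x - z t x) (K * `|t' - t|).
Proof.
move=> H t t' ta tb ta' tb'; apply: nb_eps => e0 he0.
pose e := e0 / (`|t' - t| + 1); have e1 : 0 < e by rewrite divr_gt0 // ltr_wpDl.
have [d d0 hd] := H e e1.
pose n := (Num.truncn (`|t' - t| / d)).+1.
have n0 : (0 : R) < n%:R by rewrite ltr0n.
have hn : `|t' - t| / d < n%:R by rewrite truncnS_gt.
pose st := (t' - t) / n%:R.
have std : `|st| < d.
  by rewrite normrM normfV (ger0_norm (ltW n0)) ltr_pdivrMr // mulrC -ltr_pdivrMr.
have inab i : (i <= n)%N -> a <= t + st * i%:R /\ t + st * i%:R <= b.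
  move=> iN; pose l := i%:R / n%:R : R.
  have l0 : 0 <= l by rewrite divr_ge0.
  have l1 : l <= 1 by rewrite ler_pdivrMr // mul1r ler_nat.
  have -> : t + st * i%:R = (1 - l) * t + l * t' by rewrite /st /l; ring.
  have l2 : 0 <= 1 - l by rewrite subr_ge0.
  by split; nra.
have key i : (i <= n)%N -> nb (fun x => z (t + st * i%:R) x - z t x) ((K + e) * `|st| * i%:R).
  elim: i => [|i IH] iN.
    rewrite !mulr0 addr0; under [fun x => _]funext do rewrite subrr; exact: nb0.
  have [p1 p2] := inab i (ltnW iN); have [p3 p4] := inab i.+1 iN.
  have es : t + st * i.+1%:R - (t + st * i%:R) = st by rewrite -[i.+1%:R]natr1; ring.
  have h1 := hd _ _ p1 p2 p3 p4; rewrite es in h1.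
  have := nbD (h1 std) (IH (ltnW iN)).
  have -> : (K + e) * `|st| + (K + e) * `|st| * i%:R = (K + e) * `|st| * i.+1%:R.
    by rewrite -[i.+1%:R]natr1; ring.
  by congr (nb _ _); apply/funext => x; rewrite addrA subrK.
have := key n (leqnn n); rewrite /st divfK ?gt_eqF // (addrC t) subrK => h.
apply: (nb_le h); rewrite normrM normfV (ger0_norm (ltW n0)) -!mulrA mulVf ?gt_eqF // mulr1 mulrDl lerD2l.
rewrite /e mulrAC ler_pdivrMr ?ltr_wpDl //.
by apply: ler_wpM2l; [exact: ltW|rewrite lerDl ler01].
Qed.

Lemma DT_bounded w w1 a b : locb w -> locb w1 -> DT w w1 -> 0 < a -> exists2 M, 0 <= M &
  forall t t', a <= t -> t <= b -> a <= t' -> t' <= b -> nb (fun x => w t' x - w t x) (M * `|t' - t|).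
Proof.
move=> lw lw1 hw a0; have [M hM] := locb_nb b lw a0; have [N hN] := locb_nb b lw1 a0.
have [d d0 hd] := hw a b 1 a0 ltr01.
(* The part |N| + 1 serves times closer than d, the part 2 |M| / d all others. *)
exists (`|N| + 1 + 2 * `|M| / d); first by rewrite addr_ge0 ?divr_ge0 ?mulr_ge0 ?addr_ge0 // ltW.
move=> t t' ta tb ta' tb'; case: (ltP `|t' - t| d) => td.
  have h1 := hd t t' ta tb ta' tb' td; have h2 := nbZ (t' - t) (hN t ta tb).
  have := nbD h1 h2; rewrite (_ : (fun x => _) = fun x => w t' x - w t x); last first.
    by apply/funext => x; rewrite subrK.
  move=> h; apply: (nb_le h); rewrite mul1r (mulrC _ N) -[X in X + _]mul1r -mulrDl ler_wpM2r //.
  have := ler_norm N; have : 0 <= 2 * `|M| / d by rewrite divr_ge0 ?mulr_ge0 // ltW.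
  by move: (2 * `|M| / d) => q; lra.
apply: (nb_le (nbB (hM t' ta' tb') (hM t ta tb))).
apply: (@le_trans _ _ (2 * `|M| / d * `|t' - t|)).
  rewrite mulrAC ler_pdivlMr //; have := ler_norm M; have := normr_ge0 M.
  by move: `|M| `|t' - t| td => m u td; nra.
by rewrite ler_wpM2r // lerDr addr_ge0.
Qed.

Lemma DT_add f f1 g g1 : DT f f1 -> DT g g1 -> DT (fun t x => f t x + g t x) (fun t x => f1 t x + g1 t x).
Proof.
move=> hf hg a b e a0 e0; have e2 : 0 < e / 2 by rewrite divr_gt0.
have [d d0 hd] := hf a b _ a0 e2; have [d' d0' hd'] := hg a b _ a0 e2.
exists (Num.min d d'); first by rewrite lt_min d0.
move=> t t' ta tb ta' tb'; rewrite lt_min => /andP[h1 h2].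
have := nbD (hd t t' ta tb ta' tb' h1) (hd' t t' ta tb ta' tb' h2); rewrite -mulrDl -splitr.
by congr (nb _ _); apply/funext => x; ring.
Qed.

Lemma DT_scale c f f1 : DT f f1 -> DT (fun t x => c * f t x) (fun t x => c * f1 t x).
Proof.
move=> hf a b e a0 e0; have c0 : 0 < `|c| + 1 by rewrite ltr_wpDl.
have e2 : 0 < e / (`|c| + 1) by rewrite divr_gt0.
have [d d0 hd] := hf a b _ a0 e2; exists d => // t t' ta tb ta' tb' h.
have := nbZ c (hd t t' ta tb ta' tb' h).
rewrite (_ : (fun x => _) = fun x => c * f t' x - c * f t x - (t' - t) * (c * f1 t x)); last first.
  by apply/funext => x; ring.
move=> h2; apply: (nb_le h2); rewrite mulrA ler_wpM2r // mulrA ler_pdivrMr // mulrC ler_wpM2l //; first exact: ltW.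
by rewrite lerDl.
Qed.

Lemma DT_cst q : DT (fun _ => q) (fun _ _ => 0).
Proof.
move=> a b e a0 e0; exists 1 => // t t' _ _ _ _ _.
under [fun x => _]funext do rewrite subrr mulr0 subr0.
by apply: nb0; rewrite mulr_ge0 // ltW.
Qed.

Lemma DT_mul f f1 g g1 : locb f -> locb f1 -> locb g -> locb g1 -> DT f f1 -> DT g g1 ->
  DT (fun t x => f t x * g t x) (fun t x => f1 t x * g t x + f t x * g1 t x).
Proof.
move=> lf lf1 lg lg1 hf hg a b e a0 e0.
have [M hM] := locb_nb b lf a0; have [N hN] := locb_nb b lg a0.
have [L L0 hL] := DT_bounded b lf lf1 hf a0; have [L' L'0 hL'] := DT_bounded b lg lg1 hg a0.
pose K := `|M| + `|N| + L * L' + 1; have K0 : 0 < K by rewrite ltr_wpDl // !addr_ge0 // mulr_ge0.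
have e2 : 0 < e / K by rewrite divr_gt0.
have [d d0 hd] := hf a b _ a0 e2; have [d' d0' hd'] := hg a b _ a0 e2.
(* The product of the two increments is quadratic in t' - t, so smallness of |t' - t| itself is
   required besides that of the remainders. *)
exists (Num.min (e / K) (Num.min d d')); first by rewrite !lt_min d0 e2.
move=> t t' ta tb ta' tb'; rewrite !lt_min => /andP[h0 /andP[h1 h2]].
have q1 := nbM (hd t t' ta tb ta' tb' h1) (hN t ta tb).
have q2 := nbM (hM t ta tb) (hd' t t' ta tb ta' tb' h2).
have q3 := nbM (hL t t' ta tb ta' tb') (hL' t t' ta tb ta' tb').
have := nbD (nbD q1 q2) q3.
rewrite (_ : (fun x => _) = fun x => f t' x * g t' x - f t x * g t x - (t' - t) * (f1 t x * g t x + f t x * g1 t x)); last first.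
  by apply/funext => x; ring.
move=> h; apply: (nb_le h).
have eK : e = e / K * (`|M| + `|N| + L * L' + 1) by rewrite -/K divfK ?gt_eqF.
rewrite [X in _ <= X * _]eK {eK}.
have := ler_norm M; have := ler_norm N; have u0 := normr_ge0 (t' - t).
move: (e / K) `|t' - t| `|M| `|N| e2 h0 u0 => E u m n E0 hE u0 nM mM.
have x1 : E * u * N <= E * u * n by rewrite ler_wpM2l // mulr_ge0 // ltW.
have x2 : M * (E * u) <= m * (E * u) by rewrite ler_wpM2r // mulr_ge0 // ltW.
have x3 : L * u * (L' * u) <= L * L' * (E * u).
  rewrite (_ : L * u * (L' * u) = L * L' * (u * u)); last by ring.
  by apply: ler_wpM2l; [exact: mulr_ge0|apply: ler_wpM2r => //; exact: ltW].
have x4 : 0 <= E * u by rewrite mulr_ge0 // ltW.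
have -> : E * (m + n + L * L' + 1) * u = m * (E * u) + E * u * n + L * L' * (E * u) + E * u by ring.
by lra.
Qed.

Lemma DT_comp (G dG : R -> R) C K f f1 : (forall x, is_derive x 1 G (dG x)) ->
  (forall a b, `|dG b - dG a| <= C * `|b - a|) -> (forall x, `|dG x| <= K) ->
  locb f -> locb f1 -> DT f f1 -> DT (fun t x => G (f t x)) (fun t x => dG (f t x) * f1 t x).
Proof.
move=> dGG lG bG lf lf1 hf a b e a0 e0.
have [L L0 hL] := DT_bounded b lf lf1 hf a0.
have C0 : 0 <= C by have := le_trans (normr_ge0 _) (lG 0 1); rewrite subr0 normr1 mulr1.
have K0 : 0 <= K by apply: le_trans (bG 0).
pose Q := K + C * (L * L) + 1; have Q0 : 0 < Q by rewrite ltr_wpDl // addr_ge0 // !mulr_ge0.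
have e2 : 0 < e / Q by rewrite divr_gt0.
have [d d0 hd] := hf a b _ a0 e2.
exists (Num.min (e / Q) d); first by rewrite lt_min d0 e2.
have cG := is_derive_continuous dGG; have cdG := lipschitz_continuous lG.
have mG := continuous_measurable_fun cG; have mdG := continuous_measurable_fun cdG.
have mf := locb_mfun lf; have mf1 := locb_mfun lf1.
move=> t t' ta tb ta' tb'; rewrite !lt_min => /andP[h0 h1].
have q0 := hL t t' ta tb ta' tb'; have q1 := nbZ C (nbM q0 q0).
have q2 := nbZ K (hd t t' ta tb ta' tb' h1).
have m1 := mfun2_1 t mf; have m2 := mfun2_1 t' mf; have m3 := mfun2_1 t mf1.
have q3 := nbD (nb_abs q1) (nb_abs q2).
rewrite (ger0_norm C0) (ger0_norm K0) in q3.
apply: (@nb_le _ _ (C * (L * `|t' - t| * (L * `|t' - t|)) + K * (e / Q * `|t' - t|))); last first.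
  rewrite -[X in _ <= X * _](divfK (lt0r_neq0 Q0) e) {2}/Q.
  have u0 := normr_ge0 (t' - t).
  move: (e / Q) `|t' - t| e2 h0 u0 => E u E0 hE u0.
  have x3 : C * (L * u * (L * u)) <= C * (L * L) * (E * u).
    rewrite (_ : C * (L * u * (L * u)) = C * (L * L) * (u * u)); last by ring.
    by apply: ler_wpM2l; [rewrite !mulr_ge0|apply: ler_wpM2r => //; exact: ltW].
  have x4 : 0 <= E * u by rewrite mulr_ge0 // ltW.
  by have -> : E * (K + C * (L * L) + 1) * u = K * (E * u) + C * (L * L) * (E * u) + E * u; [ring|lra].
apply: (nb_dom q3).
  apply: measurable_funB; first by apply: measurable_funB; apply: (measurableT_comp mG).
  apply: measurable_funM; first exact: measurable_cst.
  by apply: measurable_funM => //; apply: (measurableT_comp mdG).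
move=> x; rewrite [leRHS]ger0_norm ?addr_ge0 //.
have [c hc ->] := mean_value (f t x) (f t' x) dGG.
set dl := f t' x - f t x in hc *.
have -> : dG c * dl - (t' - t) * (dG (f t x) * f1 t x) = (dG c - dG (f t x)) * dl + dG (f t x) * (dl - (t' - t) * f1 t x) by ring.
apply: (le_trans (ler_normD _ _)); apply: lerD.
  rewrite !normrM (ger0_norm C0) mulrA ler_wpM2r //; apply: (le_trans (lG _ _)).
  by rewrite ler_wpM2l.
by rewrite !normrM ler_wpM2r // (ger0_norm K0).
Qed.

Lemma Dh_B h m (p q : R -> R) x : Dh h m (fun x => p x - q x) x = Dh h m p x - Dh h m q x.
Proof.
elim: m p q => [|m IH] p q //; rewrite /Dh !iterSr -3!/(Dh h m _) -IH.
by congr (Dh h m _ x); apply/funext => y; ring.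
Qed.

Lemma Dh_Z h m c (p : R -> R) x : Dh h m (fun x => c * p x) x = c * Dh h m p x.
Proof.
elim: m p => [|m IH] p //; rewrite /Dh !iterSr -2!/(Dh h m _) -IH.
by congr (Dh h m _ x); apply/funext => y; ring.
Qed.

Lemma nb_Dh_triv h m q M : nb q M -> nb (Dh h m q) (2 ^+ m * M).
Proof.
elim: m q M => [|m IH] q M hq; first by rewrite expr0 mul1r.
rewrite /Dh iterSr -/(Dh h m _); have := IH _ _ (nbB (nb_shift h hq) hq).
by rewrite exprSr -mulrA (_ : M + M = 2 * M) //; ring.
Qed.

(* The sharp constant is needed: it makes increments in [x] and [t] gain from both. *)
Lemma DT_Dh m w w1 a b : locb w -> KX locb m w1 -> DT w w1 -> 0 < a -> exists2 M, 0 <= M &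
  forall t t' h, a <= t -> t <= b -> a <= t' -> t' <= b ->
    nb (Dh h m (fun x => w t' x - w t x)) (`|h| ^+ m * M * `|t' - t|).
Proof.
move=> lw hw1 hw a0; have [M hM] := KX_sm b hw1 a0.
exists `|M| => // t t' h ta tb ta' tb'.
have -> : Dh h m (fun x => w t' x - w t x) = (fun x => Dh h m (w t') x - Dh h m (w t) x).
  by apply/funext => x; exact: Dh_B.
apply: (nb_telescope (z := fun t => Dh h m (w t)) (a := a) (b := b)) => // e e0.
(* The remainder of the time expansion is bounded crudely, with the factor 2^m and no gain in h;
   this is harmless because the telescoping lets it tend to 0. *)
have e2 : 0 < e / 2 ^+ m by rewrite divr_gt0 // exprn_gt0.
have [d d0 hd] := hw a b _ a0 e2; exists d => // s s' sa sb sa' sb' sd.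
have h1 := nb_Dh_triv h m (hd s s' sa sb sa' sb' sd).
have h2 := nbZ (s' - s) (nb_Dh h (hM s sa sb)).
have := nbD h1 h2; rewrite (_ : (fun x => _) = fun x => Dh h m (w s') x - Dh h m (w s) x); last first.
  by apply/funext => x; rewrite !Dh_B Dh_Z subrK.
move=> h3; apply: (nb_le h3); rewrite mulrA mulrCA divff ?gt_eqF ?exprn_gt0 // mulr1.
rewrite [leRHS]mulrDl addrC lerD2r mulrC ler_wpM2r // ler_wpM2l ?exprn_ge0 //; exact: ler_norm.
Qed.

Definition smooth w := forall k, KX locb k w.

Lemma smooth_locb w : smooth w -> locb w. Proof. by move=> /(_ 0). Qed.

Lemma smooth_lamb w a b : smooth w -> 0 < a -> exists M0 M2, [/\ 0 <= M0, 0 <= M2 &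
  forall t, a <= t -> t <= b -> lamb (w t) M0 M2].
Proof.
move=> hw a0; have [M0 h0] := locb_nb b (smooth_locb hw) a0; have [M2 h2] := KX_sm b (hw 2) a0.
exists `|M0|, `|M2|; split => // t ta tb; split; first by apply: (nb_le (h0 t ta tb)); exact: ler_norm.
by move=> y; apply: (nb_le (nb_d2 y (h2 t ta tb))); rewrite ler_wpM2l ?sqr_ge0 // ler_norm.
Qed.

Lemma d2_Dh q y x : d2 y q x = - Dh y 2 q (x - y).
Proof. by rewrite /Dh /d2 /= subrK; ring. Qed.

Lemma DT_lamb w w1 a b : smooth w -> smooth w1 -> DT w w1 -> 0 < a -> exists2 M, 0 <= M &
  forall t t', a <= t -> t <= b -> a <= t' -> t' <= b ->
    lamb (fun x => w t' x - w t x) (M * `|t' - t|) (M * `|t' - t|).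
Proof.
move=> hw hw1 h a0; have [L L0 hL] := DT_bounded b (smooth_locb hw) (smooth_locb hw1) h a0.
have [M M0 hM] := DT_Dh b (smooth_locb hw) (hw1 2) h a0.
exists (Num.max L M); first by rewrite le_max L0.
move=> t t' ta tb ta' tb'; split.
  by apply: (nb_le (hL t t' ta tb ta' tb')); rewrite ler_wpM2r // le_max lexx.
move=> y; have := nbN (nb_shift (- y) (hM t t' y ta tb ta' tb')).
rewrite (_ : (fun x => _) = d2 y (fun x => w t' x - w t x)); last by apply/funext => x; rewrite d2_Dh.
move=> h'; apply: (nb_le h'); rewrite normK2 -mulrA ler_wpM2l ?sqr_ge0 //.
by rewrite ler_wpM2r // le_max lexx orbT.
Qed.

Lemma DT_Lam w w1 : smooth w -> smooth w1 -> DT w w1 -> DT (fun t => Lam (w t)) (fun t => Lam (w1 t)).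
Proof.
move=> hw hw1 h a b e a0 e0.
have [M M0 hM] := DT_lamb b hw hw1 h a0.
have [N0 [N2 [N00 N20 hN]]] := smooth_lamb b hw1 a0.
have [W0 [W2 [W00 W20 hW]]] := smooth_lamb b hw a0.
(* The remainder is small in [nb], but its second differences are only Lipschitz in time. With this
   r their share in [nb_Lam] is at most e / 2, and a remainder of size e r / 8 contributes e / 4. *)
pose r := e / (M + N2 + 1); have MN : 0 < M + N2 + 1 by rewrite ltr_wpDl // addr_ge0.
have r0 : 0 < r by rewrite divr_gt0.
have e2 : 0 < e * r / 8 by rewrite divr_gt0 // mulr_gt0.
have [d d0 hd] := h a b _ a0 e2; exists d => // t t' ta tb ta' tb' td.
have u0 := normr_ge0 (t' - t).
pose q x := w t' x - w t x - (t' - t) * w1 t x.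
have l1 := hM t t' ta tb ta' tb'; have l2 := lambZ (t' - t) (hN t ta tb).
have lq : lamb q (e * r / 8 * `|t' - t|) ((M + N2) * `|t' - t|).
  split; first exact: hd.
  by move=> y; have := (lambB l1 l2).2 y; rewrite (mulrC _ N2) -mulrDl.
have -> : (fun x => Lam (w t') x - Lam (w t) x - (t' - t) * Lam (w1 t) x) = Lam q.
  apply/funext => x; rewrite /q (LamB x l1 l2) (LamZ (t' - t) x (hN t ta tb)).
  by rewrite (LamB x (hW t' ta' tb') (hW t ta tb)).
apply: (nb_le (nb_Lam r0 lq)).
rewrite (ger0_norm (mulr_ge0 (addr_ge0 M0 N20) u0)).
have -> : 4 * (e * r / 8 * `|t' - t|) / r = e / 2 * `|t' - t| by field; rewrite gt_eqF.
have : r * (M + N2) <= e by rewrite /r mulrAC ler_pdivrMr // ler_wpM2l ?(ltW e0) // lerDl.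
by move: u0; move: `|t' - t| => u u0 hr; nra.
Qed.

Fixpoint tsmooth n w : Prop := smooth w /\
  (if n is n'.+1 then exists w1, DT w w1 /\ tsmooth n' w1 else True).

Lemma tsmooth_smooth n w : tsmooth n w -> smooth w. Proof. by case: n => [|n] []. Qed.

Lemma tsmooth_pred n w : tsmooth n.+1 w -> tsmooth n w.
Proof.
elim: n w => [|n IH] w [sw [w1 [d h]]]; first by split.
by split => //; exists w1; split => //; exact: IH.
Qed.

Lemma smooth_mul f g : smooth f -> smooth g -> smooth (fun t x => f t x * g t x).
Proof. by move=> hf hg k; apply: (KX_mul regular_locb). Qed.

Lemma smooth_add f g : smooth f -> smooth g -> smooth (fun t x => f t x + g t x).
Proof. by move=> hf hg k; apply: KX_add; [exact: regular_locb|exact: hf|exact: hg]. Qed.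

Lemma smooth_scale c f : smooth f -> smooth (fun t x => c * f t x).
Proof. by move=> hf k; apply: KX_scale; [exact: regular_locb|exact: hf]. Qed.

Lemma tsmooth_add n f g : tsmooth n f -> tsmooth n g -> tsmooth n (fun t x => f t x + g t x).
Proof.
elim: n f g => [|n IH] f g; first by move=> [sf _] [sg _]; split => //; exact: smooth_add.
move=> [sf [f1 [df hf]]] [sg [g1 [dg hg]]]; split; first exact: smooth_add.
by exists (fun t x => f1 t x + g1 t x); split; [exact: DT_add|exact: IH].
Qed.

Lemma tsmooth_scale n c f : tsmooth n f -> tsmooth n (fun t x => c * f t x).
Proof.
elim: n f => [|n IH] f; first by move=> [sf _]; split => //; exact: smooth_scale.
move=> [sf [f1 [df hf]]]; split; first exact: smooth_scale.
by exists (fun t x => c * f1 t x); split; [exact: DT_scale|exact: IH].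
Qed.

Lemma tsmooth_mul n f g : tsmooth n f -> tsmooth n g -> tsmooth n (fun t x => f t x * g t x).
Proof.
elim: n f g => [|n IH] f g; first by move=> [sf _] [sg _]; split => //; exact: smooth_mul.
move=> hf hg; have pf := tsmooth_pred hf; have pg := tsmooth_pred hg.
move: hf hg => [sf [f1 [df hf]]] [sg [g1 [dg hg]]]; split; first exact: smooth_mul.
exists (fun t x => f1 t x * g t x + f t x * g1 t x); split.
  by apply: DT_mul => //; apply: smooth_locb => //; [exact: tsmooth_smooth hf|exact: tsmooth_smooth hg].
by apply: tsmooth_add; exact: IH.
Qed.

Lemma smooth_zero : smooth (fun _ _ => 0).
Proof.
have -> : (fun _ _ : R => 0) = (fun t x => 0 * bump x) by apply/funext => t; apply/funext => x; rewrite mul0r.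
by move=> k; apply: (KX_scale regular_locb); exact: (KX_bump regular_locb k).1.
Qed.

Lemma tsmooth_zero n : tsmooth n (fun _ _ => 0).
Proof.
elim: n => [|n IH]; first by split => //; exact: smooth_zero.
by split; [exact: smooth_zero|exists (fun _ _ => 0); split => //; exact: DT_cst].
Qed.

Lemma tsmooth_cst n q : smooth (fun _ => q) -> tsmooth n (fun _ => q).
Proof.
by case: n => [|n] h; split => //; exists (fun _ _ => 0); split; [exact: DT_cst|exact: tsmooth_zero].
Qed.

Lemma tsmooth_Lam n w : tsmooth n w -> tsmooth n (fun t => Lam (w t)).
Proof.
have sL f : smooth f -> smooth (fun t => Lam (f t)) by move=> h k; apply: KX_Lam; exact: h.
elim: n w => [|n IH] w; first by move=> [sw _]; split => //; exact: sL.
move=> [sw [w1 [dw hw]]]; split; first exact: sL.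
by exists (fun t => Lam (w1 t)); split; [apply: DT_Lam => //; exact: tsmooth_smooth hw|exact: IH].
Qed.

Lemma tsmooth_trig n v : tsmooth n v -> tsmooth n (fun t x => sinp (v t x)) /\ tsmooth n (fun t x => cosp (v t x)).
Proof.
have sT f : smooth f -> smooth (fun t x => sinp (f t x)) /\ smooth (fun t x => cosp (f t x)).
  by move=> h; split => k; have [] := KX_trig regular_locb (h k).
elim: n v => [|n IH] v; first by move=> [sv _]; have [h1 h2] := sT v sv.
move=> hv; have [hs hc] := IH _ (tsmooth_pred hv); move: hv => [sv [v1 [dv hv]]].
have [s1 s2] := sT v sv; have lv := smooth_locb sv; have lv1 := smooth_locb (tsmooth_smooth hv).
have p0 := pi_gt0 R.
have ds x : is_derive x 1 (@sinp R) (pi * (cosp x + 1)).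
  by apply: (is_derive_eq (is_derive_sinp (is_derive_id x 1))); ring.
have dc x : is_derive x 1 (@cosp R) (- pi * sinp x).
  by apply: (is_derive_eq (is_derive_cosp (is_derive_id x 1))); ring.
split; split => //.
  exists (fun t x => pi * (cosp (v t x) + 1) * v1 t x); split.
    apply: (DT_comp (G := sinp) (dG := fun x => pi * (cosp x + 1)) (C := pi * pi) (K := pi)) => //.
      move=> a b; rewrite -mulrBr (_ : cosp b + 1 - (cosp a + 1) = cosp b - cosp a); last by ring.
      by rewrite normrM (ger0_norm (ltW p0)) -mulrA ler_wpM2l ?(ltW p0) //; exact: cosp_lip.
    move=> x; rewrite /cosp subrK normrM (ger0_norm (ltW p0)) ler_piMr ?(ltW p0) //.
    by rewrite ler_norml cos_geN1 cos_le1.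
  rewrite (_ : (fun t x => _) = fun t x => pi * (cosp (v t x) * v1 t x) + pi * v1 t x); last first.
    by apply/funext => t; apply/funext => x; ring.
  by apply: tsmooth_add; apply: tsmooth_scale => //; exact: tsmooth_mul.
exists (fun t x => - pi * sinp (v t x) * v1 t x); split.
  apply: (DT_comp (G := cosp) (dG := fun x => - pi * sinp x) (C := pi * pi) (K := pi)) => //.
    by move=> a b; rewrite -mulrBr normrM normrN (ger0_norm (ltW p0)) -mulrA ler_wpM2l ?(ltW p0) //; exact: sinp_lip.
  move=> x; rewrite normrM normrN (ger0_norm (ltW p0)) ler_piMr ?(ltW p0) //.
  by rewrite ler_norml sin_geN1 sin_le1.
rewrite (_ : (fun t x => _) = fun t x => - pi * (sinp (v t x) * v1 t x)); last first.
  by apply/funext => t; apply/funext => x; rewrite mulrA.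
by apply: tsmooth_scale => //; exact: tsmooth_mul.
Qed.

Lemma tsmooth_Gnl n v : tsmooth n v -> tsmooth n (fun t x => Gnl x (v t x)).
Proof.
move=> hv; have [hs hc] := tsmooth_trig hv.
have hb : tsmooth n (fun _ => bump) by apply: tsmooth_cst => k; exact: (KX_bump regular_locb k).1.
have ho : tsmooth n (fun _ => odd_bump) by apply: tsmooth_cst => k; exact: (KX_bump regular_locb k).2.
have -> : (fun t x => Gnl x (v t x)) = (fun t x => v t x + pi^-1 * (cosp (v t x) * odd_bump x +
    (sinp (v t x) * bump x + -1 * sinp (v t x)))).
  by apply/funext => t; apply/funext => x; rewrite Gnl_trig.
apply: tsmooth_add => //; apply: tsmooth_scale; apply: tsmooth_add; first exact: (tsmooth_mul hc ho).
by apply: tsmooth_add; [exact: (tsmooth_mul hs hb)|exact: tsmooth_scale].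
Qed.

End TimeDerivative.

(** * The mild solution satisfies the differential equation and is smooth in time *)

Section MildEvolution.
Context {R : realType}.
Implicit Types (t s x y h a b r e : R) (M C L N K : R) (w v z g f : R -> R -> R) (q : R -> R) (k m n : nat).

Lemma expR_taylor h : 0 <= h -> 0 <= expR (- h) - 1 + h <= h ^+ 2.
Proof.
move=> h0; have d x : is_derive x 1 (fun h => expR (- h)) (- expR (- x)).
  have d1 : is_derive x 1 (fun h : R => - h) (- 1) by apply: is_derive_eq.
  by have := is_derive_comp (g := fun h => - h) (is_derive_expR (- x)) d1; rewrite mulrN1.
have [c /andP[c0 ch]] := mean_value_le h0 d; rewrite subr0 oppr0 expR0 => e.
have [c' /andP[c'0 c'c]] := mean_value_le c0 d; rewrite subr0 oppr0 expR0 => e'.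
have -> : expR (- h) - 1 + h = h * (1 - expR (- c)) by move: e; move: (expR _) (expR _) => p p' e; rewrite e; ring.
have -> : 1 - expR (- c) = expR (- c') * c by rewrite -opprB e' mulNr opprK.
have E1 := expRN_le1 c'0; have E0 : 0 <= expR (- c') := expR_ge0 _.
rewrite !mulr_ge0 //= expr2 ler_wpM2l // (le_trans _ ch) // ler_piMl //.
Qed.

Lemma nb_qc_rate q M0 M2 h : 0 < h -> h <= 1 -> 0 <= M2 -> lamb q M0 M2 ->
  nb (fun x => qc h q x - q x + h * (Lam q x + q x)) (h ^+ 2 * (3 * M0 + M2)).
Proof.
move=> h0 h1 M2' hq; have M0' := nb_ge0 hq.1.
have [E0 E1] := andP (expR_taylor (ltW h0)); have E2 := expRN_le1 (ltW h0); have E3 : 0 <= expR (- h) := expR_ge0 _.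
have n1 := nbZ (expR (- h)) (nb_pc_generator h0 M2' hq).
have n2 := nbZ (expR (- h) - 1 + h) hq.1.
have n3 := nbZ (h * (1 - expR (- h))) (nb_Lam ltr01 hq).
have := nbD (nbD n1 n2) n3.
rewrite (_ : (fun x => _) = fun x => qc h q x - q x + h * (Lam q x + q x)); last first.
  by apply/funext => x; rewrite /qc; move: (expR _) (pc _ _ _) (Lam _ _) => u p l; ring.
move=> hn; apply: (nb_le hn).
rewrite (ger0_norm E3) (ger0_norm E0) (ger0_norm M2') ger0_norm; last by rewrite mulr_ge0 ?subr_ge0 // ltW.
have e1 : 1 - expR (- h) <= h by lra.
have x1 : expR (- h) * (2^-1 * (h ^+ 2 * M2)) <= 2^-1 * (h ^+ 2 * M2).
  by rewrite ler_piMl // mulr_ge0 // mulr_ge0 // sqr_ge0.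
have x2 : (expR (- h) - 1 + h) * M0 <= h ^+ 2 * M0 by rewrite ler_wpM2r.
have x3 : h * (1 - expR (- h)) * (2^-1 * (1 * M2 + 4 * M0 / 1)) <= h ^+ 2 * (2^-1 * (1 * M2 + 4 * M0 / 1)).
  rewrite expr2 -!mulrA ler_wpM2l ?(ltW h0) // ler_wpM2r //.
  by rewrite mulr_ge0 // addr_ge0 // ?mulr_ge0.
apply: (le_trans (lerD (lerD x1 x2) x3)).
by rewrite divr1 mul1r; move: (h ^+ 2) => u; lra.
Qed.

Lemma lamb_le q M0 M2 N0 N2 : lamb q M0 M2 -> M0 <= N0 -> M2 <= N2 -> lamb q N0 N2.
Proof.
move=> [h0 h2] m0 m2; split; first exact: nb_le m0.
by move=> y; apply: (nb_le (h2 y)); rewrite ler_wpM2l ?sqr_ge0.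
Qed.

Lemma nb_qc_lip q M h : 0 < h -> h <= 1 -> 0 <= M -> lamb q M M -> nb (fun x => qc h q x - q x) (h * (8 * M)).
Proof.
move=> h0 h1 M0 hq; have n1 := nb_qc_rate h0 h1 M0 hq.
have n2 := nbZ h (nbD (nb_Lam ltr01 hq) hq.1).
have := nbB n1 n2; rewrite (_ : (fun x => _) = fun x => qc h q x - q x); last by apply/funext => x; ring.
move=> hn; apply: (nb_le hn); rewrite (ger0_norm M0) (ger0_norm (ltW h0)) divr1 mul1r.
have : h ^+ 2 <= h by rewrite expr2 ler_piMl // ltW.
by move: (h ^+ 2) => u hu; nra.
Qed.

Variable v : R -> R -> R.
Hypotheses (sv : smooth v) (hm : mild v (fun t x => Gnl x (v t x))).

Let G t x := Gnl x (v t x).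

Let sG : smooth G. Proof. by move=> k; apply: KX_Gnl; [exact: regular_locb|exact: sv]. Qed.

Definition vel t x : R := -1 * Lam (v t) x + (-1 * v t x + G t x).

Lemma nb_Gnl_diff t t' N : 0 < t -> 0 < t' -> nb (fun x => v t' x - v t x) N -> nb (fun x => G t' x - G t x) (2 * N).
Proof.
move=> t0 t0' hN; rewrite -(ger0_norm (ler0n R 2)); apply: (nb_dom (nbZ 2 hN)).
  by have mG := locb_mfun (smooth_locb sG); apply: measurable_funB; exact: mfun2_1.
by move=> x; rewrite normrM (ger0_norm (ler0n _ 2)); exact: Gnl_lip.
Qed.

Lemma duh_nearby t t' q N K : 0 < t -> t < t' -> nb q K -> 0 <= N ->
  (forall s, t < s -> s < t' -> nb (fun x => qc (t' - s) (G s) x - q x) N) ->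
  nb (fun x => duh t t' G x - (t' - t) * q x) ((t' - t) * N).
Proof.
move=> t0 tt hq N0 h; have mq := nb_mfun hq.
have [Mg hMg] := locb_nb t' (smooth_locb sG) t0.
have mG := locb_mfun (smooth_locb sG).
have -> : (fun x => duh t t' G x - (t' - t) * q x) = (fun x => \I_s (ind t t' s * (qc (t' - s) (G s) x - q x))).
  apply/funext => x.
  have ig : igr (fun s => ind t t' s * qc (t' - s) (G s) x).
    by apply: (igr_duh (C := Mg) mG); apply: dbound_nb => // s s1 s2; apply: hMg; exact: ltW.
  have ig2 : igr (fun s => q x * ind t t' s) by apply: igrZ; exact: igr_ind.
  rewrite /duh mulrC -(I_ind (ltW tt)) -(I_Z _ (igr_ind t t')) -I_B //.
  by apply: eq_I => s; ring.
apply: (nb_minkowski (k := ind t t') (h := fun z : R * R => qc (t' - z.1) (G z.1) z.2 - q z.2)) => //.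
- exact: mfun_ind1.
- by move=> s; exact: ind_ge0.
- by rewrite int_ind // ltW.
- by apply: measurable_funB; [apply: mfun_qc => //; meas|meas].
move=> s; rewrite /ind; case: ifP => [/andP[h1 h2] _|_]; last by rewrite ltxx.
by rewrite /=; exact: (h s h1 h2).
Qed.

Lemma v_lipschitz a b : 0 < a -> exists2 M, 0 <= M & forall t t', a <= t -> t <= t' -> t' <= b -> t' <= t + 1 ->
  nb (fun x => v t' x - v t x) (M * (t' - t)).
Proof.
move=> a0; have [M0 [M2 [M00 M20 hM]]] := smooth_lamb b sv a0.
have [Mg hMg] := locb_nb b (smooth_locb sG) a0.
have mG := locb_mfun (smooth_locb sG).
exists (8 * (M0 + M2) + `|Mg|); first by rewrite addr_ge0 // mulr_ge0 // addr_ge0.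
move=> t t' ta; rewrite le_eqVlt => /predU1P[<- _ _|tt tb t1].
  by rewrite subrr mulr0; under [fun x => _]funext do rewrite subrr; exact: nb0.
have t0 : 0 < t := lt_le_trans a0 ta; have h0 : 0 < t' - t by rewrite subr_gt0.
have h1 : t' - t <= 1 by lra.
have tb' : t <= b by exact: le_trans (ltW tt) tb.
have lq : lamb (v t) (M0 + M2) (M0 + M2) by apply: (lamb_le (hM t ta tb')); rewrite ?lerDl ?lerDr.
have n1 := nb_qc_lip h0 h1 (addr_ge0 M00 M20) lq.
have n2 : nb (duh t t' G) ((t' - t) * `|Mg|).
  apply: nb_duh => //; first exact: ltW.
  move=> s s1 s2; apply: (nb_le (hMg s _ _)); last exact: ler_norm.
    by rewrite (le_trans ta) // ltW.
  by rewrite (le_trans (ltW s2)).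
have := nbD n1 n2; rewrite -mulrDr mulrC; congr (nb _ _); apply/funext => x.
by rewrite (hm t0 x tt); move: (qc _ _ _) (duh _ _ _ _) => p d; ring.
Qed.

Lemma smooth_vel : smooth vel.
Proof.
apply: smooth_add; first by apply: smooth_scale => k; apply: KX_Lam; exact: sv.
by apply: smooth_add => //; exact: smooth_scale.
Qed.

(** Over a short time the semigroup is expanded to first order with quadratic error, and the Duhamel
    integrand is frozen at time t with an error linear in t' - t, hence quadratic after
    integration. *)
Lemma vel_forward a b : 0 < a -> exists2 M, 0 <= M & forall t t', a <= t -> t <= t' -> t' <= b -> t' <= t + 1 ->
  nb (fun x => v t' x - v t x - (t' - t) * vel t x) (M * (t' - t) ^+ 2).
Proof.
move=> a0; have [M0 [M2 [M00 M20 hM]]] := smooth_lamb b sv a0.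
have [N0 [N2 [N00 N20 hN]]] := smooth_lamb b sG a0.
have [L L0 hL] := v_lipschitz b a0.
exists (3 * M0 + M2 + (8 * (N0 + N2) + 2 * L)).
  by rewrite !addr_ge0 ?mulr_ge0 // !addr_ge0.
move=> t t' ta; rewrite le_eqVlt => /predU1P[<- _ _|tt tb t1].
  rewrite subrr expr0n mulr0; under [fun x => _]funext do rewrite subrr mul0r subrr; exact: nb0.
have t0 : 0 < t := lt_le_trans a0 ta; have h0 : 0 < t' - t by rewrite subr_gt0.
have h1 : t' - t <= 1 by lra.
have tb' : t <= b by exact: le_trans (ltW tt) tb.
have n1 := nb_qc_rate h0 h1 M20 (hM t ta tb').
have n2 : nb (fun x => duh t t' G x - (t' - t) * G t x) ((t' - t) * ((t' - t) * (8 * (N0 + N2) + 2 * L))).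
  apply: (duh_nearby (K := N0)) => //; first exact: (hN t ta tb').1.
    by rewrite mulr_ge0 ?(ltW h0) // addr_ge0 // mulr_ge0 // addr_ge0.
  move=> s s1 s2; have sa : a <= s by rewrite (le_trans ta) // ltW.
  have sb : s <= b by rewrite (le_trans (ltW s2)).
  have lq : lamb (G s) (N0 + N2) (N0 + N2) by apply: (lamb_le (hN s sa sb)); rewrite ?lerDl ?lerDr.
  have r0 : 0 < t' - s by rewrite subr_gt0.
  have r1 : t' - s <= 1 by lra.
  have m1 := nb_qc_lip r0 r1 (addr_ge0 N00 N20) lq.
  have s3 : s <= t + 1 by lra.
  have m2 := nb_Gnl_diff t0 (lt_trans t0 s1) (hL t s ta (ltW s1) sb s3).
  have := nbD m1 m2; rewrite (_ : (fun x => _) = fun x => qc (t' - s) (G s) x - G t x); last first.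
    by apply/funext => x; rewrite addrA subrK.
  move=> h; apply: (nb_le h).
  rewrite [leRHS]mulrDr; apply: lerD; first by apply: ler_wpM2r; [rewrite mulr_ge0 // addr_ge0|lra].
  by rewrite mulrA [leRHS]mulrC ler_wpM2l ?mulr_ge0 //; lra.
have := nbD n1 n2; rewrite (_ : (fun x => _) = fun x => v t' x - v t x - (t' - t) * vel t x); last first.
  apply/funext => x; rewrite (hm t0 x tt) /vel.
  by move: (qc _ _ _) (duh _ _ _ _) (Lam _ _) (G t x) (v t x) => p d l g' v'; ring.
move=> h; apply: (nb_le h); rewrite [leRHS]mulrDl mulrA -expr2.
by rewrite mulrC lerD2l mulrC.
Qed.

Lemma vel_continuous a b e : 0 < a -> 0 < e -> exists2 d, 0 < d & forall t t', a <= t -> t <= t' -> t' <= b ->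
  t' - t < d -> nb (fun x => vel t' x - vel t x) e.
Proof.
move=> a0 e0; have [M0 [M2 [M00 M20 hM]]] := smooth_lamb b sv a0.
have [L L0 hL] := v_lipschitz b a0.
(* Second differences of the increment are only bounded; this r makes their share at most e / 2, and
   closeness of t' to t then absorbs the term with 1 / r. *)
pose r := e / (2 * (M2 + 1)); have r0 : 0 < r by rewrite divr_gt0 // mulr_gt0 // ltr_wpDl.
pose C := 2 * L / r + 3 * L + 1; have C0 : 0 < C by rewrite ltr_wpDl // !addr_ge0 // ?mulr_ge0 // ?invr_ge0 ltW.
exists (Num.min 1 (e / (2 * C))); first by rewrite lt_min ltr01 divr_gt0 // mulr_gt0.
move=> t t' ta tt tb; rewrite lt_min => /andP[h1 h2].
have tb' : t <= b by exact: le_trans tt tb.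
have ta' : a <= t' by exact: le_trans ta tt.
have t0 : 0 < t := lt_le_trans a0 ta; have t1 : t' <= t + 1 by lra.
have n1 := hL t t' ta tt tb t1.
have lq : lamb (fun x => v t' x - v t x) (L * (t' - t)) (M2 + M2).
  by split => // y; exact: (lambB (hM t' ta' tb) (hM t ta tb')).2.
have n2 := nbN (nb_Lam r0 lq).
have n3 := nb_Gnl_diff t0 (lt_le_trans t0 tt) n1.
have := nbD n2 (nbD (nbN n1) n3).
rewrite (_ : (fun x => _) = fun x => vel t' x - vel t x); last first.
  apply/funext => x; rewrite (LamB x (hM t' ta' tb) (hM t ta tb')) /vel.
  by move: (Lam _ _) (Lam _ _) (G _ _) (G _ _) => l l' g g'; ring.
move=> h; apply: (nb_le h); rewrite (ger0_norm (addr_ge0 M20 M20)).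
have -> : 2^-1 * (r * (M2 + M2) + 4 * (L * (t' - t)) / r) + (L * (t' - t) + 2 * (L * (t' - t))) =
  r * M2 + (2 * L / r + 3 * L) * (t' - t) by field; rewrite gt_eqF.
have x1 : r * M2 <= e / 2.
  rewrite /r (_ : e / (2 * (M2 + 1)) * M2 = e / 2 * (M2 / (M2 + 1))); last first.
    by field; rewrite gt_eqF // ltr_wpDl.
  rewrite ler_piMr ?divr_ge0 ?(ltW e0) // ler_pdivrMr ?ltr_wpDl // mul1r lerDl //.
have x2 : C * (t' - t) <= e / 2.
  have := ltW h2; rewrite ler_pdivlMr ?mulr_gt0 // => h3.
  by rewrite ler_pdivlMr // (_ : C * (t' - t) * 2 = (t' - t) * (2 * C)) //; ring.
have x3 : (2 * L / r + 3 * L) * (t' - t) <= C * (t' - t).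
  by rewrite ler_wpM2r ?subr_ge0 // /C lerDl.
lra.
Qed.

(** The Duhamel formula looks forward in time. For t' < t the expansion is taken at t', and the
    velocity is then moved from t' to t by its continuity. *)
Lemma DT_vel : DT v vel.
Proof.
move=> a b e a0 e0; have [M M0 hM] := vel_forward b a0.
have e2 : 0 < e / 2 by rewrite divr_gt0.
have [d d0 hd] := vel_continuous b a0 e2.
have q0 : 0 < e / (2 * (M + 1)) by rewrite divr_gt0 // mulr_gt0 // ltr_wpDl.
exists (Num.min (Num.min 1 d) (e / (2 * (M + 1)))); first by rewrite !lt_min ltr01 d0 q0.
have Mb u : 0 <= u -> u < e / (2 * (M + 1)) -> M * u ^+ 2 <= e / 2 * u.
  move=> u0 hu; rewrite expr2 mulrA; apply: ler_wpM2r => //.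
  have := ltW hu; rewrite ler_pdivlMr ?mulr_gt0 ?ltr_wpDl // => h3.
  by rewrite ler_pdivlMr //; nra.
move=> t t' ta tb ta' tb'; rewrite !lt_min => /andP[/andP[h1 h2] h3].
case: (leP t t') => tt.
  have u0 : 0 <= t' - t by rewrite subr_ge0.
  rewrite (ger0_norm u0) in h1 h2 h3 *; have t1 : t' <= t + 1 by lra.
  apply: (nb_le (hM t t' ta tt tb' t1)); apply: (le_trans (Mb _ u0 h3)).
  by rewrite ler_wpM2r //; lra.
have u0 : 0 <= t - t' by rewrite subr_ge0 ltW.
rewrite distrC (ger0_norm u0) in h1 h2 h3 *; have t1 : t <= t' + 1 by lra.
have n1 := nbN (hM t' t ta' (ltW tt) tb t1).
have n2 := nbZ (t - t') (hd t' t ta' (ltW tt) tb h2).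
have := nbD n1 n2; rewrite (_ : (fun x => _) = fun x => v t' x - v t x - (t' - t) * vel t x); last first.
  by apply/funext => x; move: (vel t x) (vel t' x) => p p'; ring.
move=> h; apply: (nb_le h); rewrite (ger0_norm u0).
by have := Mb _ u0 h3; move: (M * _) => m hm'; lra.
Qed.

(** The equation expresses the time derivative of v through operations that preserve [tsmooth n], so
    each round gains one time derivative. *)
Theorem v_tsmooth n : tsmooth n v.
Proof.
elim: n => [|n IH]; first by split.
split => //; exists vel; split; first exact: DT_vel.
apply: tsmooth_add; first by apply: tsmooth_scale; exact: tsmooth_Lam.
by apply: tsmooth_add; [exact: tsmooth_scale|exact: tsmooth_Gnl].
Qed.

End MildEvolution.

(** * The Fourier transform and Sobolev norms *)
Section SquareIntegrable.
Context {R : realType}.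
Implicit Types (t s x y h a b r e : R) (f g k q u w : R -> R).
Notation mu := (@lebesgue_measure R).

(** Here g itself is a Borel function, whereas [in_L2] only asks for a representative; the two are
    related by [in_L2P]. *)
Definition L2 g := mfun g /\ igr (fun x => g x ^+ 2).

Definition n2 g := \I_x (g x ^+ 2).

Lemma n2_ge0 g : 0 <= n2 g. Proof. by apply: I_ge0 => x; exact: sqr_ge0. Qed.

Lemma L2_dom f g (C : R) : L2 g -> mfun f -> (forall x, `|f x| <= C * `|g x|) -> L2 f /\ n2 f <= C ^+ 2 * n2 g.
Proof.
move=> [mg ig] mf fg.
have fg2 x : f x ^+ 2 <= C ^+ 2 * g x ^+ 2.
  rewrite -normK2 -[g x ^+ 2]normK2 -exprMn.
  by rewrite lerXn2r ?nnegrE //; exact: le_trans (fg x).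
have i2 := igrZ (C ^+ 2) ig.
have i1 : igr (fun x => f x ^+ 2).
  by apply: (igr_le _ i2) => [|x]; [meas|rewrite ger0_norm ?sqr_ge0].
by split => //; rewrite /n2 -(I_Z _ ig); apply: I_le.
Qed.

Lemma L2Z c f : L2 f -> L2 (fun x => c * f x) /\ n2 (fun x => c * f x) = c ^+ 2 * n2 f.
Proof.
move=> [mf i1]; have e : (fun x => (c * f x) ^+ 2) = (fun x => c ^+ 2 * f x ^+ 2).
  by apply/funext => x; rewrite exprMn.
split; last by rewrite /n2 e I_Z.
by split; [meas|rewrite e; exact: igrZ].
Qed.

Lemma igr_mul f g : L2 f -> L2 g -> igr (fun x => f x * g x).
Proof.
move=> [mf i1] [mg i2]; apply: (igr_le _ (igrD i1 i2)) => [|x]; first by meas.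
rewrite normrM -[f x ^+ 2]normK2 -[g x ^+ 2]normK2.
have := normr_ge0 (f x); have := normr_ge0 (g x); move: `|f x| `|g x| => p p' h h'.
by have := sqr_ge0 (p - p'); nra.
Qed.

Lemma n2D f g : L2 f -> L2 g -> L2 (fun x => f x + g x) /\
  n2 (fun x => f x + g x) = n2 f + n2 g + 2 * \I_x (f x * g x).
Proof.
move=> hf hg; have i3 := igr_mul hf hg; move: hf hg => [mf i1] [mg i2].
have e : (fun x => (f x + g x) ^+ 2) = (fun x => f x ^+ 2 + g x ^+ 2 + 2 * (f x * g x)).
  by apply/funext => x; ring.
have ig2 := igrZ 2 i3; have i12 := igrD i1 i2.
split; first by split; [meas|rewrite e; exact: igrD].
by rewrite /n2 e I_D // I_D // I_Z.
Qed.

Lemma L2D f g : L2 f -> L2 g -> L2 (fun x => f x + g x).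
Proof. by move=> hf hg; have [] := n2D hf hg. Qed.

Lemma L2N f : L2 f -> L2 (fun x => - f x) /\ n2 (fun x => - f x) = n2 f.
Proof.
move=> hf; have [h1 h2] := L2Z (-1) hf.
have e : (fun x => - f x) = (fun x => -1 * f x) by apply/funext => x; rewrite mulN1r.
by rewrite e h2 sqrrN expr1n mul1r.
Qed.

Lemma L2B f g : L2 f -> L2 g -> L2 (fun x => f x - g x).
Proof. by move=> hf hg; apply: L2D => //; have [] := L2N hg. Qed.

Lemma ip_le f g r : 0 < r -> L2 f -> L2 g -> `|2 * \I_x (f x * g x)| <= r * n2 f + r^-1 * n2 g.
Proof.
move=> r0 hf hg; have i3 := igr_mul hf hg; move: hf hg => [mf i1] [mg i2].
rewrite -(I_Z _ i3) /n2 -(I_Z _ i1) -(I_Z _ i2) -I_D; [|exact: igrZ|exact: igrZ].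
apply: I_bound; [by apply: igrD; exact: igrZ|by meas|] => x.
have -> : r * f x ^+ 2 + r^-1 * g x ^+ 2 = r^-1 * (r * f x - g x) ^+ 2 + 2 * (f x * g x).
  by field; rewrite gt_eqF.
have e : r * f x ^+ 2 + r^-1 * g x ^+ 2 = r^-1 * (r * f x + g x) ^+ 2 - 2 * (f x * g x).
  by field; rewrite gt_eqF.
have q1 : 0 <= r^-1 * (r * f x - g x) ^+ 2 by rewrite mulr_ge0 ?sqr_ge0 // invr_ge0 ltW.
have q2 : 0 <= r^-1 * (r * f x + g x) ^+ 2 by rewrite mulr_ge0 ?sqr_ge0 // invr_ge0 ltW.
have e3 : r^-1 * (r * f x - g x) ^+ 2 + 2 * (f x * g x) = r^-1 * (r * f x + g x) ^+ 2 - 2 * (f x * g x).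
  by field; rewrite gt_eqF.
by rewrite ler_norml; lra.
Qed.

Lemma n2_add f g r : 0 < r -> L2 f -> L2 g ->
  n2 (fun x => f x + g x) <= (1 + r) * n2 f + (1 + r^-1) * n2 g.
Proof.
move=> r0 hf hg; have [_ ->] := n2D hf hg; have := ip_le r0 hf hg.
by rewrite ler_norml => /andP[_]; lra.
Qed.

Lemma n2_add2 f g : L2 f -> L2 g -> n2 (fun x => f x + g x) <= 2 * n2 f + 2 * n2 g.
Proof. by move=> hf hg; have := n2_add ltr01 hf hg; rewrite invr1. Qed.

Lemma n2_sub2 f g : L2 f -> L2 g -> n2 (fun x => f x - g x) <= 2 * n2 f + 2 * n2 g.
Proof. by move=> hf hg; have [h e] := L2N hg; rewrite -e; exact: n2_add2. Qed.

Lemma n2_cvg (u : nat -> R -> R) w : (forall n, L2 (u n)) -> L2 w ->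
  n2 (fun x => u n x - w x) @[n --> \oo] --> (0 : R) -> n2 (u n) @[n --> \oo] --> n2 w.
Proof.
move=> hu hw cv; apply/cvgrPdist_le => e e0.
pose r := e / (2 * (n2 w + 1)); have n0 := n2_ge0 w.
have r0 : 0 < r by rewrite divr_gt0 // mulr_gt0 // ltr_wpDl.
have q0 : 0 < e / (2 * (1 + r^-1)) by rewrite divr_gt0 // mulr_gt0 // addr_gt0 // invr_gt0.
near=> n.
have hn : n2 (fun x => u n x - w x) < e / (2 * (1 + r^-1)) by near: n; exact: (cvgr_lt _ cv).
have hd := L2B (hu n) hw; have [_ E] := n2D hw hd.
have -> : n2 w - n2 (u n) = - (n2 (fun x => u n x - w x) + 2 * \I_x (w x * (u n x - w x))).
  rewrite (_ : n2 (u n) = n2 (fun x => w x + (u n x - w x))); last first.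
    by congr n2; apply/funext => x; rewrite addrC subrK.
  by rewrite E; ring.
rewrite normrN; apply: (le_trans (ler_normD _ _)).
rewrite (ger0_norm (n2_ge0 _)).
have h1 := ip_le r0 hw hd.
have h2 : r * n2 w <= e / 2.
  rewrite /r (_ : e / (2 * (n2 w + 1)) * n2 w = e / 2 * (n2 w / (n2 w + 1))); last first.
    by field; rewrite gt_eqF // ltr_wpDl.
  by rewrite ler_piMr ?divr_ge0 ?(ltW e0) // ler_pdivrMr ?ltr_wpDl // mul1r lerDl.
have h3 : (1 + r^-1) * n2 (fun x => u n x - w x) <= e / 2.
  have p : 0 < 1 + r^-1 by rewrite addr_gt0 // invr_gt0.
  have := ltW hn; rewrite ler_pdivlMr ?mulr_gt0 // => h; rewrite ler_pdivlMr //.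
  by rewrite (_ : _ * 2 = n2 (fun x => u n x - w x) * (2 * (1 + r^-1))) //; ring.
by move: h1 h2 h3; rewrite mulrDl mul1r; lra.
Unshelve. all: by end_near. Qed.

Lemma L2_shift c g : L2 g -> L2 (fun x => g (x + c)) /\ n2 (fun x => g (x + c)) = n2 g.
Proof.
move=> [mg ig]; split; last by rewrite /n2 (I_shift c (f := fun x => g x ^+ 2)) //; meas.
by split; [meas|exact: (igr_shift c ig)].
Qed.

Lemma n2_ereal g : L2 g -> (\int[mu]_x (g x ^+ 2)%:E = (n2 g)%:E)%E.
Proof. by move=> [_ ig]; exact: I_fin. Qed.

Lemma n2_superpose k (h : R * R -> R) (A : R) : (forall y, 0 <= k y) -> igr k -> 0 < A -> \I_y k y <= A ->
  mfun h -> (forall y, L2 (fun x => h (y, x))) -> igr (fun y => k y * n2 (fun x => h (y, x))) ->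
  L2 (fun x => \I_y (k y * h (y, x))) /\
  n2 (fun x => \I_y (k y * h (y, x))) <= A * \I_y (k y * n2 (fun x => h (y, x))).
Proof.
move=> k0 ik A0 hA mh hL igk; have mk := igr_mfun ik.
have hA' : (\int[mu]_y (k y)%:E <= A%:E)%E by rewrite I_fin // lee_fin.
pose F := fun z : R * R => k z.2 * h (z.2, z.1).
have mF : mfun F by rewrite /F; meas.
have mI : mfun (fun x => \I_y (k y * h (y, x))) := measurable_I mF.
suff H : (\int[mu]_x ((\I_y (k y * h (y, x))) ^+ 2)%:E <= (A * \I_y (k y * n2 (fun x => h (y, x))))%:E)%E.
  have m2 : mfun (fun x => (\I_y (k y * h (y, x))) ^+ 2) by exact: measurable_funX.
  have [i1 i2] := I_le_ereal m2 (fun x => sqr_ge0 _) H.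
  by split => //; split.
apply: le_trans (superpose_sqr mk k0 A0 hA' mh) _.
rewrite EFinM; apply: lee_wpmul2l; first by rewrite lee_fin ltW.
rewrite -(I_fin igk) le_eqVlt; apply/orP; left; apply/eqP; apply: eq_integral => y _.
by rewrite EFinM (n2_ereal (hL y)).
Qed.

Lemma L2_pint g : L2 g -> pint g. Proof. by move=> [mg ig]; exact: pint_sqr. Qed.

Lemma measurable_n2 d (T : measurableType d) (F : T * R -> R) : mfun F -> mfun (fun z : T => n2 (fun x => F (z, x))).
Proof. by move=> mF; apply: (measurable_I (F := fun z => F z ^+ 2)); exact: measurable_funX. Qed.

Lemma n2_pc_sub t g : 0 < t -> L2 g -> L2 (fun x => pc t g x - g x) /\
  n2 (fun x => pc t g x - g x) <= \I_y (P t y * n2 (fun x => g (x + y) - g x)).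
Proof.
move=> t0 hg; have mg := hg.1; have pg := L2_pint hg.
have mP := @mfun_P R t.
have -> : (fun x => pc t g x - g x) = (fun x => \I_y (P t y * (g (x + y) - g x))).
  apply/funext => x.
  have i1 : igr (fun y => P t y * g (x + y)).
    have := igr_reflect 0 (igr_reflect x (pg.2 t x t0)).
    rewrite (_ : (fun y => _) = fun y => P t y * g (x + y)) //.
    by apply/funext => y /=; rewrite sub0r opprK opprD addrA subrr add0r PN.
  rewrite (_ : pc t g x = \I_y (P t y * g (x + y))); last first.
    rewrite pcE // -(I_reflect 0); last by meas.
    by apply: eq_I => y; rewrite sub0r PN opprK.
  rewrite -[X in _ - X]mulr1 -(I_P t0) -(I_Z _ (igr_P t0)) -I_B //; last by apply: igrZ; exact: igr_P.
  by apply: eq_I => y; ring.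
rewrite -[X in _ <= X]mul1r.
apply: (n2_superpose (h := fun z => g (z.2 + z.1) - g z.2)) => //.
- by move=> y; pos.
- exact: igr_P.
- by rewrite I_P.
- by meas.
- by move=> y; apply: L2B => //; have [] := L2_shift y hg.
apply: (igr_le _ (igrZ (4 * n2 g) (igr_P t0))) => [|y].
  apply: measurable_funM => //.
  by apply: (measurable_n2 (F := fun z => g (z.2 + z.1) - g z.2)); meas.
rewrite /= ger0_norm; last by apply: mulr_ge0; [pos|exact: n2_ge0].
rewrite mulrC; apply: ler_wpM2r; first by pos.
have [h1 h2] := L2_shift y hg; have := n2_sub2 h1 hg; rewrite h2; lra.
Qed.

Lemma L2_pc t g : 0 < t -> L2 g -> L2 (pc t g).
Proof.
move=> t0 hg; have [h _] := n2_pc_sub t0 hg; have := L2D h hg.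
by congr L2; apply/funext => x; rewrite subrK.
Qed.

Definition trunc_fun (N : nat) g x : R := ind (- N%:R) N%:R x * (if `|g x| < N%:R then g x else 0).

Lemma trunc_fun_le N g x : `|trunc_fun N g x| <= N%:R.
Proof.
rewrite /trunc_fun /ind; case: ifP => _; last by rewrite mul0r normr0.
by rewrite mul1r; case: ifP => [/ltW|_] //; rewrite normr0.
Qed.

Lemma mfun_trunc N g : mfun g -> mfun (trunc_fun N g).
Proof.
move=> mg; apply: measurable_funM; first exact: mfun_ind1.
by apply: measurable_fun_ifT => //; apply: measurable_fun_ltr; meas.
Qed.

Lemma trunc_near g x : \forall N \near \oo, trunc_fun N g x = g x.
Proof.
near=> N; have h : `|x| + `|g x| < N%:R by near: N; exact: nbhs_infty_gtr.
have x0 := normr_ge0 x; have g0 := normr_ge0 (g x).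
rewrite /trunc_fun /ind.
have -> : (- N%:R < x) && (x < N%:R) by rewrite -ltr_norml; lra.
by rewrite mul1r ifT //; lra.
Unshelve. all: by end_near. Qed.

Lemma L2_trunc_cvg g : L2 g -> (forall N, L2 (trunc_fun N g)) /\
  n2 (fun x => trunc_fun N g x - g x) @[N --> \oo] --> (0 : R).
Proof.
move=> hg; have [mg ig] := hg.
have tle N x : `|trunc_fun N g x| <= 1 * `|g x|.
  rewrite mul1r /trunc_fun normrM (ger0_norm (ind_ge0 _ _ _)).
  by rewrite /ind; case: ifP => _; rewrite ?mul0r // mul1r; case: ifP => // _; rewrite normr0.
split; first by move=> N; have [] := L2_dom hg (mfun_trunc N mg) (tle N).
rewrite -[X in _ --> X](@I_0 R); apply: (I_cvg (g := fun x => 4 * g x ^+ 2)).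
- by move=> N; have m := mfun_trunc N mg; meas.
- exact: igrZ.
- move=> N x; rewrite ger0_norm ?sqr_ge0 //.
  have h : `|trunc_fun N g x - g x| <= 2 * `|g x|.
    by apply: (le_trans (ler_normB _ _)); have := tle N x; lra.
  rewrite -normK2 -[g x ^+ 2]normK2.
  by have := normr_ge0 (trunc_fun N g x - g x); have := normr_ge0 (g x); move: h; move: `|_| `|_| => p p' *; nra.
move=> x; apply: cvg_near_cst; near=> N.
have -> : trunc_fun N g x = g x by near: N; exact: trunc_near.
by rewrite subrr expr0n.
Unshelve. all: by end_near. Qed.

End SquareIntegrable.

(** * Plancherel's identity for integrable functions in L^2 *)

Section Plancherel.
Context {R : realType}.
Implicit Types (t s x y h a b r e : R) (f g k q u w : R -> R).
Notation mu := (@lebesgue_measure R).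

(** The square of e^{p/2} >= 1 + p/2 gives e^p >= 1 + p^2 / 4, so the function lies below a multiple
    of P_1. *)
Lemma igr_expN e : 0 < e -> igr (fun x => expR (- (e * `|x|))).
Proof.
move=> e0; apply: (igr_le _ (igrZ ((1 + 4 / e ^+ 2) * pi) (igr_P ltr01))) => [|x]; first by meas.
rewrite (ger0_norm (expR_ge0 _)) /P expr1n expRN.
have h : 1 + e ^+ 2 * x ^+ 2 / 4 <= expR (e * `|x|).
  have -> : e * `|x| = 2^-1 * (e * `|x|) + 2^-1 * (e * `|x|) by field.
  have p0 : 0 <= e * `|x| by rewrite mulr_ge0 // ltW.
  have -> : e ^+ 2 * x ^+ 2 = (e * `|x|) ^+ 2 by rewrite exprMn real_normK // num_real.
  rewrite expRD; move: (e * `|x|) p0 => p p0.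
  have := expR_ge1Dx (2^-1 * p); move: (expR _) => E hE.
  have h2 : (1 + 2^-1 * p) * (1 + 2^-1 * p) <= E * E by apply: ler_pM => //; lra.
  by apply: le_trans h2; rewrite expr2; lra.
have x2 := sqr_ge0 x; have e2 : 0 < e ^+ 2 by rewrite exprn_gt0.
have -> : (1 + 4 / e ^+ 2) * pi * (pi^-1 * (1 / (1 + x ^+ 2))) = (1 + 4 / e ^+ 2) / (1 + x ^+ 2).
  by rewrite mul1r mulrA mulfK // gt_eqF // pi_gt0.
rewrite ler_pdivlMr ?ltr_pwDl // mulrC ler_pdivrMr ?expR_gt0 //.
apply: (@le_trans _ _ ((1 + 4 / e ^+ 2) * (1 + e ^+ 2 * x ^+ 2 / 4))); last first.
  by rewrite ler_wpM2l // addr_ge0 // divr_ge0 // ltW.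
have -> : (1 + 4 / e ^+ 2) * (1 + e ^+ 2 * x ^+ 2 / 4) = 1 + x ^+ 2 + (e ^+ 2 * x ^+ 2 / 4 + 4 / e ^+ 2).
  by move: e2 => /gt_eqF /negbT; move: (e ^+ 2) (x ^+ 2) => E X E0; field.
by rewrite lerDl; apply: addr_ge0; apply: divr_ge0 => //; [apply: mulr_ge0 => //; exact: ltW|exact: ltW].
Qed.

Lemma I_punct f g (c : R) : igr f -> mfun g -> (forall x, x != c -> f x = g x) ->
  igr g /\ \I_x g x = \I_x f x.
Proof.
move=> igf mg fg; have mf := igr_mfun igf.
have aeq (p q : R -> \bar R) : (forall x, x != c -> p x = q x) -> {ae mu, forall x, setT x -> p x = q x}.
  move=> pq; exists [set c]; split => //; first exact: lebesgue_measure_set1.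
  by move=> x /= /not_implyP [_ hs]; apply: contrapT => /eqP xc; apply: hs; rewrite pq.
have mfE : mfun (EFin \o f) by exact/measurable_EFinP.
have mgE : mfun (EFin \o g) by exact/measurable_EFinP.
split; last first.
  have e : (\int[mu]_x (f x)%:E = \int[mu]_x (g x)%:E)%E by apply: ae_eq_integral => //; apply: aeq => x /fg /= ->.
  by rewrite /Rintegral e.
apply: igrP => //; apply: le_lt_trans (igr_lty igf).
rewrite le_eqVlt; apply/orP; left; apply/eqP; apply: ae_eq_integral => //; [by apply/measurable_EFinP; meas|by apply/measurable_EFinP; meas|].
by apply: aeq => x /fg /= ->.
Qed.

Lemma half_kernel e z : 0 < e ->
  \I_x (if 0 < x then expR (- (e * `|x|)) * cos (z * x) else 0) = e / (e ^+ 2 + z ^+ 2).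
Proof.
move=> e0; pose Q x : R := expR (- (e * x)) * cos (z * x).
pose D := e ^+ 2 + z ^+ 2; have D0 : 0 < D by rewrite ltr_pwDl ?exprn_gt0 // sqr_ge0.
pose A x : R := D^-1 * (expR (- (e * x)) * (z * sin (z * x) - e * cos (z * x))).
have mQ : mfun Q by apply: measurable_funM; [meas|apply: (measurableT_comp (continuous_measurable_fun (@continuous_cos R))); meas].
have dA x : is_derive x 1 A (Q x).
  have d1 : is_derive x 1 (fun y => expR (- (e * y))) (- e * expR (- (e * x))).
    have h : is_derive x 1 (fun y => - (e * y)) (- e) by apply: is_derive_eq; rewrite /GRing.scale /=; ring.
    by rewrite mulrC; exact: (is_derive_comp (g := fun y => - (e * y)) (is_derive_expR (- (e * x))) h).
  have dz : is_derive x 1 (fun y => z * y) z by apply: is_derive_eq; rewrite /GRing.scale /=; ring.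
  have d2 := is_derive_comp (g := fun y => z * y) (is_derive_sin (z * x)) dz.
  have d3 := is_derive_comp (g := fun y => z * y) (is_derive_cos (z * x)) dz.
  rewrite /A /Q; apply: is_derive_eq; rewrite /GRing.scale /=.
  move: (gt_eqF D0) => /negbT; rewrite /D; move: (expR _) (sin _) (cos _) => E S C n0.
  by field.
have cQ x : {for x, continuous Q}.
  have dz : is_derive x 1 (fun y => z * y) z by apply: is_derive_eq; rewrite /GRing.scale /=; ring.
  have d3 := is_derive_comp (g := fun y => z * y) (is_derive_cos (z * x)) dz.
  have h : is_derive x 1 (fun y => - (e * y)) (- e) by apply: is_derive_eq; rewrite /GRing.scale /=; ring.
  have d1 := is_derive_comp (g := fun y => - (e * y)) (is_derive_expR (- (e * x))) h.
  apply: differentiable_continuous; apply/derivable1_diffP.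
  by apply: (@derivableM _ _ (fun y : R => expR (- (e * y))) (fun y : R => cos (z * y))); [have [] := d1|have [] := d3].
have c1 : \I_x (ind 0 n.+1%:R x * Q x) @[n --> \oo] --> \I_x (if 0 < x then expR (- (e * `|x|)) * cos (z * x) else 0).
  apply: (I_cvg (g := fun x => expR (- (e * `|x|)))).
  - by move=> n; apply: measurable_funM => //; exact: mfun_ind1.
  - exact: igr_expN.
  - move=> n x; rewrite /ind /Q; case: ifP => [/andP[x0 _]|_]; last by rewrite mul0r normr0 expR_ge0.
    rewrite mul1r normrM !(ger0_norm (expR_ge0 _)) (ger0_norm (ltW x0)).
    by rewrite ler_piMr ?expR_ge0 // ler_norml cos_geN1 cos_le1.
  move=> x; apply: cvg_near_cst; near=> n; rewrite /ind.
  have -> : (x < n.+1%:R) by rewrite (lt_trans (_ : x < n%:R)) ?ltr_nat //; near: n; exact: nbhs_infty_gtr.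
  by rewrite andbT; case: ifP => [x0|_]; rewrite ?mul0r // mul1r (ger0_norm (ltW x0)).
have A0 : A 0 = - (e / D).
  by rewrite /A !mulr0 oppr0 expR0 sin0 cos0; move: (gt_eqF D0) => /negbT n0; field.
have c2 : \I_x (ind 0 n.+1%:R x * Q x) @[n --> \oo] --> e / D.
  have E n : \I_x (ind 0 n.+1%:R x * Q x) = A n.+1%:R - A 0.
    by have [_ ->] := I_ind_FTC (ler0n R n.+1) (fun x _ _ => dA x) (fun x _ _ => cQ x) mQ.
  rewrite [X in X @ _ --> _](_ : _ = (fun n : nat => A n.+1%:R - A 0)); last by apply/funext.
  rewrite -[X in _ --> X]add0r -[e / D]opprK -A0; apply: cvgB; last exact: cvg_cst.
  apply: norm_cvg0; apply: (squeeze_cvgr (f := fun=> 0) (h := fun n : nat => D^-1 * (`|z| + e) * e^-1 * hstep n)).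
  - apply: nearW => n; rewrite normr_ge0 /= /A normrM (ger0_norm (_ : 0 <= D^-1)); last by rewrite invr_ge0 ltW.
    rewrite -!mulrA ler_pM2l ?invr_gt0 // normrM (ger0_norm (expR_ge0 _)) mulrC.
    apply: ler_pM; [by []|exact: expR_ge0| |].
      apply: (le_trans (ler_normB _ _)); rewrite !normrM (ger0_norm (ltW e0)); apply: lerD.
        by rewrite ler_piMr // ler_norml sin_geN1 sin_le1.
      by rewrite ler_piMr ?(ltW e0) // ler_norml cos_geN1 cos_le1.
    rewrite expRN /hstep -invfM lef_pV2 ?posrE ?expR_gt0 ?mulr_gt0 //.
    by apply: le_trans (expR_ge1Dx _); rewrite lerDr.
  - exact: cvg_cst.
  rewrite -[X in _ --> X](mulr0 (D^-1 * (`|z| + e) * e^-1)); apply: cvgM; [exact: cvg_cst|exact: hstep_cvg].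
exact: (cvg_unique _ c1 c2).
Unshelve. all: by end_near. Qed.

(** The two half-lines contribute equally, and the point 0, which neither covers, has measure zero.
    Read as a Fourier transform: that of e^{-e|x|} is 2 pi P_e. *)
Lemma I_kernel e z : 0 < e -> \I_x (expR (- (e * `|x|)) * cos (z * x)) = 2 * pi * P e z.
Proof.
move=> e0; pose H x : R := if 0 < x then expR (- (e * `|x|)) * cos (z * x) else 0.
have mc : mfun (fun x : R => cos (z * x)).
  by apply: (measurableT_comp (continuous_measurable_fun (@continuous_cos R))); meas.
have mH : mfun H.
  apply: measurable_fun_ifT => //; [by apply: measurable_fun_ltr; meas|by apply: measurable_funM => //; meas].
have iH : igr H.
  apply: (igr_le mH (igr_expN e0)) => x; rewrite /H; case: ifP => _; last by rewrite normr0 expR_ge0.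
  rewrite normrM (ger0_norm (expR_ge0 _)) ler_piMr ?expR_ge0 // ler_norml cos_geN1 cos_le1 //.
have iHN := igr_reflect 0 iH.
have mK : mfun (fun x => expR (- (e * `|x|)) * cos (z * x)) by apply: measurable_funM => //; meas.
have hx x : x != 0 -> H x + H (0 - x) = expR (- (e * `|x|)) * cos (z * x).
  by rewrite sub0r /H oppr_gt0 normrN mulrN cosN; case: ltgtP => // _ _; rewrite ?addr0 ?add0r.
have [_ ->] := I_punct (igrD iH iHN) mK hx.
rewrite I_D // I_reflect // half_kernel // /P.
by rewrite -mulrA mulVKf ?gt_eqF ?pi_gt0 // mulr_natl mulr2n.
Qed.

(** [FC q] and the opposite of [FS q] are the real and imaginary parts of the Fourier transform of
    q, and [rho q] is its squared modulus. *)
Definition FC q x := \I_y (q y * cos (y * x)).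
Definition FS q x := \I_y (q y * sin (y * x)).
Definition rho q x := FC q x ^+ 2 + FS q x ^+ 2.

Lemma mfun_cos : mfun (cos : R -> R).
Proof. exact: continuous_measurable_fun (@continuous_cos R). Qed.

Lemma mfun_sin : mfun (sin : R -> R).
Proof. exact: continuous_measurable_fun (@continuous_sin R). Qed.

Lemma cos_abs x : `|cos x| <= 1. Proof. by rewrite ler_norml cos_geN1 cos_le1. Qed.
Lemma sin_abs x : `|sin x| <= 1. Proof. by rewrite ler_norml sin_geN1 sin_le1. Qed.

Lemma igr_mul1 q f : igr q -> mfun f -> (forall x, `|f x| <= 1) -> igr (fun x => q x * f x).
Proof.
move=> iq mf f1; have mq := igr_mfun iq; apply: (igr_le _ (igr_abs iq)) => [|x]; first by meas.
by rewrite normrM ler_piMr.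
Qed.

Lemma igr_FC q x : igr q -> igr (fun y => q y * cos (y * x)).
Proof. by have mc := mfun_cos => iq; apply: igr_mul1 => // [|y]; [meas|exact: cos_abs]. Qed.

Lemma igr_FS q x : igr q -> igr (fun y => q y * sin (y * x)).
Proof. by have mc := mfun_sin => iq; apply: igr_mul1 => // [|y]; [meas|exact: sin_abs]. Qed.

Lemma mfun_FC q : mfun q -> mfun (FC q).
Proof. by have mc := mfun_cos => mq; apply: (measurable_I (F := fun z => q z.2 * cos (z.2 * z.1))); meas. Qed.

Lemma mfun_FS q : mfun q -> mfun (FS q).
Proof. by have mc := mfun_sin => mq; apply: (measurable_I (F := fun z => q z.2 * sin (z.2 * z.1))); meas. Qed.

Lemma fin_prod f g (F : R * R -> R) : igr f -> igr g -> mfun F ->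
  (forall x y, `|F (x, y)| <= `|f x| * `|g y|) -> (\int[mu]_x \int[mu]_y (`|F (x, y)|)%:E < +oo)%E.
Proof.
move=> i1 i2 mF h; have m1 := igr_mfun i1; have m2 := igr_mfun i2.
apply: (@le_lt_trans _ _ (\int[mu]_x ((`|f x|)%:E * (\I_y `|g y|)%:E)%E)%E).
  apply: ge0_le_integral => //.
  - by move=> x _; apply: integral_ge0 => y _; rewrite lee_fin.
  - by apply: (measurable_int_param (F := fun z => `|F z|)) => //; meas.
  - by apply/measurable_EFinP; meas.
  move=> x _; rewrite -I_fin; last exact: igr_abs.
  rewrite -ge0_integralZl //; last by apply/measurable_EFinP; meas.
  apply: ge0_le_integral => //.
  - by apply/measurable_EFinP; meas.
  - by apply/measurable_EFinP; meas.
  - by move=> y _; rewrite -EFinM lee_fin.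
rewrite ge0_integralZr //; last 2 first.
- by apply/measurable_EFinP; meas.
- by rewrite lee_fin; apply: I_ge0.
by rewrite I_fin; [rewrite -EFinM ltry|exact: igr_abs].
Qed.

Lemma phase_split q a x : igr q ->
  \I_y (q y * cos ((a - y) * x)) = cos (a * x) * FC q x + sin (a * x) * FS q x.
Proof.
move=> iq; rewrite /FC /FS -(I_Z _ (igr_FC x iq)) -(I_Z _ (igr_FS x iq)) -I_D; last 2 first.
- by apply: igrZ; exact: igr_FC.
- by apply: igrZ; exact: igr_FS.
by apply: eq_I => y; rewrite mulrBl cosB; ring.
Qed.

Lemma rhoE q x : igr q -> rho q x = \I_a (q a * \I_y (q y * cos ((a - y) * x))).
Proof.
move=> iq; rewrite (_ : (fun a => _) = fun a => FC q x * (q a * cos (a * x)) + FS q x * (q a * sin (a * x))).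
  have i1 := igr_FC x iq; have i2 := igr_FS x iq.
  by rewrite I_D ?I_Z //; exact: igrZ.
by apply/funext => a; rewrite phase_split //; ring.
Qed.

Lemma igr_Pq e q x : igr q -> 0 < e -> igr (fun y => P e (x - y) * q y).
Proof.
move=> iq e0; have mq := igr_mfun iq.
apply: (igr_le _ (igrZ (pi * e)^-1 (igr_abs iq))) => [|y]; first by meas2.
by rewrite normrM ler_wpM2r // ger0_norm ?P_le //; pos.
Qed.

Lemma pc_igr_bound e q x : 0 < e -> igr q -> `|pc e q x| <= (pi * e)^-1 * \I_y `|q y|.
Proof.
move=> e0 iq; have mq := igr_mfun iq; rewrite /pc -(I_Z _ (igr_abs iq)).
apply: I_bound; [exact: igrZ (igr_abs iq)|by meas2|move=> y].
by rewrite normrM ler_wpM2r // ger0_norm ?P_le //; pos.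
Qed.

Lemma igr_mul_pc e q : 0 < e -> igr q -> igr (fun x => q x * pc e q x).
Proof.
move=> e0 iq; have mq := igr_mfun iq; have mpc := mfun_pc1 e mq.
apply: (igr_le _ (igrZ ((pi * e)^-1 * \I_y `|q y|) (igr_abs iq))) => [|x]; first by meas.
by rewrite normrM mulrC ler_wpM2r // pc_igr_bound.
Qed.

(** Plancherel's identity regularised by a damping factor, which makes both exchanges of integrals
    absolutely convergent; the damping turns into a Poisson kernel by [I_kernel]. *)
Lemma I_rho e q : 0 < e -> igr q -> \I_x (expR (- (e * `|x|)) * rho q x) = 2 * pi * \I_x (q x * pc e q x).
Proof.
move=> e0 iq; have mq := igr_mfun iq; have iE := igr_expN e0; have mc := mfun_cos.
pose K := \I_y `|q y|; pose Gh a x := \I_y (q y * cos ((a - y) * x)).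
have mG : mfun (fun z : R * R => Gh z.1 z.2).
  rewrite (_ : (fun z => _) = fun z : R * R => cos (z.1 * z.2) * FC q z.2 + sin (z.1 * z.2) * FS q z.2).
    move: (mfun_FC mq) (mfun_FS mq) mfun_sin mc; move: (FC q) (FS q) (@cos R) (@sin R) => c1 s1 c2 s2 m1 m2 m3 m4; by meas.
  by apply/funext => z; rewrite /Gh phase_split.
have mGx x : mfun (fun a => Gh a x) by apply: (mfun2_comp (g := Gh)).
have G1 a x : `|Gh a x| <= K.
  apply: I_bound; [exact: igr_abs|by meas|move=> y]; by rewrite normrM ler_piMr // cos_abs.
pose F1 z : R := expR (- (e * `|z.1|)) * (q z.2 * Gh z.2 z.1).
have mF1 : mfun (F1 : R * R -> R).
  rewrite /F1; apply: measurable_funM; first by meas.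
  apply: measurable_funM; first by meas.
  exact: (measurableT_comp mG (measurable_fun_pair measurable_snd measurable_fst)).
have fin1 : (\int[mu]_x \int[mu]_y (`|F1 (x, y)|)%:E < +oo)%E.
  apply: (fin_prod iE (igrZ K iq)) => // x y; rewrite /F1 /= normrM ler_wpM2l //.
  rewrite normrM mulrC [leRHS]normrM; apply: ler_wpM2r => //.
  by rewrite (le_trans (G1 _ _)) // ler_norm.
have [_ _ S1] := I_swap mF1 fin1.
transitivity (\I_x \I_y F1 (x, y)).
  apply: eq_I => x.
  have iqG : igr (fun a => q a * Gh a x).
    apply: (igr_le _ (igrZ K (igr_abs iq))) => [|y]; first by apply: measurable_funM.
    by rewrite normrM mulrC ler_wpM2r // G1.
  by rewrite (rhoE x iq) -(I_Z _ iqG).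
rewrite S1 -I_Z; last exact: igr_mul_pc.
apply: eq_I => a.
have iEG : igr (fun x => expR (- (e * `|x|)) * Gh a x).
  apply: (igr_le _ (igrZ K iE)) => [|x]; first by apply: measurable_funM; [meas|apply: (mfun2_comp (g := Gh))].
  by rewrite normrM mulrC (ger0_norm (expR_ge0 _)) ler_wpM2r ?expR_ge0.
rewrite /F1 /= (_ : (fun x => _) = fun x => q a * (expR (- (e * `|x|)) * Gh a x)); last by apply/funext => x; ring.
rewrite (I_Z _ iEG) mulrCA; congr (_ * _).
pose F2 z : R := expR (- (e * `|z.1|)) * (q z.2 * cos ((a - z.2) * z.1)).
have mF2 : mfun (F2 : R * R -> R) by rewrite /F2; meas.
have fin2 : (\int[mu]_x \int[mu]_y (`|F2 (x, y)|)%:E < +oo)%E.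
  apply: (fin_prod iE iq mF2) => x y; rewrite /F2 /= normrM; apply: ler_wpM2l; first exact: normr_ge0.
  by rewrite normrM ler_piMr ?normr_ge0 ?cos_abs.
have [_ _ S2] := I_swap mF2 fin2.
transitivity (\I_x \I_y F2 (x, y)).
  apply: eq_I => x; rewrite /F2 /= I_Z; first by [].
  by apply: (igr_mul1 iq) => [|y]; [meas|exact: cos_abs].
rewrite S2 /pc -(I_Z _ (igr_Pq a iq e0)).
apply: eq_I => y.
have iEc : igr (fun x => expR (- (e * `|x|)) * cos ((a - y) * x)).
  by apply: (igr_mul1 iE) => [|x]; [meas|exact: cos_abs].
rewrite mulrA -(I_kernel _ e0) mulrC -(I_Z _ iEc).
by apply: eq_I => x; rewrite /F2 /=; ring.
Qed.

(** A cutoff and, in the next lemma, a clipping to [-a, a], both written with absolute values so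
    that their continuity is immediate. *)
Lemma ramp_facts (v : R) : [/\ v <= 0 -> 2^-1 * (`|v| - `|v - 1| + 1) = 0, 1 <= v -> 2^-1 * (`|v| - `|v - 1| + 1) = 1 &
  0 <= 2^-1 * (`|v| - `|v - 1| + 1) <= 1].
Proof.
split=> [h|h|].
- by rewrite (ler0_norm h) ler0_norm; lra.
- by rewrite ger0_norm ?ger0_norm; lra.
by case: (ger0P v) => h1; case: (ger0P (v - 1)) => h2; apply/andP; split; lra.
Qed.

Lemma clip_facts (a v : R) : 0 <= a -> [/\ `|2^-1 * (`|v + a| - `|v - a|)| <= a,
  `|2^-1 * (`|v + a| - `|v - a|)| <= `|v| & forall w : R, `|w| <= a -> `|2^-1 * (`|v + a| - `|v - a|) - w| <= `|v - w|].
Proof.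
move=> a0; have key (w : R) : `|w| <= a -> `|2^-1 * (`|v + a| - `|v - a|) - w| <= `|v - w|.
  rewrite ler_norml => /andP[w1 w2].
  case: (ger0P (v + a)) => h1; case: (ger0P (v - a)) => h2; case: (ger0P (v - w)) => h3; rewrite ler_norml; apply/andP; split; lra.
split => //.
  by case: (ger0P (v + a)) => h1; case: (ger0P (v - a)) => h2; rewrite ler_norml; apply/andP; split; lra.
by have := key 0; rewrite normr0 !subr0; exact.
Qed.

(** After truncation g is bounded with bounded support, hence approximable in L^1 by continuous
    functions; clipping and cutting off make the approximant bounded and supported in a compact set,
    and boundedness converts L^1 closeness into L^2 closeness. *)
Lemma L2_dense g e : L2 g -> 0 < e -> exists k, [/\ continuous k, exists M : R, forall x, `|k x| <= M,
  igr k, L2 k & n2 (fun x => k x - g x) <= e].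
Proof.
move=> hg e0; have [Lt ct] := L2_trunc_cvg hg.
have e4 : 0 < e / 4 by rewrite divr_gt0.
have [N _ hN] := @cvgr_lt _ _ _ _ _ _ ct _ e4.
have {hN} hN := hN N (leqnn N); set f := trunc_fun N g in hN.
have Lf : L2 f := Lt N; have mf := Lf.1.
pose a : R := N%:R; have a0 : 0 <= a by rewrite ler0n.
pose E := `[- (a + 1), a + 1]%classic : set R.
have mE : measurable E := measurable_itv _.
have Efin : (mu E < +oo)%E by rewrite /E lebesgue_measure_itv /=; case: ifP => _; rewrite ?ltry.
have iF : mu.-integrable E (EFin \o f).
  apply: measurable_bounded_integrable => //; first exact: measurable_funTS.
  exists a; split; first exact: num_real.
  by move=> M aM x _; apply: le_trans (ltW aM); exact: trunc_fun_le.
have [g_ [cg ig cvg_g]] := approximation_continuous_integrable mE Efin iF.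
(* Both functions will be bounded by a, so |k - f|^2 <= 2 a |k - f|, and an L^1 error of this size
   gives a squared L^2 error of at most e / 4. *)
have d0 : 0 < e / (4 * (2 * a + 1)) by rewrite divr_gt0 // mulr_gt0 // ltr_pwDr // mulr_ge0.
have : \forall n \near \oo, (\int[mu]_(z in E) (`|f z - g_ n z|)%:E < (e / (4 * (2 * a + 1)))%:E)%E.
  by move/fine_cvgP : cvg_g => [fi cv]; near=> n; rewrite -[ltLHS]fineK; [rewrite lte_fin; near: n; exact: (cvgr_lt _ cv)|near: n; exact: fi].
move=> [n _ hn]; have {hn} hn := hn n (leqnn n).
pose cl v : R := 2^-1 * (`|v + a| - `|v - a|).
pose ra (v : R) : R := 2^-1 * (`|v| - `|v - 1| + 1).
(* Clipping does not increase the distance to f, whose values lie in [-a, a]. The cutoff is 1 for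
   |x| <= a, beyond which f vanishes, and 0 off E. *)
pose k x : R := ra (a + 1 - `|x|) * cl (g_ n x).
have cabs (p : R -> R) : continuous p -> continuous (fun x => `|p x|).
  by move=> cp x; apply: cvg_norm; exact: cp.
have cdd (p : R -> R) c : continuous p -> continuous (fun x => p x + c).
  by move=> cp x; apply: cvgD; [exact: cp|exact: cvg_cst].
have ck : continuous k.
  have cid : continuous (fun x : R => x) by move=> x; exact: cvg_id.
  have c1 : continuous (fun x : R => a + 1 - `|x|) by move=> x; apply: cvgB; [exact: cvg_cst|exact: cabs].
  move=> x; apply: cvgM; (apply: cvgM; [exact: cvg_cst|]).
    apply: (cdd (fun x : R => `|a + 1 - `|x| | - `|a + 1 - `|x| - 1|)) => z.
    by apply: cvgB; [exact: cabs c1 z|apply: (cabs _ _ z); exact: cdd].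
  by apply: cvgB; [apply: (cabs _ _ x); apply: cdd|apply: (cabs _ _ x); apply: cdd]; exact: cg.
have kE x : ~ E x -> k x = 0.
  rewrite /E /= in_itv /= => /negP hx; rewrite /k /ra; have [hz _ _] := ramp_facts (a + 1 - `|x|); rewrite hz ?mul0r //.
  by rewrite subr_le0; move: hx; rewrite -ler_norml -ltNge => /ltW.
have ka x : `|k x| <= a.
  rewrite /k normrM; have [_ _ /andP[r0 r1]] := ramp_facts (a + 1 - `|x|).
  have [c1 _ _] := clip_facts (g_ n x) a0; rewrite (ger0_norm r0).
  by rewrite -[leRHS]mul1r; apply: ler_pM.
have mk : mfun k := continuous_measurable_fun ck.
have mEi : mfun (\1_E : R -> R) by exact: measurable_indic.
have iEi : igr (fun x => \1_E x : R).
  apply: igrP => //; under eq_integral do rewrite ger0_norm //.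
  by rewrite integral_indic // setIT.
have ik : igr k.
  apply: (igr_le mk (igrZ a iEi)) => x; rewrite indicE.
  by case: (boolP (x \in E)) => [_|/negP hx]; [rewrite mulr1|rewrite kE ?normr0 ?mulr0 // => /mem_set].
have Lk : L2 k.
  split => //; apply: (igr_le _ (igrZ a (igr_abs ik))) => [|x]; first by meas.
  by rewrite normrX expr2 ler_wpM2r.
exists k; split => //; first by exists a.
have kf : n2 (fun x => k x - f x) <= e / 4.
  have h : (\int[mu]_x ((k x - f x) ^+ 2)%:E <= (e / 4)%:E)%E.
    apply: (@le_trans _ _ (\int[mu]_(z in E) ((2 * a)%:E * (`|f z - g_ n z|)%:E))%E).
      rewrite [leRHS]integral_mkcond; apply: ge0_le_integral => //.
      - by move=> x _; rewrite lee_fin sqr_ge0.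
      - by apply/measurable_EFinP; meas.
      - have mgn : mfun (g_ n) := continuous_measurable_fun (cg n).
        by apply/(measurable_restrictT _ mE); apply: measurable_funTS; apply/measurable_EFinP; meas.
      move=> x _; rewrite patchE; case: ifPn => [xE|/negP xE].
        rewrite -EFinM lee_fin -normK2 expr2.
        have fa := trunc_fun_le N g x.
        apply: ler_pM => //.
          by apply: (le_trans (ler_normB _ _)); have := ka x; rewrite -/f -/a in fa; lra.
        rewrite [leRHS]distrC /k; have [_ r1 /andP[r0 r2]] := ramp_facts (a + 1 - `|x|).
        have [_ c1 c2] := clip_facts (g_ n x) a0.
        case: (ltrP `|x| a) => xa; first by rewrite /ra r1 ?mul1r; [exact: c2|lra].
        have -> : f x = 0.
          rewrite /f /trunc_fun /ind; have -> : ((- N%:R < x) && (x < N%:R)) = false; last by rewrite mul0r.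
          by apply: negbTE; rewrite -ltr_norml -leNgt.
        rewrite !subr0 normrM (ger0_norm r0); apply: le_trans c1; exact: ler_piMl.
      rewrite kE; last by move=> /mem_set.
      have -> : f x = 0; last by rewrite subr0 expr0n.
      rewrite /f /trunc_fun /ind; have -> : ((- N%:R < x) && (x < N%:R)) = false; last by rewrite mul0r.
      apply: negbTE; apply/negP => /andP[x1 x2]; apply: xE; rewrite inE /E /= in_itv /=.
      by rewrite /a; apply/andP; split; lra.
    rewrite ge0_integralZl //; last 2 first.
    - have mgn : mfun (g_ n) := continuous_measurable_fun (cg n).
      by apply: measurable_funTS; apply/measurable_EFinP; meas.
    - by rewrite lee_fin mulr_ge0.
    apply: (@le_trans _ _ ((2 * a)%:E * (e / (4 * (2 * a + 1)))%:E)%E).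
      by apply: lee_wpmul2l; [rewrite lee_fin mulr_ge0|exact: ltW].
    rewrite -EFinM lee_fin mulrA ler_pdivrMr; last by rewrite mulr_gt0 // ltr_pwDr // mulr_ge0.
    have -> : e / 4 * (4 * (2 * a + 1)) = 2 * a * e + e by field.
    by rewrite lerDl ltW.
  have m2 : mfun (fun x => (k x - f x) ^+ 2) by meas.
  by have [] := I_le_ereal m2 (fun x => sqr_ge0 _) h.
have -> : (fun x => k x - g x) = (fun x => (k x - f x) + (f x - g x)) by apply/funext => x; ring.
by apply: (le_trans (n2_add2 (L2B Lk Lf) (L2B Lf hg))); lra.
Unshelve. all: by end_near. Qed.

Lemma pc_sym t f g : 0 < t -> L2 f -> L2 g -> \I_x (f x * pc t g x) = \I_x (pc t f x * g x).
Proof.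
move=> t0 hf hg; have [mf _] := hf; have [mg _] := hg.
have aabs q : L2 q -> L2 (fun x => `|q x|).
  by move=> [mq iq]; split; [meas|rewrite (_ : (fun x => _) = fun x => q x ^+ 2) //; apply/funext => x; rewrite real_normK ?num_real].
pose F z : R := f z.1 * (P t (z.1 - z.2) * g z.2).
have mF : mfun (F : R * R -> R) by rewrite /F; meas2.
have pw (a b : R) : `|F (a, b)| = `|f a| * (P t (a - b) * `|g b|).
  by rewrite /F /= normrM [`|P _ _ * _|]normrM (ger0_norm (P_ge0 (a - b) (ltW t0))).
have fin : (\int[mu]_x \int[mu]_y (`|F (x, y)|)%:E < +oo)%E.
  have ig := igr_mul (aabs _ hf) (L2_pc t0 (aabs _ hg)).
  apply: le_lt_trans (igr_lty ig); apply: ge0_le_integral => //.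
  - by move=> x _; apply: integral_ge0 => y _; rewrite lee_fin.
  - by apply: (measurable_int_param (F := fun z => `|F z|)) => //; meas.
  - by apply/measurable_EFinP; have m := igr_mfun ig; meas.
  move=> x _; rewrite normrM normr_id ger0_norm; last by apply: pc_ge0.
  have pg := (pint_abs (L2_pint hg)).2 t x t0.
  rewrite (_ : (\int[mu]_y (`|F (x, y)|)%:E = \int[mu]_y ((`|f x|)%:E * (P t (x - y) * `|g y|)%:E))%E).
    rewrite ge0_integralZl //; last 2 first.
    - by apply/measurable_EFinP; meas2.
    - by move=> y _; rewrite lee_fin; pos.
    by rewrite (I_fin pg).
  by apply: eq_integral => y _; rewrite -EFinM pw.
have [_ _ S] := I_swap mF fin.
transitivity (\I_x \I_y F (x, y)).
  apply: eq_I => x; rewrite /F /= I_Z //; exact: (L2_pint hg).2.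
rewrite S; apply: eq_I => y; rewrite mulrC /pc -I_Z; last exact: (L2_pint hf).2.
by apply: eq_I => x; rewrite /F /= P_sym; ring.
Qed.

Lemma n2_pcE t g : 0 < t -> L2 g -> n2 (pc t g) = \I_x (g x * pc (t + t) g x).
Proof.
move=> t0 hg; have -> : pc (t + t) g = pc t (pc t g) by apply/funext => x; rewrite pc_semigroup //; exact: L2_pint.
by rewrite pc_sym //; exact: L2_pc.
Qed.

Lemma n2_pc_le t g : 0 < t -> L2 g -> n2 (pc t g) <= n2 g.
Proof.
move=> t0 hg; have mg := hg.1.
have sh y : L2 (fun x => g (x - y)) /\ n2 (fun x => g (x - y)) = n2 g by exact: L2_shift.
have hA : \I_y P t y <= 1 by rewrite I_P.
have mh : mfun (fun z : R * R => g (z.2 - z.1)) by meas.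
have ig : igr (fun y => P t y * n2 (fun x => g (x - y))).
  by rewrite (_ : (fun y => _) = fun y => n2 g * P t y); [exact: igrZ (igr_P t0)|apply/funext => y; rewrite (sh y).2 mulrC].
have [_] := n2_superpose (fun y => P_ge0 y (ltW t0)) (igr_P t0) ltr01 hA mh (fun y => (sh y).1) ig.
rewrite mul1r (_ : (fun y => P t y * n2 _) = fun y => n2 g * P t y); last by apply/funext => y; rewrite (sh y).2 mulrC.
rewrite (I_Z _ (igr_P t0)) (I_P t0) mulr1.
by rewrite (_ : pc t g = fun x => \I_y (P t y * g (x - y))) //; apply/funext => x; rewrite pcE.
Qed.

Lemma pc_to_id k (M : R) (t_ : nat -> R) x : continuous k -> (forall y, `|k y| <= M) -> (forall n, 0 < t_ n) ->
  t_ @ \oo --> (0 : R) -> pc (t_ n) k x @[n --> \oo] --> k x.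
Proof.
move=> ck kM t0 tc; have mk : mfun k := continuous_measurable_fun ck.
apply/cvgrPdist_le => e e0; have e2 : 0 < e / 2 by rewrite divr_gt0.
have /cvgrPdist_lt/(_ _ e2) := ck x; rewrite -nbhs_ballE => -[d /= d0 hd].
have M0 : 0 <= M := le_trans (normr_ge0 _) (kM 0).
(* For |y| >= d the kernel P_t is at most t (1 + d^-2) P_1, so the tail of the average contributes
   at most t C. *)
pose C := 2 * M * (1 + d ^- 2); have C0 : 0 <= C by rewrite !mulr_ge0 // addr_ge0 // invr_ge0 exprn_ge0 // ltW.
near=> n.
have tn1 : t_ n <= 1 by near: n; apply: (cvgr_le _ tc).
have tn2 : t_ n * C <= e / 2.
  have : t_ n <= e / 2 / (C + 1) by near: n; apply: (cvgr_le _ tc); rewrite divr_gt0 // ltr_wpDl.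
  rewrite ler_pdivlMr ?ltr_wpDl // => h; apply: le_trans h; rewrite ler_pM2l //; lra.
have {}t0 := t0 n; move: (t_ n) t0 tn1 tn2 => t t0 t1 t2.
have i1 : igr (fun y => P t y * k (x - y)).
  have mP := mfun_P t; apply: (igr_le _ (igrZ M (igr_P t0))) => [|y].
    by apply: measurable_funM => //; apply: (measurableT_comp mk); meas.
  by rewrite normrM mulrC (ger0_norm (P_ge0 y (ltW t0))) ler_wpM2r ?P_ge0 ?(ltW t0).
rewrite pcE // -[k x]mulr1 -(I_P t0) -(I_Z _ (igr_P t0)) -I_B //; last exact: igrZ (igr_P t0).
apply: (@le_trans _ _ (\I_y (e / 2 * P t y + t * C * P 1 y))).
  have mP := mfun_P t; apply: I_bound; [by apply: igrD; apply: igrZ; exact: igr_P| |move=> y].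
    by apply: measurable_funB; apply: measurable_funM => //; apply: (measurableT_comp mk); meas.
  rewrite (_ : k x * P t y - P t y * k (x - y) = P t y * (k x - k (x - y))); last by ring.
  rewrite normrM (ger0_norm (P_ge0 _ (ltW t0))) mulrC.
  have p1 : 0 <= t * C * P 1 y by rewrite mulr_ge0 ?P_ge0 // mulr_ge0 // ltW.
  have p2 : 0 <= e / 2 * P t y by rewrite mulr_ge0 ?P_ge0 // ltW.
  case: (ltrP `|y| d) => yd.
    rewrite -[leLHS]addr0; apply: lerD => //; apply: ler_wpM2r; first by pos.
    by apply/ltW/hd; rewrite /ball /= opprB addrC subrK.
  rewrite -[leLHS]add0r; apply: lerD => //.
  apply: (@le_trans _ _ (2 * M * P t y)).
    by apply: ler_wpM2r; [pos|]; apply: (le_trans (ler_normB _ _)); have := kM x; have := kM (x - y); lra.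
  rewrite /C (_ : t * _ * _ = 2 * M * (t * (1 + d ^- 2) * P 1 y)); last by ring.
  rewrite ler_wpM2l ?mulr_ge0 // /P expr1n.
  have d2 : d ^+ 2 <= y ^+ 2 by rewrite -[y ^+ 2]normK2 lerXn2r ?nnegrE // ltW.
  have d2' : 0 < d ^+ 2 by rewrite exprn_gt0.
  rewrite [leRHS]mulrCA; apply: ler_wpM2l; first by rewrite invr_ge0 pi_ge0.
  rewrite -mulrA; apply: ler_wpM2l; first exact: ltW.
  have T0 : 0 < t ^+ 2 + y ^+ 2 by rewrite ltr_pwDl ?exprn_gt0 ?sqr_ge0.
  rewrite -[(t ^+ 2 + _)^-1]div1r (ler_pdivrMr _ _ T0).
  rewrite mul1r mulrAC ler_pdivlMr; last by have := sqr_ge0 y; lra.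
  rewrite mul1r; move: (d ^+ 2) (y ^+ 2) d2 d2' (sqr_ge0 t) => D Y h1 h2 h3.
  have q : 1 <= Y / D by rewrite ler_pdivlMr // mul1r.
  rewrite mulrDl mul1r (mulrC D^-1) mulrDl; have : 0 <= t ^+ 2 / D by rewrite divr_ge0 // ltW.
  lra.
have ip1 : igr (fun y => e / 2 * P t y) by apply: igrZ; exact: igr_P.
have ip2 : igr (fun y => t * C * P 1 y) by apply: igrZ; exact: igr_P.
by rewrite (I_D ip1 ip2) (I_Z _ (igr_P t0)) (I_Z _ (igr_P ltr01)) (I_P t0) (I_P ltr01) !mulr1; lra.
Unshelve. all: by end_near. Qed.

(** For continuous, bounded, integrable k the squared norm is the pairing of k with P_{2t} k, where
    dominated convergence applies. Density transfers this to g, because P_t does not increase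
    norms. *)
Lemma n2_pc_cvg g (t_ : nat -> R) : L2 g -> (forall n, 0 < t_ n) -> t_ @ \oo --> (0 : R) ->
  n2 (pc (t_ n) g) @[n --> \oo] --> n2 g.
Proof.
move=> hg t0 tc; apply/cvgrPdist_le => e e0.
have N0 := n2_ge0 g; pose r := Num.min 1 (e / (12 * (n2 g + 1))).
have r0 : 0 < r by rewrite lt_min ltr01 divr_gt0 // mulr_gt0 // ltr_wpDl.
have r1 : r <= 1 by rewrite ge_min lexx.
have r2 : r * n2 g <= e / 12.
  have : r <= e / (12 * (n2 g + 1)) by rewrite ge_min lexx orbT.
  rewrite ler_pdivlMr; last by rewrite mulr_gt0 // ltr_wpDl.
  by move: r0 N0; move: (n2 g) r {r1} => N r r0 N0; nra.
have q0 : 0 < 1 + r^-1 by rewrite addr_gt0 // invr_gt0.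
have [k [ck [M kM] ik Lk kg]] := L2_dense hg (divr_gt0 e0 (mulr_gt0 (ltr0Sn R 11) q0)).
have kg2 : (1 + r^-1) * n2 (fun x => k x - g x) <= e / 12.
  by move: kg; rewrite ler_pdivlMr ?mulr_gt0 // => h; rewrite ler_pdivlMr //; lra.
have ckk : n2 (pc (t_ n) k) @[n --> \oo] --> n2 k.
  rewrite (_ : (fun n => _) = fun n => \I_x (k x * pc (t_ n + t_ n) k x)); last by apply/funext => n; rewrite n2_pcE.
  apply: (I_cvg (g := fun x => M * `|k x|)).
  - by move=> n; have m := mfun_pc1 (t_ n + t_ n) Lk.1; have m2 := Lk.1; meas.
  - exact: igrZ (igr_abs ik).
  - by move=> n x; rewrite normrM mulrC ler_wpM2r // pc_sup // ?addr_gt0 //; exact: Lk.1.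
  move=> x; rewrite expr2; apply: cvgM; first exact: cvg_cst.
  have hh := @pc_to_id k M (fun n => t_ n + t_ n) x ck kM; apply: hh; first by move=> n; rewrite addr_gt0.
  by rewrite -[X in _ --> X]addr0; exact: cvgD.
near=> n.
have h1 : n2 k - e / 12 <= n2 (pc (t_ n) k).
  by near: n; apply: (cvgr_ge _ ckk); rewrite ltrBlDr ltrDl divr_gt0.
have tn := t0 n; have Lg := L2_pc tn hg; have Lkt := L2_pc tn Lk.
have le := n2_pc_le tn hg; rewrite ger0_norm ?subr_ge0 //.
have h2 : n2 (pc (t_ n) k) <= (1 + r) * n2 (pc (t_ n) g) + (1 + r^-1) * n2 (fun x => k x - g x).
  have := n2_add r0 Lg (L2B Lkt Lg).
  rewrite (_ : (fun x => _) = pc (t_ n) k); last by apply/funext => x; rewrite addrC subrK.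
  move=> h; apply: (le_trans h); rewrite lerD2l ler_pM2l //.
  apply: le_trans (n2_pc_le tn (L2B Lk hg)).
  have -> : (fun x => pc (t_ n) k x - pc (t_ n) g x) = pc (t_ n) (fun x => k x - g x).
    by apply/funext => x; rewrite (pcB x tn (L2_pint Lk) (L2_pint hg)).
  exact: lexx.
have h3 : n2 g <= (1 + r) * n2 k + (1 + r^-1) * n2 (fun x => k x - g x).
  have := n2_add r0 Lk (L2B hg Lk).
  rewrite (_ : (fun x => _) = g); last by apply/funext => x; rewrite addrC subrK.
  have [_ <-] := L2N (L2B Lk hg).
  by rewrite (_ : (fun x => - (k x - g x)) = fun x => g x - k x) //; apply/funext => x; rewrite opprB.
have b0 := n2_ge0 (pc (t_ n) g); clear q0 kg.
move: (n2 (pc _ k)) (n2 (pc _ g)) (n2 k) (n2 g) b0 h1 h2 h3 kg2 le r2 N0 => a b c N b0 h1 h2 h3 kg2 le r2 N0.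
move: ((1 + r^-1) * _) h2 h3 kg2 r0 r1 r2; move: r => {}r d h2 h3 kg2 r0 r1 r2.
have rp : 0 < 1 + r by rewrite addr_gt0.
have p1 : (1 + r) * c <= (1 + r) * (a + e / 12) by rewrite (ler_pM2l rp) -lerBlDr.
have p2 : (1 + r) * a <= (1 + r) * ((1 + r) * b + e / 12).
  by rewrite (ler_pM2l rp); apply: (le_trans h2); rewrite lerD2l.
have p3 : r * b <= r * N by rewrite ler_pM2l.
have p4 : r * (r * b) <= 1 * (r * b) by rewrite ler_wpM2r // mulr_ge0 // ltW.
have p5 : r * e <= 1 * e by rewrite ler_wpM2r // ltW.
lra.
Unshelve. all: by end_near. Qed.

(** The damping in [I_rho] is removed: Fatou's lemma gives integrability of the squared modulus,
    which then serves as a majorant for the limit on the left, while [n2_pc_cvg] gives the limit on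
    the right. *)
Lemma Plancherel q : igr q -> L2 q -> igr (rho q) /\ \I_x rho q x = 2 * pi * n2 q.
Proof.
move=> iq Lq; have mq := iq.
have mr : mfun (rho q) by have m1 := mfun_FC Lq.1; have m2 := mfun_FS Lq.1; rewrite /rho; meas.
have r0 x : 0 <= rho q x by rewrite addr_ge0 ?sqr_ge0.
have pi2 : 0 < 2 * pi :> R by rewrite mulr_gt0 // pi_gt0.
(* The squared norm of the extension at time t corresponds to damping 2 t, hence the factor 1/2. *)
pose t_ n : R := 2^-1 * hstep n.
have t0 n : 0 < t_ n by rewrite mulr_gt0 // /hstep invr_gt0.
have tc : t_ @ \oo --> (0 : R).
  by rewrite -[X in _ --> X](mulr0 2^-1); apply: cvgM; [exact: cvg_cst|exact: hstep_cvg].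
have tt n : t_ n + t_ n = hstep n by rewrite /t_; field.
have En n : \I_x (expR (- (hstep n * `|x|)) * rho q x) = 2 * pi * n2 (pc (t_ n) q).
  have hp : 0 < hstep n :> R by rewrite /hstep invr_gt0.
  by rewrite (I_rho hp iq) (n2_pcE (t0 n) Lq) tt.
have cE x : expR (- (hstep n * `|x|)) @[n --> \oo] --> (1 : R).
  have h : - (hstep n * `|x|) @[n --> \oo] --> (0 : R).
    by rewrite -oppr0; apply: cvgN; rewrite -(mul0r `|x|); apply: cvgM; [exact: hstep_cvg|exact: cvg_cst].
  by have := cvg_comp _ _ h (@continuous_expR R 0); rewrite expR0.
have igE n : igr (fun x => expR (- (hstep n * `|x|)) * rho q x).
  have hn : 0 < hstep n :> R by rewrite /hstep invr_gt0.
  pose K := \I_y `|q y|.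
  have FCb x : `|FC q x| <= K by apply: I_bound; [exact: igr_abs|exact: igr_mfun (igr_FC x iq)|move=> y; rewrite normrM ler_piMr // cos_abs].
  have FSb x : `|FS q x| <= K by apply: I_bound; [exact: igr_abs|exact: igr_mfun (igr_FS x iq)|move=> y; rewrite normrM ler_piMr // sin_abs].
  have K0 : 0 <= K := le_trans (normr_ge0 _) (FCb 0).
  apply: (igr_le _ (igrZ (2 * K ^+ 2) (igr_expN hn))) => [|x]; first by meas.
  rewrite normrM mulrC (ger0_norm (expR_ge0 _)) (ger0_norm (r0 x)) ler_wpM2r ?expR_ge0 //.
  rewrite mulr_natl mulr2n; apply: lerD; rewrite -[leLHS]normK2 lerXn2r ?nnegrE //.
have [||||ir _] := @fatou_bound R (fun n x => expR (- (hstep n * `|x|)) * rho q x) (rho q) (2 * pi * n2 q).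
- by move=> n; exact: igr_mfun (igE n).
- by move=> n x; rewrite mulr_ge0 ?expR_ge0.
- by move=> x; rewrite -[X in _ --> X]mul1r; apply: cvgM; [exact: cE|exact: cvg_cst].
- by apply: nearW => n; rewrite (I_fin (igE n)) lee_fin En ler_pM2l // n2_pc_le.
split => //.
have c1 : \I_x (expR (- (hstep n * `|x|)) * rho q x) @[n --> \oo] --> \I_x rho q x.
  apply: (I_cvg (g := rho q)) => //.
  - by move=> n; exact: igr_mfun (igE n).
  - move=> n x; rewrite normrM (ger0_norm (r0 x)) (ger0_norm (expR_ge0 _)); apply: ler_piMl => //.
    by apply: expRN_le1; rewrite mulr_ge0 // /hstep invr_ge0.
  by move=> x; rewrite -[X in _ --> X]mul1r; apply: cvgM; [exact: cE|exact: cvg_cst].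
have c2 : \I_x (expR (- (hstep n * `|x|)) * rho q x) @[n --> \oo] --> 2 * pi * n2 q.
  rewrite (_ : (fun n => _) = fun n => 2 * pi * n2 (pc (t_ n) q)); last by apply/funext => n; exact: En.
  by apply: cvgM; [exact: cvg_cst|exact: n2_pc_cvg].
exact: (cvg_unique _ c1 c2).
Qed.

End Plancherel.

(** * Almost everywhere equality and completeness of L^2 *)

Section AlmostEverywhere.
Context {R : realType}.
Notation mu := (@lebesgue_measure R).

Import HBNNSimple.

Lemma aeS (A B : R -> Prop) : (forall x, A x -> B x) -> {ae mu, forall x, A x} -> {ae mu, forall x, B x}.
Proof.
move=> AB [N [mN N0 sub]]; exists N; split => // x /= nB; apply: sub => /= nA; exact: nB (AB _ nA).
Qed.

Lemma aeS2 (A B C : R -> Prop) : (forall x, A x -> B x -> C x) -> {ae mu, forall x, A x} ->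
  {ae mu, forall x, B x} -> {ae mu, forall x, C x}.
Proof.
move=> ABC hA hB; have := negligibleU hA hB; apply: negligibleS => x /= nC.
by have [a|a] := EM (A x); have [b|b] := EM (B x); [case: nC; exact: ABC|right|left|left].
Qed.

(* No measurability is required: the integral of an arbitrary function is a difference of suprema over simple functions. *)
Lemma ge0_ae_int (p q : R -> \bar R) : (forall x, 0 <= p x)%E -> (forall x, 0 <= q x)%E ->
  {ae mu, forall x, p x = q x} -> (\int[mu]_x p x = \int[mu]_x q x)%E.
Proof.
have key (f g : R -> \bar R) : (forall x, 0 <= f x)%E -> (forall x, 0 <= g x)%E ->
    {ae mu, forall x, f x = g x} -> (\int[mu]_x f x <= \int[mu]_x g x)%E.
  move=> f0 g0 [N [mN N0 Nsub]].
  rewrite ge0_integralTE // [leRHS]ge0_integralTE //.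
  apply: ge_ereal_sup => _ [h hf <-].
  pose h' := proj_nnsfun h (measurableC mN).
  apply: (@le_trans _ _ (sintegral mu h')); last first.
    apply: ereal_sup_ubound; exists h' => //= x; rewrite /h' /= mindicE.
    case: (boolP (x \in ~` N)) => hx; last by rewrite mulr0.
    rewrite mulr1; apply: (le_trans (hf x)).
    have -> // : f x = g x by apply: contrapT => hn; move: hx; rewrite inE /= => /(_ (Nsub _ hn)).
  rewrite -!integralT_nnsfun le_eqVlt; apply/orP; left; apply/eqP; apply: ae_eq_integral => //.
  - by apply/measurable_EFinP.
  - by apply/measurable_EFinP.
  exists N; split => // x /= /not_implyP [_ hx]; apply: contrapT => xN; apply: hx; congr EFin.
  by rewrite /= mindicE; have -> : (x \in ~` N) by [rewrite inE]; rewrite mulr1.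
move=> p0 q0 pq; apply/eqP; rewrite eq_le; apply/andP; split; apply: key => //.
by apply: aeS pq => x ->.
Qed.

Lemma ae_int (p q : R -> \bar R) : {ae mu, forall x, p x = q x} -> (\int[mu]_x p x = \int[mu]_x q x)%E.
Proof.
move=> pq; rewrite integralE [RHS]integralE; congr (_ - _)%E; apply: ge0_ae_int => //;
  by apply: aeS pq => x h; rewrite ?funeposE ?funenegE h.
Qed.

Lemma riesz_fischer (u : nat -> R -> R) : (forall n, L2 (u n)) ->
  (forall e, 0 < e -> exists N, forall n m, (N <= n)%N -> (N <= m)%N -> n2 (fun x => u n x - u m x) <= e) ->
  exists w, L2 w /\ n2 (fun x => u n x - w x) @[n --> \oo] --> (0 : R).
Proof.
move=> hu hc.
have e4 k : 0 < (4 ^+ k)^-1 :> R by rewrite invr_gt0 exprn_gt0.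
have /choice[s0 hs0] k := hc _ (e4 k).
(* A strictly increasing majorant of [s0], so that consecutive terms of the subsequence both lie
   beyond [s0 k]. *)
pose s k : nat := (\sum_(i < k.+1) (s0 i).+1)%N.
have s_mono k : (s0 k <= s k)%N by rewrite /s big_ord_recr /= addnS ltnW // ltnS leq_addl.
have s_le k : (s k < s k.+1)%N by rewrite /s [ltnRHS]big_ord_recr /= addnS ltnS leq_addr.
have s_ge k : (k <= s k)%N by elim: k => // k IH; exact: leq_ltn_trans IH _.
pose D k x := u (s k.+1) x - u (s k) x.
have LD k : L2 (D k) by exact: L2B.
have nD k : n2 (D k) <= (4 ^+ k)^-1.
  by apply: hs0; [exact: leq_trans (s_mono k) (ltnW (s_le k))|exact: s_mono].
(* The weight 2^k meets two needs: the integrals, at most 2^k / 4^k, are summable, and |D k| <= (2^k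
   (D k)^2 + 2^-k) / 2 bounds the telescoping series pointwise. *)
pose f k x : \bar R := (2 ^+ k * D k x ^+ 2)%:E.
have mD k : mfun (D k) := (LD k).1.
have mf k : mfun (f k) by apply/measurable_EFinP; meas.
have f0 k x : (0 <= f k x)%E by rewrite lee_fin mulr_ge0 ?sqr_ge0 ?exprn_ge0.
pose Fs x := (\sum_(k <oo) f k x)%E.
have geo n : \sum_(0 <= k < n) (2 ^+ k)^-1 <= 2 :> R.
  suff -> : \sum_(0 <= k < n) (2 ^+ k)^-1 = 2 - 2 * (2 ^+ n)^-1 :> R.
    by rewrite gerBl mulr_ge0 // invr_ge0 exprn_ge0.
  elim: n => [|n IH]; first by rewrite big_nil expr0 invr1 mulr1 subrr.
  rewrite big_nat_recr //= IH exprS invfM; move: (2 ^+ n)^-1 => p.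
  by field.
have mFs : mfun Fs.
  by apply: ge0_emeasurable_sum => [k x _ _|k _]; [exact: f0|exact: mf].
have intF : (\int[mu]_x Fs x < +oo)%E.
  rewrite /Fs integral_nneseries //; apply: (@le_lt_trans _ _ 2%:E); last by rewrite ltry.
  apply: lime_le; first by apply: is_cvg_nneseries => k _ _; apply: integral_ge0 => x _; exact: f0.
  apply: nearW => n; apply: (@le_trans _ _ (\sum_(0 <= k < n) ((2 ^+ k)^-1)%:E)%E); last by rewrite sumEFin lee_fin.
  apply: lee_sum => k _; rewrite /f; under eq_integral do rewrite EFinM.
  rewrite ge0_integralZl ?lee_fin ?exprn_ge0 //; last 2 first.
  - by apply/measurable_EFinP; apply: measurable_funX; exact: mD.
  - by move=> x _; rewrite lee_fin sqr_ge0.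
  rewrite n2_ereal // -EFinM lee_fin.
  have p2 : 0 < 2 ^+ k :> R by rewrite exprn_gt0.
  have -> : (2 ^+ k)^-1 = 2 ^+ k * (4 ^+ k)^-1 :> R.
    have -> : 4 = 2 * 2 :> R by rewrite -natrM.
    by rewrite exprMn invfM mulrA mulfV ?mul1r // gt_eqF.
  by rewrite ler_pM2l.
have aeF : {ae mu, forall x, (Fs x < +oo)%E}.
  have Fs0 x : (0 <= Fs x)%E by apply: nneseries_ge0 => k _ _; exact: f0.
  have ig : mu.-integrable setT Fs.
    by apply/integrableP; split => //; under eq_integral do rewrite gee0_abs //.
  by apply: aeS (integrable_ae measurableT ig) => x /(_ I); rewrite ge0_fin_numE.
have good x : (Fs x < +oo)%E -> cvgn (fun k => u (s k) x).
  move=> Fx; have Ff : Fs x \is a fin_num by rewrite ge0_fin_numE //; apply: nneseries_ge0 => k _ _; exact: f0.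
  have -> : (fun k => u (s k) x) = (fun n => u (s 0%N) x + series (telescope (fun k => u (s k) x)) n).
    by apply/funext => n; rewrite -eq_sum_telescope.
  apply: is_cvgD; first exact: is_cvg_cst.
  apply: normed_cvg; apply: nondecreasing_is_cvgn.
    by apply: nondecreasing_series => k _ _; exact: normr_ge0.
  exists (2^-1 * (fine (Fs x) + 2)) => _ [n _ <-]; rewrite /series /=.
  have h : \sum_(0 <= k < n) (2 ^+ k * D k x ^+ 2) <= fine (Fs x).
    by rewrite -lee_fin fineK // -sumEFin; apply: nneseries_lim_ge => k _ _; exact: f0.
  apply: (@le_trans _ _ (\sum_(0 <= k < n) 2^-1 * (2 ^+ k * D k x ^+ 2 + (2 ^+ k)^-1))); last first.
    by rewrite -big_distrr /= ler_pM2l // big_split /= lerD.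
  apply: ler_sum => k _; rewrite /telescope -/(D k x).
  have p2 : 0 < 2 ^+ k :> R by rewrite exprn_gt0.
  rewrite -[D k x ^+ 2]normK2; move: (2 ^+ k) p2 `|D k x| => p p0 d.
  have e : 2^-1 * (p * d ^+ 2 + p^-1) = d + 2^-1 * p^-1 * (p * d - 1) ^+ 2 by field; rewrite gt_eqF.
  by rewrite e lerDl mulr_ge0 ?sqr_ge0 // mulr_ge0 // invr_ge0 ltW.
(* On the null set where the series is infinite the sequence is replaced by 0; the limit then exists
   everywhere and is Borel. *)
pose u' n x := if (Fs x < +oo)%E then u n x else 0.
have mu' n : mfun (u' n).
  apply: measurable_fun_ifT => //; last exact: (hu n).1.
  by apply: (measurable_fun_lte (f := Fs) (g := cst +oo%E)) => //; exact: measurable_cst.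
pose w x := limn (fun k => u' (s k) x).
have cw x : (fun k => u' (s k) x) @ \oo --> w x.
  have [h|h] := boolP (Fs x < +oo)%E; rewrite /w /u' ?h; first exact: good.
  by rewrite (negbTE h) lim_cst //; exact: cvg_cst.
have mw : mfun w by apply: (measurable_fun_cvg (h := fun k => u' (s k))).
have near_bound e : 0 < e -> exists N, forall n, (N <= n)%N ->
    igr (fun x => (u n x - w x) ^+ 2) /\ n2 (fun x => u n x - w x) <= e.
  move=> e0; have [N hN] := hc e e0; exists N => n Nn.
  have [i1 i2] : igr (fun x => (u' n x - w x) ^+ 2) /\ \I_x ((u' n x - w x) ^+ 2) <= e.
    apply: (@fatou_bound R (fun k x => (u' n x - u' (s k) x) ^+ 2)).
    - by move=> k; apply: measurable_funX; apply: measurable_funB.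
    - by move=> k x; exact: sqr_ge0.
    - move=> x; rewrite [_ ^+ 2]expr2; under eq_fun do rewrite expr2.
      by apply: cvgM; apply: cvgB => //; exact: cvg_cst.
    near=> k; apply: (@le_trans _ _ (n2 (fun x => u n x - u (s k) x))%:E); last first.
      by rewrite lee_fin hN // (leq_trans _ (s_ge k)) //; near: k; exact: nbhs_infty_ge.
    rewrite -(n2_ereal (L2B (hu n) (hu (s k)))); apply: ge0_le_integral => //.
    - by move=> x _; rewrite lee_fin sqr_ge0.
    - by apply/measurable_EFinP; apply: measurable_funX; apply: measurable_funB; exact: mu'.
    - by apply/measurable_EFinP; apply: measurable_funX; apply: measurable_funB; exact: (hu _).1.
    by move=> x _; rewrite lee_fin /u'; case: ifP => // _; rewrite subrr expr0n sqr_ge0.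
  have ae : {ae mu, forall x, (u' n x - w x) ^+ 2 = (u n x - w x) ^+ 2}.
    by apply: aeS aeF => x h; rewrite /u' h.
  have eI : (\int[mu]_x ((u' n x - w x) ^+ 2)%:E = \int[mu]_x ((u n x - w x) ^+ 2)%:E)%E.
    by apply: ae_int; apply: aeS ae => x ->.
  apply: I_le_ereal; [|by move=> x; exact: sqr_ge0|].
    by apply: measurable_funX; apply: measurable_funB => //; exact: (hu _).1.
  by rewrite -eI (I_fin i1) lee_fin.
have [N0 hN0] := near_bound 1 ltr01; have [i0 _] := hN0 N0 (leqnn _).
exists w; split.
  have Ld : L2 (fun x => u N0 x - w x) by split => //; apply: measurable_funB => //; exact: (hu _).1.
  have := L2B (hu N0) Ld; congr L2; apply/funext => x; by rewrite opprB addrC subrK.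
apply/cvgrPdist_le => e e0; have [N hN] := near_bound e e0; exists N => // n /= Nn.
by rewrite sub0r normrN ger0_norm ?n2_ge0 //; exact: (hN n Nn).2.
Unshelve. all: by end_near. Qed.

Lemma Lfun2P (g : R -> R) : g \in Lfun mu 2%:E <-> L2 g.
Proof.
have e : mfun g -> ('N[mu]_2%:E[EFin \o g] = (\int[mu]_x (g x ^+ 2)%:E) `^ (2^-1))%E.
  move=> mg; rewrite unlock /=; congr (_ `^ _)%E; apply: eq_integral => x _ /=.
  by rewrite powR_mulrn // real_normK // num_real.
split=> [h|[mg ig]].
  have := Lfun2_integrable_sqr h; move: h; rewrite inE => /andP[]; rewrite inE /= => mg _ ig.
  by split.
rewrite inE /=; apply/andP; split; first by rewrite inE.
by rewrite inE /= /finite_norm (e mg) (I_fin ig) poweR_EFin ltry.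
Qed.

Lemma in_L2P (g : R -> R) : in_L2 g <-> exists2 h, L2 h & {ae mu, forall x, g x = h x}.
Proof. by split=> -[h /Lfun2P Lh gh]; exists h => //; apply: aeS gh => x // /(_ I). Qed.

Lemma L2_norm_ae (g h : R -> R) : L2 h -> {ae mu, forall x, g x = h x} -> L2_norm g = ((n2 h) `^ (2^-1))%:E.
Proof.
move=> Lh gh; rewrite /L2_norm unlock /= -poweR_EFin -(n2_ereal Lh); congr (_ `^ _)%E.
apply: ae_int; apply: aeS gh => x /= ->.
by rewrite powR_mulrn // real_normK // num_real.
Qed.

End AlmostEverywhere.

(** * The Fourier-Plancherel transform and spectral densities *)

Section Spectrum.
Context {R : realType}.
Implicit Types (t s x y h a b r e : R) (f g k q u w z : R -> R).
Notation mu := (@lebesgue_measure R).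

Definition tr (n : nat) g x : R := (if - n%:R <= x <= n%:R then g x else 0).

Lemma truncated_fourierE n g x : truncated_fourier n g x = (FC (tr n g) x +i* - FS (tr n g) x)%C.
Proof.
rewrite /truncated_fourier /FC /FS /tr; congr (_ +i* - _)%C; rewrite Rintegral_mkcond;
  apply: eq_I => y; rewrite patchE mem_setE in_itv /=; by case: ifP => _; rewrite ?mul0r.
Qed.

Lemma L2_tr g : L2 g -> [/\ forall n, igr (tr n g), forall n, L2 (tr n g) &
  n2 (fun x => tr n g x - g x) @[n --> \oo] --> (0 : R)].
Proof.
move=> Lg; have [mg ig] := Lg.
have mt n : mfun (tr n g).
  apply: measurable_fun_ifT => //.
  by apply: measurable_and; apply: measurable_fun_ler; meas.
have tle n x : `|tr n g x| <= 1 * `|g x| by rewrite mul1r /tr; case: ifP => // _; rewrite normr0.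
have Lt n : L2 (tr n g) by have [] := L2_dom Lg (mt n) (tle n).
split => // [n|].
  apply: (igr_le (mt n) (igrD (Lt n).2 (igr_ind (- n.+1%:R) n.+1%:R))) => x; rewrite /tr /ind.
  case: ifP => [/andP[h1 h2]|_]; last by rewrite normr0 addr_ge0 ?sqr_ge0 //; case: ifP.
  have -> : (- n.+1%:R < x) && (x < n.+1%:R).
    by rewrite (lt_le_trans _ h1) ?(le_lt_trans h2) ?ltrN2 ?ltr_nat.
  rewrite -[g x ^+ 2]normK2; have := sqr_ge0 (`|g x| - 2^-1); have := normr_ge0 (g x); nra.
rewrite -[X in _ --> X](@I_0 R); apply: (I_cvg (g := fun x => g x ^+ 2)) => //.
- by move=> n; apply: measurable_funX; exact: measurable_funB.
- by move=> n x; rewrite ger0_norm ?sqr_ge0 // /tr; case: ifP => _; rewrite ?subrr ?expr0n ?sqr_ge0 // sub0r sqrrN.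
move=> x; apply: cvg_near_cst; near=> n.
have h : `|x| <= n%:R by near: n; exact: nbhs_infty_ger.
by move: h; rewrite ler_norml /tr => ->; rewrite subrr expr0n.
Unshelve. all: by end_near. Qed.

Lemma FCB f g x : igr f -> igr g -> FC (fun y => f y - g y) x = FC f x - FC g x.
Proof.
move=> hf hg; rewrite /FC -I_B; [|exact: igr_FC|exact: igr_FC].
by apply: eq_I => y; rewrite mulrBl.
Qed.

Lemma FSB f g x : igr f -> igr g -> FS (fun y => f y - g y) x = FS f x - FS g x.
Proof.
move=> hf hg; rewrite /FS -I_B; [|exact: igr_FS|exact: igr_FS].
by apply: eq_I => y; rewrite mulrBl.
Qed.

Lemma L2_FCS q : igr q -> L2 q -> [/\ L2 (FC q), L2 (FS q) & n2 (FC q) + n2 (FS q) = 2 * pi * n2 q].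
Proof.
move=> iq Lq; have [ir e] := Plancherel iq Lq; have m1 := mfun_FC Lq.1; have m2 := mfun_FS Lq.1.
have i1 : igr (fun x => FC q x ^+ 2).
  by apply: (igr_le _ ir) => [|x]; [meas|rewrite ger0_norm ?sqr_ge0 // /rho lerDl sqr_ge0].
have i2 : igr (fun x => FS q x ^+ 2).
  by apply: (igr_le _ ir) => [|x]; [meas|rewrite ger0_norm ?sqr_ge0 // /rho lerDr sqr_ge0].
by split => //; rewrite -e /rho I_D.
Qed.

(** By Plancherel's identity the transforms of the truncations form a Cauchy sequence in L^2. *)
Lemma transform_exists z : L2 z -> exists w1 w2, [/\ L2 w1, L2 w2,
  n2 (fun x => FC (tr n z) x - w1 x) @[n --> \oo] --> (0 : R) &
  n2 (fun x => FS (tr n z) x - w2 x) @[n --> \oo] --> (0 : R)].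
Proof.
move=> Lz; have [it Lt ct] := L2_tr Lz.
have key n m : n2 (fun x => FC (tr n z) x - FC (tr m z) x) + n2 (fun x => FS (tr n z) x - FS (tr m z) x) =
    2 * pi * n2 (fun x => tr n z x - tr m z x).
  have [_ _ <-] := L2_FCS (igrB (it n) (it m)) (L2B (Lt n) (Lt m)).
  by congr (n2 _ + n2 _); apply/funext => x; rewrite ?FCB ?FSB.
have pi2 : 0 < 2 * pi :> R by rewrite mulr_gt0 // pi_gt0.
have cau e : 0 < e -> exists N, forall n m, (N <= n)%N -> (N <= m)%N ->
    2 * pi * n2 (fun x => tr n z x - tr m z x) <= e.
  move=> e0; have d0 : 0 < e / (2 * pi * 4) by rewrite divr_gt0 // mulr_gt0.
  have [N _ hN] := @cvgr_lt _ _ _ _ _ _ ct _ d0; exists N => n m Nn Nm.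
  have h3 := n2_sub2 (L2B (Lt n) Lz) (L2B (Lt m) Lz).
  have e3 : (fun x => tr n z x - z x - (tr m z x - z x)) = fun x => tr n z x - tr m z x by apply/funext => x; ring.
  rewrite e3 in h3; have h1 := hN n Nn; have h2 := hN m Nm.
  have p8 : 0 < 2 * pi * 4 :> R by rewrite mulr_gt0.
  rewrite /= (ltr_pdivlMr _ _ p8) in h1; rewrite /= (ltr_pdivlMr _ _ p8) in h2.
  rewrite -(ler_pM2l pi2) in h3.
  by move: (n2 _) (n2 _) (n2 _) h1 h2 h3 => a b c; move: (pi : R) => p; lra.
have [w1 [L1 c1]] : exists w, L2 w /\ n2 (fun x => FC (tr n z) x - w x) @[n --> \oo] --> (0 : R).
  apply: riesz_fischer => [n|e e0]; first by have [] := L2_FCS (it n) (Lt n).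
  have [N hN] := cau e e0; exists N => n m Nn Nm; apply: le_trans (hN n m Nn Nm).
  by rewrite -key lerDl n2_ge0.
have [w2 [LL2 c2]] : exists w, L2 w /\ n2 (fun x => FS (tr n z) x - w x) @[n --> \oo] --> (0 : R).
  apply: riesz_fischer => [n|e e0]; first by have [] := L2_FCS (it n) (Lt n).
  have [N hN] := cau e e0; exists N => n m Nn Nm; apply: le_trans (hN n m Nn Nm).
  by rewrite -key lerDr n2_ge0.
by exists w1, w2.
Qed.

End Spectrum.


Section Spectrum2.
Context {R : realType}.
Implicit Types (t s x y h a b r e : R) (f g k q u w z : R -> R) (m n : nat).
Notation mu := (@lebesgue_measure R).

(** The transform is chosen from a predicate that depends on f only through integrals, so functions
    equal almost everywhere have the same predicate and hence literally the same chosen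
    transform. *)
Lemma fourier_ae f g : L2 g -> {ae mu, forall x, f x = g x} -> fourier f = fourier g.
Proof.
move=> Lg fg; suff S : is_fourier f = is_fourier g by rewrite /fourier S.
apply/funext => w; apply/propext.
have i1 : in_L2 f by apply/in_L2P; exists g.
have i2 : in_L2 g by apply/in_L2P; exists g => //; exact: aeW.
have e n x : truncated_fourier n f x = truncated_fourier n g x.
  rewrite /truncated_fourier /Rintegral; congr (fine _ +i* - fine _)%C; rewrite integral_mkcond [RHS]integral_mkcond;
    apply: ae_int; apply: aeS fg => y h; by rewrite !patchE h.
have E : (fun n => \int[mu]_x (normsq (truncated_fourier n f x - w x))%:E)%E =
         (fun n => \int[mu]_x (normsq (truncated_fourier n g x - w x))%:E)%E.
  by apply/funext => n; apply: eq_integral => x _; rewrite e.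
split=> -[_ q1 q2 q3]; split; [exact: i2|exact: q1|exact: q2| |exact: i1|exact: q1|exact: q2|].
  exact: (eq_ind _ (fun G : nat -> \bar R => G @ \oo --> 0%E) q3 _ E).
exact: (eq_ind _ (fun G : nat -> \bar R => G @ \oo --> 0%E) q3 _ (esym E)).
Qed.

Lemma is_fourier_fourier z : L2 z -> is_fourier z (fourier z).
Proof.
move=> Lz; rewrite /fourier; apply: (@xgetPex _ (fun=> 0) [set w | is_fourier z w]).
have [w1 [w2 [L1 LL c1 c2]]] := transform_exists Lz.
have [it Lt _] := L2_tr Lz.
exists (fun x => (w1 x +i* - w2 x)%C) => /=; split.
- by apply/in_L2P; exists z => //; exact: aeW.
- by apply/in_L2P; exists w1 => //; exact: aeW.
- by apply/in_L2P; exists (fun x => - w2 x); [have [] := L2N LL|exact: aeW].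
rewrite (_ : (fun n => _) = fun n => (n2 (fun x => FC (tr n z) x - w1 x) + n2 (fun x => FS (tr n z) x - w2 x))%:E).
  by apply: cvg_EFin; [exact: nearW|rewrite -[X in _ --> X]addr0; exact: cvgD].
apply/funext => n; have [F1 F2 _] := L2_FCS (it n) (Lt n).
have M1 := L2B F1 L1; have M2 := L2B F2 LL.
rewrite /n2 -(I_D M1.2 M2.2) -(I_fin (igrD M1.2 M2.2)); apply: eq_integral => x _.
by rewrite truncated_fourierE /normsq /=; congr EFin; ring.
Qed.

(** The squared modulus of the symbol of [Dh h m], that is |e^{ihx} - 1|^{2m}. *)
Definition W h m x : R := ((2 * sin (2^-1 * (h * x))) ^+ m) ^+ 2.

Lemma rho_shift h q x : igr q -> rho (fun y => q (y + h) - q y) x = (2 * sin (2^-1 * (h * x))) ^+ 2 * rho q x.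
Proof.
move=> iq; have iqh := igr_shift h iq; have mq := igr_mfun iq; rewrite /rho FCB // FSB //.
have mc := @mfun_cos R; have ms := @mfun_sin R.
have i1 := igr_FC x iq; have i2 := igr_FS x iq.
have e1 : FC (fun y => q (y + h)) x = cos (h * x) * FC q x + sin (h * x) * FS q x.
  rewrite /FC /FS -(I_Z _ i1) -(I_Z _ i2) -I_D; [|exact: igrZ|exact: igrZ].
  have mG : mfun (fun y => q y * cos ((y - h) * x)) by meas.
  rewrite -[RHS](_ : \I_y (q y * cos ((y - h) * x)) = _).
    by rewrite -(I_shift h mG); apply: eq_I => y; rewrite addrK.
  by apply: eq_I => y; rewrite mulrBl cosB; ring.
have e2 : FS (fun y => q (y + h)) x = cos (h * x) * FS q x - sin (h * x) * FC q x.
  rewrite /FC /FS -(I_Z _ i1) -(I_Z _ i2) -I_B; [|exact: igrZ|exact: igrZ].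
  have mG : mfun (fun y => q y * sin ((y - h) * x)) by meas.
  rewrite -[RHS](_ : \I_y (q y * sin ((y - h) * x)) = _).
    by rewrite -(I_shift h mG); apply: eq_I => y; rewrite addrK.
  by apply: eq_I => y; rewrite mulrBl sinB; ring.
rewrite {}e1 {}e2; have hs := sin2cos2 (h * x).
have hc : cos (h * x) = 1 - 2 * sin (2^-1 * (h * x)) ^+ 2.
  have -> : h * x = 2^-1 * (h * x) + 2^-1 * (h * x) by field.
  rewrite cosD; have := sin2cos2 (2^-1 * (h * x)).
  have -> : 2^-1 * (2^-1 * (h * x) + 2^-1 * (h * x)) = 2^-1 * (h * x) by field.
  by move: (sin _) (cos _) => s c; rewrite !expr2 => h2; lra.
move: hs hc; move: (sin (2^-1 * (h * x))) (sin (h * x)) (cos (h * x)) (FC q x) (FS q x) => d s c C S hs hc.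
have -> : (c * C + s * S - C) ^+ 2 + (c * S - s * C - S) ^+ 2 = (C ^+ 2 + S ^+ 2) * (c ^+ 2 - 2 * c + 1 + s ^+ 2) by ring.
by rewrite hs hc; ring.
Qed.

Lemma igr_Dh h m q : igr q -> igr (Dh h m q).
Proof. by elim: m q => // m IH q iq; rewrite /Dh iterSr; apply: IH; apply: igrB => //; exact: igr_shift. Qed.

Lemma L2_Dh h m q : L2 q -> L2 (Dh h m q) /\ n2 (Dh h m q) <= 4 ^+ m * n2 q.
Proof.
elim: m q => [|m IH] q Lq; first by rewrite expr0 mul1r.
have [Ls es] := L2_shift h Lq; have Ld := L2B Ls Lq; have [L1 h1] := IH _ Ld.
rewrite /Dh iterSr -/(Dh h m _); split => //; apply: (le_trans h1).
rewrite exprSr -mulrA ler_pM2l ?exprn_gt0 //; have := n2_sub2 Ls Lq; rewrite es; lra.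
Qed.

Lemma rho_Dh h m q x : igr q -> rho (Dh h m q) x = W h m x * rho q x.
Proof.
move=> iq; elim: m => [|m IH]; first by rewrite /W expr0 expr1n mul1r.
have -> : rho (Dh h m.+1 q) x = (2 * sin (2^-1 * (h * x))) ^+ 2 * rho (Dh h m q) x.
  by rewrite -(rho_shift h x (igr_Dh h m iq)).
by rewrite IH /W; move: (2 * sin _) => d; rewrite [d ^+ m.+1]exprS exprMn mulrA.
Qed.

(** A squared modulus of the transform of z, described only by what it does when tested against the
    symbols of differences, of Poisson extensions and of Sobolev norms. The transform itself, known
    up to a null set, no longer appears. *)
Definition spec z (p : R -> R) := [/\ mfun p, forall x, 0 <= p x, igr p,
  forall h m, \I_x (W h m x * p x) = 2 * pi * n2 (Dh h m z) &
  (forall t, 0 < t -> \I_x (expR (- (2 * t * `|x|)) * p x) = 2 * pi * n2 (pc t z)) /\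
  (forall s, sobolev_norm s z = ((\int[mu]_x ((1 + x ^+ 2) `^ s * p x)%:E) `^ (2^-1))%E)].

Lemma spec_exists z : L2 z -> exists p, spec z p.
Proof.
move=> Lz; have [_ /in_L2P[w1 L1 h1] /in_L2P[w2 LL hw2] cv] := is_fourier_fourier Lz.
have [it Lt ct] := L2_tr Lz.
have [L2n en] := L2N LL.
have c0 : n2 (fun x => FC (tr n z) x - w1 x) + n2 (fun x => FS (tr n z) x - (- w2 x)) @[n --> \oo] --> (0 : R).
  apply: (fine_cvg (f := fun n => (n2 (fun x => FC (tr n z) x - w1 x) + n2 (fun x => FS (tr n z) x - (- w2 x)))%:E)).
  rewrite (_ : (fun n => _) = fun n => (\int[mu]_x (normsq (truncated_fourier n z x - fourier z x))%:E)%E); first exact: cv.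
  apply/funext => n; have [F1 F2 _] := L2_FCS (it n) (Lt n).
  have M1 := L2B F1 L1; have M2 := L2B F2 L2n.
  rewrite /n2 -(I_D M1.2 M2.2) -(I_fin (igrD M1.2 M2.2)); apply: ae_int.
  apply: (aeS2 _ h1 hw2) => x e1 e2; rewrite truncated_fourierE /normsq.
  case: (fourier z x) e1 e2 => a b /= -> ->; congr EFin; ring.
have c1 : n2 (fun x => FC (tr n z) x - w1 x) @[n --> \oo] --> (0 : R).
  apply: (squeeze_cvgr _ (cvg_cst 0) c0); apply: nearW => n; by rewrite n2_ge0 lerDl n2_ge0.
have c2 : n2 (fun x => FS (tr n z) x - (- w2 x)) @[n --> \oo] --> (0 : R).
  apply: (squeeze_cvgr _ (cvg_cst 0) c0); apply: nearW => n; by rewrite n2_ge0 lerDr n2_ge0.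
pose p x := w1 x ^+ 2 + w2 x ^+ 2.
have ip : igr p := igrD L1.2 LL.2.
have mp := igr_mfun ip.
have p0 x : 0 <= p x by rewrite addr_ge0 ?sqr_ge0.
(* Any identity tested against the square of a bounded multiplier passes from the integrable
   truncations of z to z, because the transforms converge in L^2. *)
have pass (c : R -> R) (C : R) (A : nat -> R) (l : R) : mfun c -> (forall x, `|c x| <= C) ->
    (forall n, \I_x (c x ^+ 2 * rho (tr n z) x) = A n) -> A @ \oo --> l -> \I_x (c x ^+ 2 * p x) = l.
  move=> mc cC hA cA.
  have Lc f : L2 f -> L2 (fun x => c x * f x) /\ n2 (fun x => c x * f x) <= C ^+ 2 * n2 f.
    move=> Lf; have mcf : mfun (fun x => c x * f x) by apply: measurable_funM => //; exact: Lf.1.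
    by apply: (L2_dom Lf mcf) => x; rewrite normrM ler_wpM2r.
  have lim (v : nat -> R -> R) w : (forall n, L2 (v n)) -> L2 w -> n2 (fun x => v n x - w x) @[n --> \oo] --> (0 : R) ->
      n2 (fun x => c x * v n x) @[n --> \oo] --> n2 (fun x => c x * w x).
    move=> Lv Lw cvw; apply: n2_cvg => [n||]; [exact: (Lc _ (Lv n)).1|exact: (Lc _ Lw).1|].
    apply: (squeeze_cvgr (f := fun=> 0) (h := fun n => C ^+ 2 * n2 (fun x => v n x - w x))); last 2 first.
    - exact: cvg_cst.
    - by rewrite -[X in _ --> X](mulr0 (C ^+ 2)); apply: cvgM; [exact: cvg_cst|].
    apply: nearW => n; rewrite n2_ge0 /=; have [_ h] := Lc _ (L2B (Lv n) Lw); apply: le_trans h.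
    by rewrite le_eqVlt; apply/orP; left; apply/eqP; congr n2; apply/funext => x; rewrite mulrBr.
  have l1 := lim _ _ (fun n => let: And3 a _ _ := L2_FCS (it n) (Lt n) in a) L1 c1.
  have l2 := lim _ _ (fun n => let: And3 _ a _ := L2_FCS (it n) (Lt n) in a) L2n c2.
  have l3 : n2 (fun x => c x * FC (tr n z) x) + n2 (fun x => c x * FS (tr n z) x) @[n --> \oo] -->
      n2 (fun x => c x * w1 x) + n2 (fun x => c x * - w2 x) by exact: cvgD.
  have e1 : \I_x (c x ^+ 2 * p x) = n2 (fun x => c x * w1 x) + n2 (fun x => c x * - w2 x).
    rewrite /n2 -(I_D (Lc _ L1).1.2 (Lc _ L2n).1.2); apply: eq_I => x.
    by rewrite /p !exprMn sqrrN mulrDr.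
  rewrite e1; suff eA : (fun n => n2 (fun x => c x * FC (tr n z) x) + n2 (fun x => c x * FS (tr n z) x)) = A.
    by rewrite eA in l3; exact: cvg_unique _ l3 cA.
  apply/funext => n; rewrite -hA /=; have [F1 F2 _] := L2_FCS (it n) (Lt n).
  rewrite /n2 -(I_D (Lc _ F1).1.2 (Lc _ F2).1.2); apply: eq_I => x.
  by rewrite /rho !exprMn mulrDr.
exists p; split => //.
- move=> h m; apply: (pass (fun x => (2 * sin (2^-1 * (h * x))) ^+ m) (2 ^+ m) (fun n => 2 * pi * n2 (Dh h m (tr n z)))).
  + have ms := @mfun_sin R; apply: measurable_funX; apply: measurable_funM => //; apply: (measurableT_comp ms).
    by apply: measurable_funM => //; apply: measurable_funM.
  + move=> x; rewrite normrX lerXn2r ?nnegrE // normrM ger0_norm // ler_piMr // sin_abs //.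
  + move=> n; have [_ e] := Plancherel (igr_Dh h m (it n)) (L2_Dh h m (Lt n)).1.
    by rewrite -e; apply: eq_I => x; rewrite rho_Dh.
  apply: cvgM; first exact: cvg_cst.
  apply: n2_cvg => [n||]; [exact: (L2_Dh h m (Lt n)).1|exact: (L2_Dh h m Lz).1|].
  apply: (squeeze_cvgr (f := fun=> 0) (h := fun n => 4 ^+ m * n2 (fun x => tr n z x - z x))); last 2 first.
  + exact: cvg_cst.
  + by rewrite -[X in _ --> X](mulr0 (4 ^+ m)); apply: cvgM; [exact: cvg_cst|].
  apply: nearW => n; rewrite n2_ge0 /=; have [_ h'] := L2_Dh h m (L2B (Lt n) Lz); apply: le_trans h'.
  by rewrite le_eqVlt; apply/orP; left; apply/eqP; congr n2; apply/funext => x; rewrite Dh_B.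
split=> [t t0|s].
  rewrite (_ : (fun x => _) = fun x => expR (- (t * `|x|)) ^+ 2 * p x); last first.
    by apply/funext => x; rewrite expr2 -expRD; congr (expR _ * _); ring.
  apply: (pass _ 1 (fun n => 2 * pi * n2 (pc t (tr n z)))); first by meas.
  + by move=> x; rewrite ger0_norm ?expR_ge0 // expRN_le1 // mulr_ge0 // ltW.
  + move=> n; rewrite (n2_pcE t0 (Lt n)) -(I_rho (addr_gt0 t0 t0) (it n)).
    by apply: eq_I => x; rewrite expr2 -expRD; congr (expR _ * _); ring.
  apply: cvgM; first exact: cvg_cst.
  apply: n2_cvg => [n||]; [exact: L2_pc|exact: L2_pc|].
  apply: (squeeze_cvgr _ (cvg_cst 0) ct); apply: nearW => n; rewrite n2_ge0 /=.
  apply: le_trans (n2_pc_le t0 (L2B (Lt n) Lz)).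
  rewrite le_eqVlt; apply/orP; left; apply/eqP; congr n2; apply/funext => x.
  by rewrite (pcB x t0 (L2_pint (Lt n)) (L2_pint Lz)).
rewrite /sobolev_norm; congr (_ `^ _)%E; apply: ae_int.
by apply: (aeS2 _ h1 hw2) => x e1 e2; rewrite /normsq e1 e2.
Qed.

End Spectrum2.

(** * Sobolev norms of integer order through iterated differences *)

Section SobolevBounds.
Context {R : realType}.
Implicit Types (t s x y h a b r e : R) (f g k q u w z p : R -> R) (m n j : nat).
Notation mu := (@lebesgue_measure R).

Lemma nb_L2 g (M : R) : nb g M -> L2 g /\ n2 g <= M ^+ 2.
Proof.
by move=> h; have [i l] := nb_I h; split => //; split => //; exact: nb_mfun h.
Qed.

Lemma sob_le z p s e : spec z p -> 0 <= e -> (\int[mu]_x ((1 + x ^+ 2) `^ s * p x)%:E <= (e ^+ 2)%:E)%E ->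
  (sobolev_norm s z <= e%:E)%E.
Proof.
move=> [_ p0 _ _ [_ ->]] e0 h.
have i0 : (0 <= \int[mu]_x ((1 + x ^+ 2) `^ s * p x)%:E)%E.
  by apply: integral_ge0 => x _; rewrite lee_fin mulr_ge0 ?powR_ge0.
apply: (@le_trans _ _ ((e ^+ 2)%:E `^ (2^-1))%E).
  by apply: gt0_ler_poweR => //; rewrite ?in_itv /= ?leey ?i0 // lee_fin sqr_ge0.
by rewrite poweR_EFin powR12_sqrt ?sqr_ge0 // sqrtr_sqr ger0_norm.
Qed.

Lemma sob_ge z p s e : spec z p -> 0 <= e -> (sobolev_norm s z <= e%:E)%E ->
  igr (fun x => (1 + x ^+ 2) `^ s * p x) /\ \I_x ((1 + x ^+ 2) `^ s * p x) <= e ^+ 2.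
Proof.
move=> [mp p0 _ _ [_ ->]] e0 h.
have i0 : (0 <= \int[mu]_x ((1 + x ^+ 2) `^ s * p x)%:E)%E.
  by apply: integral_ge0 => x _; rewrite lee_fin mulr_ge0 ?powR_ge0.
have mw : mfun (fun x : R => (1 + x ^+ 2) `^ s * p x).
  by apply: measurable_funM => //; apply: (measurableT_comp (@measurable_powR R s)); meas.
apply: I_le_ereal => //; first by move=> x; rewrite mulr_ge0 ?powR_ge0.
rewrite (poweR12_sqrt i0) in h.
move: i0 h; case: (\int[mu]_x _)%E => [r|//|//] /=.
rewrite !lee_fin => r0 h.
by rewrite -(sqr_sqrtr r0) lerXn2r ?nnegrE ?sqrtr_ge0.
Qed.

Lemma spec_n2 z p : spec z p -> \I_x p x = 2 * pi * n2 z.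
Proof.
move=> [_ _ _ /(_ 0 0%N) h _]; rewrite -[n2 z]/(n2 (Dh 0 0 z)) -h.
by apply: eq_I => x; rewrite /W expr0 expr1n mul1r.
Qed.

Lemma sob_n2 z s e : L2 z -> 0 <= s -> 0 <= e -> (sobolev_norm s z <= e%:E)%E -> 2 * pi * n2 z <= e ^+ 2.
Proof.
move=> Lz s0 e0 h; have [p hp] := spec_exists Lz; have [ig le] := sob_ge hp e0 h.
have [_ p0 ip _ _] := hp.
rewrite -(spec_n2 hp); apply: le_trans le; apply: I_le => // x.
rewrite -[leLHS]mul1r ler_wpM2r // [leLHS](_ : _ = 1 `^ s); last by rewrite powR1.
apply: ge0_ler_powR => //.
- by rewrite nnegrE.
- by rewrite nnegrE addr_ge0 ?sqr_ge0.
- by rewrite lerDl sqr_ge0.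
Qed.

Lemma sin_abs_le a : `|sin a| <= `|a|.
Proof. by have := sin_lip 0 a; rewrite sin0 !subr0. Qed.

Lemma W_ge0 h m x : 0 <= W h m x. Proof. exact: sqr_ge0. Qed.

Lemma W_le h m x : W h m x <= (h * x) ^+ (2 * m).
Proof.
rewrite /W -exprM mulnC !exprM; apply: lerXn2r; rewrite ?nnegrE ?sqr_ge0 //.
rewrite -normK2 -[leRHS]normK2 lerXn2r ?nnegrE //.
have hh := sin_abs_le (2^-1 * (h * x)); rewrite [`|2 * _|]normrM.
rewrite [`|2^-1 * _|]normrM (ger0_norm (_ : 0 <= 2^-1)) // in hh; rewrite (ger0_norm (_ : 0 <= 2)) //; lra.
Qed.

Lemma mfun_W h m : mfun (W h m).
Proof.
have ms := @mfun_sin R; apply: measurable_funX; apply: measurable_funX; apply: measurable_funM => //.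
by apply: (measurableT_comp ms); apply: measurable_funM => //; apply: measurable_funM.
Qed.

Lemma W_cvg m x : (hstep n) ^- (2 * m) * W (hstep n) m x @[n --> \oo] --> x ^+ (2 * m).
Proof.
have d : is_derive (0 : R) 1 (fun h => sin (2^-1 * (h * x))) (2^-1 * x).
  have h1 : is_derive (0 : R) 1 (fun h => 2^-1 * (h * x)) (2^-1 * x) by apply: is_derive_eq; rewrite /GRing.scale /=; ring.
  have := is_derive_comp (g := fun h => 2^-1 * (h * x)) (is_derive_sin (2^-1 * (0 * x))) h1.
  by rewrite mul0r mulr0 cos0 mul1r.
have c := derive_seq d (@hstep_neq0 R) hstep_cvg.
have c2 : 2 * ((hstep n)^-1 * sin (2^-1 * (hstep n * x))) @[n --> \oo] --> x.
  rewrite -[X in _ --> X](_ : 2 * (2^-1 * x) = x); last by rewrite mulrA divff ?mul1r.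
  apply: cvgM; first exact: cvg_cst.
  by move: c; under eq_fun do rewrite add0r mul0r mulr0 sin0 subr0.
have cX (v : nat -> R) (l : R) (N : nat) : v @ \oo --> l -> v n ^+ N @[n --> \oo] --> l ^+ N.
  move=> cv; elim: N => [|N IH]; first by under eq_fun do rewrite expr0; exact: cvg_cst.
  by under eq_fun do rewrite exprS; rewrite exprS; apply: cvgM.
rewrite (_ : (fun n => _) = fun n => (2 * ((hstep n)^-1 * sin (2^-1 * (hstep n * x)))) ^+ (2 * m)); first exact: cX.
apply/funext => n; rewrite /W -exprM [(m * 2)%N]mulnC -exprVn -exprMn; congr (_ ^+ _); ring.
Qed.

(** The symbols h^{-2m} W h m tend to x^{2m} as h -> 0, so Fatou's lemma turns bounds on iterated
    differences into a bound on a moment of the density. *)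
Lemma spec_moment z p m (B : R) : spec z p -> (forall n, n2 (Dh (hstep n) m z) <= hstep n ^+ (2 * m) * B) ->
  igr (fun x => x ^+ (2 * m) * p x) /\ \I_x (x ^+ (2 * m) * p x) <= 2 * pi * B.
Proof.
move=> [mp p0 ip hW _] hB; have mW := mfun_W.
have h0 n : 0 < hstep n :> R by rewrite /hstep invr_gt0.
apply: (@fatou_bound R (fun n x => hstep n ^- (2 * m) * W (hstep n) m x * p x)).
- by move=> n; have mWn := mW (hstep n) m; meas.
- by move=> n x; rewrite mulr_ge0 // mulr_ge0 ?W_ge0 // invr_ge0 exprn_ge0 // ltW.
- by move=> x; apply: cvgM; [exact: W_cvg|exact: cvg_cst].
apply: nearW => n; have hp : 0 < hstep n ^+ (2 * m) :> R by rewrite exprn_gt0.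
have iWp : igr (fun x => W (hstep n) m x * p x).
  apply: (igr_le _ (igrZ (4 ^+ m) ip)) => [|x]; first by have mWn := mW (hstep n) m; meas.
  rewrite ger0_norm; last by rewrite mulr_ge0 ?W_ge0.
  rewrite ler_wpM2r // /W -exprM mulnC exprM; apply: lerXn2r; rewrite ?nnegrE ?sqr_ge0 //.
  rewrite -normK2 normrM ger0_norm //.
  by have := sin_abs (2^-1 * (hstep n * x)); have := normr_ge0 (sin (2^-1 * (hstep n * x))); nra.
have -> : (\int[mu]_x (hstep n ^- (2 * m) * W (hstep n) m x * p x)%:E = (hstep n ^- (2 * m) * (2 * pi * n2 (Dh (hstep n) m z)))%:E)%E.
  rewrite -hW -(I_Z _ iWp) -(I_fin (igrZ _ iWp)); apply: eq_integral => x _; by rewrite mulrA.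
rewrite lee_fin [leLHS]mulrC ler_pdivrMr // -[leRHS]mulrA ler_pM2l ?mulr_gt0 ?pi_gt0 // [leRHS]mulrC; exact: hB.
Qed.

Lemma one_plus_pow j a : 0 <= a -> (1 + a) ^+ j <= 2 ^+ j * (1 + a ^+ j).
Proof.
move=> a0; have a1 : 0 <= a ^+ j by rewrite exprn_ge0.
have [a1'|a1'] := lerP a 1.
  apply: (@le_trans _ _ (2 ^+ j)); first by rewrite lerXn2r ?nnegrE ?addr_ge0 //; lra.
  by rewrite ler_peMr ?exprn_ge0 // lerDl.
apply: (@le_trans _ _ (2 ^+ j * a ^+ j)); last by rewrite ler_pM2l ?exprn_gt0 // lerDr.
by rewrite -exprMn lerXn2r ?nnegrE ?addr_ge0 ?mulr_ge0 //; lra.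
Qed.

Lemma sob_le_moment z p j (A B e : R) : spec z p -> n2 z <= A ->
  igr (fun x => x ^+ (2 * j) * p x) -> \I_x (x ^+ (2 * j) * p x) <= 2 * pi * B ->
  0 <= e -> 2 ^+ j * (2 * pi * (A + B)) <= e ^+ 2 -> (sobolev_norm j%:R z <= e%:E)%E.
Proof.
move=> hp hA ig hB e0 he; apply: (sob_le hp e0); have [mp p0 ip _ _] := hp.
have igs : igr (fun x => 2 ^+ j * (p x + x ^+ (2 * j) * p x)) by apply: igrZ; exact: igrD.
apply: (@le_trans _ _ (\I_x (2 ^+ j * (p x + x ^+ (2 * j) * p x)))%:E).
  rewrite -(I_fin igs); apply: ge0_le_integral => //.
  - by move=> x _; rewrite lee_fin mulr_ge0 ?powR_ge0.
  - apply/measurable_EFinP; apply: measurable_funM => //; apply: (measurableT_comp (@measurable_powR R j%:R)); meas.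
  - by apply/measurable_EFinP; exact: igr_mfun.
  move=> x _; rewrite lee_fin powR_mulrn ?addr_ge0 ?sqr_ge0 //.
  have -> : 2 ^+ j * (p x + x ^+ (2 * j) * p x) = 2 ^+ j * (1 + x ^+ (2 * j)) * p x by ring.
  by rewrite ler_wpM2r // exprM; exact: one_plus_pow (sqr_ge0 x).
rewrite lee_fin (I_Z _ (igrD ip ig)) (I_D ip ig) (spec_n2 hp); apply: le_trans he.
rewrite ler_pM2l ?exprn_gt0 // [leRHS]mulrDr; apply: lerD => //; by rewrite ler_pM2l // mulr_gt0 // pi_gt0.
Qed.

Lemma nb_moment z p m (B : R) : spec z p -> (forall h, nb (Dh h m z) (`|h| ^+ m * B)) ->
  igr (fun x => x ^+ (2 * m) * p x) /\ \I_x (x ^+ (2 * m) * p x) <= 2 * pi * B ^+ 2.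
Proof.
move=> hp hB; apply: (spec_moment hp) => n; have [_] := nb_L2 (hB (hstep n)).
by rewrite exprMn -exprM [(m * 2)%N]mulnC exprM normK2 -exprM.
Qed.

Lemma nb_sobolev z j (A B : R) : nb z A -> (forall h, nb (Dh h j z) (`|h| ^+ j * B)) -> in_sobolev j%:R z.
Proof.
move=> hA hB; have [Lz nz] := nb_L2 hA; have [p hp] := spec_exists Lz.
split; first by apply/in_L2P; exists z => //; exact: aeW.
have [ig le] := nb_moment hp hB.
pose E := 2 ^+ j * (2 * pi * (A ^+ 2 + B ^+ 2)).
have E0 : 0 <= E by rewrite !mulr_ge0 ?exprn_ge0 ?pi_ge0 // addr_ge0 ?sqr_ge0.
apply: le_lt_trans (ltry (Num.sqrt E)); apply: (sob_le_moment hp nz ig le); first exact: sqrtr_ge0.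
by rewrite sqr_sqrtr.
Qed.

(* interpolation between L^2 and H^{2j} *)
Lemma sob_small j (B e : R) : 0 < e -> exists2 d, 0 < d & forall z, nb z d ->
  (forall h, nb (Dh h (2 * j) z) (`|h| ^+ (2 * j) * B)) -> (sobolev_norm j%:R z <= e%:E)%E.
Proof.
move=> e0; pose K : R := 2 ^+ j * (2 * pi).
have K0 : 0 < K by rewrite !mulr_gt0 ?exprn_gt0 ?pi_gt0.
(* The budget e^2 is split in two: r gives at most half of it to the moment of high order, and [d2']
   gives the other half to the L^2 norm. *)
pose r : R := e ^+ 2 / (2 * K * (B ^+ 2 + 1)).
have B0 := sqr_ge0 B.
have r0 : 0 < r by rewrite divr_gt0 ?exprn_gt0 // mulr_gt0 ?ltr_wpDl // mulr_gt0.
pose d2' : R := e ^+ 2 / (2 * K * (1 + r^-1)).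
have q0 : 0 < 1 + r^-1 by rewrite addr_gt0 // invr_gt0.
have d20 : 0 < d2' by rewrite divr_gt0 ?exprn_gt0 // mulr_gt0 // mulr_gt0.
exists (Num.sqrt d2'); first by rewrite sqrtr_gt0.
move=> z hz hB; have [Lz nz] := nb_L2 hz; rewrite sqr_sqrtr ?(ltW d20) // in nz.
have [p hp] := spec_exists Lz; have [ig le] := nb_moment hp hB.
have [mp p0 ip _ _] := hp.
have pw x : x ^+ (2 * j) * p x <= r * (x ^+ (2 * (2 * j)) * p x) + r^-1 * p x.
  rewrite [(2 * (2 * j))%N]mulnC [in X in _ <= X]exprM; set a := x ^+ (2 * j).
  have -> : r * (a ^+ 2 * p x) + r^-1 * p x = a * p x + ((r^-1 * (r * a - 2^-1) ^+ 2) + 3 / 4 * r^-1) * p x.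
    by field; rewrite gt_eqF.
  rewrite lerDl; apply: mulr_ge0 => //; apply: addr_ge0; apply: mulr_ge0; rewrite ?sqr_ge0 ?invr_ge0 ?(ltW r0) //.
have a0 x : 0 <= x ^+ (2 * j) by rewrite exprM exprn_ge0 ?sqr_ge0.
have igs : igr (fun x => r * (x ^+ (2 * (2 * j)) * p x) + r^-1 * p x) by apply: igrD; exact: igrZ.
have ig1 : igr (fun x => x ^+ (2 * j) * p x).
  apply: (igr_le _ igs) => [|x]; last by rewrite ger0_norm ?pw // mulr_ge0.
  by apply: measurable_funM => //; exact: exprn_measurable.
apply: (sob_le_moment (A := d2') (B := r * B ^+ 2 + r^-1 * d2') hp nz ig1); [|exact: ltW|].
  apply: (le_trans (I_le ig1 igs pw)); rewrite I_D ?I_Z ?(spec_n2 hp) //; try exact: igrZ.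
  have pi2 : 0 < 2 * pi :> R by rewrite mulr_gt0 // pi_gt0.
  rewrite [leRHS]mulrDr; apply: lerD.
    by rewrite [leRHS]mulrCA ler_pM2l.
  by rewrite mulrCA ler_pM2l // ler_pM2l ?invr_gt0.
rewrite mulrA -/K (_ : d2' + (r * B ^+ 2 + r^-1 * d2') = d2' * (1 + r^-1) + r * B ^+ 2); last by ring.
have e1 : K * (d2' * (1 + r^-1)) = e ^+ 2 / 2.
  have F (k q E : R) : 0 < k -> 0 < q -> k * (E / (2 * k * q) * q) = E / 2.
    by move=> k0 q1; field; rewrite !gt_eqF.
  exact: F.
have e2 : K * (r * B ^+ 2) <= e ^+ 2 / 2.
  rewrite /r; have : B ^+ 2 / (B ^+ 2 + 1) <= 1 by rewrite ler_pdivrMr ?ltr_wpDl // mul1r lerDl.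
  have -> : K * (e ^+ 2 / (2 * K * (B ^+ 2 + 1)) * B ^+ 2) = e ^+ 2 / 2 * (B ^+ 2 / (B ^+ 2 + 1)).
    have F (k b E : R) : 0 < k -> 0 <= b -> k * (E / (2 * k * (b + 1)) * b) = E / 2 * (b / (b + 1)).
      by move=> k0 b0; field; rewrite !gt_eqF // ltr_wpDl.
    exact: F.
  by move=> h; rewrite ler_piMr // divr_ge0 ?sqr_ge0.
by rewrite mulrDr e1; lra.
Qed.

Lemma sobolev_fin s z : (sobolev_norm s z < +oo)%E -> exists2 e : R, 0 <= e & (sobolev_norm s z <= e%:E)%E.
Proof.
have h0 : (0 <= sobolev_norm s z)%E by exact: poweR_ge0.
by move: h0; case: (sobolev_norm s z) => // r r0 _; exists r.
Qed.

(** The symbol of the second difference is at most (y xi)^2 in modulus, and xi^4 <= (1 + xi^2)^2.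
    Uniqueness uses the spatial smoothness of an arbitrary solution in this form. *)
Lemma H2_d2 z : L2 z -> in_sobolev 2%:R z -> exists C, forall y, n2 (d2 y z) <= C * y ^+ 4.
Proof.
move=> Lz [_ /sobolev_fin[e e0 h]]; have [p hp] := spec_exists Lz; have [ig le] := sob_ge hp e0 h.
have [mp p0 ip hW _] := hp.
have pi2 : 0 < 2 * pi :> R by rewrite mulr_gt0 // pi_gt0.
exists (e ^+ 2 / (2 * pi)) => y; have y4 : 0 <= y ^+ 4 by exact: exprn_even_ge0.
have -> : n2 (d2 y z) = n2 (Dh y 2 z).
  have [LD _] := L2_Dh y 2 Lz; have [Ls <-] := L2_shift (- y) LD; have [_ <-] := L2N Ls.
  by congr n2; apply/funext => x; rewrite /Dh /d2 /= subrK; ring.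
rewrite mulrAC ler_pdivlMr // mulrC -hW.
have mW := mfun_W y 2.
have i1 := igrZ (y ^+ 4) ig.
rewrite mulrC; apply: (@le_trans _ _ (\I_x (y ^+ 4 * ((1 + x ^+ 2) `^ 2%:R * p x)))); last first.
  by rewrite (I_Z _ ig) ler_wpM2l.
have pw x : W y 2 x * p x <= y ^+ 4 * ((1 + x ^+ 2) `^ 2%:R * p x).
  rewrite mulrA ler_wpM2r //; apply: (le_trans (W_le y 2 x)).
  rewrite exprMn; apply: ler_wpM2l; first exact: y4.
  rewrite exprM powR_mulrn ?addr_ge0 ?sqr_ge0 // lerXn2r ?nnegrE ?addr_ge0 ?sqr_ge0 // lerDr //.
apply: I_le => //; apply: (igr_le _ i1) => [|x]; first by meas.
by rewrite ger0_norm ?pw // mulr_ge0 ?W_ge0.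
Qed.

End SobolevBounds.

(** * The norm of order 1/2 and its gain in the Duhamel term *)

Section HalfOrder.
Context {R : realType}.
Implicit Types (t s x h a b r e : R) (f q u w z k p g : R -> R) (m n j : nat).
Notation mu := (@lebesgue_measure R).

(* (2 pi)^-1 times the integral of [1 - e^{-2 t |xi|}] against the spectral density *)
Definition En t z := n2 z - n2 (pc t z).

Lemma En_ge0 t z : 0 < t -> L2 z -> 0 <= En t z.
Proof. by move=> t0 Lz; rewrite subr_ge0; exact: n2_pc_le. Qed.

(** The part of [spec] that refers to Poisson extensions only. It is inherited by P_s z and by P_t z
    - z, whose densities are those of z times explicit factors. *)
Definition dens z p := [/\ mfun p, forall x, 0 <= p x, igr p, \I_x p x = 2 * pi * n2 z &
  forall t, 0 < t -> \I_x (expR (- (2 * t * `|x|)) * p x) = 2 * pi * n2 (pc t z)].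

Lemma dens_of_spec z p : spec z p -> dens z p.
Proof. by move=> hp; have e := spec_n2 hp; have [mp p0 ip _ [hP _]] := hp; split. Qed.

Lemma igr_damp a p : 0 <= a -> mfun p -> (forall x, 0 <= p x) -> igr p -> igr (fun x => expR (- (a * `|x|)) * p x).
Proof.
move=> a0 mp p0 ip; apply: (igr_le _ ip) => [|x]; first by meas.
by rewrite ger0_norm ?mulr_ge0 ?expR_ge0 // ler_piMl // expRN_le1 // mulr_ge0.
Qed.

Lemma EnE t z p : dens z p -> 0 < t ->
  igr (fun x => (1 - expR (- (2 * t * `|x|))) * p x) /\
  \I_x ((1 - expR (- (2 * t * `|x|))) * p x) = 2 * pi * En t z.
Proof.
move=> [mp p0 ip e hP] t0.
have t2 : 0 <= 2 * t by rewrite mulr_ge0 // ltW.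
have iE := igr_damp t2 mp p0 ip.
have -> : (fun x => (1 - expR (- (2 * t * `|x|))) * p x) = (fun x => p x - expR (- (2 * t * `|x|)) * p x).
  by apply/funext => x; ring.
by split; [exact: igrB|rewrite (I_B ip iE) (hP _ t0) e /En mulrBr].
Qed.

Lemma expN_facts a : 0 <= a -> [/\ 0 <= 1 - expR (- a), 1 - expR (- a) <= a, 1 - expR (- a) <= 1 & a * expR (- a) <= 1].
Proof.
move=> a0; have h1 : expR (- a) <= 1 by rewrite expRN_le1.
have h2 := expR_ge1Dx (- a); have h3 := expR_ge0 (- a); split; try lra.
by rewrite expRN ler_pdivrMr ?expR_gt0 // mul1r; have := expR_ge1Dx a; lra.
Qed.

(** The quotients (1 - e^{-2t|x|}) / (2t) tend to |x| as t -> 0, and Fatou's lemma applies; the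
    half-order norm is thus read off from [En]. *)
Lemma half_moment z p (K : R) : spec z p -> (forall t, 0 < t -> En t z <= t * K) ->
  igr (fun x => `|x| * p x) /\ \I_x (`|x| * p x) <= pi * K.
Proof.
move=> hp hK; have [mp p0 ip _ _] := hp.
have h0 n : 0 < hstep n :> R by rewrite /hstep invr_gt0.
apply: (@fatou_bound R (fun n x => (2 * hstep n)^-1 * (1 - expR (- (2 * hstep n * `|x|))) * p x)).
- by move=> n; meas.
- move=> n x; have q0 : 0 <= 2 * hstep n * `|x| by rewrite !mulr_ge0 // ltW.
  by have [q _ _ _] := expN_facts q0; rewrite !mulr_ge0 ?q ?invr_ge0 ?mulr_ge0 // ltW.
- move=> x; apply: cvgM; last exact: cvg_cst.
  have d : is_derive (0 : R) 1 (fun h => expR (- (2 * h * `|x|))) (- (2 * `|x|)).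
    have h1 : is_derive (0 : R) 1 (fun h => - (2 * h * `|x|)) (- (2 * `|x|)) by apply: is_derive_eq; rewrite /GRing.scale /=; ring.
    have := is_derive_comp (g := fun h => - (2 * h * `|x|)) (is_derive_expR (- (2 * 0 * `|x|))) h1.
    by rewrite mulr0 mul0r oppr0 expR0 mul1r.
  have c := derive_seq d (@hstep_neq0 R) hstep_cvg.
  have c2 : (- 2^-1) * ((hstep n)^-1 * (expR (- (2 * (0 + hstep n) * `|x|)) - expR (- (2 * 0 * `|x|)))) @[n --> \oo] --> `|x|.
    rewrite -[X in _ --> X](_ : - 2^-1 * - (2 * `|x|) = `|x|); last by rewrite mulrNN mulrA mulVf ?mul1r.
    by apply: cvgM => //; exact: cvg_cst.
  rewrite (_ : (fun n => _) = fun n => (- 2^-1) * ((hstep n)^-1 * (expR (- (2 * (0 + hstep n) * `|x|)) - expR (- (2 * 0 * `|x|))))) //.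
  apply/funext => n; rewrite mulr0 mul0r oppr0 expR0 add0r invfM; ring.
apply: nearW => n; have [ig e] := EnE (dens_of_spec hp) (h0 n).
have -> : (\int[mu]_x ((2 * hstep n)^-1 * (1 - expR (- (2 * hstep n * `|x|))) * p x)%:E = ((2 * hstep n)^-1 * (2 * pi * En (hstep n) z))%:E)%E.
  by rewrite -e -(I_Z _ ig) -(I_fin (igrZ _ ig)); apply: eq_integral => x _; rewrite mulrA.
rewrite lee_fin ler_pdivrMl ?mulr_gt0 //.
by have := hK _ (h0 n); rewrite -(ler_pM2l (pi_gt0 R)); lra.
Qed.

Lemma sob_half_le z p (A K e : R) : spec z p -> n2 z <= A -> (forall t, 0 < t -> En t z <= t * K) -> 0 <= e ->
  2 * pi * A + pi * K <= e ^+ 2 -> (sobolev_norm 2^-1 z <= e%:E)%E.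
Proof.
move=> hp hA hK e0 he; have [ig le] := half_moment hp hK; have [mp p0 ip _ _] := hp.
apply: (sob_le hp e0); have igs := igrD ip ig.
apply: (@le_trans _ _ (\I_x (p x + `|x| * p x))%:E).
  rewrite -(I_fin igs); apply: ge0_le_integral => //.
  - by move=> x _; rewrite lee_fin mulr_ge0 ?powR_ge0.
  - apply/measurable_EFinP; apply: measurable_funM => //; apply: (measurableT_comp (@measurable_powR R 2^-1)); meas.
  - by apply/measurable_EFinP; exact: igr_mfun.
  move=> x _; rewrite lee_fin (_ : p x + `|x| * p x = (1 + `|x|) * p x); last by ring.
  rewrite ler_wpM2r // powR12_sqrt ?addr_ge0 ?sqr_ge0 // -[leRHS](ger0_norm (_ : 0 <= 1 + `|x|)) ?addr_ge0 //.
  rewrite -sqrtr_sqr ler_wsqrtr // sqrrD expr1n normK2 mul1r lerD2r lerDl.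
  by rewrite mulrn_wge0.
rewrite lee_fin (I_D ip ig) (spec_n2 hp); apply: le_trans he; apply: lerD => //.
by rewrite ler_pM2l // mulr_gt0 // pi_gt0.
Qed.

Lemma En_Z t c z : 0 < t -> L2 z -> En t (fun x => c * z x) = c ^+ 2 * En t z.
Proof.
move=> t0 Lz; have [_ e1] := L2Z c Lz; have [_ e2] := L2Z c (L2_pc t0 Lz).
rewrite /En e1 mulrBr -e2; congr (_ - n2 _); apply/funext => x; rewrite pcZ //; exact: L2_pint.
Qed.

(** [En t] is a nonnegative quadratic form: this is the parallelogram law with the term for f - q
    dropped. *)
Lemma En_add t f q : 0 < t -> L2 f -> L2 q -> En t (fun x => f x + q x) <= 2 * En t f + 2 * En t q.
Proof.
move=> t0 Lf Lq; have [Lfq e1] := n2D Lf Lq; have Lm := L2B Lf Lq.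
have [LN eN] := L2N Lq; have [_ e2] := n2D Lf LN.
have [_ e3] := n2D (L2_pc t0 Lf) (L2_pc t0 Lq).
have [LN' eN'] := L2N (L2_pc t0 Lq); have [_ e4] := n2D (L2_pc t0 Lf) LN'.
have ge := En_ge0 t0 Lm; move: ge; rewrite /En.
have -> : pc t (fun x => f x - q x) = fun x => pc t f x - pc t q x.
  by apply/funext => x; rewrite (pcB x t0 (L2_pint Lf) (L2_pint Lq)).
have -> : pc t (fun x => f x + q x) = fun x => pc t f x + pc t q x.
  by apply/funext => x; rewrite (pcD x t0 (L2_pint Lf) (L2_pint Lq)).
rewrite e1 e2 e3 e4 eN eN'.
have n (a b : R -> R) : L2 a -> L2 b -> \I_x (a x * - b x) = - \I_x (a x * b x).
  move=> La Lb; rewrite -mulN1r -(I_Z _ (igr_mul La Lb)); apply: eq_I => x; ring.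
rewrite (n _ _ Lf Lq) (n _ _ (L2_pc t0 Lf) (L2_pc t0 Lq)).
by move: (n2 _) (n2 _) (n2 _) (n2 _) (\I_x _) (\I_x _); clear => a b c d i j h; lra.
Qed.

Lemma n2_pc_expand t z : 0 < t -> L2 z ->
  n2 (fun x => pc t z x - z x) = n2 (pc t z) + n2 z - 2 * n2 (pc (2^-1 * t) z).
Proof.
move=> t0 Lz; have t2 : 0 < 2^-1 * t by rewrite mulr_gt0.
have [LN eN] := L2N Lz; have [_ e] := n2D (L2_pc t0 Lz) LN.
have tt : 2^-1 * t + 2^-1 * t = t by field.
have e3 : \I_x (pc t z x * - z x) = - n2 (pc (2^-1 * t) z).
  rewrite (n2_pcE t2 Lz) tt -mulN1r -(I_Z _ (igr_mul Lz (L2_pc t0 Lz))).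
  by apply: eq_I => x; ring.
by rewrite e eN e3 mulrN.
Qed.

Lemma pc_pc s t z : 0 < s -> 0 < t -> L2 z -> pc s (pc t z) = pc (s + t) z.
Proof. by move=> s0 t0 Lz; apply/funext => x; rewrite pc_semigroup //; exact: L2_pint. Qed.

Lemma dens_pc s z p : dens z p -> L2 z -> 0 < s -> dens (pc s z) (fun x => expR (- (2 * s * `|x|)) * p x).
Proof.
move=> [mp p0 ip e hP] Lz s0; have s2 : 0 <= 2 * s by rewrite mulr_ge0 // ltW.
split; [by meas|by move=> x; rewrite mulr_ge0 ?expR_ge0|exact: igr_damp|exact: hP|].
move=> t t0; rewrite (pc_pc t0 s0 Lz) -(hP _ (addr_gt0 t0 s0)); apply: eq_I => x.
have -> : - (2 * (t + s) * `|x|) = - (2 * t * `|x|) + - (2 * s * `|x|) by ring.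
by rewrite expRD mulrA.
Qed.

Lemma n2_pc_diff t z p : dens z p -> L2 z -> 0 < t ->
  igr (fun x => (1 - expR (- (t * `|x|))) ^+ 2 * p x) /\
  \I_x ((1 - expR (- (t * `|x|))) ^+ 2 * p x) = 2 * pi * n2 (fun x => pc t z x - z x).
Proof.
move=> [mp p0 ip e hP] Lz t0; have t2 : 0 < 2^-1 * t by rewrite mulr_gt0.
have i1 : igr (fun x => expR (- (2 * t * `|x|)) * p x) by apply: igr_damp; rewrite ?mulr_ge0 // ltW.
have i2 : igr (fun x => expR (- (2 * (2^-1 * t) * `|x|)) * p x) by apply: igr_damp; rewrite ?mulr_ge0 // ltW.
have -> : (fun x => (1 - expR (- (t * `|x|))) ^+ 2 * p x) =
    fun x => p x + expR (- (2 * t * `|x|)) * p x - 2 * (expR (- (2 * (2^-1 * t) * `|x|)) * p x).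
  apply/funext => x; have -> : 2 * (2^-1 * t) * `|x| = t * `|x| by field.
  have -> : - (2 * t * `|x|) = - (t * `|x|) + - (t * `|x|) by ring.
  by rewrite expRD; ring.
split; first exact: igrB (igrD ip i1) (igrZ 2 i2).
rewrite (I_B (igrD ip i1) (igrZ 2 i2)) (I_D ip i1) (I_Z _ i2) e (hP _ t0) (hP _ t2) (n2_pc_expand t0 Lz).
by move: (n2 _) (n2 _) (n2 _) => a b c; move: (pi : R) => q; ring.
Qed.

Lemma dens_diff t z p : dens z p -> L2 z -> 0 < t ->
  dens (fun x => pc t z x - z x) (fun x => (1 - expR (- (t * `|x|))) ^+ 2 * p x).
Proof.
move=> hp Lz t0; have [ig e] := n2_pc_diff hp Lz t0; have [mp p0 ip _ _] := hp.
split; [exact: igr_mfun ig|by move=> x; rewrite mulr_ge0 ?sqr_ge0|exact: ig|exact: e|].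
move=> s s0; have [_ es] := n2_pc_diff (dens_pc hp Lz s0) (L2_pc s0 Lz) t0.
have -> : pc s (fun x => pc t z x - z x) = fun x => pc t (pc s z) x - pc s z x.
  apply/funext => x; rewrite (pcB x s0 (L2_pint (L2_pc t0 Lz)) (L2_pint Lz)) (pc_pc s0 t0 Lz).
  by rewrite addrC (pc_pc t0 s0 Lz) addrC (addrC s).
rewrite -es; apply: eq_I => x; ring.
Qed.

(** At each frequency, 1 - e^{-2t|x|} <= 2 t |x| and 2 s |x| e^{-2s|x|} <= 1. Half a derivative is
    gained in L^2 at the price s^{-1/2}. *)
Lemma En_pc s t g p : dens g p -> L2 g -> 0 < s -> 0 < t -> s * En t (pc s g) <= t * n2 g.
Proof.
move=> hp Lg s0 t0; have [ig e] := EnE (dens_pc hp Lg s0) t0; have [mp p0 ip ep _] := hp.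
have pi2 : 0 < 2 * pi :> R by rewrite mulr_gt0 // pi_gt0.
rewrite -(ler_pM2l pi2) mulrCA -e [leRHS]mulrCA -ep -(I_Z _ ig) -(I_Z _ ip).
apply: I_le; [exact: igrZ|exact: igrZ|move=> x].
rewrite !mulrA ler_wpM2r // -mulrA.
have p1 : 0 <= 2 * t * `|x| by rewrite !mulr_ge0 // ltW.
have p2 : 0 <= 2 * s * `|x| by rewrite !mulr_ge0 // ltW.
have [_ h1 _ _] := expN_facts p1; have [_ _ _ h2] := expN_facts p2.
have h3 : (1 - expR (- (2 * t * `|x|))) * expR (- (2 * s * `|x|)) <= 2 * t * `|x| * expR (- (2 * s * `|x|)).
  by rewrite ler_wpM2r ?expR_ge0.
apply: (@le_trans _ _ (s * (2 * t * `|x| * expR (- (2 * s * `|x|))))); first by rewrite ler_pM2l.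
have -> : s * (2 * t * `|x| * expR (- (2 * s * `|x|))) = t * (2 * s * `|x| * expR (- (2 * s * `|x|))) by ring.
by rewrite ler_piMr // ltW.
Qed.

Lemma En_le_moment t z p : dens z p -> 0 < t -> igr (fun x => `|x| * p x) -> En t z <= t * (pi^-1 * \I_x (`|x| * p x)).
Proof.
move=> hp t0 im; have [ig e] := EnE hp t0; have [mp p0 ip _ _] := hp.
have pi0 := pi_gt0 R.
have h : \I_x ((1 - expR (- (2 * t * `|x|))) * p x) <= \I_x (2 * t * (`|x| * p x)).
  apply: I_le => //; first exact: igrZ.
  move=> x; rewrite mulrA ler_wpM2r //.
  have q0 : 0 <= 2 * t * `|x| by rewrite !mulr_ge0 // ltW.
  by have [_ h _ _] := expN_facts q0.
rewrite e (I_Z _ im) in h; rewrite mulrCA mulrC ler_pdivlMr //.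
have -> : En t z * pi = 2^-1 * (2 * pi * En t z) by field.
by rewrite mulrC ler_pdivrMr // mulrC; lra.
Qed.

Lemma pcE_add t g x : 0 < t -> pint g ->
  igr (fun y => P t y * g (x + y)) /\ pc t g x = \I_y (P t y * g (x + y)).
Proof.
move=> t0 pg; have mg := pint_mfun pg; split.
  have := igr_reflect 0 (igr_reflect x (pg.2 _ x t0)).
  rewrite (_ : (fun y => _) = fun y => P t y * g (x + y)) //.
  by apply/funext => y /=; rewrite sub0r opprK opprD addrA subrr add0r PN.
have mP := mfun_P t.
have mI : mfun (fun y => P t y * g (x - y)) by apply: measurable_funM => //; apply: (measurableT_comp mg); meas.
rewrite pcE // -(I_reflect 0 mI).
by apply: eq_I => y; rewrite sub0r PN opprK.
Qed.

(** A Gagliardo-type formula, from expanding the square and the symmetry of the kernel P_{2t}. It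
    writes [En] as an average of squared L^2 norms, which is the form that passes through
    superpositions. *)
Lemma mul_gagliardo t z : 0 < t -> L2 z ->
  En t z = 2^-1 * \I_h (P (t + t) h * n2 (fun x => z (x + h) - z x)).
Proof.
move=> t0 Lz; have [mz iz] := Lz; have tt : 0 < t + t by rewrite addr_gt0.
pose F c : R := P (t + t) c.1 * (z (c.2 + c.1) * z c.2).
have mF : mfun (F : R * R -> R) by rewrite /F; meas2.
have Lh h := L2_shift h Lz.
have ih h : igr (fun x => z (x + h) * z x) := igr_mul (Lh h).1 Lz.
have habs h : \I_x `|z (x + h) * z x| <= n2 z.
  have -> : n2 z = \I_x (2^-1 * (z (x + h) ^+ 2 + z x ^+ 2)).
    rewrite (I_Z _ (igrD (Lh h).1.2 iz)) (I_D (Lh h).1.2 iz) -/(n2 (fun x => z (x + h))) (Lh h).2 -/(n2 z); by field.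
  apply: I_le; [exact: igr_abs|by apply: igrZ; apply: igrD => //; exact: (Lh h).1.2|move=> x].
  rewrite normrM -[z (x + h) ^+ 2]normK2 -[z x ^+ 2]normK2.
  by have := sqr_ge0 (`|z (x + h)| - `|z x|); move: `|z (x + h)| `|z x| => a b; nra.
have fin : (\int[mu]_h \int[mu]_x (`|F (h, x)|)%:E < +oo)%E.
  apply: (@le_lt_trans _ _ (\int[mu]_h (n2 z * P (t + t) h)%:E)%E); last first.
    by rewrite (I_fin (igrZ _ (igr_P tt))) ltry.
  apply: ge0_le_integral => //.
  - by move=> h _; apply: integral_ge0 => x _; rewrite lee_fin.
  - by apply: (measurable_int_param (F := fun c => `|F c|)) => //; meas.
  - by apply/measurable_EFinP; exact: igr_mfun (igrZ _ (igr_P tt)).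
  move=> h _; have -> : (\int[mu]_x (`|F (h, x)|)%:E = (P (t + t) h * \I_x `|z (x + h) * z x|)%:E)%E.
    have ia := igr_abs (ih h); rewrite -(I_Z _ ia) -(I_fin (igrZ _ ia)); apply: eq_integral => x _.
    by rewrite /F /= normrM (ger0_norm (P_ge0 h (ltW tt))).
  by rewrite lee_fin mulrC ler_wpM2r ?P_ge0 // ltW.
have [i1 _ S] := I_swap mF fin.
have e1 h : \I_x F (h, x) = P (t + t) h * \I_x (z (x + h) * z x) by rewrite /F /= I_Z.
have e2 h : n2 (fun x => z (x + h) - z x) = 2 * n2 z - 2 * \I_x (z (x + h) * z x).
  have [LN eN] := L2N Lz; have [_ ->] := n2D (Lh h).1 LN; rewrite eN (Lh h).2.
  have -> : \I_x (z (x + h) * - z x) = - \I_x (z (x + h) * z x).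
    by rewrite -mulN1r -(I_Z _ (ih h)); apply: eq_I => x; ring.
  by ring.
have i3 : igr (fun h => P (t + t) h * \I_x (z (x + h) * z x)).
  by rewrite (_ : (fun h => _) = fun h => \I_x F (h, x)) //; apply/funext => h; rewrite e1.
rewrite (_ : (fun h => _) = fun h => 2 * n2 z * P (t + t) h - 2 * (P (t + t) h * \I_x (z (x + h) * z x))); last first.
  by apply/funext => h; rewrite e2; ring.
rewrite (I_B (igrZ _ (igr_P tt)) (igrZ _ i3)) (I_Z _ (igr_P tt)) (I_P tt) (I_Z _ i3) mulr1.
rewrite /En (n2_pcE t0 Lz).
have -> : \I_x (z x * pc (t + t) z x) = \I_h (P (t + t) h * \I_x (z (x + h) * z x)).
  transitivity (\I_h \I_x F (h, x)); last by apply: eq_I => h; rewrite e1.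
  rewrite S; apply: eq_I => x.
  have [ip ->] := pcE_add x tt (L2_pint Lz).
  by rewrite -(I_Z _ ip); apply: eq_I => h; rewrite /F /=; ring.
by field.
Qed.

(** Minkowski's inequality for the half-order energy: in the Gagliardo form, Cauchy-Schwarz in s is
    applied to each increment and the integrals in h and s are exchanged. *)
Lemma En_superpose t k (y : R -> R -> R) (A C K : R) : 0 < t -> (forall s, 0 <= k s) -> igr k -> 0 < A -> \I_s k s <= A ->
  mfun2 y -> (forall x, igr (fun s => k s * y s x)) -> (forall s, L2 (y s)) -> (forall s, n2 (y s) <= C) -> (forall s, En t (y s) <= K) ->
  L2 (fun x => \I_s (k s * y s x)) /\ En t (fun x => \I_s (k s * y s x)) <= A ^+ 2 * K.
Proof.
move=> t0 k0 ik A0 hA my igy Ly yC yK; have mk := igr_mfun ik; have tt : 0 < t + t by rewrite addr_gt0.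
have C0 : 0 <= C := le_trans (n2_ge0 _) (yC 0).
have K0 : 0 <= K := le_trans (En_ge0 t0 (Ly 0)) (yK 0).
have Lysh h s : L2 (fun x => y s (x + h) - y s x) by apply: L2B => //; have [] := L2_shift h (Ly s).
pose N h s := n2 (fun x => y s (x + h) - y s x).
have mN : mfun (fun c : R * R => N c.1 c.2).
  apply: (measurable_n2 (F := fun c : (R * R) * R => y c.1.2 (c.2 + c.1.1) - y c.1.2 c.2)).
  have m1 : mfun (fun c : (R * R) * R => c.1.1) by apply: (measurableT_comp measurable_fst); exact: measurable_fst.
  have m2 : mfun (fun c : (R * R) * R => c.1.2) by apply: (measurableT_comp measurable_snd); exact: measurable_fst.
  have m3 : mfun (fun c : (R * R) * R => c.2) by exact: measurable_snd.
  by apply: measurable_funB; apply: (mfun2_comp my) => //; exact: measurable_funD.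
have N0 h s : 0 <= N h s := n2_ge0 _.
have NC h s : N h s <= 4 * C.
  have [L1 e1] := L2_shift h (Ly s); have := n2_sub2 L1 (Ly s); rewrite e1 -/(N h s); have := yC s; lra.
have iy h : igr (fun s => k s * N h s).
  apply: (igr_le _ (igrZ (4 * C) ik)) => [|s].
    by apply: measurable_funM => //; apply: (mfun2_comp (g := N)).
  by rewrite ger0_norm ?mulr_ge0 // mulrC ler_wpM2r.
have mysh h : mfun (fun c : R * R => y c.1 (c.2 + h) - y c.1 c.2).
  by apply: measurable_funB; apply: (mfun2_comp my); meas.
pose Y x := \I_s (k s * y s x).
have LY : L2 Y.
  have iC : igr (fun s => k s * n2 (y s)).
    apply: (igr_le _ (igrZ C ik)) => [|s].
      apply: measurable_funM => //; apply: (measurable_n2 (F := fun c : R * R => y c.1 c.2)).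
      exact: my.
    by rewrite ger0_norm ?mulr_ge0 ?n2_ge0 // mulrC ler_wpM2r.
  have my' : mfun (fun c : R * R => y c.1 c.2) := my.
  exact: (n2_superpose (h := fun c => y c.1 c.2) k0 ik A0 hA my' Ly iC).1.
have sup h : n2 (fun x => Y (x + h) - Y x) <= A * \I_s (k s * N h s).
  have [_] := n2_superpose (h := fun c => y c.1 (c.2 + h) - y c.1 c.2) k0 ik A0 hA (mysh h) (Lysh h) (iy h).
  rewrite (_ : (fun x => \I_s _) = fun x => Y (x + h) - Y x) //; apply/funext => x.
  by rewrite /Y -I_B //; apply: eq_I => s /=; rewrite mulrBr.
split; first exact: LY.
pose F c : R := P (t + t) c.1 * (k c.2 * N c.1 c.2).
have mF : mfun (F : R * R -> R).
  have mP := mfun_P (t + t); apply: measurable_funM; first by meas.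
  by apply: measurable_funM; [meas|exact: mN].
have iCk : igr (fun s => 4 * C * k s) := igrZ _ ik.
have iPN s : igr (fun h => P (t + t) h * N h s).
  have mP := mfun_P (t + t); have mNs : mfun (fun h => N h s) by apply: (mfun2_comp (g := N)).
  apply: (igr_le _ (igrZ (4 * C) (igr_P tt))) => [|h]; first exact: measurable_funM.
  rewrite ger0_norm; last by apply: mulr_ge0; [exact: P_ge0 (ltW tt)|exact: N0].
  by rewrite mulrC; apply: ler_wpM2r; [exact: P_ge0 (ltW tt)|exact: NC].
have fin : (\int[mu]_h \int[mu]_s (`|F (h, s)|)%:E < +oo)%E.
  apply: (fin_prod (igr_P tt) iCk mF) => h s; rewrite /F /= [leLHS]normrM; apply: ler_wpM2l; first exact: normr_ge0.
  rewrite normrM (ger0_norm (k0 s)) (ger0_norm (N0 h s)) ger0_norm ?mulr_ge0 //.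
  by rewrite mulrC ler_wpM2r.
have [i1 i2 S] := I_swap mF fin.
have e1 h : \I_s F (h, s) = P (t + t) h * \I_s (k s * N h s) by rewrite /F /= I_Z.
have e2 s : \I_h F (h, s) = 2 * (k s * En t (y s)).
  rewrite (mul_gagliardo t0 (Ly s)) /F /=.
  rewrite (_ : (fun h => _) = fun h => k s * (P (t + t) h * N h s)); last by apply/funext => h; ring.
  by rewrite (I_Z _ (iPN s)) /N; move: (\I_h _) (k s) => J c; field.
have ek1 : (fun h => \I_s F (h, s)) = (fun h => P (t + t) h * \I_s (k s * N h s)) by apply/funext => h; rewrite e1.
have ek2 : (fun s => \I_h F (h, s)) = (fun s => 2 * (k s * En t (y s))) by apply/funext => s; rewrite e2.
rewrite ek1 in i1; rewrite ek2 in i2.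
have S' : \I_h (P (t + t) h * \I_s (k s * N h s)) = \I_s (2 * (k s * En t (y s))).
  by rewrite -ek1 -ek2; exact: S.
have i1' : igr (fun h => A * (P (t + t) h * \I_s (k s * N h s))) := igrZ A i1.
clear S fin e1 e2 ek1 ek2 F mF; rewrite (mul_gagliardo t0 LY).
apply: (@le_trans _ _ (2^-1 * \I_h (A * (P (t + t) h * \I_s (k s * N h s))))).
  rewrite ler_pM2l //; apply: I_le; [|exact: i1'|].
    apply: (igr_le _ i1') => [|h].
      have mP := mfun_P (t + t); apply: measurable_funM; first exact: mP.
      apply: (measurable_n2 (F := fun c : R * R => Y (c.2 + c.1) - Y c.2)).
      by have mY := LY.1; meas.
    rewrite ger0_norm; last by apply: mulr_ge0; [exact: P_ge0 (ltW tt)|exact: n2_ge0].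
    by rewrite mulrCA; apply: ler_wpM2l; [exact: P_ge0 (ltW tt)|exact: sup].
  by move=> h; rewrite mulrCA; apply: ler_wpM2l; [exact: P_ge0 (ltW tt)|exact: sup].
rewrite (I_Z _ i1) S'.
have le : \I_s (2 * (k s * En t (y s))) <= \I_s (2 * K * k s).
  apply: I_le; [exact: i2|exact: igrZ|move=> s].
  by rewrite -mulrA ler_pM2l // mulrC ler_wpM2r.
rewrite (I_Z _ ik) in le; have h2 : 2 * K * \I_s k s <= 2 * K * A by rewrite ler_wpM2l ?mulr_ge0.
have h3 : A * \I_s (2 * (k s * En t (y s))) <= A * (2 * K * A) by rewrite ler_pM2l //; exact: le_trans le h2.
by move: h3; move: (A * _) => X h3; rewrite expr2; lra.
Qed.

Lemma mfun_sqrt : mfun (@Num.sqrt R).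
Proof. exact: continuous_measurable_fun (@sqrt_continuous R). Qed.

(** The primitive - 2 sqrt (t - s) is used on intervals that stop short of the singular end t, and
    Fatou's lemma reaches t. *)
Lemma singular_weight t : 0 < t ->
  igr (fun s => ind 0 t s * (Num.sqrt (t - s))^-1) /\ \I_s (ind 0 t s * (Num.sqrt (t - s))^-1) <= 2 * Num.sqrt t.
Proof.
move=> t0; have ms := mfun_sqrt; have h0 n : 0 < hstep n :> R by rewrite /hstep invr_gt0.
have h1 n : hstep n <= 1 :> R by rewrite /hstep invf_le1 // ler1n.
have mk : mfun (fun s => (Num.sqrt (t - s))^-1) by meas.
apply: (@fatou_bound R (fun n s => ind 0 (t - t * hstep n) s * (Num.sqrt (t - s))^-1)).
- by move=> n; apply: measurable_funM => //; exact: mfun_ind1.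
- by move=> n s; rewrite mulr_ge0 ?ind_ge0 ?invr_ge0 ?sqrtr_ge0.
- move=> s; apply: cvg_near_cst; case: (ltrP s t) => st; last first.
    apply: nearW => n; rewrite /ind [s < t]ltNge st.
    by rewrite [s < t - _](_ : _ = false) //; apply: negbTE; rewrite -leNgt (le_trans _ st) // gerBl mulr_ge0 // ltW.
  have ts : 0 < (t - s) / t by rewrite divr_gt0 // subr_gt0.
  near=> n; congr (_ * _); rewrite /ind st.
  suff -> : s < t - t * hstep n by [].
  by rewrite ltrBrDr -ltrBrDl mulrC -ltr_pdivlMr //; near: n; exact: (cvgr_lt _ hstep_cvg).
apply: nearW => n; set b := t - t * hstep n.
have bt : b < t by rewrite /b gtrBl mulr_gt0.
have b0 : 0 <= b by rewrite subr_ge0 ler_piMr // ltW.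
have dF (s : R) : 0 <= s -> s <= b -> is_derive s 1 (fun s => - 2 * Num.sqrt (t - s)) ((Num.sqrt (t - s))^-1).
  move=> _ sb; have ts : 0 < t - s by rewrite subr_gt0 (le_lt_trans sb).
  have d1 : is_derive s 1 (fun s => t - s) (-1) by apply: is_derive_eq; rewrite /GRing.scale /=; ring.
  have d2 := is_derive_comp (g := fun s => t - s) (is_derive1_sqrt ts) d1.
  apply: is_derive_eq; rewrite /GRing.scale /=; have q : Num.sqrt (t - s) != 0 by rewrite gt_eqF // sqrtr_gt0.
  by move: (Num.sqrt _) q => S q; field.
have cF (s : R) : 0 <= s -> s <= b -> {for s, continuous (fun s => (Num.sqrt (t - s))^-1)}.
  move=> _ sb; have ts : 0 < t - s by rewrite subr_gt0 (le_lt_trans sb).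
  apply: cvgV; first by rewrite gt_eqF // sqrtr_gt0.
  apply: (continuous_comp (f := fun s => t - s) (g := Num.sqrt)); last exact: sqrt_continuous.
  by apply: cvgB; [exact: cvg_cst|exact: cvg_id].
have [ig e] := I_ind_FTC b0 dF cF mk.
by rewrite (I_fin ig) e lee_fin subr0; have := sqrtr_ge0 (t - b); lra.
Unshelve. all: by end_near. Qed.

(** By [En_pc] the integrand at time s has half-order energy at most r G / (t - s). Its square root
    is integrable in time, with integral of order sqrt t, and 4 t is the square of 2 sqrt t. *)
Lemma duh_half t (g : R -> R -> R) (G : R) : 0 < t -> mfun2 g -> 0 <= G -> (forall s, 0 < s -> s < t -> L2 (g s) /\ n2 (g s) <= G) ->
  (forall x, exists C, dbound 0 t g x C) ->
  [/\ L2 (duh 0 t g), n2 (duh 0 t g) <= t ^+ 2 * G & forall r, 0 < r -> En r (duh 0 t g) <= r * (4 * t * G)].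
Proof.
move=> t0 mg G0 hg hd; have [ik Ik] := singular_weight t0; have ms := mfun_sqrt.
pose q s x := ind 0 t s * qc (t - s) (g s) x.
have mq : mfun2 q.
  apply: measurable_funM; first by apply: mfun_ind; meas.
  by apply: mfun_qc => //; meas.
have q0 s : ~~ ((0 < s) && (s < t)) -> q s = fun=> 0.
  by move=> /negbTE h; apply/funext => x; rewrite /q /ind h mul0r.
have q1 s x : (0 < s) && (s < t) -> q s x = expR (- (t - s)) * pc (t - s) (g s) x.
  by move=> h; rewrite /q /ind h mul1r.
have L0 : L2 (fun=> 0 : R) /\ n2 (fun=> 0 : R) = 0.
  have e : (fun=> 0 ^+ 2 : R) = (fun=> 0 : R) by rewrite expr0n.
  split; last by rewrite /n2 expr0n I_0.
  by split => //; rewrite expr0n; apply: igrP => //; under eq_integral do rewrite normr0; rewrite integral0.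
have Lq s : L2 (q s) /\ n2 (q s) <= G.
  case: (boolP ((0 < s) && (s < t))) => [hs|/q0 ->]; last by rewrite L0.2; split => //; exact: L0.1.
  have [s0 st] := andP hs; have ts : 0 < t - s by rewrite subr_gt0.
  have [Lg ng] := hg s s0 st; have -> : q s = fun x => expR (- (t - s)) * pc (t - s) (g s) x by apply/funext => x; exact: q1.
  have [L1 e1] := L2Z (expR (- (t - s))) (L2_pc ts Lg); split => //; rewrite e1.
  apply: le_trans ng; apply: le_trans (n2_pc_le ts Lg); rewrite ler_piMl ?n2_ge0 // expr_le1 ?expR_ge0 //.
  by apply: expRN_le1; exact: ltW.
have iq x : igr (fun s => q s x) by have [C hC] := hd x; exact: (igr_duh mg hC).
have ei : duh 0 t g = fun x => \I_s (ind 0 t s * q s x).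
  apply/funext => x; apply: eq_I => s; rewrite /q /ind.
  by case: ifP => _; rewrite ?mul0r // !mul1r.
have It : \I_s ind 0 t s <= t by rewrite I_ind ?subr0 // ltW.
have mq' : mfun (fun c : R * R => q c.1 c.2) := mq.
have iG : igr (fun s => ind 0 t s * n2 (q s)).
  apply: (igr_le _ (igrZ G (igr_ind 0 t))) => [|s].
    by apply: measurable_funM; [exact: mfun_ind1|exact: (measurable_n2 mq')].
  by rewrite ger0_norm ?mulr_ge0 ?n2_ge0 ?ind_ge0 // mulrC ler_wpM2r ?ind_ge0 ?(Lq s).2.
have [L1 n1] := n2_superpose (h := fun c => q c.1 c.2) (ind_ge0 0 t) (igr_ind 0 t) t0 It mq' (fun s => (Lq s).1) iG.
have n3 : n2 (duh 0 t g) <= t ^+ 2 * G.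
  rewrite ei; apply: (le_trans n1); rewrite expr2 -mulrA ler_pM2l //.
  apply: (@le_trans _ _ (\I_s (G * ind 0 t s))); last by rewrite (I_Z _ (igr_ind 0 t)) mulrC ler_wpM2r.
  apply: I_le; [exact: iG|exact: igrZ (igr_ind 0 t)|move=> s].
  by rewrite mulrC ler_wpM2r ?ind_ge0 ?(Lq s).2.
split; [by rewrite ei|exact: n3|move=> r r0].
(* The factor sqrt (t - s) is moved from the weight to the functions, whose energies then have a
   bound independent of s, as [En_superpose] requires. *)
pose y s x := Num.sqrt (t - s) * q s x.
pose k s := ind 0 t s * (Num.sqrt (t - s))^-1.
have ky s x : k s * y s x = q s x.
  rewrite /k /y /q; rewrite /ind; case: ifP => [/andP[s0 st]|_]; last by rewrite !mul0r.
  have S0 : Num.sqrt (t - s) != 0 by rewrite gt_eqF // sqrtr_gt0 subr_gt0.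
  by rewrite !mul1r mulKf.
have ed : duh 0 t g = fun x => \I_s (k s * y s x).
  by apply/funext => x; apply: eq_I => s; rewrite ky.
have my : mfun2 y by apply: measurable_funM => //; apply: (measurableT_comp ms); meas.
have A0 : 0 < 2 * Num.sqrt t by rewrite mulr_gt0 // sqrtr_gt0.
have k0 s : 0 <= k s by rewrite mulr_ge0 ?ind_ge0 ?invr_ge0 ?sqrtr_ge0.
have Ly s : L2 (y s) /\ n2 (y s) = (Num.sqrt (t - s)) ^+ 2 * n2 (q s) := L2Z _ (Lq s).1.
have E0 : En r (fun=> 0) = 0 by rewrite /En /n2 (_ : pc r (fun=> 0) = fun=> 0) ?subrr //; apply/funext => x; rewrite pc_cst.
have Ey s : En r (y s) <= r * G.
  have rG : 0 <= r * G by rewrite mulr_ge0 // ltW.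
  case: (boolP ((0 < s) && (s < t))) => [hs|/q0 h]; last first.
    by rewrite (_ : y s = fun=> 0) ?E0 //; apply/funext => x; rewrite /y h mulr0.
  have [s0 st] := andP hs; have ts : 0 < t - s by rewrite subr_gt0.
  have [Lg ng] := hg s s0 st; have [p hp] := spec_exists Lg.
  have Lp := L2_pc ts Lg.
  have -> : y s = fun x => (Num.sqrt (t - s) * expR (- (t - s))) * pc (t - s) (g s) x.
    by apply/funext => x; rewrite /y q1 // mulrA.
  rewrite (En_Z _ r0 Lp) exprMn sqr_sqrtr ?(ltW ts) // mulrAC.
  have h1 := En_pc (dens_of_spec hp) Lg ts r0.
  have h2 : (t - s) * En r (pc (t - s) (g s)) <= r * G by apply: (le_trans h1); rewrite ler_pM2l.
  apply: le_trans h2; rewrite ler_piMr ?mulr_ge0 ?(En_ge0 r0 Lp) ?(ltW ts) // expr_le1 ?expR_ge0 //.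
  by apply: expRN_le1; exact: ltW.
have yC s : n2 (y s) <= t * G.
  case: (boolP ((0 < s) && (s < t))) => [/andP[s0 st]|/q0 h]; last first.
    rewrite (_ : y s = fun=> 0) ?L0.2 ?mulr_ge0 ?(ltW t0) //; apply/funext => x; by rewrite /y h mulr0.
  rewrite (Ly s).2 sqr_sqrtr ?subr_ge0 ?(ltW st) //; apply: ler_pM; rewrite ?subr_ge0 ?n2_ge0 ?(ltW st) //.
    by rewrite gerBl ltW.
  exact: (Lq s).2.
have igy x : igr (fun s => k s * y s x) by rewrite (_ : (fun s => _) = fun s => q s x) //; apply/funext => s; exact: ky.
have [_ h] := En_superpose r0 k0 ik A0 Ik my igy (fun s => (Ly s).1) yC Ey.
rewrite ed; apply: (le_trans h); rewrite exprMn sqr_sqrtr ?(ltW t0) //.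
by rewrite le_eqVlt; apply/orP; left; apply/eqP; ring.
Qed.

End HalfOrder.

(** * Continuity at the initial time in the norm of order 1/2 *)

Section HalfContinuity.
Context {R : realType}.
Implicit Types (t s x h a b r e : R) (f q u w z k p : R -> R).

Let arith_En (m j x y c d f r t G : R) : x <= r * m -> y <= t * (r * j) -> c <= r * (4 * t * G) ->
  f <= 2 * x + 2 * d -> d <= 2 * y + 2 * c -> f <= r * (2 * m + 4 * (t * j) + 16 * (t * G)).
Proof. lra. Qed.

Let arith_n2 (x y c d f b n t G : R) : x <= b -> y <= t * n -> c <= t * G ->
  f <= 2 * x + 2 * d -> d <= 2 * y + 2 * c -> f <= 2 * b + 4 * (t * (n + G)).
Proof. lra. Qed.

Let arith_time (t C E : R) : 0 <= t -> t * (2 * (C + 1)) < E -> t * C <= E / 2.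
Proof. lra. Qed.

Let arith_total (b m j n c t G : R) : c = 2 * pi * b + m ->
  2 * pi * (2 * b + 4 * (t * (n + G))) + pi * (2 * (pi^-1 * m) + 4 * (t * (pi^-1 * j)) + 16 * (t * G)) =
  2 * c + t * (8 * pi * (n + G) + 4 * j + 16 * pi * G).
Proof. by move=> ->; move: (pi : R) (gt_eqF (pi_gt0 R)) => q /negbT q0; field. Qed.

Let arith_sum (c d E : R) : c <= E / 4 -> d <= E / 2 -> 2 * c + d <= E.
Proof. lra. Qed.

Lemma half_continuity z (g : R -> R -> R) (G T : R) : L2 z -> in_sobolev 2^-1 z -> 0 < T -> mfun2 g -> 0 <= G ->
  (forall s, 0 < s -> s < T -> L2 (g s) /\ n2 (g s) <= G) -> (forall t x, exists C, dbound 0 t g x C) ->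
  forall e, 0 < e -> exists2 d, 0 < d & forall t, 0 < t -> t < d ->
    (sobolev_norm 2^-1 (fun x => qc t z x + duh 0 t g x - z x)%R <= e%:E)%E.
Proof.
move=> Lz [_ /sobolev_fin[e1 e10 he1]] T0 mg G0 hg hd e e0.
have [p hp] := spec_exists Lz; have dp := dens_of_spec hp; have [mp p0 ip ep _] := dp.
have [ish _] := sob_ge hp e10 he1.
have sq1 x : `|x| <= Num.sqrt (1 + x ^+ 2) by rewrite -sqrtr_sqr ler_wsqrtr // lerDr.
have im : igr (fun x => `|x| * p x).
  apply: (igr_le _ ish) => [|x]; first by meas.
  by rewrite ger0_norm ?mulr_ge0 // ler_wpM2r // powR12_sqrt ?addr_ge0 ?sqr_ge0 //; exact: sq1.
pose J := \I_x (`|x| * p x).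
have J0 : 0 <= J by apply: I_ge0 => x; rewrite mulr_ge0.
pose w x := p x + `|x| * p x.
have iw : igr w := igrD ip im.
have w0 x : 0 <= w x by rewrite addr_ge0 ?mulr_ge0.
have mw := igr_mfun iw.
(* Up to constants this is the squared half-order norm of P_t z - z: the weight w combines the
   density and its first absolute moment. *)
pose c t := \I_x ((1 - expR (- (t * `|x|))) ^+ 2 * w x).
have sqle t x : 0 <= t -> 0 <= (1 - expR (- (t * `|x|))) ^+ 2 <= 1.
  move=> t0; have q0 : 0 <= t * `|x| by rewrite mulr_ge0.
  by have [h1 _ h2 _] := expN_facts q0; rewrite sqr_ge0 expr_le1.
have iq (f : R -> R) t : 0 <= t -> igr f -> (forall x, 0 <= f x) -> igr (fun x => (1 - expR (- (t * `|x|))) ^+ 2 * f x).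
  move=> t0 if0 f0; have mf := igr_mfun if0; apply: (igr_le _ if0) => [|x]; first by meas.
  have /andP[h1 h2] := sqle t x t0; by rewrite ger0_norm; [exact: ler_piMl|exact: mulr_ge0].
have h0 n : 0 < hstep n :> R by rewrite /hstep invr_gt0.
have cc : c (hstep n) @[n --> \oo] --> (0 : R).
  rewrite -[X in _ --> X](@I_0 R); apply: (I_cvg (g := w)) => //.
  - by move=> n; meas.
  - move=> n x; have /andP[h1 h2] := sqle (hstep n) x (ltW (h0 n)).
    by rewrite ger0_norm; [exact: ler_piMl|exact: mulr_ge0].
  move=> x; rewrite -(mul0r (w x)); apply: cvgM; last exact: cvg_cst.
  have k : - (hstep n * `|x|) @[n --> \oo] --> (0 : R).
    by rewrite -oppr0; apply: cvgN; rewrite -(mul0r `|x|); apply: cvgM; [exact: hstep_cvg|exact: cvg_cst].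
  have k1 := cvg_comp _ _ k (@continuous_expR R 0); rewrite expR0 in k1.
  have k2 : 1 - expR (- (hstep n * `|x|)) @[n --> \oo] --> (0 : R).
    by rewrite -(subrr 1); apply: cvgB; [exact: cvg_cst|exact: k1].
  by rewrite -(mul0r 0); under eq_fun do rewrite expr2; exact: cvgM.
have e4 : 0 < e ^+ 2 / 4 by rewrite divr_gt0 ?exprn_gt0.
have [N _ hN] := @cvgr_lt _ _ _ _ _ _ cc _ e4.
have {hN} hN := hN N (leqnn N).
(* The integrand of [c] increases with t, so smallness at one time of the sequence extends to all
   earlier ones. *)
have cmono t : 0 < t -> t < hstep N -> c t <= e ^+ 2 / 4.
  move=> t0 tN; apply: le_trans (ltW hN); apply: I_le; [exact: iq (ltW t0) iw w0|exact: iq (ltW (h0 N)) iw w0|move=> x].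
  have [q1 _ _ _] := expN_facts (mulr_ge0 (ltW t0) (normr_ge0 x)).
  have [q2 _ _ _] := expN_facts (mulr_ge0 (ltW (h0 N)) (normr_ge0 x)).
  have q3 : t * `|x| <= hstep N * `|x| by rewrite ler_wpM2r // ltW.
  apply: ler_wpM2r => //; apply: lerXn2r; [by rewrite nnegrE|by rewrite nnegrE|].
  by rewrite lerD2l lerN2 ler_expR lerN2.
pose C := 8 * pi * (n2 z + G) + 4 * J + 16 * pi * G.
have Z0 := n2_ge0 z; have pi0 := pi_gt0 R; have pi0' := ltW pi0.
have C0 : 0 <= C.
  have c1 : 0 <= 8 * pi * (n2 z + G) by apply: mulr_ge0; [exact: mulr_ge0|exact: addr_ge0].
  have c2 : 0 <= 16 * pi * G by apply: mulr_ge0 => //; exact: mulr_ge0.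
  by rewrite /C; lra.
pose d := Num.min (Num.min T 1) (Num.min (hstep N) (e ^+ 2 / (2 * (C + 1)))).
have d0 : 0 < d.
  by rewrite !lt_min T0 ltr01 h0 divr_gt0 ?exprn_gt0 // mulr_gt0 // ltr_wpDl.
exists d => // t t0; rewrite !lt_min => /andP[/andP[tT t1] /andP[tN tC]].
have ct := cmono t t0 tN.
have hC : t * C <= e ^+ 2 / 2.
  by apply: arith_time; [exact: ltW|rewrite -ltr_pdivlMr ?mulr_gt0 ?ltr_wpDl].
have [LD nD ED] := duh_half t0 mg G0 (fun s i1 i2 => hg s i1 (lt_trans i2 tT)) (hd t).
have L1 := (n2_pc_sub t0 Lz).1.
have dd := dens_diff dp Lz t0.
have E1 := expR_ge0 (- t); have [E2 E3 E4 _] := expN_facts (ltW t0).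
have E5 : (expR (- t)) ^+ 2 <= 1 by rewrite expr_le1 // -subr_ge0.
have E6 : (expR (- t) - 1) ^+ 2 <= t ^+ 2.
  rewrite -sqrrN opprB; apply: lerXn2r; [by rewrite nnegrE|by rewrite nnegrE ltW|exact: E3].
set a1 := expR (- t) in E1 E2 E3 E4 E5 E6.
have [La na] := L2Z a1 L1; have [Lb nb'] := L2Z (a1 - 1) Lz.
have LbD := L2D Lb LD; have LY := L2D La LbD.
(* Three contributions: the Poisson extension, handled by [c t], the damping factor e^{-t} - 1, and
   the Duhamel term; the last two are O(t) in the squared half-order norm. *)
pose y x := a1 * (pc t z x - z x) + ((a1 - 1) * z x + duh 0 t g x).
have -> : (fun x => qc t z x + duh 0 t g x - z x) = y.
  apply/funext => x; rewrite /y /qc -/a1; ring.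
have [py hpy] := spec_exists LY.
have [_ ec] := n2_pc_diff dp Lz t0.
have iqp := iq _ _ (ltW t0) ip p0.
have iqm := iq _ _ (ltW t0) im (fun x => mulr_ge0 (normr_ge0 x) (p0 x)).
have cE : c t = 2 * pi * n2 (fun x => pc t z x - z x) + \I_x ((1 - expR (- (t * `|x|))) ^+ 2 * (`|x| * p x)).
  rewrite -ec -(I_D iqp iqm); apply: eq_I => x; rewrite /w; ring.
set b1 := n2 (fun x => pc t z x - z x) in cE na.
set m1 := \I_x ((1 - expR (- (t * `|x|))) ^+ 2 * (`|x| * p x)) in cE.
have eqm : (fun x => `|x| * ((1 - expR (- (t * `|x|))) ^+ 2 * p x)) = (fun x => (1 - expR (- (t * `|x|))) ^+ 2 * (`|x| * p x)).
  by apply/funext => x; ring.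
have im1 : igr (fun x => `|x| * ((1 - expR (- (t * `|x|))) ^+ 2 * p x)) by rewrite eqm.
have t2 : t ^+ 2 <= t by rewrite expr2 ler_piMl // ltW.
have n1 : n2 y <= 2 * b1 + 4 * (t * (n2 z + G)).
  have h1 := n2_add2 La LbD; have h2 := n2_add2 Lb LD.
  rewrite na in h1; rewrite nb' in h2.
  have h3 : a1 ^+ 2 * b1 <= b1 by rewrite ler_piMl // n2_ge0.
  have h4 : (a1 - 1) ^+ 2 * n2 z <= t * n2 z by rewrite ler_wpM2r ?n2_ge0 //; exact: le_trans E6 t2.
  have h5 : n2 (duh 0 t g) <= t * G by apply: (le_trans nD); rewrite ler_wpM2r.
  exact: arith_n2 h3 h4 h5 h1 h2.
have k1 r : 0 < r -> En r y <= r * (2 * (pi^-1 * m1) + 4 * (t * (pi^-1 * J)) + 16 * (t * G)).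
  move=> r0; have h1 := En_add r0 La LbD; have h2 := En_add r0 Lb LD.
  rewrite (En_Z _ r0 L1) in h1; rewrite (En_Z _ r0 Lz) in h2.
  have h3 := En_le_moment dd r0 im1; rewrite eqm -/m1 in h3.
  have h4 := En_le_moment dp r0 im; rewrite -/J in h4.
  have h3' : a1 ^+ 2 * En r (fun x => pc t z x - z x) <= r * (pi^-1 * m1).
    by apply: le_trans h3; rewrite ler_piMl // En_ge0.
  have h4' : (a1 - 1) ^+ 2 * En r z <= t * (r * (pi^-1 * J)).
    by apply: ler_pM; rewrite ?sqr_ge0 ?En_ge0 //; exact: le_trans E6 t2.
  exact: arith_En h3' h4' (ED r r0) h1 h2.
apply: (sob_half_le hpy n1 k1 (ltW e0)).
rewrite (arith_total J (n2 z) t G cE); exact: arith_sum ct hC.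
Qed.

End HalfContinuity.

(** * The equation and uniqueness *)
Section HalfLaplacianAE.
Context {R : realType}.
Implicit Types (t s x y h a b r e C : R) (f q u w z : R -> R).
Notation mu := (@lebesgue_measure R).

(** What membership in H^2 gives for second differences. It lets the half-Laplacian converge almost
    everywhere and lie in L^2. *)
Definition H2c z C := L2 z /\ forall y, n2 (d2 y z) <= C * y ^+ 4.

(** Normalised so that [P 1 y * hh z (y, x)] is the integrand of [Lam z x]. Its L^2 norm in x is
    bounded uniformly in y: [H2c] serves small y, the trivial bound large y. *)
Let hh z c : R := (1 + c.1 ^+ 2) * c.1 ^- 2 * d2 c.1 z c.2.

Lemma mfun_d2_pair z : mfun z -> mfun (fun c : R * R => d2 c.1 z c.2).
Proof. by move=> mz; apply: (mfun_d2 (mfun2_cst mz) (s := fun=> 0)); meas. Qed.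

Let mfun_hh z : mfun z -> mfun (fun c : R * R => hh z c).
Proof. by move=> mz; apply: measurable_funM; [meas|exact: mfun_d2_pair]. Qed.

Lemma hhE z y x : pi^-1 * y ^- 2 * d2 y z x = P 1 y * hh z (y, x).
Proof. by rewrite (LamE z x y ltr01) invr1 mul1r expr1n. Qed.

Lemma L2_d2 y z : L2 z -> L2 (d2 y z) /\ n2 (d2 y z) <= 22 * n2 z.
Proof.
move=> Lz; have [La na] := L2_shift y Lz; have [Lb nb'] := L2_shift (- y) Lz; have [L0 n0] := L2Z 2 Lz.
have L1 := L2B L0 La; split; first exact: L2B L1 Lb.
have h1 := n2_sub2 L0 La; have h2 := n2_sub2 L1 Lb; rewrite /d2.
by move: h1 h2; rewrite n0 na nb'; move: (n2 _) (n2 _) (n2 _) => c d j; lra.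
Qed.

Lemma n2_hh z C y : 0 <= C -> H2c z C -> L2 (fun x => hh z (y, x)) /\ n2 (fun x => hh z (y, x)) <= 4 * (C + 22 * n2 z).
Proof.
move=> C0 [Lz hC]; have [Ld nd] := L2_d2 y Lz; have [L1 n1] := L2Z ((1 + y ^+ 2) * y ^- 2) Ld.
split; first exact: L1.
rewrite /hh n1; have N0 := n2_ge0 z; have [->|y0] := eqVneq y 0.
  by rewrite expr0n /= invr0 mulr0 expr0n mul0r mulr_ge0 // addr_ge0 // mulr_ge0.
have y2 : 0 < y ^+ 2 by rewrite lt_neqAle sqr_ge0 andbT eq_sym sqrf_eq0.
have hy := hC y; rewrite exprMn exprVn.
have e4 : y ^+ 4 = (y ^+ 2) ^+ 2 by rewrite -exprM.
rewrite e4 in hy; move: (y ^+ 2) (n2 (d2 y z)) (n2_ge0 (d2 y z)) y2 nd hy => Y D D0 Y0 nd hy.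
have Y2 : 0 < Y ^+ 2 by rewrite exprn_gt0.
rewrite mulrAC ler_pdivrMr //.
case: (lerP Y 1) => Y1.
  have p1 : (1 + Y) ^+ 2 <= 4 by rewrite expr2; nra.
  apply: (@le_trans _ _ (4 * D)); first by rewrite ler_wpM2r.
  apply: (@le_trans _ _ (4 * (C * Y ^+ 2))); first by rewrite ler_pM2l.
  by rewrite mulrA ler_pM2r // ler_pM2l // lerDl mulr_ge0.
have p1 : (1 + Y) ^+ 2 <= 4 * Y ^+ 2 by rewrite !expr2; nra.
apply: (@le_trans _ _ (4 * Y ^+ 2 * D)); first by rewrite ler_wpM2r.
rewrite mulrAC ler_pM2r // ler_pM2l //; apply: (le_trans nd); by rewrite lerDr.
Qed.

Lemma igr_n2_hh z C : 0 <= C -> H2c z C -> igr (fun y => P 1 y * n2 (fun x => hh z (y, x))).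
Proof.
move=> C0 hz; have mz := hz.1.1.
apply: (igr_le _ (igrZ (4 * (C + 22 * n2 z)) (igr_P ltr01))) => [|y].
  apply: measurable_funM; first exact: mfun_P.
  apply: (measurable_n2 (F := fun c : R * R => hh z c)); exact: mfun_hh.
rewrite ger0_norm; last by apply: mulr_ge0; [exact: P_ge0|exact: n2_ge0].
by rewrite mulrC ler_wpM2r ?P_ge0 //; exact: (n2_hh y C0 hz).2.
Qed.

Lemma L2_Lam z C : 0 <= C -> H2c z C -> L2 (Lam z).
Proof.
move=> C0 hz; have mz := hz.1.1.
have I1 : \I_y P 1 y <= 1 by rewrite (I_P ltr01).
have [h _] := n2_superpose (fun y => P_ge0 y ler01) (igr_P ltr01) ltr01 I1 (mfun_hh mz)
  (fun y => (n2_hh y C0 hz).1) (igr_n2_hh C0 hz).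
have [h2 _] := L2Z 2^-1 h; move: h2; congr L2; apply/funext => x; rewrite /Lam; congr (_ * _).
by apply: eq_I => y; rewrite hhE.
Qed.

(** By Tonelli the slice of [hh] at almost every x is square integrable against P_1, which has mass
    1, hence it is integrable against it. *)
Lemma ae_Lam_cvg z C : 0 <= C -> H2c z C -> {ae mu, forall x, igr (fun y => pi^-1 * y ^- 2 * d2 y z x)}.
Proof.
move=> C0 hz; have mz := hz.1.1; have mh := mfun_hh mz.
pose F c : R := P 1 c.2 * hh z (c.2, c.1) ^+ 2.
have mF : mfun (F : R * R -> R).
  apply: measurable_funM; first exact: (measurableT_comp (mfun_P 1) measurable_snd).
  apply: measurable_funX; apply: (measurableT_comp mh); exact: measurable_fun_pair measurable_snd measurable_fst.
have F0 c : 0 <= F c by rewrite mulr_ge0 ?P_ge0 ?sqr_ge0.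
pose G x := (\int[mu]_y (F (x, y))%:E)%E.
have mG : mfun G by exact: (measurable_int_param mF F0).
have G0 x : (0 <= G x)%E by apply: integral_ge0 => y _; rewrite lee_fin.
have fin : (\int[mu]_x G x < +oo)%E.
  rewrite /G (tonelli mF F0); have i1 := igr_n2_hh C0 hz.
  apply: le_lt_trans (igr_lty i1); rewrite le_eqVlt; apply/orP; left; apply/eqP; apply: eq_integral => y _.
  have [Lh _] := n2_hh y C0 hz.
  rewrite /comp (ger0_norm (mulr_ge0 (P_ge0 y ler01) (n2_ge0 _))) EFinM -(n2_ereal Lh) /F /=.
  under eq_integral do rewrite EFinM.
  rewrite ge0_integralZl ?lee_fin ?P_ge0 //.
    by apply/measurable_EFinP; apply: measurable_funX; exact: Lh.1.
  by move=> x _; rewrite lee_fin sqr_ge0.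
have ig : mu.-integrable setT G by apply/integrableP; split => //; under eq_integral do rewrite gee0_abs //.
apply: aeS (integrable_ae measurableT ig) => x /(_ I); rewrite ge0_fin_numE // => Gx.
have md : mfun (fun y => d2 y z x) by apply: (mfun_d2 (mfun2_cst mz) (s := fun=> 0)); meas.
have mFx : mfun (fun y => F (x, y)).
  apply: measurable_funM; first exact: mfun_P.
  by apply: measurable_funX; apply: measurable_funM md; meas.
have iF : igr (fun y => F (x, y)).
  by apply: igrP => //; apply: le_lt_trans Gx; apply: ge0_le_integral => //; [apply/measurable_EFinP; meas|apply/measurable_EFinP|move=> y _; rewrite ger0_norm].
apply: (igr_le _ (igrD (igr_P ltr01) iF)) => [|y].
  by apply: measurable_funM md; meas.
rewrite hhE normrM (ger0_norm (P_ge0 y ler01)) /F /= -[X in X + _]mulr1 -mulrDr.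
rewrite ler_wpM2l ?P_ge0 // -[hh z (y, x) ^+ 2]normK2.
by have := sqr_ge0 (`|hh z (y, x)| - 2^-1); move: `|hh _ _| (normr_ge0 (hh z (y, x))) => c c0; nra.
Qed.

Lemma tail_weight e y : 0 < e -> e < `|y| -> y ^- 2 <= (1 + e ^- 2) * (1 + y ^+ 2)^-1.
Proof.
move=> e0 ey; have h : e ^+ 2 < y ^+ 2 by rewrite -[y ^+ 2]normK2 ltrXn2r // ltW.
have e2 : 0 < e ^+ 2 by rewrite exprn_gt0.
move: (y ^+ 2) (e ^+ 2) h e2 => Y r rY r0; have Y0 := lt_trans r0 rY.
rewrite ler_pdivlMr ?addr_gt0 // mulrDr mulr1 (mulVf (lt0r_neq0 Y0)) addrC lerD2l lef_pV2 ?posrE //.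
exact: ltW.
Qed.

(** Away from the singularity z(x) - z(y) is integrable against |x - y|^-2, so the integral may be
    averaged with its reflection about x, which produces the second difference. *)
Lemma truncated_half_laplacian z x e : L2 z -> 0 < e ->
  pi^-1 * \int[mu]_(y in [set y | e < `|x - y|]) ((z x - z y) / `|x - y| ^+ 2) =
  2^-1 * \I_y ((if e < `|y| then 1 else 0) * (pi^-1 * y ^- 2 * d2 y z x)).
Proof.
move=> Lz e0; have mz := Lz.1.
pose T y : R := (if e < `|y| then 1 else 0) * ((z x - z (x + y)) * y ^- 2).
have mi : mfun (fun y : R => (if e < `|y| then 1 else 0) : R).
  by apply: measurable_fun_ifT => //; apply: measurable_fun_ltr; meas.
have mzx : mfun (fun y => z (x + y)).
  by apply: (measurableT_comp mz); apply: measurable_funD; [exact: measurable_cst|exact: measurable_id].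
have mT : mfun T by apply: measurable_funM => //; apply: measurable_funM; [exact: measurable_funB (measurable_cst _) mzx|meas].
have [i1 _] := pcE_add x ltr01 (pint_abs (L2_pint Lz)).
pose c : R := pi * (1 + e ^- 2).
have c0 : 0 <= c by rewrite mulr_ge0 ?pi_ge0 // addr_ge0 // invr_ge0 exprn_ge0 // ltW.
have iT : igr T.
  apply: (igr_le mT (igrZ c (igrD (igrZ `|z x| (igr_P ltr01)) i1))) => y; rewrite /T.
  case: ltrP => ey; last first.
    rewrite mul0r normr0; have p0 := P_ge0 y (@ler01 R).
    exact: (mulr_ge0 c0 (addr_ge0 (mulr_ge0 (normr_ge0 _) p0) (mulr_ge0 p0 (normr_ge0 _)))).
  rewrite mul1r normrM (_ : `|z x| * P 1 y + P 1 y * `|z (x + y)| = (`|z x| + `|z (x + y)|) * P 1 y); last by ring.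
  rewrite mulrCA; apply: ler_pM => //; first exact: ler_normB.
  rewrite normfV (ger0_norm (sqr_ge0 y)) /c /P expr1n.
  rewrite (_ : pi * (1 + e ^- 2) * (pi^-1 * (1 / (1 + y ^+ 2))) = (pi * pi^-1) * ((1 + e ^- 2) * (1 + y ^+ 2)^-1)); last by rewrite mul1r; ring.
  by rewrite (mulfV (lt0r_neq0 (@pi_gt0 R))) mul1r; exact: tail_weight.
have i2 : igr (fun y => T (0 - y)) by exact: igr_reflect.
have -> : \int[mu]_(y in [set y | e < `|x - y|]) ((z x - z y) / `|x - y| ^+ 2) = \I_y T y.
  rewrite Rintegral_mkcond -(I_shift (- x) mT); apply: eq_I => y.
  rewrite patchE /T distrC; have -> : x + (y - x) = y by ring.
  rewrite (_ : (y \in [set y | e < `|x - y|]) = (e < `|y - x|)); last first.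
    by apply/idP/idP; rewrite inE /= distrC.
  by case: ifP => _; rewrite ?mul1r ?mul0r // -[`|_ - _| ^+ 2]normrX ger0_norm ?sqr_ge0.
have -> : (fun y => (if e < `|y| then 1 else 0) * (pi^-1 * y ^- 2 * d2 y z x)) = fun y => pi^-1 * (T y + T (0 - y)).
  apply/funext => y; rewrite /T sub0r normrN sqrrN /d2; move: (if _ then _ else _) => i; ring.
rewrite (I_Z _ (igrD iT i2)) (I_D iT i2) (I_reflect 0 mT); by move: (\I_x _) (pi^-1) => k p; rewrite mulrA -[k in LHS]mul1r mulrA -mulr2n; field.
Qed.

(** Dominated convergence as the truncation is removed, with the absolutely convergent symmetric
    integrand as its own majorant. *)
Lemma half_laplacianE z x : L2 z -> igr (fun y => pi^-1 * y ^- 2 * d2 y z x) -> half_laplacian z x = Lam z x.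
Proof.
move=> Lz iq; pose S e := \int[mu]_(y in [set y | e < `|x - y|]) ((z x - z y) / `|x - y| ^+ 2).
have cv : S e @[e --> 0^'+] --> pi * Lam z x.
  apply/cvg_at_rightP => u [u0 ucv].
  have E n : S (u n) = pi * (2^-1 * \I_y ((if u n < `|y| then 1 else 0) * (pi^-1 * y ^- 2 * d2 y z x))).
    by rewrite -truncated_half_laplacian // mulrA (mulfV (lt0r_neq0 (@pi_gt0 R))) mul1r.
  rewrite (funext E); apply: cvgMr; apply: cvgMr.
  apply: (I_cvg (f_ := fun n y => (if u n < `|y| then 1 else 0) * (pi^-1 * y ^- 2 * d2 y z x)) _ (igr_abs iq)) => [n|n y|y].
  - apply: measurable_funM; last exact: igr_mfun iq.
    by apply: measurable_fun_ifT => //; apply: measurable_fun_ltr; meas.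
  - by rewrite normrM; case: ifP => _; rewrite ?normr1 ?normr0 ?mul1r ?mul0r.
  (* At y = 0 no truncation is ever removed, but the integrand is 0 there because the inverse of 0
     is 0. *)
  - have [->|y0] := eqVneq y 0.
      rewrite expr0n /= invr0 mulr0 mul0r (_ : (fun n => _) = fun=> 0); first exact: cvg_cst.
      by apply/funext => n; rewrite mulr0.
    have y0' : 0 < `|y| by rewrite normr_gt0.
    apply: cvg_near_cst; near=> n; rewrite (_ : u n < `|y|) ?mul1r //.
    by near: n; apply: (cvgr_lt 0 ucv).
rewrite /half_laplacian (cvg_lim _ cv) // mulrA mulVf ?mul1r //.
by rewrite gt_eqF // pi_gt0.
Unshelve. all: by end_near.
Qed.

Lemma half_laplacian_ae z C : 0 <= C -> H2c z C -> {ae mu, forall x, half_laplacian z x = Lam z x}.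
Proof. by move=> C0 hz; apply: aeS (ae_Lam_cvg C0 hz) => x; exact: half_laplacianE hz.1. Qed.

Lemma H2cB z u C e : H2c z C -> H2c u e -> H2c (fun x => z x - u x) (2 * (C + e)).
Proof.
move=> [Lz hz] [Lu hu]; split; first exact: L2B.
move=> y; have [L1 _] := L2_d2 y Lz; have [L3 _] := L2_d2 y Lu.
have -> : d2 y (fun x => z x - u x) = fun x => d2 y z x - d2 y u x.
  by apply/funext => x; rewrite /d2; ring.
have := n2_sub2 L1 L3; have := hz y; have := hu y.
by move: (y ^+ 4) (n2 _) (n2 _) (n2 _) => c d j k; lra.
Qed.

Lemma Lam_sub_ae z u C e : 0 <= C -> 0 <= e -> H2c z C -> H2c u e ->
  {ae mu, forall x, Lam (fun x => z x - u x) x = Lam z x - Lam u x}.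
Proof.
move=> C0 e0 hz hu; apply: aeS2 (ae_Lam_cvg C0 hz) (ae_Lam_cvg e0 hu) => x i1 i2.
rewrite /Lam -mulrBr -I_B //; congr (_ * Rintegral _ _ _); apply/funext => y; rewrite /d2; ring.
Qed.

(** Translations preserve the norm, so by Cauchy-Schwarz the pairing of z with either translate is
    at most its squared norm. *)
Lemma d2_positive z y : L2 z -> 0 <= \I_x (z x * d2 y z x).
Proof.
move=> Lz; have [La na] := L2_shift y Lz; have [Lb nb'] := L2_shift (- y) Lz.
have i0 := Lz.2; have ia := igr_mul Lz La; have ib := igr_mul Lz Lb.
have -> : (fun x => z x * d2 y z x) = fun x => 2 * z x ^+ 2 - z x * z (x + y) - z x * z (x + - y).
  by apply/funext => x; rewrite /d2; ring.
rewrite (I_B (igrB (igrZ 2 i0) ia) ib) (I_B (igrZ 2 i0) ia) (I_Z 2 i0).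
have h1 := ip_le ltr01 Lz La; have h2 := ip_le ltr01 Lz Lb; rewrite na nb' invr1 !mul1r in h1 h2.
rewrite -/(n2 z); have := ler_norm (2 * \I_x (z x * z (x + y))); have := ler_norm (2 * \I_x (z x * z (x + - y))).
move: h1 h2; move: `|2 * \I_x (z x * z (x + y))| `|2 * \I_x (z x * z (x + - y))| (\I_x (z x * z (x + y))) (\I_x (z x * z (x + - y))) (n2 z).
by move=> a1 a2 a3 a4 a5; lra.
Qed.

(** After Fubini the inequality holds for each fixed y by [d2_positive]; the uniform bound on [hh]
    makes the double integral absolutely convergent. *)
Lemma Lam_positive z C : 0 <= C -> H2c z C -> 0 <= \I_x (z x * Lam z x).
Proof.
move=> C0 hz; have [Lz _] := hz; have mz := Lz.1.
pose F c : R := P 1 c.2 * (z c.1 * hh z (c.2, c.1)).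
have mh : mfun (fun c : R * R => hh z (c.2, c.1)).
  by apply: (measurableT_comp (mfun_hh mz)); exact: measurable_fun_pair measurable_snd measurable_fst.
have mF : mfun (F : R * R -> R).
  apply: measurable_funM; first exact: (measurableT_comp (mfun_P 1) measurable_snd).
  by apply: measurable_funM mh; exact: (measurableT_comp mz measurable_fst).
have i1 := igr_n2_hh C0 hz.
have fin : (\int[mu]_x \int[mu]_y (`|F (x, y)|)%:E < +oo)%E.
  rewrite (tonelli (F := fun c => `|F c|)) //; last exact: measurableT_comp.
  apply: (@le_lt_trans _ _ (\int[mu]_y (n2 z * P 1 y + P 1 y * n2 (fun x => hh z (y, x)))%:E)%E).
    apply: ge0_le_integral => //.
    - by move=> y _; apply: integral_ge0.
    - apply: (measurable_int_param (F := fun c => `|F (c.2, c.1)|)) => //.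
      apply: measurableT_comp => //; apply: (measurableT_comp mF); exact: measurable_fun_pair measurable_snd measurable_fst.
    - by apply/measurable_EFinP; exact: igr_mfun (igrD (igrZ (n2 z) (igr_P ltr01)) i1).
    - move=> y _; have [Lh _] := n2_hh y C0 hz.
      have i3 := igr_abs (igrZ (P 1 y) (igr_mul Lz Lh)).
      have -> : (fun x => (`|F (x, y)|)%:E) = fun x => (`|P 1 y * (z x * hh z (y, x))|)%:E by [].
      rewrite (I_fin i3) lee_fin.
      rewrite (_ : n2 z * P 1 y + P 1 y * n2 (fun x => hh z (y, x)) = \I_x (P 1 y * (z x ^+ 2 + hh z (y, x) ^+ 2))); last first.
        by rewrite (I_Z _ (igrD Lz.2 Lh.2)) (I_D Lz.2 Lh.2) mulrDr [X in X + _]mulrC.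
      apply: (I_le i3 (igrZ _ (igrD Lz.2 Lh.2))) => x.
      rewrite normrM (ger0_norm (P_ge0 y ler01)) normrM; apply: ler_wpM2l; first exact: P_ge0.
      rewrite -[z x ^+ 2]normK2 -[hh _ _ ^+ 2]normK2.
      move: `|z x| `|hh z (y, x)| => a1 a2; have := sqr_ge0 (a1 - a2); have := sqr_ge0 (a1 + a2); rewrite !expr2; lra.
  rewrite (I_fin (igrD (igrZ (n2 z) (igr_P ltr01)) i1)); exact: ltry.
have [_ _ sw] := I_swap mF fin.
have FE x y : F (x, y) = z x * (pi^-1 * y ^- 2 * d2 y z x) by rewrite hhE /F /= mulrCA.
have -> : \I_x (z x * Lam z x) = \I_x (2^-1 * \I_y F (x, y)).
  congr fine; apply: ae_int; apply: aeS (ae_Lam_cvg C0 hz) => x iq; congr EFin.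
  have -> : (fun y => F (x, y)) = fun y => z x * (pi^-1 * y ^- 2 * d2 y z x) by apply/funext => y.
  by rewrite /Lam (I_Z _ iq) mulrCA.
rewrite I_Z; last by have [] := I_swap mF fin.
rewrite sw; apply: mulr_ge0; first by rewrite invr_ge0.
apply: I_ge0 => y; have [Ld _] := L2_d2 y Lz.
rewrite (_ : (fun x => F (x, y)) = fun x => (pi^-1 * y ^- 2) * (z x * d2 y z x)); last first.
  by apply/funext => x; rewrite FE mulrCA.
rewrite (I_Z _ (igr_mul Lz Ld)); apply: mulr_ge0 (d2_positive y Lz).
by rewrite mulr_ge0 ?invr_ge0 ?sqr_ge0 ?pi_ge0.
Qed.

End HalfLaplacianAE.

(** * Energy estimate for the difference of two solutions *)

Section Uniqueness.
Context {R : realType}.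
Implicit Types (t s x y h a b r e C : R) (q w z : R -> R).
Notation mu := (@lebesgue_measure R).

Lemma L2_of_in_L2 z : mfun z -> in_L2 z -> L2 z.
Proof.
move=> mz /in_L2P[h [mh ih] zh]; split => //; apply: igrP; first by meas.
apply: le_lt_trans (igr_lty ih); rewrite le_eqVlt; apply/orP; left; apply/eqP.
by apply: ae_int; apply: aeS zh => x /= ->.
Qed.

Lemma continuous_mfun z : continuous z -> mfun z.
Proof. exact: continuous_measurable_fun. Qed.

(** A nonzero value would persist on a ball, whose measure is positive. *)
Lemma ae_zero_continuous z : continuous z -> {ae mu, forall x, z x = 0} -> forall x, z x = 0.
Proof.
move=> cz [N [mN N0 sub]] x; apply/eqP/negPn/negP => zx.
have zx0 : 0 < `|z x| by rewrite normr_gt0.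
have /nbhs_ballP[e /= e0 he] : \forall y \near x, z y != 0 by exact: (cvgr_neq0 _ (cz x) zx).
suff : (mu (ball x e) <= mu N)%E.
  by rewrite N0 (lebesgue_measure_ball x (ltW e0)) lee_fin leNgt pmulrn_lgt0 // e0.
apply: le_measure; rewrite ?inE //; first exact: measurable_ball.
by move=> y /he zy; apply: sub => /= h; rewrite h eqxx in zy.
Qed.

Lemma cvge0_le (T : Type) (F : set_system T) {FF : Filter F} (N : T -> \bar R) e :
  N @ F --> 0%E -> 0 < e -> \forall h \near F, (N (h : T) <= e%:E)%E.
Proof.
move=> /fine_cvgP[fn cv] e0; have hlt := cvgr_lt _ cv _ e0.
by apply: filterS2 fn (hlt FF) => h fh /= lh; rewrite -(fineK fh) lee_fin ltW.
Qed.

Lemma cvg_n2 (T : Type) (F : set_system T) {FF : Filter F} (N : T -> \bar R) (n : T -> R) :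
  N @ F --> 0%E -> (\forall h \near F, N (h : T) = ((n h) `^ (2^-1))%:E) -> (forall h : T, 0 <= n h) -> n @ F --> (0 : R).
Proof.
move=> /fine_cvgP[_ cv] E n0; rewrite -(mulr0 (0 : R)); apply: cvg_trans (cvgM cv cv).
apply: near_eq_cvg; apply: filterS E => h Eh.
by rewrite /= /GRing.mul_fun /= Eh /= powR12_sqrt // -expr2 sqr_sqrtr.
Qed.

(** The squared norm of w + h (p + q) is expanded, where p tends to 0 in L^2; the pairing of w with
    p is split by Young's inequality with a small weight r. *)
Lemma n2_derive (w : R -> R -> R) (q : R -> R) t : L2 q -> (forall s, 0 < s -> L2 (w s)) -> 0 < t ->
  n2 (fun x => h^-1 * (w (t + h) x - w t x) - q x) @[h --> 0^'] --> (0 : R) ->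
  is_derive t 1 (fun s => n2 (w s)) (2 * \I_x (w t x * q x)).
Proof.
move=> Lq Lw t0; set p := fun h x => h^-1 * (w (t + h) x - w t x) - q x => cv.
apply: is_derive_cvg; apply/cvgrPdist_le => e e0.
have A0 := n2_ge0 (w t); pose r := e / (2 * (n2 (w t) + 1)).
have d0 : 0 < 2 * (n2 (w t) + 1) by lra.
have r0 : 0 < r by rewrite divr_gt0.
have rA : r * n2 (w t) < e by rewrite /r mulrAC ltr_pdivrMr // ltr_pM2l //; lra.
pose B h := r * n2 (w t) + (r^-1 * n2 (p h) + `|h| * (2 * n2 (p h) + 2 * n2 q)).
have cB : B h @[h --> 0^'] --> (r * n2 (w t) + (r^-1 * 0 + `|0 : R| * (2 * 0 + 2 * n2 q)) : R).
  have c1 : `|h| @[h --> (0 : R)^'] --> (`|0 : R| : R).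
    apply: (@cvg_norm R R); exact: (@nbhs_dnbhs R 0).
  apply: cvgD; first exact: cvg_cst.
  apply: cvgD; first exact: cvgMr.
  by apply: cvgM c1 _; apply: cvgD; [exact: cvgMr|exact: cvg_cst].
have lB : r * n2 (w t) + (r^-1 * 0 + `|0 : R| * (2 * 0 + 2 * n2 q)) < e by rewrite normr0 mul0r mulr0 !addr0.
near=> h.
have h0 : h != 0 by near: h; exact: nbhs_dnbhs_neq.
have th : 0 < t + h.
  have : `|h| < t by near: h; exact: dnbhs0_lt.
  by rewrite ltr_norml => /andP[]; lra.
have hB : B h < e by near: h; exact: (cvgr_lt _ cB _ lB).
have Lp : L2 (p h) by apply: L2B Lq; exact: (L2Z _ (L2B (Lw _ th) (Lw _ t0))).1.
have Ls := L2D Lp Lq; have [Lhs nhs] := L2Z h Ls.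
have E : w (t + h) = fun x => w t x + h * (p h x + q x).
  by apply/funext => x; rewrite /p; field.
have I1 : \I_x (w t x * (h * (p h x + q x))) = h * (\I_x (w t x * p h x) + \I_x (w t x * q x)).
  have i1 := igr_mul (Lw _ t0) Lp; have i2 := igr_mul (Lw _ t0) Lq.
  rewrite -(I_D i1 i2) -(I_Z _ (igrD i1 i2)); apply: eq_I => x; ring.
rewrite {1}E (n2D (Lw _ t0) Lhs).2 nhs I1.
have -> : 2 * \I_x (w t x * q x) - h^-1 * (n2 (w t) + h ^+ 2 * n2 (fun x => p h x + q x) +
   2 * (h * (\I_x (w t x * p h x) + \I_x (w t x * q x))) - n2 (w t)) =
   - (2 * \I_x (w t x * p h x)) - h * n2 (fun x => p h x + q x) by field.
have k1 := ip_le r0 (Lw _ t0) Lp; have k2 := n2_add2 Lp Lq.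
apply: le_trans (ler_normB _ _) _; rewrite normrN [X in _ + X <= _]normrM (ger0_norm (n2_ge0 (fun x => p h x + q x))).
apply: le_trans (ltW hB); rewrite /B addrA; apply: lerD k1 _.
by rewrite ler_wpM2l.
Unshelve. all: by end_near.
Qed.

Section Solutions.
Variables (u0 : R -> R) (v0 : R -> R).
Hypothesis L0 : L2 v0.
Hypothesis ae0 : {ae mu, forall x, u0 x - phi x = v0 x}.

Lemma gss_H2c u t : global_smooth_solution u0 u -> 0 < t -> exists2 C, 0 <= C & H2c (fun x => u t x - phi x) C.
Proof.
move=> [_ hk hc _ _] t0; have [D [D0 hD _ _]] := hk 1 2 isT isT.
have hs := hD 0 t isT t0; rewrite D0 in hs.
have Lv := L2_of_in_L2 (continuous_mfun (hc t t0)) hs.1.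
have [C h] := H2_d2 Lv hs; exists `|C| => //; split => // y.
by apply: le_trans (h y) _; rewrite ler_wpM2r ?ler_norm // exprn_even_ge0.
Qed.

(** The right-hand side of the equation is known only almost everywhere, as is the agreement of
    [half_laplacian] with [Lam]; q is a Borel representative on which L^2 calculus can work. *)
Lemma gss_velocity u t : global_smooth_solution u0 u -> 0 < t ->
  exists q, [/\ L2 q,
    {ae mu, forall x, q x = - Lam (fun x => u t x - phi x) x - f (u t x) + f (phi x)} &
    n2 (fun x => h^-1 * ((u (t + h) x - phi x) - (u t x - phi x)) - q x) @[h --> 0^'] --> (0 : R)].
Proof.
move=> gs t0; have [C C0 hC] := gss_H2c gs t0.
have [_ _ _ _ /(_ t t0) /= [/in_L2P[q Lq rq] hd]] := gs.
exists q; split => //.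
  by apply: aeS2 rq (half_laplacian_ae C0 hC) => x <- ->; rewrite subrK.
apply: (cvg_n2 hd) => [|h]; last exact: n2_ge0.
near=> h.
have th : 0 < t + h.
  have : `|h| < t by near: h; exact: dnbhs0_lt.
  by rewrite ltr_norml => /andP[]; lra.
have [C1 _ [L1 _]] := gss_H2c gs th.
apply: L2_norm_ae; first by apply: L2B Lq; exact: (L2Z _ (L2B L1 hC.1)).1.
by apply: aeS rq => x <-.
Unshelve. all: by end_near.
Qed.

(** The slice at time 0 is only almost everywhere equal to the datum; by [fourier_ae] it may be
    replaced by v0 inside the Sobolev norm, which dominates the L^2 norm. *)
Lemma gss_initial u e : global_smooth_solution u0 u -> 0 < e -> exists2 d, 0 < d &
  forall t, 0 < t -> t < d -> n2 (fun x => u t x - phi x - v0 x) <= e.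
Proof.
move=> gs e0; have [/(_ 0 (lexx _))[_ hc] _ _ hi _] := gs.
have pi2 : 0 < 2 * pi :> R by rewrite mulr_gt0 // pi_gt0.
have se : 0 < Num.sqrt (2 * pi * e) by rewrite sqrtr_gt0 mulr_gt0.
have hw := cvge0_le hc se.
have /nbhs_ballP[d d0 hd] : nbhs (0 : R) (fun r : R => 0 <= r ->
    (sobolev_norm 2^-1 (fun x => (u r x - phi x - (u 0 x - phi x))%R) <= (Num.sqrt (2 * pi * e))%:E)%E) by exact: hw.
exists d => // t t0 td.
have [C C0 [Lt _]] := gss_H2c gs t0.
have Lz := L2B Lt L0; have aez : {ae mu, forall x, u t x - phi x - (u 0 x - phi x) = u t x - phi x - v0 x}.
  by apply: aeS2 hi ae0 => x h1 h2; rewrite (h1 I) h2.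
have /hd : ball 0 d t by rewrite /ball /= sub0r normrN gtr0_norm.
move=> /(_ (ltW t0)); rewrite /sobolev_norm (fourier_ae Lz aez) => hN.
have := sob_n2 Lz _ (ltW se) hN; rewrite sqr_sqrtr ?(ltW (mulr_gt0 pi2 e0)) // ler_pM2l //.
by apply; rewrite invr_ge0.
Qed.

Lemma gss_unique u1 u2 : global_smooth_solution u0 u1 -> global_smooth_solution u0 u2 ->
  forall t x, 0 < t -> u1 t x = u2 t x.
Proof.
move=> g1 g2.
pose w t x := (u1 t x - phi x) - (u2 t x - phi x).
have Lw s : 0 < s -> L2 (w s).
  by move=> s0; have [_ _ [l1 _]] := gss_H2c g1 s0; have [_ _ [l2 _]] := gss_H2c g2 s0; exact: L2B.
have dw s : 0 < s -> exists2 D, is_derive s 1 (fun s => n2 (w s)) D & D <= 2 * n2 (w s).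
  move=> s0; have [C1 C10 h1] := gss_H2c g1 s0; have [C2 C20 h2] := gss_H2c g2 s0.
  have [q1 [Lq1 aq1 cq1]] := gss_velocity g1 s0; have [q2 [Lq2 aq2 cq2]] := gss_velocity g2 s0.
  have Lq := L2B Lq1 Lq2; exists (2 * \I_x (w s x * (q1 x - q2 x))).
    apply: (n2_derive Lq Lw s0).
    have c4 : 2 * n2 (fun x => h^-1 * ((u1 (s + h) x - phi x) - (u1 s x - phi x)) - q1 x) +
       2 * n2 (fun x => h^-1 * ((u2 (s + h) x - phi x) - (u2 s x - phi x)) - q2 x) @[h --> 0^'] --> (2 * 0 + 2 * 0 : R).
      by apply: cvgD; exact: cvgMr.
    rewrite !mulr0 addr0 in c4.
    apply: (squeeze_cvgr _ (cvg_cst (0 : R)) c4); near=> h; apply/andP; split; first exact: n2_ge0.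
    have th : 0 < s + h.
      have : `|h| < s by near: h; exact: dnbhs0_lt.
      by rewrite ltr_norml => /andP[]; lra.
    have [_ _ [l1 _]] := gss_H2c g1 th; have [_ _ [l2 _]] := gss_H2c g2 th.
    have Lp1 := L2B (L2Z h^-1 (L2B l1 h1.1)).1 Lq1; have Lp2 := L2B (L2Z h^-1 (L2B l2 h2.1)).1 Lq2.
    apply: le_trans (n2_sub2 Lp1 Lp2); rewrite le_eqVlt; apply/orP; left; apply/eqP; congr n2.
    by apply/funext => x; rewrite /w; ring.
  rewrite ler_pM2l //.
  have hB := H2cB h1 h2; have B0 : 0 <= 2 * (C1 + C2) by rewrite mulr_ge0 // addr_ge0.
  have LL := L2_Lam B0 hB; have iL := igr_mul (Lw s s0) LL.
  have pos := Lam_positive B0 hB.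
  (* This is - (f u1 - f u2). The slopes of [Gnl] lie between 0 and 2, so subtracting the identity
     leaves a 1-Lipschitz map, whence the rate 2 for the squared norm. *)
  pose F x := (Gnl x (u1 s x - phi x) - (u1 s x - phi x)) - (Gnl x (u2 s x - phi x) - (u2 s x - phi x)).
  have Fab x : `|F x| <= `|w s x|.
    rewrite /F /w; move: (u1 s x - phi x) (u2 s x - phi x) => a1 a2.
    case: (lerP a1 a2) => a12; [have := Gnl_mono x a12|have := Gnl_mono x (ltW a12)];
    move=> /andP[]; move: (Gnl x a1) (Gnl x a2) => b1 b2 k1 k2.
      by rewrite ler_norml; apply/andP; split; lra.
    by rewrite ler_norml; apply/andP; split; lra.
  have wFab x : `|w s x * F x| <= w s x ^+ 2.
    by rewrite normrM -[w s x ^+ 2]normK2 expr2 ler_wpM2l.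
  have Fle x : w s x * F x <= w s x ^+ 2 by exact: le_trans (ler_norm _) (wFab x).
  have E : {ae mu, forall x, w s x * (q1 x - q2 x) = w s x * F x - w s x * Lam (w s) x}.
    have a3 : {ae mu, forall x, q1 x - q2 x = F x - (Lam (fun x => u1 s x - phi x) x - Lam (fun x => u2 s x - phi x) x)}.
      apply: aeS2 aq1 aq2 => x -> ->; rewrite /F /Gnl !subrK /gnl /Defs.f; ring.
    by apply: aeS2 (Lam_sub_ae C10 C20 h1 h2) a3 => x hL ->; transitivity (w s x * (F x - Lam (w s) x)); [congr (_ * (_ - _)); exact: esym hL|exact: mulrBr].
  have EI : \I_x (w s x * (q1 x - q2 x)) + \I_x (w s x * Lam (w s) x) = \I_x (w s x * F x).
    have i1 := igr_mul (Lw s s0) Lq; rewrite -(I_D i1 iL); congr fine; apply: ae_int.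
    by apply: aeS E => x ->; rewrite subrK.
  have m1 := h1.1.1; have m2 := h2.1.1.
  have iF : igr (fun x => w s x * F x).
    apply: (igr_le _ (Lw s s0).2 wFab); apply: measurable_funM; first exact: (Lw s s0).1.
    have mG z : mfun z -> mfun (fun x => Gnl x (z x) - z x).
      by move=> mz; apply: measurable_funB => //; apply: (mfun_Gnl (a := fun x => x)) => //; exact: measurable_id.
    exact: (measurable_funB (mG _ m1) (mG _ m2)).
  have := I_le iF (Lw s s0).2 Fle; rewrite -EI -/(n2 (w s)); lra.
(* Gronwall's inequality as monotonicity of the damped squared norm, which is available at positive
   times only; time 0 is reached by [gss_initial]. *)
pose E t := expR (- (2 * t)) * n2 (w t).
have mono s t : 0 < s -> s <= t -> E t <= E s.
  move=> s0 st.
  have dE r : 0 < r -> exists2 D, is_derive r 1 E D & D <= 0.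
    move=> r0; have [D hD Dle] := dw r r0.
    have he : is_derive r 1 (fun t => expR (- (2 * t)) : R) (- 2 * expR (- (2 * r))).
      have hl : is_derive r 1 (fun t => - (2 * t) : R) (- 2).
        rewrite (_ : (fun t => - (2 * t)) = fun t => (- 2) * t :> R); last by apply/funext => x; rewrite mulNr.
        by have := is_deriveZ (- 2) (is_derive_id r 1); rewrite /GRing.scale /= mulr1.
      by rewrite mulrC; exact: (is_derive_comp (g := fun t => - (2 * t)) (is_derive_expR (- (2 * r))) hl).
    exists (expR (- (2 * r)) * D + n2 (w r) * (- 2 * expR (- (2 * r)))).
      exact: (is_deriveM he hD).
    by have := expR_ge0 (- (2 * r)); move: Dle; move: (expR _) (n2 _) => c d h1 h2; nra.
  have rp r : r \in `]s, t[%R -> 0 < r by rewrite in_itv /= => /andP[h _]; exact: lt_trans h.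
  have nin := @ler0_derive1_nincr R E s t; apply: (nin _ _ _ s t (lexx s) st (lexx t)).
  - by move=> r /rp /dE[D [h _] _].
  - by move=> r /rp /dE[D hD D0]; rewrite derive1E (@derive_val _ _ _ _ _ _ _ hD).
  - apply: derivable_within_continuous => r; rewrite in_itv /= => /andP[h _].
    by have [D [h1 _] _] := dE r (lt_le_trans s0 h).
have z0 t : 0 < t -> n2 (w t) = 0.
  move=> t0; apply/eqP; rewrite eq_le n2_ge0 andbT leNgt; apply/negP => np.
  have Ep : 0 < E t by rewrite mulr_gt0 ?expR_gt0.
  (* With E t / 8 for each solution, the difference at a small time r has squared norm at most E t /
     2, against E t <= E r <= n2 (w r). *)
  have [d1 d10 hd1] := gss_initial g1 (divr_gt0 Ep (ltr0n _ 8)).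
  have [d2 d20 hd2] := gss_initial g2 (divr_gt0 Ep (ltr0n _ 8)).
  pose m := Num.min t (Num.min d1 d2); have m0 : 0 < m by rewrite !lt_min t0 d10 d20.
  have [mt md1 md2] : [/\ m <= t, m <= d1 & m <= d2] by rewrite !ge_min !lexx !orbT.
  pose r := m / 2; have r0 : 0 < r by rewrite divr_gt0.
  have rm : r < m by rewrite /r; lra.
  have k1 := hd1 r r0 (lt_le_trans rm md1); have k2 := hd2 r r0 (lt_le_trans rm md2).
  have [C1 _ [L1 _]] := gss_H2c g1 r0; have [C2 _ [L2' _]] := gss_H2c g2 r0.
  have k3 := n2_sub2 (L2B L1 L0) (L2B L2' L0).
  have k4 := mono r t r0 (ltW (lt_le_trans rm mt)).
  have k5 : E r <= n2 (w r).
    by rewrite ler_piMl ?n2_ge0 // -[leRHS]expR0 ler_expR oppr_le0 mulr_ge0 // ltW.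
  have k6 : (fun x => u1 r x - phi x - v0 x - (u2 r x - phi x - v0 x)) = w r.
    by apply/funext => x; rewrite /w; ring.
  rewrite k6 in k3; move: Ep k1 k2 k3 k4 k5; move: (E t) (E r) (n2 _) (n2 _) (n2 _) => c1 c2 c3 c4 c5; lra.
move=> t x t0; apply/eqP; rewrite -subr_eq0; apply/eqP.
have [_ _ /(_ t t0) c1 _ _] := g1; have [_ _ /(_ t t0) c2 _ _] := g2.
have cw : continuous (w t) by move=> y; apply: cvgB; [exact: c1|exact: c2].
have aw : {ae mu, forall x, w t x = 0}.
  have m2 : mfun (EFin \o (fun x => w t x ^+ 2)) by apply/measurable_EFinP; apply: measurable_funX; exact: (Lw t t0).1.
  have : (\int[mu]_x `|(w t x ^+ 2)%R%:E| = 0)%E.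
    rewrite -[RHS](congr1 EFin (z0 t t0)) -(n2_ereal (Lw t t0)); apply: eq_integral => y _.
    by rewrite /= ger0_norm ?sqr_ge0.
  move=> /(ae_eq_integral_abs mu measurableT m2).1 hh; apply: aeS hh => y /(_ I) [] /eqP.
  by rewrite sqrf_eq0 => /eqP.
by have := ae_zero_continuous cw aw x; rewrite /w => <-; ring.
Unshelve. all: by end_near.
Qed.

End Solutions.
End Uniqueness.

(** * From uniform estimates to differentiability in Sobolev norms *)

Section SmoothCurves.
Context {R : realType}.
Implicit Types (t s x y h a b r e C M : R) (q z p : R -> R) (w v : R -> R -> R).
Notation mu := (@lebesgue_measure R).

Lemma cvge0P (T : Type) (F : set_system T) {FF : Filter F} (N : T -> \bar R) : (forall h : T, 0 <= N h)%E ->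
  (forall e, 0 < e -> \forall h \near F, (N (h : T) <= e%:E)%E) -> N @ F --> 0%E.
Proof.
move=> N0 hN; apply/fine_cvgP; split.
  apply: filterS (hN 1 ltr01) => h Nh; rewrite ge0_fin_numE //; exact: le_lt_trans Nh (ltry _).
apply/cvgr0Pnorm_le => e e0; apply: filterS (hN e e0) => h Nh /=.
rewrite ger0_norm ?fine_ge0 // -lee_fin fineK // ge0_fin_numE //; exact: le_lt_trans Nh (ltry _).
Qed.

Lemma sob_mono z (s s' : R) : L2 z -> s <= s' -> (sobolev_norm s z <= sobolev_norm s' z)%E.
Proof.
move=> Lz ss; have [p [mp p0 _ _ [_ hs]]] := spec_exists Lz; rewrite !hs.
have m1 (r : R) : mfun (fun x : R => (1 + x ^+ 2) `^ r * p x).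
  apply: measurable_funM mp; apply: (measurableT_comp (measurable_powR r)).
  by apply: measurable_funD => //; exact: measurable_funX.
have q0 (r : R) x : 0 <= (1 + x ^+ 2) `^ r * p x by rewrite mulr_ge0 ?powR_ge0.
have i0 (r : R) : (0 <= \int[mu]_x ((1 + x ^+ 2) `^ r * p x)%:E)%E by apply: integral_ge0 => x _; rewrite lee_fin.
apply: gt0_ler_poweR; rewrite ?in_itv /= ?leey ?i0 //.
apply: ge0_le_integral => //; try by [move=> x _; rewrite lee_fin|apply/measurable_EFinP; exact: m1].
by move=> x _; rewrite lee_fin ler_wpM2r // ler_powR // lerDl sqr_ge0.
Qed.

Lemma smooth_L2 w t : smooth w -> 0 < t -> L2 (w t).
Proof.
move=> sw t0; have [M hM] := locb_nb t (smooth_locb sw) t0.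
exact: (nb_L2 (hM t (lexx _) (lexx _))).1.
Qed.

Lemma smooth_Dh w t m : smooth w -> 0 < t -> exists M, forall h, nb (Dh h m (w t)) (`|h| ^+ m * M).
Proof.
move=> sw t0; have [M hM] := KX_sm t (sw m) t0; exists M => h.
exact: nb_Dh (hM t (lexx _) (lexx _)).
Qed.

Lemma smooth_sobolev w t j : smooth w -> 0 < t -> in_sobolev j%:R (w t).
Proof.
move=> sw t0; have [M hM] := locb_nb t (smooth_locb sw) t0; have [B hB] := smooth_Dh j sw t0.
exact: nb_sobolev (hM t (lexx _) (lexx _)) hB.
Qed.

Lemma nb_diff_quotient w w1 t e : DT w w1 -> 0 < t -> 0 < e -> exists2 d, 0 < d &
  forall h, h != 0 -> `|h| < d -> nb (fun x => h^-1 * (w (t + h) x - w t x) - w1 t x) e.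
Proof.
move=> hw t0 e0; have t2 : 0 < t / 2 by rewrite divr_gt0.
have [d d0 hd] := hw (t / 2) (2 * t) e t2 e0.
exists (Num.min d (t / 2)); first by rewrite lt_min d0.
move=> h h0; rewrite lt_min => /andP[hd1]; rewrite ltr_norml => /andP[h1 h2].
have th : t + h - t = h by ring.
have := hd t (t + h); rewrite th => /(_ _ _ _ _ hd1) hn.
have k : nb (fun x => w (t + h) x - w t x - h * w1 t x) (e * `|h|) by apply: hn; lra.
have := nbZ h^-1 k; rewrite normfV mulrCA mulVf ?normr_eq0 // mulr1.
by congr (nb _ _); apply/funext => x; field.
Qed.

Lemma near_dnbhs0 e (A : R -> Prop) : 0 < e -> (forall h, h != 0 -> `|h| < e -> A h) -> \forall h \near (0 : R)^', A h.
Proof.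
move=> e0 hA; near=> h; apply: hA; first by near: h; exact: nbhs_dnbhs_neq.
by near: h; exact: dnbhs0_lt.
Unshelve. all: by end_near.
Qed.

(** Interpolation: the remainder of the difference quotient tends to 0 in [nb], while its spatial
    differences of order 2 j stay bounded by [DT_Dh]; [sob_small] combines the two. *)
Lemma DT_sobolev w w1 t j : smooth w -> smooth w1 -> DT w w1 -> 0 < t ->
  has_time_derivative (sobolev_norm j%:R) w t (w1 t).
Proof.
move=> sw sw1 hw t0; apply: cvge0P => [h|e e0]; first exact: poweR_ge0.
have t2 : 0 < t / 2 by rewrite divr_gt0.
have [M M0 hM] := DT_Dh (2 * t) (smooth_locb sw) (sw1 (2 * j)%N) hw t2.
have [B hB] := smooth_Dh (2 * j) sw1 t0.
have [d d0 hd] := sob_small j (M + B) e0.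
have [d' d0' hd'] := nb_diff_quotient hw t0 d0.
apply: (near_dnbhs0 (e := Num.min d' (t / 2))); first by rewrite lt_min d0'.
move=> h h0; rewrite lt_min => /andP[hd1]; rewrite ltr_norml => /andP[h1 h2].
apply: hd; first exact: hd'.
move=> h'; have k : nb (Dh h' (2 * j) (fun x => w (t + h) x - w t x)) (`|h'| ^+ (2 * j) * M * `|h|).
  by have th : t + h - t = h by [ring]; have := hM t (t + h) h'; rewrite th; apply; lra.
have := nbB (nbZ h^-1 k) (hB h').
rewrite normfV mulrCA mulVf ?normr_eq0 // mulr1 -mulrDr; congr (nb _ _); apply/funext => x.
by rewrite -Dh_Z -Dh_B.
Qed.

Lemma DT_sobolev_continuous w w1 t j e : smooth w -> smooth w1 -> DT w w1 -> 0 < t -> 0 < e ->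
  exists2 d, 0 < d & forall r, `|r - t| < d -> (sobolev_norm j%:R (fun x => w r x - w t x)%R <= e%:E)%E.
Proof.
move=> sw sw1 hw t0 e0; have t2 : 0 < t / 2 by rewrite divr_gt0.
have [M M0 hM] := DT_Dh (2 * t) (smooth_locb sw) (sw1 (2 * j)%N) hw t2.
have [K K0 hK] := DT_bounded (2 * t) (smooth_locb sw) (smooth_locb sw1) hw t2.
have [d d0 hd] := sob_small j (M * t) e0.
have K1 : 0 < K + 1 by lra.
exists (Num.min (t / 2) (d / (K + 1))); first by rewrite lt_min t2 divr_gt0.
move=> r; rewrite lt_min => /andP[rt rd]; have rt' := rt; move: rt'; rewrite ltr_norml => /andP[h1 h2].
have a1 : t / 2 <= t by lra. have a2 : t <= 2 * t by lra. have a3 : t / 2 <= r by lra. have a4 : r <= 2 * t by lra.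
apply: hd => [|h].
  apply: (nb_le (hK t r a1 a2 a3 a4)); move: rd; rewrite ltr_pdivlMr // => rd.
  by apply: le_trans (ltW rd); rewrite mulrC ler_wpM2l // lerDl.
apply: (nb_le (hM t r h a1 a2 a3 a4)); rewrite -mulrA ler_wpM2l ?exprn_ge0 // ler_wpM2l //.
by apply: ltW; apply: lt_trans rt _; lra.
Qed.

Lemma near_nbhs t d (A : R -> Prop) : 0 < d -> (forall r, `|r - t| < d -> A r) -> \forall r \near t, A r.
Proof.
move=> d0 hA; apply/nbhs_ballP; exists d => // r; rewrite /ball /= distrC; exact: hA.
Qed.

Lemma near_within (I : set R) t (A : R -> Prop) : (\forall r \near t, A r) -> \forall r \near within I (nbhs t), A r.
Proof. by move=> h; rewrite near_withinE; apply: filterS h => r Ar _. Qed.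

Lemma tsmooth_derivatives n w : tsmooth n w -> exists D : nat -> R -> R -> R, [/\ D 0 = w,
  forall i, (i <= n)%N -> smooth (D i) & forall i, (i < n)%N -> DT (D i) (D i.+1)].
Proof.
elim: n w => [|n IH] w [sw h].
  by exists (fun=> w); split => // -[].
have [w1 [dw /IH[D [D0 hs hd]]]] := h.
exists (fun i => if i is i'.+1 then D i' else w); split => //; first by case=> [|i] //; exact: hs.
by case=> [_|i]; [rewrite D0|exact: hd].
Qed.

Lemma tsmooth_Ck w k j : (forall n, tsmooth n w) -> Ck_sobolev k j%:R w.
Proof.
(* One time derivative more than required yields the continuity of the k-th. *)
move=> hw; have [D [D0 hs hd]] := tsmooth_derivatives (hw k.+1); exists D; split => //.
- by move=> i t ik t0; apply: smooth_sobolev => //; apply: hs; exact: leqW.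
- move=> i t ik t0; apply: DT_sobolev => //; [apply: hs; exact: leqW (ltnW ik)|apply: hs; exact: leqW|apply: hd; exact: ltnW].
- move=> t t0; apply: cvge0P => [h|e e0]; first exact: poweR_ge0.
  have [d d0 h] := DT_sobolev_continuous j (hs k (leqnSn k)) (hs k.+1 (leqnn _)) (hd k (ltnSn k)) t0 e0.
  by apply: near_within; exact: near_nbhs h.
Qed.

Lemma half_laplacian_smooth w t x : smooth w -> 0 < t -> half_laplacian (w t) x = Lam (w t) x.
Proof.
move=> sw t0; have [M0 [M2 [_ _ hM]]] := smooth_lamb t sw t0.
by apply: half_laplacianE; [exact: smooth_L2|exact: igr_Lam (hM t (lexx _) (lexx _))].
Qed.

Lemma L2_norm_nb z e : nb z e -> (L2_norm z <= e%:E)%E.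
Proof.
move=> hz; have [Lz nz] := nb_L2 hz; rewrite (L2_norm_ae Lz); last exact: aeW.
by rewrite lee_fin powR12_sqrt ?n2_ge0 // -(ger0_norm (nb_ge0 hz)) -sqrtr_sqr ler_wsqrtr.
Qed.

Lemma smooth_equation v t : smooth v -> mild v (fun t x => Gnl x (v t x)) -> 0 < t ->
  let rhs x := - half_laplacian (v t) x - f (v t x + phi x) + f (phi x) in
  in_L2 rhs /\ has_time_derivative L2_norm v t rhs.
Proof.
move=> sv hm t0 rhs; have rE : rhs = vel v t.
  by apply/funext => x; rewrite /rhs /vel (half_laplacian_smooth x sv t0) /Gnl /gnl /f; ring.
have Lr := smooth_L2 (smooth_vel sv) t0.
rewrite rE; split; first by apply/in_L2P; exists (vel v t) => //; exact: aeW.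
apply: cvge0P => [h|e e0]; first exact: Lnorm_ge0.
have [d d0 hd] := nb_diff_quotient (DT_vel sv hm) t0 e0.
by apply: (near_dnbhs0 d0) => h h0 hdh; apply: L2_norm_nb; exact: hd.
Qed.

End SmoothCurves.

(** * The mild solution is a global smooth solution *)

Section Existence.
Context {R : realType}.
Implicit Types (t s x y h a b r e C M : R) (q z : R -> R).
Notation mu := (@lebesgue_measure R).

Lemma L2_abs z : L2 z -> L2 (fun x => `|z x|) /\ n2 (fun x => `|z x|) = n2 z.
Proof.
move=> [mz iz]; have E : (fun x => `|z x| ^+ 2) = (fun x => z x ^+ 2).
  by apply/funext => x; rewrite real_normK ?num_real.
by rewrite /L2 /n2 E; split => //; split => //; meas.
Qed.

Lemma pc_L2_sup t z x : 0 < t -> L2 z -> pc t z x <= (pi * t)^-1 + n2 z.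
Proof.
move=> t0 Lz; have [mz iz] := Lz; have pz := L2_pint Lz.
have i1 := igrZ (pi * t)^-1 (igr_Px x t0).
apply: (@le_trans _ _ (\I_y ((pi * t)^-1 * P t (x - y) + z y ^+ 2))).
  apply: I_le; [exact: pz.2|exact: igrD i1 iz|] => y.
  have P0 := P_ge0 (x - y) (ltW t0); have Pt := P_le (x - y) t0.
  move: (P t (x - y)) ((pi * t)^-1) (z y) P0 Pt => p k c p0 pk.
  have := sqr_ge0 (p - c); have := sqr_ge0 (p + c); have : p * p <= k * p by rewrite ler_wpM2r.
  have := mulr_ge0 p0 (le_trans p0 pk); rewrite !expr2; lra.
by rewrite (I_D i1 iz) (I_Z _ (igr_Px x t0)) (I_Px x t0) mulr1.
Qed.

Lemma sob_zero (s e : R) : s <= 1%:R -> 0 < e -> (sobolev_norm s (fun=> (0 : R)%R) <= e%:E)%E.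
Proof.
move=> s1 e0; have [d d0 hd] := sob_small 1 (0 : R) e0.
have [Lz _] := nb_L2 (nb0 (lexx (0 : R))).
apply: le_trans (sob_mono Lz s1) _; apply: hd => [|h]; first exact: nb0 (ltW d0).
by rewrite mulr0 /Dh /= !subrr; exact: nb0.
Qed.

Section FromData.
Variable v0 : R -> R.
Hypotheses (L0 : L2 v0) (S0 : in_sobolev 2^-1 v0).
Variable v : R -> R -> R.
Hypotheses (mv : mfun2 v) (v_neg : forall t, t <= 0 -> v t = v0)
  (v_Maj : forall t x, 0 < t -> `|v t x| <= Maj v0 t x)
  (v_mild : mild_from 0 v (fun s y => Gnl y (v s y))).

Let G s y := Gnl y (v s y).
Let va := fun y => `|v0 y|.

Lemma mild_L2 t b : 0 < t -> t <= b -> L2 (v t) /\ n2 (v t) <= expR b ^+ 2 * n2 v0.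
Proof.
move=> t0 tb; have [La na] := L2_abs L0.
have h x : `|v t x| <= expR b * `|pc t va x|.
  apply: (le_trans (v_Maj x t0)); rewrite /Maj -/va; apply: ler_pM; rewrite ?expR_ge0 ?ler_expR ?ler_norm //.
  by apply: pc_ge0 => // y; exact: normr_ge0.
have [Lv nv] := L2_dom (L2_pc t0 La) (mfun2_1 t mv) h; split => //.
apply: (le_trans nv); rewrite ler_wpM2l ?sqr_ge0 // -na; exact: n2_pc_le.
Qed.

(** For t >= a the kernel is at most 1 / (pi a), so the majorant is bounded. A single constant must
    dominate both norms; the summand 1 makes its square exceed the squared L^2 norm. *)
Lemma mild_lnb : lnb v.
Proof.
split => // a b a0; have [La na] := L2_abs L0; have N0 := n2_ge0 v0.
have k0 : 0 <= (pi * a)^-1 by rewrite invr_ge0 mulr_ge0 ?pi_ge0 ?ltW.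
exists (expR b * (1 + (pi * a)^-1 + n2 v0)) => t ta tb.
have t0 := lt_le_trans a0 ta; have [[mt it] nt] := mild_L2 t0 tb; split => // [x|].
  apply: (le_trans (v_Maj x t0)); rewrite /Maj; apply: ler_pM; rewrite ?expR_ge0 ?ler_expR //.
    by apply: pc_ge0 => // y; exact: normr_ge0.
  apply: (le_trans (pc_L2_sup x t0 La)); rewrite na lerD2r.
  apply: (@le_trans _ _ ((pi * a)^-1)); last by lra.
  by rewrite lef_pV2 ?posrE ?mulr_gt0 ?pi_gt0 // ler_pM2l ?pi_gt0.
rewrite (I_fin it) lee_fin; apply: (le_trans nt); rewrite exprMn ler_wpM2l ?sqr_ge0 //.
by move: k0 N0; move: (_^-1) (n2 _) => c d c0 d0; rewrite expr2; nra.
Qed.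

Let dG t x : exists C, dbound 0 t G x C.
Proof.
exists (2 * Maj v0 t x); apply: (dbound_le (@dbound_Maj R v0 (L2_pint L0) t x) (lexx _)) => [s|s y s0 st].
  exact: mfun2_1 (mfun2_Gnl mv).
by apply: (le_trans (Gnl_le _ _)); rewrite ler_pM2l //; exact: v_Maj.
Qed.

Lemma mild_later b : 0 <= b -> solves b v.
Proof.
move=> b0; apply: (mild_restart b0 (mfun2_Gnl mv) dG _ v_mild).
by rewrite v_neg //; exact: L2_pint.
Qed.

Let hm : mild v G. Proof. by move=> a a0; exact: mild_later (ltW a0). Qed.

Let sv : smooth v. Proof. by move=> k; exact: mild_smooth mild_lnb hm k. Qed.

(** At time 0 this is [half_continuity]; at positive times the solution is continuous in H^1, whose
    norm dominates that of H^{1/2}. *)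
Lemma C0_half : C0_sobolev 2^-1 v.
Proof.
have ts := v_tsmooth sv hm; have h1 : 2^-1 <= 1%:R :> R by lra.
move=> t; rewrite le_eqVlt => /predU1P[<-|t0].
  rewrite v_neg //; split => //; apply: cvge0P => [h|e e0]; first exact: poweR_ge0.
  have G0 : 0 <= 2 ^+ 2 * (expR 1 ^+ 2 * n2 v0) by rewrite !mulr_ge0 ?sqr_ge0 ?n2_ge0.
  have hG s : 0 < s -> s < 1 -> L2 (G s) /\ n2 (G s) <= 2 ^+ 2 * (expR 1 ^+ 2 * n2 v0).
    move=> s0 s1; have [Lv nv] := mild_L2 s0 (ltW s1).
    have [LG nG] := L2_dom Lv (mfun2_1 s (mfun2_Gnl mv)) (fun x => Gnl_le x (v s x)); split => //.
    by apply: (le_trans nG); rewrite ler_pM2l // exprn_gt0.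
  have [d d0 hd] := half_continuity L0 S0 ltr01 (mfun2_Gnl mv) G0 hG dG e0.

  rewrite near_withinE; apply: (near_nbhs d0) => r; rewrite subr0 => rd; rewrite /= le_eqVlt => /predU1P[<-|r0].
    have -> : (fun x => v 0 x - v 0 x) = fun=> 0 by apply/funext => x; rewrite subrr.
    exact: sob_zero.
  have -> : (fun x => v r x - v 0 x) = fun x => qc r v0 x + duh 0 r G x - v0 x.
    by apply/funext => x; rewrite (v_mild x r0) subr0 (v_neg (lexx 0)).
  by apply: hd => //; move: rd; rewrite gtr0_norm.
have Lt := smooth_L2 sv t0; split.
  split; first by apply/in_L2P; exists (v t) => //; exact: aeW.
  by apply: le_lt_trans (sob_mono Lt h1) _; have [] := smooth_sobolev 1 sv t0.
apply: cvge0P => [h|e e0]; first exact: poweR_ge0.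
have [d d0 h] := DT_sobolev_continuous 1 sv (smooth_vel sv) (DT_vel sv hm) t0 e0.
apply: near_within; apply: (near_nbhs (d := Num.min d t)); first by rewrite lt_min d0.
move=> r; rewrite lt_min => /andP[rd]; rewrite ltr_norml => /andP[r1 _].
have r0 : 0 < r by lra.
by apply: le_trans (h r rd); apply: sob_mono h1; apply: L2B => //; exact: smooth_L2.
Qed.

Lemma mild_gss u0 : {ae mu, forall x, u0 x - phi x = v0 x} -> global_smooth_solution u0 (fun t x => v t x + phi x).
Proof.
move=> ae0; have ts := v_tsmooth sv hm.
have Et t : (fun x => v t x + phi x - phi x) = v t by apply/funext => x; rewrite addrK.
have E : (fun t x => v t x + phi x - phi x) = v by apply/funext => t; exact: Et.
rewrite /global_smooth_solution E; split.
- exact: C0_half.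
- by move=> k j _ _; exact: tsmooth_Ck.
- by move=> t t0; have [_ c _] := smooth_locb sv; rewrite Et; exact: c.
- by apply: aeS ae0 => x h _; rewrite v_neg // h addrK.
- move=> t t0; have -> : (fun x => - half_laplacian (fun y => v t y + phi y - phi y) x -
      f (v t x + phi x - phi x + phi x) + f (phi x)) =
      fun x => - half_laplacian (v t) x - f (v t x + phi x) + f (phi x).
    by apply/funext => x; rewrite Et addrK.
  exact: smooth_equation sv hm t0.
Qed.

Lemma mild_decay a b : a <= b -> (forall x, psi b x <= v0 x <= psi a x) ->
  exists x0 c m : R, [/\ 0 < c, 0 < m & forall t x, 0 <= t ->
    `|v t x + phi x - phi (x - x0)| <= c * Num.min (1 / (1 + `|x|)) (expR (- (m * t)))].
Proof.
move=> ab tr; apply: (decay mv mild_later _ ab); last by move=> x; rewrite v_neg.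
have v02 x : `|v0 x| <= 2.
  have /andP[h1 h2] := tr x; have := psi_bound a x; have := psi_bound b x.
  by rewrite !ler_norml => /andP[h3 h4] /andP[h5 h6]; apply/andP; split; lra.
move=> T; exists (expR `|T| * 2) => s y; rewrite le_eqVlt => /predU1P[<- _|s0 sT].
  rewrite v_neg //; apply: (le_trans (v02 y)); rewrite ler_peMl // -expR0 ler_expR //.
apply: (le_trans (v_Maj y s0)); rewrite /Maj; apply: ler_pM; rewrite ?expR_ge0 //.
- by apply: pc_ge0 => // z; exact: normr_ge0.
- by rewrite ler_expR (le_trans sT) // ler_norm.
rewrite -[leRHS](pc_cst (2 : R) y s0); apply: pc_le => //; first exact: pint_abs (L2_pint L0).
by apply: (@pint_bounded _ _ 2) => // x; rewrite ger0_norm.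
Qed.

End FromData.

(** The datum may fail to be Borel, and a Borel representative lies between the barriers only almost
    everywhere, whereas comparison is pointwise. Clipping the representative between the barriers
    changes it on a null set only. *)
Lemma clipped_data (u0 : R -> R) : in_L2 (fun x => u0 x - phi x) -> exists v0, [/\ L2 v0,
  {ae mu, forall x, u0 x - phi x = v0 x} &
  (exists a b, a <= b /\ forall x, phi (x - b) <= u0 x <= phi (x - a)) ->
  exists a b, a <= b /\ forall x, psi b x <= v0 x <= psi a x].
Proof.
move=> /in_L2P[z Lz hz]; have [[a [b [ab h]]]|no] := EM (exists a b, a <= b /\ forall x, phi (x - b) <= u0 x <= phi (x - a)); last by exists z.
pose c x := Num.max (psi b x) (Num.min (z x) (psi a x)).
have pp x : psi b x <= psi a x by rewrite lerD2r; exact: phi_shift_le.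
have cz : {ae mu, forall x, u0 x - phi x = c x}.
  apply: aeS hz => x zx; have /andP[h1 h2] := h x.
  have /min_idPl e1 : z x <= psi a x by rewrite -zx lerD2r.
  by rewrite /c e1 -zx; apply/esym/max_idPr; rewrite lerD2r.
have mc : mfun c.
  by apply: measurable_maxr; [exact: mfun_psi|apply: measurable_minr; [exact: Lz.1|exact: mfun_psi]].
exists c; split => //; first by apply: L2_of_in_L2 => //; apply/in_L2P; exists z => //; apply: aeS2 hz cz => x -> ->.
move=> _; exists a, b; split => // x; rewrite /c ge_max pp /= le_max lexx /=.
by rewrite ge_min lexx orbT.
Qed.

End Existence.

Theorem theorem1p1 (R : realType) (u0 : R -> R)
    (hu0 : in_sobolev 2^-1 (fun x => u0 x - phi x)) :
  exists u : R -> R -> R,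
    [/\ global_smooth_solution u0 u,
        (forall u' : R -> R -> R, global_smooth_solution u0 u' ->
           forall t x : R, 0 < t -> u' t x = u t x) &
        ((energy u0 < +oo)%E ->
         (exists a b : R, a <= b /\
            forall x : R, phi (x - b) <= u0 x <= phi (x - a)) ->
         exists x0 c mu : R,
           [/\ 0 < c, 0 < mu &
               forall t x : R, 0 < t ->
                 `|u t x - phi (x - x0)|
                   <= c * Num.min (1 / (1 + `|x|)) (expR (- (mu * t)))])].
Proof.
have [v0 [L0 ae0 clip]] := clipped_data hu0.1.
have S0 : in_sobolev 2^-1 v0.
  split; first by apply/in_L2P; exists v0 => //; exact: aeW.
  by have := hu0.2; rewrite /sobolev_norm (fourier_ae L0 ae0).
have [v [mv v_neg v_Maj v_mild]] := mild_solution (L2_pint L0).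
have gv := mild_gss L0 S0 mv v_neg v_Maj v_mild ae0.
exists (fun t x => v t x + phi x); split => // [u' gu' t x t0|_ /clip[a [b [ab tr]]]].
  exact: gss_unique L0 ae0 u' _ gu' gv t x t0.
have [x0 [c [m [c0 m0 h]]]] := mild_decay L0 mv v_neg v_Maj v_mild ab tr.
by exists x0, c, m; split => // t x t0; apply: h; exact: ltW.
Qed.
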